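(* Let $(X_t)_{t\in\mathbb{Z}}$ be stationary real-valued, $\eta\in(0,1)$, and let $b_n$ be integers with $b_n\to\infty$, $b_n=o(n)$. Let $T_n$, $T_{i,b_n}$, $L_{n,b_n}$, $C_{n,b_n}$ be as defined below, and $C(y)=\inf\{x:\mathbb{P}(\xi_\kappa/\zeta_{\kappa/2}\le x)\ge y\}$. Suppose $\mathbb{E}[X_0]=0$ and either (i) Assumption (FV) holds and $\sigma^2:=\mathrm{var}(X_0)+2\sum_{t\ge1}\mathrm{cov}(X_0,X_t)>0$, or (ii) Assumptions (RV) and (AC+MX) hold with $\kappa\in(1,2)$ and $x\mapsto\mathbb{P}(\xi_\kappa/\zeta_{\kappa/2}\le x)$ is continuous in neighborhoods of $C(\eta/2)$ and $C(1-\eta/2)$. Then $\mathbb{P}(T_n\notin[C_{n,b_n}(\eta/2),C_{n,b_n}(1-\eta/2)])\to\eta$. If instead either Assumption (FV) holds or Assumptions (RV), (AC+MX) hold with $\kappa\in(1,2)$, and $\mathbb{E}[X_0]\neq0$, then $\mathbb{P}(T_n\notin[C_{n,b_n}(\eta/2),C_{n,b_n}(1-\eta/2)])\to1$.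
   Context: $T_n=\sum_{t=1}^nX_t/(\sum_{t=1}^nX_t^2)^{1/2}$; $q_n=n-b_n+1$; $T_{i,b_n}=\sum_{t=i}^{i+b_n-1}X_t/(\sum_{t=i}^{i+b_n-1}X_t^2)^{1/2}$, $i=1,\dots,q_n$; $L_{n,b_n}(x)=q_n^{-1}\sum_{i=1}^{q_n}\mathbf{1}(T_{i,b_n}\le x)$; $C_{n,b_n}(y)=\inf\{x:L_{n,b_n}(x)\ge y\}$. Strong mixing coefficients $\alpha_k=\sup|\mathrm{cov}(g_1(\dots,X_{-1},X_0),g_2(X_k,\dots))|$ over measurable $|g_i|\le1$. Assumption (FV): some $\varepsilon>0$ with $\mathbb{E}|X_0|^{2+\varepsilon}<\infty$ and $\sum_k\alpha_k^{\varepsilon/(2+\varepsilon)}<\infty$. Regular variation of a real variable with index $\kappa$: $\mathbb{P}(X>x)\sim p_+L(x)x^{-\kappa}$, $\mathbb{P}(X<-x)\sim p_-L(x)x^{-\kappa}$ ($L$ slowly varying, $p_\pm\ge0$, $p_++p_-=1$); of a stationary process: $X_0$ regularly varying and a spectral tail process $(\Theta_t)$ exists with $\mathbb{P}(|X_0|^{-1}(X_{-h},\dots,X_h)\in\cdot\mid|X_0|>x)\to\mathbb{P}((\Theta_{-h},\dots,\Theta_h)\in\cdot)$ weakly, all $h\ge0$. Assumption (RV): index $\kappa\in(0,1)\cup(1,2)$. $(a_n)$: $a_n\to\infty$, $n\mathbb{P}(|X_0|>a_n)\to1$. Assumption (AC+MX): integer $r_n\to\infty$, $r_n=o(n)$,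 with $\lim_k\limsup_n n\sum_{t=k}^{r_n}\mathbb{E}[\min\{|X_t|/a_n,1\}\min\{|X_0|/a_n,1\}]=0$, and $\ell_n\to\infty$, $\ell_n=o(r_n)$, $(n/r_n)\alpha_{\ell_n}\to0$. Under (RV),(AC+MX) with $\kappa\in(1,2)$ and $\mathbb{E}X_0=0$, $(\xi_\kappa,\zeta_{\kappa/2})$ denotes the limit in distribution of $a_n^{-1}(\sum_{t=1}^nX_t,(\sum_{t=1}^nX_t^2)^{1/2})$. *)

(* Defs.v *)
From HB Require Import structures.
From mathcomp Require Import all_boot all_order all_algebra.
From mathcomp Require Import all_classical all_reals all_analysis.
Set Implicit Arguments. Unset Strict Implicit. Unset Printing Implicit Defensive.
Import Order.TTheory GRing.Theory Num.Theory.
Import numFieldNormedType.Exports.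
Local Open Scope classical_set_scope.
Local Open Scope ring_scope.

Section Defs.
Context {R : realType} {d : measure_display} {T : measurableType d}.
Variable P : probability T R.

Definition rE (f : T -> R) : R := fine (\int[P]_w (f w)%:E).
Definition pr (A : set T) : R := fine (P A).
Definition rcov (f g : T -> R) : R := rE (fun w => f w * g w) - rE f * rE g.

Definition stationary (X : int -> T -> R) : Prop :=
  forall (n : nat) (t : 'I_n -> int) (s : int) (B : 'I_n -> set R),
    (forall i, measurable (B i)) ->
    P (\bigcap_(i in [set: 'I_n]) (X (t i + s) @^-1` B i)) =
    P (\bigcap_(i in [set: 'I_n]) (X (t i) @^-1` B i)).

Definition gen_sigma (X : int -> T -> R) (I : set int) : set (set T) :=
  <<s [set A | exists t, I t /\ exists B, measurable B /\ A = X t @^-1` B] >>.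

Definition measurable_wrt (F : set (set T)) (g : T -> R) : Prop :=
  forall B : set R, measurable B -> F (g @^-1` B).

Definition alpha (X : int -> T -> R) (k : nat) : R :=
  sup [set r | exists g1 g2 : T -> R,
        measurable_wrt (gen_sigma X [set s | s <= 0]) g1 /\
        measurable_wrt (gen_sigma X [set s | k%:Z <= s]) g2 /\
        (forall w, `|g1 w| <= 1) /\ (forall w, `|g2 w| <= 1) /\
        r = `|rcov g1 g2|].

Definition FV (X : int -> T -> R) : Prop :=
  exists eps : R, 0 < eps /\
    (\int[P]_w ((`|X 0 w| `^ (2 + eps))%:E) < +oo)%E /\
    (\sum_(0 <= k <oo) ((alpha X k `^ (eps / (2 + eps)))%:E) < +oo)%E.

Definition sigma2 (X : int -> T -> R) : R :=
  rcov (X 0) (X 0) + 2 * limn (series (fun t : nat => rcov (X 0) (X t.+1%:Z))).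

Definition slowly_varying (L : R -> R) : Prop :=
  (\forall x \near +oo, 0 < L x) /\
  forall lam : R, 0 < lam -> L (lam * x) / L x @[x --> +oo] --> (1 : R).

(** regular variation of a real random variable with index kappa
    (P(Y>x) ~ p_+ L(x) x^-kappa read as ratio convergence) *)
Definition regvar (Y : T -> R) (kappa : R) : Prop :=
  exists (L : R -> R) (pp pm : R),
    slowly_varying L /\ 0 <= pp /\ 0 <= pm /\ pp + pm = 1 /\
    (pr [set w | x < Y w] / (L x * x `^ (- kappa)) @[x --> +oo] --> pp) /\
    (pr [set w | Y w < - x] / (L x * x `^ (- kappa)) @[x --> +oo] --> pm).

Definition has_spectral_tail (X : int -> T -> R) : Prop :=
  exists (d' : measure_display) (T' : measurableType d')
         (Q : probability T' R) (Theta : int -> T' -> R),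
    (forall t, measurable_fun setT (Theta t)) /\
    forall (h : nat) (f : 'rV[R]_(2 * h + 1) -> R),
      continuous f -> (exists M, forall v, `|f v| <= M) ->
      rE (fun w => f (\row_(i < 2 * h + 1) (X (i%:Z - h%:Z) w / `|X 0 w|))
                    * (if x < `|X 0 w| then 1 else 0))
        / pr [set w | x < `|X 0 w|] @[x --> +oo]
      --> fine (\int[Q]_w (f (\row_(i < 2 * h + 1) Theta (i%:Z - h%:Z) w))%:E).

Definition RV (X : int -> T -> R) (kappa : R) : Prop :=
  regvar (X 0) kappa /\ has_spectral_tail X.

Definition norming (X : int -> T -> R) (a : nat -> R) : Prop :=
  (a n @[n --> \oo] --> +oo) /\
  (n%:R * pr [set w | a n < `|X 0 w|] @[n --> \oo] --> (1 : R)).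

Definition AC_MX (X : int -> T -> R) (a : nat -> R) : Prop :=
  exists r l : nat -> nat,
    (((r n)%:R : R) @[n --> \oo] --> +oo) /\ ((r n)%:R / n%:R @[n --> \oo] --> (0 : R)) /\
    (limn_esup (fun n => (n%:R * \sum_(k <= t < (r n).+1)
        rE (fun w => Num.min (`|X t%:Z w| / a n) 1 * Num.min (`|X 0 w| / a n) 1))%:E)
       @[k --> \oo] --> 0%E) /\
    (((l n)%:R : R) @[n --> \oo] --> +oo) /\ ((l n)%:R / (r n)%:R @[n --> \oo] --> (0 : R)) /\
    (n%:R / (r n)%:R * alpha X (l n) @[n --> \oo] --> (0 : R)).

Definition Ssum (X : int -> T -> R) (i b : nat) (w : T) : R :=
  \sum_(i <= t < i + b) X t%:Z w.
Definition Qsum (X : int -> T -> R) (i b : nat) (w : T) : R :=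
  Num.sqrt (\sum_(i <= t < i + b) X t%:Z w ^+ 2).

Definition Tstat (X : int -> T -> R) (n : nat) (w : T) : R :=
  Ssum X 1 n w / Qsum X 1 n w.
Definition Tsub (X : int -> T -> R) (b i : nat) (w : T) : R :=
  Ssum X i b w / Qsum X i b w.
Definition qn (n b : nat) : nat := n - b + 1.
Definition Lsub (X : int -> T -> R) (n b : nat) (x : R) (w : T) : R :=
  (qn n b)%:R^-1 * \sum_(1 <= i < (qn n b).+1) (if Tsub X b i w <= x then 1 else 0).
Definition Csub (X : int -> T -> R) (n b : nat) (y : R) (w : T) : R :=
  inf [set x | y <= Lsub X n b x w].

Definition dist_limit (X : int -> T -> R) (a : nat -> R)
    {d' : measure_display} {T' : measurableType d'} (Q : probability T' R)
    (xi zeta : T' -> R) : Prop :=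
  measurable_fun setT xi /\ measurable_fun setT zeta /\
  forall f : R * R -> R, continuous f -> (exists M, forall v, `|f v| <= M) ->
    rE (fun w => f (Ssum X 1 n w / a n, Qsum X 1 n w / a n)) @[n --> \oo]
    --> fine (\int[Q]_w (f (xi w, zeta w))%:E).

Definition noncover (X : int -> T -> R) (b : nat -> nat) (eta : R) (n : nat) : set T :=
  [set w | ~ (Csub X n (b n) (eta / 2) w <= Tstat X n w <= Csub X n (b n) (1 - eta / 2) w)].

End Defs.

Definition ratio_cdf {R : realType} {d' : measure_display} {T' : measurableType d'}
  (Q : probability T' R) (xi zeta : T' -> R) (x : R) : R :=
  fine (Q [set w | xi w / zeta w <= x]).
Definition ratio_quantile {R : realType} {d' : measure_display} {T' : measurableType d'}
  (Q : probability T' R) (xi zeta : T' -> R) (y : R) : R :=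
  inf [set x | y <= ratio_cdf Q xi zeta x].
Definition cont_near {R : realType} (F : R -> R) (c : R) : Prop :=
  exists delta : R, 0 < delta /\ forall x, `|x - c| < delta -> {for x, continuous F}.

(* Main.v *)
(** Proof idea.  The subsampling distribution [L_n] concentrates around the law of
    [T_b]: its variance is an average of covariances of indicators of blocks, which
    mixing makes small as [b = o(n)].  Hence, if [P(T_n <= x)] converges to [F x] near
    the two quantiles and [F] crosses the levels strictly there, the random quantiles
    converge to those of [F] and the coverage follows.

    Under finite variance, [F] is a centred normal distribution function: the sum is
    truncated, cut into blocks separated by gaps, and compared by Lindeberg's
    replacement with a Gaussian convolution semigroup acting on logistic test
    functions; the remainders are controlled by a Davydov-type covariance inequality,
    and the denominator by the law of large numbers.

    In the stable case [F] is the distribution function of [xi / zeta], where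
    [zeta > 0] almost surely because anti-clustering and mixing produce large values in
    most blocks.  It remains to see that [F] has no flat piece.  If [xi / zeta] avoided
    [(c, c')] but charged both sides, take support points [(x1, z1)] and [(x2, z2)] of
    [(xi, zeta)] on either side and [l > 0] for which
    [(x1 + l x2) / sqrt (z1^2 + l^2 z2^2)] is the midpoint.  Two blocks of lengths [n] and
    about [l^kappa n], separated by a fixed gap, are nearly independent, so with
    probability bounded below they realize the two points, and then the statistic of
    the concatenation falls in [(c, c')]: a contradiction.

    If the mean is not zero, [|T_n|] is of order [n / c_n], where [c_n] is the order of
    [Q_n], and the subsample statistics are of the smaller order [b_n / c_(b_n)], so
    [T_n] leaves their range. *)

Require Import Defs.
From HB Require Import structures.
From mathcomp Require Import all_boot all_order all_algebra.
From mathcomp Require Import all_classical all_reals all_analysis.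
From mathcomp Require Import measurable_realfun zify ring lra.
Import Order.TTheory GRing.Theory Num.Theory.
Import numFieldNormedType.Exports.
Local Open Scope classical_set_scope.
Local Open Scope ring_scope.
Set Implicit Arguments. Unset Strict Implicit. Unset Printing Implicit Defensive.

(** * Expectations and probabilities *)

(** Mixing and stationarity are properties of the process, while the statistics live on blocks.
    Every block statistic is therefore a function on path space, measurable for a finite window of
    coordinates, and is moved in time by a shift. Coverage only needs the limit law near two points:
    there the random quantile converges to a constant, so the joint law of [T_n] and the subsample
    never has to be analysed. In the Gaussian case the blocks are dependent, and no independent
    copies are built: each block is exchanged for a smoothing operator acting on the test function,
    and the error is a covariance between a block and a bounded function of its past. Truncation
    makes the normalized blocks, of length of order [sqrt n], uniformly small; their number is of
    the same order, so mixing costs a multiple of [q * alpha q] for a gap [q], which tends to 0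
    because the coefficients are monotone and summable. In the stable case continuity gives the
    level at the quantile and the infimum gives strictness on its left; strictness on its right is
    what the absence of flat pieces is for. *)

Section Expectation.
Context {R : realType} {d : measure_display} {T : measurableType d}.
Variable P : probability T R.
Implicit Types f g : T -> R.

Definition Lint f := P.-integrable setT (EFin \o f).

Lemma Lint_meas f : Lint f -> measurable_fun setT f.
Proof. by move=> /integrableP[/measurable_EFinP]. Qed.

Lemma Lint_le f g : measurable_fun setT f -> Lint g ->
  (forall w, `|f w| <= g w) -> Lint f.
Proof.
move=> mf ig fg; apply: (le_integrable _ _ _ ig) => //; first exact/measurable_EFinP.
by move=> w _; rewrite lee_fin (le_trans (fg w))// ler_norm.
Qed.

Lemma Lint_cst c : Lint (cst c).
Proof. exact: finite_measure_integrable_cst. Qed.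

Lemma Lint_bnd f M : measurable_fun setT f -> (forall w, `|f w| <= M) -> Lint f.
Proof. by move=> mf fM; apply: (Lint_le mf (Lint_cst M)). Qed.

Lemma LintD f g : Lint f -> Lint g -> Lint (fun w => f w + g w).
Proof. by move=> lf lg; apply: eq_integrable (integrableD measurableT lf lg). Qed.

Lemma LintZ c f : Lint f -> Lint (fun w => c * f w).
Proof. by move=> lf; apply: eq_integrable (integrableZl measurableT c lf). Qed.

Lemma LintN f : Lint f -> Lint (fun w => - f w).
Proof.
move=> /(LintZ (-1)); rewrite (_ : (fun w => _) = (fun w => - f w))//.
by apply/funext => w; rewrite mulN1r.
Qed.

Lemma LintB f g : Lint f -> Lint g -> Lint (fun w => f w - g w).
Proof. by move=> lf lg; apply: LintD => //; exact: LintN. Qed.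

Lemma Lint_abs f : Lint f -> Lint (fun w => `|f w|).
Proof. by move=> lf; apply: integrable_norm. Qed.

Lemma Lint_sum (I : Type) (s : seq I) (Q : pred I) (F : I -> T -> R) :
  (forall i, Q i -> Lint (F i)) -> Lint (fun w => \sum_(i <- s | Q i) F i w).
Proof.
move=> lF; elim: s => [|i s IH].
  by rewrite (_ : (fun w => _) = cst 0) ?Lint_cst//; apply/funext => w; rewrite big_nil.
rewrite (_ : (fun w => _) =
  (fun w => (if Q i then F i w else 0) + \sum_(j <- s | Q j) F j w)); last first.
  by apply/funext => w; rewrite big_cons; case: ifP => //; rewrite add0r.
by apply: LintD => //; case: (Q i) (@lF i) => [h|_]; [exact: h|exact: (Lint_cst 0)].
Qed.

Lemma rED f g : Lint f -> Lint g -> rE P (fun w => f w + g w) = rE P f + rE P g.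
Proof. by move=> lf lg; exact: RintegralD. Qed.

Lemma rEB f g : Lint f -> Lint g -> rE P (fun w => f w - g w) = rE P f - rE P g.
Proof. by move=> lf lg; exact: RintegralB. Qed.

Lemma rEZ c f : Lint f -> rE P (fun w => c * f w) = c * rE P f.
Proof. by move=> lf; exact: RintegralZl. Qed.

Lemma rE_cst c : rE P (fun=> c) = c.
Proof.
rewrite /rE (_ : (\int[P]_w c%:E)%E = (c%:E * P setT)%E); last exact: integral_cst.
by rewrite probability_setT mule1.
Qed.

Lemma rE_sum (I : Type) (s : seq I) (Q : pred I) (F : I -> T -> R) :
  (forall i, Q i -> Lint (F i)) ->
  rE P (fun w => \sum_(i <- s | Q i) F i w) = \sum_(i <- s | Q i) rE P (F i).
Proof.
move=> lF; elim: s => [|i s IH].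
  rewrite big_nil -[RHS](rE_cst 0); congr rE; apply/funext => w.
  by rewrite big_nil.
rewrite big_cons -IH.
transitivity (rE P (fun w => (if Q i then F i w else 0) + \sum_(j <- s | Q j) F j w)).
  by congr rE; apply/funext => w; rewrite big_cons; case: ifP => //; rewrite add0r.
rewrite rED; [|by case: (Q i) (@lF i) => [h|_]; [exact: h|exact: (Lint_cst 0)]|exact: Lint_sum].
by case: (Q i) => //; rewrite (rE_cst 0) add0r.
Qed.

Lemma rE_le f g : Lint f -> Lint g -> (forall w, f w <= g w) -> rE P f <= rE P g.
Proof. by move=> lf lg fg; apply: le_Rintegral. Qed.

Lemma rE_ge0 f : (forall w, 0 <= f w) -> 0 <= rE P f.
Proof. by move=> f0; apply: Rintegral_ge0. Qed.

Lemma rE_abs f : Lint f -> `|rE P f| <= rE P (fun w => `|f w|).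
Proof. by move=> lf; apply: le_normr_Rintegral. Qed.

Lemma rE_abs_le f g : Lint f -> Lint g -> (forall w, `|f w| <= g w) ->
  `|rE P f| <= rE P g.
Proof.
move=> lf lg fg; apply: le_trans (rE_abs lf) _; apply: rE_le => //.
exact: Lint_abs.
Qed.

Lemma rE_bnd f M : measurable_fun setT f -> (forall w, `|f w| <= M) -> `|rE P f| <= M.
Proof.
move=> mf fM; rewrite -[leRHS]rE_cst; apply: rE_abs_le => //; last exact: Lint_cst.
exact: Lint_bnd fM.
Qed.

Lemma EFin_rE f : Lint f -> (rE P f)%:E = (\int[P]_w (f w)%:E)%E.
Proof. by move=> lf; rewrite /rE fineK//; exact: integrable_fin_num. Qed.

Lemma Lint_lty f : measurable_fun setT f -> (\int[P]_w `|f w|%:E < +oo)%E -> Lint f.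
Proof. by move=> mf h; apply/integrableP; split => //; exact/measurable_EFinP. Qed.

Lemma EFin_pr (A : set T) : measurable A -> (pr P A)%:E = P A.
Proof. by move=> mA; rewrite /pr fineK// fin_num_measure. Qed.

Lemma rE_indic (A : set T) : measurable A -> rE P (\1_A) = pr P A.
Proof. by move=> mA; rewrite /rE /pr integral_indic// setIT. Qed.

Lemma Lint_indic (A : set T) : measurable A -> Lint (\1_A).
Proof. by move=> mA; exact: integrable_indic. Qed.

Lemma pr_ge0 (A : set T) : 0 <= pr P A.
Proof. exact: fine_ge0. Qed.

Lemma pr_le (A B : set T) : measurable A -> measurable B -> A `<=` B -> pr P A <= pr P B.
Proof.
by move=> mA mB AB; rewrite -lee_fin !EFin_pr// le_measure ?inE.
Qed.

Lemma pr_le1 (A : set T) : measurable A -> pr P A <= 1.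
Proof. by move=> mA; rewrite -lee_fin EFin_pr// probability_le1. Qed.

Lemma pr_setC (A : set T) : measurable A -> pr P (~` A) = 1 - pr P A.
Proof.
move=> mA; apply: EFin_inj; rewrite EFin_pr ?probability_setC ?EFinB ?EFin_pr//.
exact: measurableC.
Qed.

Lemma pr_le_setU (A B C : set T) : measurable A -> measurable B -> measurable C ->
  A `<=` B `|` C -> pr P A <= pr P B + pr P C.
Proof.
move=> mA mB mC ABC; rewrite -!rE_indic// -rED; [|exact: Lint_indic..].
apply: rE_le; [exact: Lint_indic|by apply: LintD; exact: Lint_indic|].
move=> w; rewrite !indicE; have [wA|wA] := boolP (w \in A); last by rewrite addr_ge0.
by have [] := ABC w (set_mem wA) => /mem_set ->; rewrite ?lerDl ?lerDr.
Qed.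

Lemma pr_setU_disj (A B : set T) : measurable A -> measurable B ->
  A `&` B = set0 -> pr P (A `|` B) = pr P A + pr P B.
Proof.
move=> mA mB AB; apply: EFin_inj; rewrite EFinD !EFin_pr ?measureU//.
exact: measurableU.
Qed.

Lemma meas_le f g : measurable_fun setT f -> measurable_fun setT g ->
  measurable [set w | f w <= g w].
Proof. by move=> mf mg; rewrite -[X in measurable X]setTI; apply: measurable_fun_le. Qed.

Lemma meas_lt f g : measurable_fun setT f -> measurable_fun setT g ->
  measurable [set w | f w < g w].
Proof.
move=> mf mg; rewrite (_ : [set w | _] = ~` [set w | g w <= f w]).
  by apply: measurableC; exact: meas_le.
by apply/seteqP; split => w /=; rewrite ltNge => /negP.
Qed.

Lemma markov_le f t : measurable_fun setT f -> Lint f -> (forall w, 0 <= f w) -> 0 < t ->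
  pr P [set w | t <= f w] <= rE P f / t.
Proof.
move=> mf lf f0 t0.
have mA : measurable [set w | t <= f w].
  exact: (meas_le (measurable_cst t) mf).
rewrite ler_pdivlMr// mulrC -rE_indic// -rEZ; last exact: Lint_indic.
apply: rE_le => //; first by apply: LintZ; exact: Lint_indic.
move=> w; rewrite indicE; have [wA|wA] := boolP (w \in _); rewrite ?mulr0 ?mulr1//.
by have := set_mem wA.
Qed.

End Expectation.
Arguments Lint_bnd {R d T P f} M.
Arguments Lint_le {R d T P f} g.
Arguments LintD {R d T P f g}.
Arguments LintB {R d T P f g}.
Arguments LintN {R d T P f}.
Arguments LintZ {R d T P} c {f}.
Arguments Lint_abs {R d T P f}.
Arguments Lint_meas {R d T P f}.
Arguments Lint_cst {R d T P} c.
Arguments Lint_indic {R d T P} A.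
Arguments rED {R d T P f g}.
Arguments rEB {R d T P f g}.
Arguments rEZ {R d T P} c {f}.
Arguments rE_cst {R d T} P c.
Arguments rE_le {R d T P f g}.
Arguments rE_abs {R d T P f}.
Arguments rE_abs_le {R d T P f} g.
Arguments rE_bnd {R d T P f} M.
Arguments EFin_rE {R d T P f}.
Arguments Lint_lty {R d T P f}.
Arguments EFin_pr {R d T P A}.
Arguments rE_indic {R d T P A}.
Arguments pr_ge0 {R d T P} A.
Arguments pr_le {R d T P A} B.
Arguments pr_le1 {R d T P A}.
Arguments pr_setC {R d T P A}.
Arguments pr_le_setU {R d T P A} B C.
Arguments pr_setU_disj {R d T P A B}.
Arguments markov_le {R d T P f t}.

(** * Paths of a stationary process and strong mixing *)

Section Path.
Context {R : realType}.

Definition cyl (I : set int) : set (set (int -> R)) :=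
  [set A | exists t, I t /\ exists B, measurable B /\ A = (fun x => x t) @^-1` B].
(** The carrier is always the full path space and only the sigma-algebra shrinks with [I]. Depending
    on a window of coordinates is then plain measurability, and enlarging the window ([meas_sub])
    keeps the same function. *)
Definition pathT (I : set int) := g_sigma_algebraType (cyl I).

Lemma coord_meas (I : set int) t : I t ->
  measurable_fun setT (fun x : pathT I => x t).
Proof.
by move=> It _ B mB; rewrite setTI; apply: sub_sigma_algebra; exists t; split=> //; exists B.
Qed.

Definition shift (s : int) (x : int -> R) : int -> R := fun t => x (t + s).

Lemma into_path_meas d (U : measurableType d) (I : set int) (f : U -> int -> R) :
  (forall t, I t -> measurable_fun setT (fun u => f u t)) ->
  measurable_fun setT (f : U -> pathT I).
Proof.
move=> mf; apply: (@measurability _ _ U (pathT I) setT f (cyl I) erefl).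
by move=> A [B [t [It [C [mC ->]]]] <-]; exact: (mf t It measurableT C mC).
Qed.

Lemma meas_sub (I J : set int) (h : (int -> R) -> R) : I `<=` J ->
  measurable_fun setT (h : pathT I -> R) -> measurable_fun setT (h : pathT J -> R).
Proof.
move=> IJ mh.
have mid : measurable_fun setT (fun x : pathT J => x : pathT I).
  by apply: into_path_meas => t /IJ Jt; exact: coord_meas.
exact: (measurableT_comp mh mid).
Qed.

Definition rect n (t : 'I_n -> int) (B : 'I_n -> set R) : set (int -> R) :=
  \bigcap_(i in [set: 'I_n]) ((fun x => x (t i)) @^-1` B i).
Definition rects : set (set (int -> R)) :=
  [set A | exists n (t : 'I_n -> int) (B : 'I_n -> set R),
    (forall i, measurable (B i)) /\ A = rect t B].

Lemma rectsI : setI_closed rects.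
Proof.
move=> _ _ [n [t [B [mB ->]]]] [m [u [C [mC ->]]]].
exists (n + m)%N, (fun i => match fintype.split i with inl j => t j | inr j => u j end),
  (fun i => match fintype.split i with inl j => B j | inr j => C j end); split.
  by move=> i; case: (fintype.split i).
apply/seteqP; split => [x [xB xC] i _|x xBC]; rewrite /preimage/=.
  by case: (fintype.split i) => j; [exact: xB|exact: xC].
split=> j _; rewrite /preimage/=.
  by have := xBC (lshift m j) I; rewrite /preimage/= (unsplitK (inl j)).
by have := xBC (rshift n j) I; rewrite /preimage/= (unsplitK (inr j)).
Qed.

Lemma rects_meas : rects `<=` (@measurable _ (pathT setT)).
Proof.
move=> _ [n [t [B [mB ->]]]]; apply: fin_bigcap_measurable => // i _.
by rewrite -[X in measurable X]setTI; apply: (coord_meas (I := setT) (t := t i)).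
Qed.

Lemma cyl_rects : @measurable _ (pathT setT) = <<s rects >>.
Proof.
apply/seteqP; split.
  apply: smallest_sub; first exact: smallest_sigma_algebra.
  move=> _ [t [_ [B [mB ->]]]]; apply: sub_sigma_algebra.
  exists 1, (fun=> t), (fun=> B); split=> //.
  by apply/seteqP; split => x /=; [move=> xB i _|move=> /(_ ord0 I)].
apply: smallest_sub; last exact: rects_meas.
exact: (@sigma_algebra_measurable _ (pathT setT)).
Qed.
End Path.

Section Stationary.
Context {R : realType} {d : measure_display} {T : measurableType d}.
Variable P : probability T R.
Variable X : int -> T -> R.
Hypothesis mX : forall t, measurable_fun setT (X t).
Hypothesis sX : stationary P X.

Definition path (s : int) (w : T) : int -> R := fun t => X (t + s) w.

Lemma path_meas s : measurable_fun setT (path s : T -> pathT setT).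
Proof. by apply: into_path_meas => t _; exact: mX. Qed.

(** Stationarity is given on finite rectangles. These are stable under intersection and generate the
    path sigma-algebra, so two probability laws that agree on them are equal. *)
Lemma path_law s (A : set (pathT setT)) : measurable A ->
  P (path s @^-1` A) = P (path 0 @^-1` A).
Proof.
move=> mA.
have m0 := path_meas 0; have ms := path_meas s.
have := @measure_unique _ R (pathT setT) rects (fun=> setT) _ _ _ _
  (pushforward P (path s : T -> pathT setT)) (pushforward P (path 0 : T -> pathT setT)) _ _ A mA.
apply => //.
- exact: cyl_rects.
- exact: rectsI.
- move=> _; exists 0, (fun=> 0), (fun=> setT); split=> //.
  by apply/seteqP; split.
- by rewrite bigcup_const//; exists 0.
- move=> _ [n [t [B [mB ->]]]] /=.
  have := sX t s mB; rewrite /pushforward/rect !preimage_bigcap => e.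
  transitivity (P (\bigcap_(i in [set: 'I_n]) (X (t i) @^-1` B i))) => //.
  by congr (P _); apply: eq_bigcapr => i _; rewrite /preimage/path/= addr0.
- by move=> _; rewrite /= /pushforward preimage_setT probability_setT ltry.
Qed.

Lemma path_integral_ge0 s (f : pathT setT -> \bar R) : measurable_fun setT f ->
  (forall x, 0 <= f x)%E -> (\int[P]_w f (path s w) = \int[P]_w f (path 0 w))%E.
Proof.
move=> mf f0.
rewrite -[LHS](@ge0_integral_pushforward _ _ _ _ R _ (path_meas s) P setT f)//.
rewrite -[RHS](@ge0_integral_pushforward _ _ _ _ R _ (path_meas 0) P setT f)//.
have E := @eq_measure_integral _ _ R setT (pushforward P (path 0 : T -> pathT setT))
  (pushforward P (path s : T -> pathT setT)) f.
by apply: (E (path_meas 0) (path_meas s)) => A mA _; exact: path_law.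
Qed.

Lemma path_integral s (f : pathT setT -> \bar R) : measurable_fun setT f ->
  (\int[P]_w f (path s w) = \int[P]_w f (path 0 w))%E.
Proof.
move=> mf; rewrite [LHS]integralE [RHS]integralE.
have cp u : ((fun w => f (path u w))^\+ = (fun w => f^\+ (path u w)))%E.
  exact: (funepos_comp f (path u)).
have cn u : ((fun w => f (path u w))^\- = (fun w => f^\- (path u w)))%E.
  exact: (funeneg_comp f (path u)).
rewrite !cp !cn.
rewrite (path_integral_ge0 s (measurable_funepos mf) (fun x => funepos_ge0 f x)).
by rewrite (path_integral_ge0 s (measurable_funeneg mf) (fun x => funeneg_ge0 f x)).
Qed.

Lemma path_rE s (f : (int -> R) -> R) : measurable_fun setT (f : pathT setT -> R) ->
  rE P (f \o path s) = rE P (f \o path 0).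
Proof.
move=> mf; congr fine; apply: (path_integral s (f := fun x => (f x)%:E)).
exact/measurable_EFinP.
Qed.
Definition gens (I : set int) : set (set T) :=
  [set A | exists t, I t /\ exists B, measurable B /\ A = X t @^-1` B].

Lemma gens_meas (I : set int) : gens I `<=` measurable.
Proof.
by move=> _ [t [_ [B [mB ->]]]]; rewrite -[X in measurable X]setTI; exact: mX.
Qed.

Lemma gen_sigma_meas (I : set int) (A : set T) : gen_sigma X I A -> measurable A.
Proof. by apply: smallest_sub; [exact: sigma_algebra_measurable|exact: gens_meas]. Qed.

Lemma measurable_wrt_fun (I : set int) (g : T -> R) :
  measurable_wrt (gen_sigma X I) g -> measurable_fun setT g.
Proof. by move=> mg _ B mB; rewrite setTI; apply: gen_sigma_meas (mg B mB). Qed.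

Lemma path_meas_wrt (I J : set int) s (h : (int -> R) -> R) :
  (forall t, I t -> J (t + s)) -> measurable_fun setT (h : pathT I -> R) ->
  measurable_wrt (gen_sigma X J) (h \o path s).
Proof.
move=> IJ mh B mB.
have mp : measurable_fun setT (path s : g_sigma_algebraType (gens J) -> pathT I).
  apply: into_path_meas => t It _ C mC; rewrite setTI; apply: sub_sigma_algebra.
  by exists (t + s); split; [exact: IJ|exists C].
have mhp := measurableT_comp mh mp.
by have := mhp measurableT B mB; rewrite setTI.
Qed.

Lemma comp_path_meas s (h : (int -> R) -> R) : measurable_fun setT (h : pathT setT -> R) ->
  measurable_fun setT (h \o path s).
Proof. by move=> mh; exact: (measurableT_comp mh (path_meas s)). Qed.

Lemma rcov_bnd (f g : T -> R) : measurable_fun setT f -> measurable_fun setT g ->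
  (forall w, `|f w| <= 1) -> (forall w, `|g w| <= 1) -> `|rcov P f g| <= 2.
Proof.
move=> mf mg f1 g1; rewrite /rcov (le_trans (ler_normB _ _))//.
rewrite (_ : 2 = 1 + 1)// lerD//.
  apply: rE_bnd => [|w]; first exact: measurable_funM.
  by rewrite normrM mulr_ile1.
by rewrite normrM mulr_ile1//; exact: rE_bnd.
Qed.

Local Notation aset k := [set r | exists g1 g2 : T -> R,
        measurable_wrt (gen_sigma X [set s | s <= 0]) g1 /\
        measurable_wrt (gen_sigma X [set s | k%:Z <= s]) g2 /\
        (forall w, `|g1 w| <= 1) /\ (forall w, `|g2 w| <= 1) /\
        r = `|rcov P g1 g2|].

(** A real supremum is informative for nonempty bounded sets only. Covariances of functions bounded
    by 1 are at most 2, which is also the bound on [alpha] used later. *)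
Lemma alpha_has_sup k : has_sup (aset k).
Proof.
split.
  exists `|rcov P (cst 0) (cst 0)|, (cst 0), (cst 0).
  have m0 I : measurable_wrt (gen_sigma X I) (cst (0 : R)).
    move=> B mB.
    have := measurable_cst (0 : R) (D := [set: g_sigma_algebraType (gens I)]).
    by move=> /(_ measurableT B mB); rewrite setTI.
  split; [exact: m0|split; [exact: m0|]].
  have z1 (w : T) : `|(cst (0 : R) : T -> R) w| <= 1 by rewrite normr0 ler01.
  by split; [exact: z1|split; [exact: z1|]].
exists 2 => _ [g1 [g2 [m1 [m2 [b1 [b2 ->]]]]]].
by apply: rcov_bnd => //; [exact: measurable_wrt_fun m1|exact: measurable_wrt_fun m2].
Qed.

Lemma alpha_ge k (g1 g2 : T -> R) :
  measurable_wrt (gen_sigma X [set s | s <= 0]) g1 ->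
  measurable_wrt (gen_sigma X [set s | k%:Z <= s]) g2 ->
  (forall w, `|g1 w| <= 1) -> (forall w, `|g2 w| <= 1) ->
  `|rcov P g1 g2| <= alpha P X k.
Proof.
move=> m1 m2 b1 b2; apply: sup_upper_bound; first exact: alpha_has_sup.
by exists g1, g2.
Qed.

Lemma alpha_ge0 k : 0 <= alpha P X k.
Proof.
have [[r Hr] _] := alpha_has_sup k.
have : r <= alpha P X k by apply: sup_upper_bound => //; exact: alpha_has_sup.
by apply: le_trans; case: Hr => g1 [g2 [_ [_ [_ [_ ->]]]]].
Qed.

Lemma alpha_le2 k : alpha P X k <= 2.
Proof.
apply: ge_sup; first by case: (alpha_has_sup k).
move=> _ [g1 [g2 [m1 [m2 [b1 [b2 ->]]]]]].
by apply: rcov_bnd => //; [exact: measurable_wrt_fun m1|exact: measurable_wrt_fun m2].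
Qed.

Lemma alpha_anti k l : (k <= l)%N -> alpha P X l <= alpha P X k.
Proof.
move=> kl; apply: ge_sup; first by case: (alpha_has_sup l).
move=> _ [g1 [g2 [m1 [m2 [b1 [b2 ->]]]]]]; apply: alpha_ge => // B mB.
move: (g2 @^-1` B) (m2 B mB); apply: smallest_sub; first exact: smallest_sigma_algebra.
move=> _ [t [lt [C [mC ->]]]]; apply: sub_sigma_algebra; exists t; split; last by exists C.
by apply: le_trans lt; rewrite lez_nat.
Qed.

(** [alpha] is anchored at time 0. Reading the path from [- s] puts the past of [s] at nonpositive
    times and its future after [k], and stationarity makes the covariance independent of the
    starting point [u]. *)
Lemma mix_cov1 (s u : int) k (h1 h2 : (int -> R) -> R) :
  measurable_fun setT (h1 : pathT [set t | t <= s] -> R) ->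
  measurable_fun setT (h2 : pathT [set t | s + k%:Z <= t] -> R) ->
  (forall x, `|h1 x| <= 1) -> (forall x, `|h2 x| <= 1) ->
  `|rcov P (h1 \o path u) (h2 \o path u)| <= alpha P X k.
Proof.
move=> m1 m2 b1 b2.
have e (h : (int -> R) -> R) : measurable_fun setT (h : pathT setT -> R) ->
    rE P (h \o path u) = rE P (h \o path (- s)).
  by move=> mh; rewrite [LHS]path_rE// [RHS]path_rE.
have M1 := meas_sub (@subsetT _ _) m1; have M2 := meas_sub (@subsetT _ _) m2.
have -> : rcov P (h1 \o path u) (h2 \o path u) =
    rcov P (h1 \o path (- s)) (h2 \o path (- s)).
  rewrite /rcov (e _ M1) (e _ M2); congr (_ - _).
  by apply: (e (fun x => h1 x * h2 x)); exact: measurable_funM.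
apply: alpha_ge => [||w|w]; rewrite ?b1 ?b2//.
  by apply: path_meas_wrt m1 => t /=; rewrite subr_le0.
by apply: path_meas_wrt m2 => t /=; rewrite lerBrDl.
Qed.

Lemma mix_cov (s u : int) k (h1 h2 : (int -> R) -> R) M1 M2 :
  measurable_fun setT (h1 : pathT [set t | t <= s] -> R) ->
  measurable_fun setT (h2 : pathT [set t | s + k%:Z <= t] -> R) ->
  0 < M1 -> 0 < M2 ->
  (forall x, `|h1 x| <= M1) -> (forall x, `|h2 x| <= M2) ->
  `|rcov P (h1 \o path u) (h2 \o path u)| <= M1 * M2 * alpha P X k.
Proof.
move=> m1 m2 M1p M2p b1 b2.
have B1 := meas_sub (@subsetT _ _) m1; have B2 := meas_sub (@subsetT _ _) m2.
have L1 : Lint P (h1 \o path u) by apply: (Lint_bnd M1) (comp_path_meas u B1) _ => w; exact: b1.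
have L2 : Lint P (h2 \o path u) by apply: (Lint_bnd M2) (comp_path_meas u B2) _ => w; exact: b2.
have L12 : Lint P (fun w => (h1 \o path u) w * (h2 \o path u) w).
  apply: (Lint_bnd (M1 * M2)) => [|w]; last by rewrite normrM ler_pM//; [exact: b1|exact: b2].
  exact: measurable_funM (comp_path_meas u B1) (comp_path_meas u B2).
have := @mix_cov1 s u k (fun x => M1^-1 * h1 x) (fun x => M2^-1 * h2 x).
have -> : rcov P ((fun x => M1^-1 * h1 x) \o path u) ((fun x => M2^-1 * h2 x) \o path u)
    = M1^-1 * M2^-1 * rcov P (h1 \o path u) (h2 \o path u).
  rewrite /rcov mulrBr -(rEZ _ L12) mulrACA -(rEZ _ L1) -(rEZ _ L2).
  by congr (rE P _ - _); apply/funext => w /=; rewrite mulrACA.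
rewrite normrM gtr0_norm ?mulr_gt0 ?invr_gt0// -invfM mulrC ler_pdivrMr ?mulr_gt0//.
rewrite [leRHS]mulrC; apply.
- by apply: measurable_funM.
- by apply: measurable_funM.
- by move=> x; rewrite normrM gtr0_norm ?invr_gt0// mulrC ler_pdivrMr ?mul1r.
- by move=> x; rewrite normrM gtr0_norm ?invr_gt0// mulrC ler_pdivrMr ?mul1r.
Qed.
End Stationary.

(** * Functionals of blocks *)

Section MeasAux.
Context {R : realType} {d : measure_display} {U : measurableType d}.

(** The power with exponent -1 is measurable everywhere and equals the inverse on nonnegative
    numbers, 0 included, where both are 0. *)
Lemma meas_inv_ge0 (f : U -> R) : measurable_fun setT f -> (forall u, 0 <= f u) ->
  measurable_fun setT (fun u => (f u)^-1).
Proof.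
move=> mf f0; rewrite (_ : (fun u => _) = (fun u => f u `^ (-1))).
  exact: (measurableT_comp (@measurable_powR R (-1)) mf).
by apply/funext => u; rewrite powR_inv1.
Qed.

Lemma meas_sqrt (f : U -> R) : measurable_fun setT f ->
  measurable_fun setT (fun u => Num.sqrt (f u)).
Proof.
by move=> mf; exact: (measurableT_comp (continuous_measurable_fun (@sqrt_continuous R)) mf).
Qed.

Lemma meas_if (A : set U) : measurable A ->
  measurable_fun setT (fun u => if u \in A then 1 else 0 : R).
Proof.
move=> /(@measurable_indicP _ _ R) mA.
rewrite (_ : (fun u => _) = \1_A) //; apply/funext => u; rewrite indicE.
by case: (u \in A).
Qed.

Lemma meas_le_if (f g : U -> R) : measurable_fun setT f -> measurable_fun setT g ->
  measurable_fun setT (fun u => if f u <= g u then 1 else 0 : R).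
Proof.
move=> mf mg; rewrite (_ : (fun u => _) =
  (fun u => if u \in [set w | f w <= g w] then 1 else 0)); first exact: meas_if (meas_le mf mg).
by apply/funext => u; congr (if _ then _ else _); apply/idP/idP; rewrite inE.
Qed.
End MeasAux.

Section Blocks.
Context {R : realType} {d : measure_display} {T : measurableType d}.
Variable P : probability T R.
Variable X : int -> T -> R.
Hypothesis mX : forall t, measurable_fun setT (X t).
Hypothesis sX : stationary P X.

Definition Ib (b : nat) : set int := [set t | 0 <= t < b%:Z].
Definition coord (t : int) (x : int -> R) : R := x t.

(** The first block reads the times from [s] to [s + b - 1], so the true distance is one more than
    [k]; counting from [s + b] keeps the arithmetic simple. *)
Lemma mix_blocks (s s' b b' k : nat) (h h' : (int -> R) -> R) M M' :
  (s + b + k <= s')%N ->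
  measurable_fun setT (h : pathT (Ib b) -> R) ->
  measurable_fun setT (h' : pathT (Ib b') -> R) ->
  0 < M -> 0 < M' -> (forall x, `|h x| <= M) -> (forall x, `|h' x| <= M') ->
  `|rcov P (h \o path X s) (h' \o path X s')| <= M * M' * alpha P X k.
Proof.
move=> sbk mh mh' M0 M'0 hM hM'.
have e (u : nat) (g : (int -> R) -> R) : g \o path X u = (g \o shift u) \o path X 0.
  by apply/funext => w /=; congr g; apply/funext => t; rewrite /path/shift addr0.
rewrite (e s) (e s'); apply: (mix_cov mX sX (s := (s + b)%N)) => //.
- have m1 : measurable_fun setT (shift s : @pathT R [set t : int | t <= (s + b)%N] -> pathT (Ib b)).
    by apply: into_path_meas => t /andP[t0 tb]; apply: coord_meas => /=; rewrite addrC PoszD lerD2l ltW.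
  exact: (measurableT_comp mh m1).
- have m1 : measurable_fun setT (shift s' : @pathT R [set t : int | (s + b)%N%:Z + k%:Z <= t] -> pathT (Ib b')).
    apply: into_path_meas => t /andP[t0 tb]; apply: coord_meas => /=; rewrite -PoszD.
    by rewrite (@le_trans _ _ s'%:Z) ?lez_nat// lerDr.
  exact: (measurableT_comp mh' m1).
- by move=> x; exact: hM.
- by move=> x; exact: hM'.
Qed.

Lemma Ib_meas (b : nat) (h : (int -> R) -> R) :
  measurable_fun setT (h : pathT (Ib b) -> R) ->
  measurable_fun setT (h : pathT setT -> R).
Proof. exact: meas_sub. Qed.

Lemma block_meas (b s : nat) (h : (int -> R) -> R) :
  measurable_fun setT (h : pathT (Ib b) -> R) ->
  measurable_fun setT (h \o path X s).
Proof. by move=> /Ib_meas mh; exact: comp_path_meas. Qed.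

Lemma block_rE (b s : nat) (h : (int -> R) -> R) :
  measurable_fun setT (h : pathT (Ib b) -> R) ->
  rE P (h \o path X s) = rE P (h \o path X 0).
Proof. by move=> /Ib_meas mh; exact: path_rE. Qed.

(** The statistics of the coordinate process itself, started at 0. A subsample starting at [i] is
    this one functional composed with [path X i], which is how stationarity and mixing reach it. *)
Definition fS (b : nat) : (int -> R) -> R := @Ssum R _ (pathT setT) coord 0 b.
Definition fQ (b : nat) : (int -> R) -> R := @Qsum R _ (pathT setT) coord 0 b.
Definition fT (b : nat) : (int -> R) -> R := @Tsub R _ (pathT setT) coord b 0.

Lemma coordI_meas (b t : nat) : (t < b)%N ->
  measurable_fun setT (coord t : pathT (Ib b) -> R).
Proof. by move=> tb; apply: coord_meas; rewrite /Ib/= ltz_nat. Qed.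

Lemma block_sum_meas (b : nat) (g : R -> R) : measurable_fun setT g ->
  measurable_fun setT (fun x : pathT (Ib b) => \sum_(0 <= t < b) g (coord t x)).
Proof.
move=> mg; rewrite (_ : (fun x => _) = (fun x => \sum_(t < b) g (coord t x))).
  apply: (@measurable_sum _ (pathT (Ib b)) _ _ _ _ (fun (t : 'I_b) x => g (coord t x))) => t.
  exact: (measurableT_comp mg (coordI_meas (ltn_ord t))).
by apply/funext => x; rewrite big_mkord.
Qed.

Lemma fS_meas b : measurable_fun setT (fS b : pathT (Ib b) -> R).
Proof. by rewrite /fS/Ssum add0n; exact: (block_sum_meas (@measurable_id _ _ _)). Qed.

Lemma fQ_meas b : measurable_fun setT (fQ b : pathT (Ib b) -> R).
Proof.
have := @block_sum_meas b (fun x : R => x ^+ 2) (@exprn_measurable R setT 2).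
by move=> /meas_sqrt; rewrite /fQ/Qsum add0n.
Qed.

Lemma fT_meas b : measurable_fun setT (fT b : pathT (Ib b) -> R).
Proof.
apply: measurable_funM; first exact: fS_meas.
by apply: meas_inv_ge0; [exact: fQ_meas|move=> x; exact: sqrtr_ge0].
Qed.

Lemma Ssum_path b i : Ssum X i b = fS b \o path X i.
Proof.
apply/funext => w; rewrite /fS/Ssum/= add0n -[X in index_iota X _]add0n.
by rewrite big_addn addKn; apply: eq_bigr => t _; rewrite /coord/path PoszD.
Qed.

Lemma Qsum_path b i : Qsum X i b = fQ b \o path X i.
Proof.
apply/funext => w; rewrite /fQ/Qsum/= add0n -[X in index_iota X _]add0n.
by rewrite big_addn addKn; congr Num.sqrt; apply: eq_bigr => t _; rewrite /coord/path PoszD.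
Qed.

Lemma Tsub_path b i : Tsub X b i = fT b \o path X i.
Proof. by rewrite /Tsub Ssum_path Qsum_path. Qed.

Lemma Ssum_meas b i : measurable_fun setT (Ssum X i b).
Proof. by rewrite Ssum_path; exact: block_meas (@fS_meas b). Qed.

Lemma Qsum_meas b i : measurable_fun setT (Qsum X i b).
Proof. by rewrite Qsum_path; exact: block_meas (@fQ_meas b). Qed.

Lemma Tsub_meas b i : measurable_fun setT (Tsub X b i).
Proof. by rewrite Tsub_path; exact: block_meas (@fT_meas b). Qed.

Lemma block_pr (b s : nat) (h : (int -> R) -> R) (A : set R) :
  measurable_fun setT (h : pathT (Ib b) -> R) -> measurable A ->
  pr P [set w | A (h (path X s w))] = pr P [set w | A (h (path X 0 w))].
Proof.
move=> /Ib_meas mh mA.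
have := path_law mX sX s (A := h @^-1` A); rewrite /pr => ->//.
by have := mh measurableT A mA; rewrite setTI.
Qed.
End Blocks.

(** * Variance of averages under weak dependence *)

Section Variance.
Context {R : realType} {d : measure_display} {T : measurableType d}.
Variable P : probability T R.

Lemma rE_sqr_sum (I : Type) (s : seq I) (Y : I -> T -> R) (c : I -> R) :
  (forall i, Lint P (Y i)) -> (forall i j, Lint P (fun w => Y i w * Y j w)) ->
  (forall i, c i = rE P (Y i)) ->
  rE P (fun w => (\sum_(i <- s) (Y i w - c i)) ^+ 2) =
  \sum_(i <- s) \sum_(j <- s) rcov P (Y i) (Y j).
Proof.
move=> LY LYY cE.
have L i j : Lint P (fun w => (Y i w - c i) * (Y j w - c j)).
  rewrite (_ : (fun w => _) = (fun w => Y i w * Y j w - c j * Y i w - c i * Y j w + c i * c j)).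
    by apply: (LintD _ (Lint_cst _)); apply: LintB; [apply: LintB => //|]; exact: LintZ.
  by apply/funext => w; ring.
transitivity (rE P (fun w => \sum_(i <- s) \sum_(j <- s) (Y i w - c i) * (Y j w - c j))).
  congr rE; apply/funext => w; rewrite expr2 mulr_suml; apply: eq_bigr => i _.
  by rewrite mulr_sumr.
rewrite rE_sum; last by move=> i _; apply: Lint_sum => j _; exact: L.
apply: eq_bigr => i _; rewrite rE_sum//; apply: eq_bigr => j _.
transitivity (rE P (fun w => Y i w * Y j w - c j * Y i w - c i * Y j w + c i * c j)).
  by congr rE; apply/funext => w; ring.
rewrite rED; [|by apply: LintB; [apply: LintB => //|]; exact: LintZ|exact: Lint_cst].
rewrite rEB; [|by apply: LintB => //; exact: LintZ|exact: LintZ].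
rewrite rEB//; last exact: LintZ.
rewrite (rE_cst P (c i * c j)) !rEZ// /rcov -!cE; ring.
Qed.

Lemma sum_near_diag (q B i : nat) :
  \sum_(j < q) (if (j < i + B)%N && (i < j + B)%N then 1 else 0 : R) <= (2 * B)%:R.
Proof.
rewrite -big_mkcond/=.
rewrite -(big_mkord (fun j => (j < i + B)%N && (i < j + B)%N) (fun=> 1 : R)).
rewrite big_const_seq iter_addr_0 ler_nat /index_iota subn0 -size_filter.
apply: (@leq_trans (size (iota (i - B) (2 * B)))); last by rewrite size_iota.
apply: uniq_leq_size; first by rewrite filter_uniq// iota_uniq.
by move=> j; rewrite mem_filter !mem_iota; lia.
Qed.

(* Two indices at distance at least [B] contribute at most [e], the others at most [C]. *)
Lemma var_avg (q B : nat) (Y : nat -> T -> R) (C e M : R) :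
  (0 < q)%N -> 0 <= C -> 0 <= e ->
  (forall i, measurable_fun setT (Y i)) -> (forall i w, `|Y i w| <= M) ->
  (forall i j, `|rcov P (Y i) (Y j)| <= C) ->
  (forall i j, (i + B <= j)%N || (j + B <= i)%N -> `|rcov P (Y i) (Y j)| <= e) ->
  rE P (fun w => (q%:R^-1 * \sum_(i < q) Y i w - q%:R^-1 * \sum_(i < q) rE P (Y i)) ^+ 2)
    <= (2 * B)%:R * C / q%:R + e.
Proof.
move=> q0 C0 e0 mY bY hC he.
have LY i : Lint P (Y i) by exact: (Lint_bnd M).
have LYY i j : Lint P (fun w => Y i w * Y j w).
  apply: (Lint_bnd (M * M)) => [|w]; first exact: measurable_funM.
  by rewrite normrM ler_pM.
have qp : 0 < (q%:R : R) by rewrite ltr0n.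
have LS : Lint P (fun w => (\sum_(i < q) (Y i w - rE P (Y i))) ^+ 2).
  rewrite (_ : (fun w => _) = (fun w => \sum_(i < q) \sum_(j < q) (Y i w - rE P (Y i)) * (Y j w - rE P (Y j)))).
    apply: Lint_sum => i _; apply: Lint_sum => j _.
    apply: (Lint_bnd ((M + M) * (M + M))) => [|w].
      by apply: measurable_funM; apply: measurable_funB => //.
    rewrite normrM; have h k : `|Y k w - rE P (Y k)| <= M + M.
      by rewrite (le_trans (ler_normB _ _))// lerD//; exact: rE_bnd.
    by rewrite ler_pM.
  apply/funext => w; rewrite expr2 mulr_suml; apply: eq_bigr => i _.
  by rewrite mulr_sumr.
have -> : rE P (fun w => (q%:R^-1 * \sum_(i < q) Y i w - q%:R^-1 * \sum_(i < q) rE P (Y i)) ^+ 2)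
   = q%:R^-1 ^+ 2 * \sum_(i < q) \sum_(j < q) rcov P (Y i) (Y j).
  rewrite -(rE_sqr_sum _ (Y := fun i : 'I_q => Y i) (c := fun i => rE P (Y i)))//.
  rewrite -rEZ//; congr rE; apply/funext => w.
  by rewrite -mulrBr sumrB exprMn.
apply: (@le_trans _ _ (q%:R^-1 ^+ 2 * \sum_(i < q) ((2 * B)%:R * C + q%:R * e))).
  rewrite ler_pM2l ?exprn_gt0 ?invr_gt0//; apply: ler_sum => i _.
  apply: (@le_trans _ _ (\sum_(j < q) ((if (j < i + B)%N && (i < j + B)%N then 1 else 0) * C + e))).
    apply: ler_sum => j _; apply: le_trans (ler_norm _) _.
    case: ifPn => [_|]; first by rewrite mul1r (le_trans (hC _ _))// lerDl.
    by rewrite mul0r add0r negb_and -!leqNgt => /he.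
  rewrite big_split/= -mulr_suml lerD//; first by rewrite ler_wpM2r// sum_near_diag.
  by rewrite sumr_const card_ord mulr_natl.
rewrite sumr_const card_ord -mulr_natl le_eqVlt; apply/orP; left; apply/eqP.
by field; rewrite gt_eqF.
Qed.
End Variance.

(** * Law of large numbers *)

Section NearSeq.
Context {R : realType}.

Lemma cvg_nearP (u : nat -> R) (l : R) :
  u n @[n --> \oo] --> l <-> forall e, 0 < e -> \forall n \near \oo, `|u n - l| < e.
Proof.
split=> [/cvgrPdist_lt h e /h|h].
  by apply: filterS => n; rewrite distrC.
by apply/cvgrPdist_lt => e /h; apply: filterS => n; rewrite distrC.
Qed.

Lemma near_ge (N : nat) : \forall n \near \oo, (N <= n)%N.
Proof. by exists N. Qed.

Lemma near_sub (b : nat -> nat) (Q : nat -> Prop) :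
  (forall K, \forall n \near \oo, (K <= b n)%N) ->
  (\forall m \near \oo, Q m) -> \forall n \near \oo, Q (b n).
Proof. by move=> hb [N _ hN]; apply: filterS (hb N) => n; exact: hN. Qed.

Lemma natr_cvgy (b : nat -> nat) : ((b n)%:R : R) @[n --> \oo] --> +oo ->
  forall K, \forall n \near \oo, (K <= b n)%N.
Proof.
by move=> /cvgryPge h K; apply: filterS (h K%:R) => n; rewrite ler_nat.
Qed.

Lemma near_natr (A : R) : \forall n \near \oo, A <= n%:R.
Proof.
have [N hN] : exists N : nat, A <= N%:R.
  by exists (Num.truncn `|A|).+1; rewrite (le_trans (ler_norm _))// ltW// truncnS_gt.
by exists N => // n /= Nn; rewrite (le_trans hN)// ler_nat.
Qed.

Lemma near_small_inv (A e : R) : 0 < e -> \forall n \near \oo, A / n%:R <= e.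
Proof.
move=> e0; apply: filterS2 (near_natr (A / e)) (near_ge 1) => n h n1.
by rewrite ler_pdivrMr ?ltr0n// mulrC -ler_pdivrMr.
Qed.
End NearSeq.

Section Conc.
Context {R : realType} {d : measure_display} {T : measurableType d}.
Variable P : probability T R.

Lemma chebyshev_le (f : T -> R) (e V : R) : measurable_fun setT f ->
  Lint P (fun w => f w ^+ 2) -> 0 < e -> rE P (fun w => f w ^+ 2) <= V ->
  pr P [set w | e <= `|f w|] <= V / e ^+ 2.
Proof.
move=> mf lf e0 hV.
rewrite (_ : [set w | _] = [set w | e ^+ 2 <= f w ^+ 2]); last first.
  apply/seteqP; split => w /=; rewrite -[f w ^+ 2]real_normK ?num_real//.
    by move=> h; rewrite lerXn2r ?nnegrE// ltW.
  by rewrite ler_pXn2r ?nnegrE// ltW.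
apply: le_trans (markov_le _ lf _ _) _ => //; rewrite ?exprn_gt0//.
- exact: measurable_funX.
- by move=> w; rewrite sqr_ge0.
- by rewrite ler_pM2r ?invr_gt0 ?exprn_gt0.
Qed.

(** Dominated convergence: the part of [f] above level [n] vanishes pointwise and is dominated by
    [|f|]. *)
Lemma tail_small (f : T -> R) e : Lint P f -> 0 < e -> exists M, 0 < M /\
  rE P (fun w => if `|f w| <= M then 0 else `|f w|) <= e.
Proof.
move=> lf e0; have mf := Lint_meas lf.
pose g (n : nat) w := if `|f w| <= n%:R then 0 else `|f w|.
have mg n : measurable_fun setT (g n).
  rewrite (_ : g n = fun w => `|f w| - (if `|f w| <= n%:R then 1 else 0) * `|f w|).
    have ma : measurable_fun setT (fun w => `|f w|) by exact: measurableT_comp.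
    apply: measurable_funB => //; apply: measurable_funM => //.
    by apply: meas_le_if => //; exact: measurable_cst.
  by apply/funext => w; rewrite /g; case: ifP; rewrite ?mul1r ?subrr// mul0r subr0.
have gf n w : `|g n w| <= `|f w| by rewrite /g; case: ifP; rewrite ?normr0// normr_id.
have Lg n : Lint P (g n) by exact: (Lint_le (fun w => `|f w|) (mg n) (Lint_abs lf)).
have [|||||_ _] := @dominated_convergence _ T R P setT measurableT
   (fun n w => (g n w)%:E) (fun=> 0%E) (fun w => `|f w|%:E).
- by move=> n; exact/measurable_EFinP.
- exact: measurable_cst.
- apply: aeW => w _; apply: cvg_near_cst.
  apply: filterS (near_natr `|f w|) => n h; rewrite /g h//.
- exact: Lint_abs.
- by apply: aeW => w n _; rewrite lee_fin.
rewrite integral_cst//= mul0e => h.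
have h' : rE P (g n) @[n --> \oo] --> (0 : R).
  have := @fine_cvg _ _ _ _ (fun n => (\int[P]_w (g n w)%:E)%E) 0 h; exact.
move/cvg_nearP: h' => /(_ e e0) [N _ hN].
exists N.+1%:R; split; first by rewrite ltr0n.
by have := hN N.+1 (leqnSn N); rewrite subr0 => /ltW; apply: le_trans; exact: ler_norm.
Qed.
End Conc.

Section LLN.
Context {R : realType} {d : measure_display} {T : measurableType d}.
Variable P : probability T R.
Variable X : int -> T -> R.
Hypothesis mX : forall t, measurable_fun setT (X t).
Hypothesis sX : stationary P X.

Lemma rcovC (f g : T -> R) : rcov P f g = rcov P g f.
Proof.
by rewrite /rcov mulrC; congr (_ - _); congr rE; apply/funext => w; rewrite mulrC.
Qed.

Lemma rcov_bndM (f g : T -> R) M : measurable_fun setT f -> measurable_fun setT g ->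
  (forall w, `|f w| <= M) -> (forall w, `|g w| <= M) -> `|rcov P f g| <= 2 * M ^+ 2.
Proof.
move=> mf mg f1 g1; rewrite /rcov (le_trans (ler_normB _ _))//.
rewrite mulr_natl mulr2n expr2 lerD//.
  by apply: rE_bnd => [|w]; [exact: measurable_funM|rewrite normrM ler_pM].
by rewrite normrM ler_pM//; exact: rE_bnd.
Qed.

(** Blocks of length [b] whose starting points differ by at least [b + k] leave a gap [k], so
    [var_avg] applies with [B = b + k]; closer pairs are bounded trivially. *)
Lemma block_avg_conc (b k q : nat) (h : (int -> R) -> R) (M : R) : (0 < q)%N -> 0 < M ->
  measurable_fun setT (h : pathT (Ib b) -> R) -> (forall x, `|h x| <= M) ->
  rE P (fun w => (q%:R^-1 * \sum_(i < q) h (path X i.+1 w) - rE P (h \o path X 0)) ^+ 2)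
  <= (2 * (b + k))%:R * (2 * M ^+ 2) / q%:R + M ^+ 2 * alpha P X k.
Proof.
move=> q0 M0 mh hM.
have qp : 0 < (q%:R : R) by rewrite ltr0n.
pose Y (i : nat) := h \o path X i.+1.
have mY i : measurable_fun setT (Y i) by exact: block_meas mX _ _ _ mh.
have bY i w : `|Y i w| <= M by exact: hM.
have far i j : (i + (b + k) <= j)%N -> `|rcov P (Y i) (Y j)| <= M ^+ 2 * alpha P X k.
  move=> ij; rewrite expr2.
  by apply: (mix_blocks mX sX (s := i.+1) (s' := j.+1) (b := b) (b' := b)) => //; lia.
have a0 := alpha_ge0 P mX k.
have -> : rE P (h \o path X 0) = q%:R^-1 * \sum_(i < q) rE P (Y i).
  rewrite (eq_bigr (fun=> rE P (h \o path X 0))) => [|i _]; last exact: block_rE mX sX _ _ _ mh.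
  by rewrite sumr_const card_ord -[rE P _ *+ q]mulr_natl mulrA mulVf ?mul1r// gt_eqF.
apply: (var_avg (B := (b + k)%N) (M := M) (Y := Y)) => //.
- by rewrite mulr_ge0// sqr_ge0.
- by rewrite mulr_ge0// sqr_ge0.
- by move=> i j; exact: rcov_bndM.
- by move=> i j /orP[|] /far //; rewrite rcovC.
Qed.

Lemma block_avg_Lint2 (q : nat) (h : (int -> R) -> R) M c :
  measurable_fun setT (h : pathT setT -> R) -> (forall x, `|h x| <= M) ->
  measurable_fun setT (fun w => q%:R^-1 * \sum_(i < q) h (path X i.+1 w) - c) /\
  Lint P (fun w => (q%:R^-1 * \sum_(i < q) h (path X i.+1 w) - c) ^+ 2).
Proof.
move=> mh hM.
have m1 : measurable_fun setT (fun w => q%:R^-1 * \sum_(i < q) h (path X i.+1 w) - c).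
  apply: measurable_funB => //; apply: measurable_funM => //.
  apply: (@measurable_sum _ T R setT _ _ (fun (i : 'I_q) w => h (path X i.+1 w))) => i.
  exact: (comp_path_meas mX _ mh).
split=> //; apply: (Lint_bnd ((q%:R^-1 * (q%:R * M) + `|c|) ^+ 2)) => [|w].
  exact: measurable_funX.
rewrite normrX lerXn2r ?nnegrE//.
  have M0 : 0 <= M by exact: le_trans (hM (fun=> 0)).
  by rewrite addr_ge0// mulr_ge0 ?invr_ge0// mulr_ge0.
rewrite (le_trans (ler_normB _ _))// lerD2r normrM ger0_norm ?invr_ge0//.
rewrite ler_wpM2l ?invr_ge0// (le_trans (ler_norm_sum _ _ _))//.
apply: (@le_trans _ _ (\sum_(i < q) M)); first by apply: ler_sum => i _; exact: hM.
by rewrite sumr_const card_ord mulr_natl.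
Qed.

Hypothesis alpha0 : alpha P X k @[k --> \oo] --> (0 : R).

Lemma block_avg_pr (b : nat -> nat) (q : nat -> nat) (h : nat -> (int -> R) -> R) (M e dl : R) :
  0 < M -> (forall n, measurable_fun setT (h n : pathT (Ib (b n)) -> R)) ->
  (forall n x, `|h n x| <= M) ->
  (forall k (eta : R), 0 < eta ->
    \forall n \near \oo, (0 < q n)%N /\ (b n + k)%:R <= eta * (q n)%:R) ->
  0 < e -> 0 < dl -> \forall n \near \oo,
  pr P [set w | e <= `|(q n)%:R^-1 * \sum_(i < q n) h n (path X i.+1 w) - rE P (h n \o path X 0)|] <= dl.
Proof.
move=> M0 mh hM hq e0 d0.
pose D := dl * e ^+ 2.
have D0 : 0 < D by rewrite mulr_gt0// exprn_gt0.
have M20 : 0 < M ^+ 2 by rewrite exprn_gt0.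
(* [D] is the variance budget of Chebyshev's inequality. A fixed gap [k] takes care of one half, and
   only then does [n] grow to push the near-diagonal part below the other half. *)
have /cvg_nearP/(_ (D / 2 / M ^+ 2)) : alpha P X k @[k --> \oo] --> (0 : R) by [].
rewrite !divr_gt0// => /(_ isT) [k _ /(_ k (leqnn k))]; rewrite subr0 => hk.
have ak : M ^+ 2 * alpha P X k <= D / 2.
  by rewrite mulrC -ler_pdivlMr// ltW// (le_lt_trans (ler_norm _)).
have eta0 : 0 < D / 2 / (4 * M ^+ 2) by rewrite !divr_gt0// mulr_gt0.
apply: filterS (hq k _ eta0) => n [q0 bk].
have [m1 l1] := block_avg_Lint2 (q n) (rE P (h n \o path X 0)) (Ib_meas (mh n)) (hM n).
apply: le_trans (chebyshev_le m1 l1 e0 (block_avg_conc k q0 M0 (mh n) (hM n))) _.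
rewrite ler_pdivrMr ?exprn_gt0// -/D.
rewrite [leRHS](_ : D = D / 2 + D / 2); last by field.
rewrite lerD// ler_pdivrMr ?ltr0n//.
rewrite (_ : (2 * (b n + k))%:R * _ = (b n + k)%:R * (4 * M ^+ 2)); last first.
  by rewrite natrM; ring.
by rewrite -ler_pdivlMr ?mulr_gt0// mulrAC.
Qed.

Lemma path0E t : X t = (fun x => x 0) \o path X t.
Proof. by apply/funext => w; rewrite /path/= add0r. Qed.

Lemma stat_rE1 (g : R -> R) t : measurable_fun setT g ->
  rE P (g \o X t) = rE P (g \o X 0).
Proof.
move=> mg; rewrite (path0E t) (path0E 0).
apply: (path_rE mX sX t (f := g \o (fun x => x 0))).
exact: (measurableT_comp mg (coord_meas (t := 0) I)).
Qed.

Lemma stat_Lint1 (g : R -> R) t : measurable_fun setT g -> Lint P (g \o X 0) ->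
  Lint P (g \o X t).
Proof.
move=> mg Lg; apply: Lint_lty; first exact: measurableT_comp.
have /integrableP[_] := Lg; apply: le_lt_trans.
rewrite le_eqVlt; apply/orP; left; apply/eqP.
rewrite (path0E t) (path0E 0).
apply: (path_integral mX sX t (f := fun x => `|g (x 0)|%:E)).
apply/measurable_EFinP; apply: measurableT_comp => //.
exact: (measurableT_comp mg (coord_meas (t := 0) I)).
Qed.

(** Heavy-tailed variables need not be square integrable, so Chebyshev is applied after truncation.
    The bounded part concentrates by mixing; the remainder is small in mean, uniformly in [n] by
    stationarity, and goes through Markov's inequality. *)
Lemma lln (g : R -> R) (e dl : R) : measurable_fun setT g -> Lint P (g \o X 0) ->
  0 < e -> 0 < dl -> \forall n \near \oo,
  pr P [set w | e <= `|n%:R^-1 * \sum_(i < n) g (X i.+1%:Z w) - rE P (g \o X 0)|] <= dl.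
Proof.
move=> mg Lg e0 d0.
have e3 : 0 < e / 3 by rewrite divr_gt0.
have d2 : 0 < dl / 2 by rewrite divr_gt0.
(* The first bound controls the bias that truncation puts in the mean; the second is what Markov's
   inequality at level [e / 3] needs for a probability [dl / 2]. *)
have m3 : 0 < Order.min (e / 3) (dl / 2 * (e / 3)) by rewrite lt_min e3 mulr_gt0.
have [M [M0]] := tail_small Lg m3.
rewrite le_min => /andP[hM1 hM2].
pose gM x := if `|g x| <= M then g x else 0.
pose tl x := if `|g x| <= M then 0 else `|g x|.
have mabs : measurable_fun setT (fun x => `|g x|) by exact: measurableT_comp.
have mi : measurable_fun setT (fun x => if `|g x| <= M then 1 else 0 : R).
  by apply: meas_le_if => //; exact: measurable_cst.
have mgM : measurable_fun setT gM.
  rewrite (_ : gM = fun x => (if `|g x| <= M then 1 else 0) * g x).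
    exact: measurable_funM.
  by apply/funext => x; rewrite /gM; case: ifP; rewrite ?mul1r ?mul0r.
have mtl : measurable_fun setT tl.
  rewrite (_ : tl = fun x => `|g x| - (if `|g x| <= M then 1 else 0) * `|g x|).
    by apply: measurable_funB => //; exact: measurable_funM.
  by apply/funext => x; rewrite /tl; case: ifP; rewrite ?mul1r ?subrr// mul0r subr0.
have gMM x : `|gM x| <= M.
  by rewrite /gM; have [//|_] := leP `|g x| M; rewrite normr0 ltW.
have ggM x : `|g x - gM x| = tl x.
  by rewrite /gM /tl; case: ifP; rewrite ?subrr ?normr0// subr0.
have tl0 x : 0 <= tl x by rewrite -ggM.
have tlg x : `|tl x| <= `|g x| by rewrite /tl; case: ifP; rewrite ?normr0// normr_id.
have Ltl : Lint P (tl \o X 0).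
  by apply: (Lint_le (fun w => `|g (X 0 w)|)) (Lint_abs Lg) _; [exact: measurableT_comp|move=> w; exact: tlg].
have LgM t : Lint P (gM \o X t).
  by apply: (Lint_bnd M); [exact: measurableT_comp|move=> w; exact: gMM].
pose h (n : nat) := gM \o coord (R := R) 0.
have mh n : measurable_fun setT (h n : pathT (Ib 1) -> R).
  exact: (measurableT_comp mgM (coordI_meas (ltn0Sn 0))).
have hq k (eta : R) : 0 < eta -> \forall n \near \oo, (0 < n)%N /\ (1 + k)%:R <= eta * n%:R :> R.
  move=> eta0; apply: filterS2 (near_ge 1) (near_natr ((1 + k)%:R / eta)) => n n1.
  by rewrite ler_pdivrMr// mulrC.
have e3' := e3.
have := @block_avg_pr (fun=> 1%N) id h M (e / 3) (dl / 2) M0 mh (fun n x => gMM _) hq e3 d2.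
apply: filterS2 (near_ge 1) => n n1 H.
have n0 : 0 < (n%:R : R) by rewrite ltr0n.
have E0 : h n \o path X 0 = gM \o X 0.
  by apply/funext => w; rewrite /h/coord/path/= addr0.
have Ei (i : nat) w : h n (path X i w) = gM (X i w) by rewrite /h/coord/path/= add0r.
rewrite E0 in H.
pose S2 w := n%:R^-1 * \sum_(i < n) tl (X i.+1%:Z w).
have mX' (f : R -> R) (i : 'I_n) : measurable_fun setT f -> measurable_fun setT (fun w => f (X i.+1%:Z w)).
  by move=> mf; exact: measurableT_comp.
have mavg (f : R -> R) : measurable_fun setT f -> measurable_fun setT (fun w => n%:R^-1 * \sum_(i < n) f (X i.+1%:Z w)).
  move=> mf; apply: measurable_funM => //.
  by apply: (@measurable_sum _ T R setT _ _ (fun (i : 'I_n) w => f (X i.+1%:Z w))) => i; exact: mX'.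
have LS2 : Lint P S2.
  apply: LintZ; apply: Lint_sum => i _; exact: (stat_Lint1 _ mtl Ltl).
have ES2 : rE P S2 = rE P (tl \o X 0).
  rewrite rEZ; last by apply: Lint_sum => i _; exact: (stat_Lint1 _ mtl Ltl).
  rewrite rE_sum; last by move=> i _; exact: (stat_Lint1 _ mtl Ltl).
  rewrite (eq_bigr (fun=> rE P (tl \o X 0))) => [|i _]; last exact: stat_rE1.
  by rewrite sumr_const card_ord -[rE P _ *+ n]mulr_natl mulrA mulVf ?mul1r// gt_eqF.
have mmeas (f : R -> R) c (m : measurable_fun setT f) a : measurable [set w | a <= `|n%:R^-1 * \sum_(i < n) f (X i.+1%:Z w) - c|].
  apply: meas_le; first exact: measurable_cst.
  by apply: measurableT_comp => //; apply: measurable_funB => //; exact: mavg.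
apply: le_trans (pr_le_setU
  [set w | e / 3 <= `|n%:R^-1 * \sum_(i < n) gM (X i.+1%:Z w) - rE P (gM \o X 0)|]
  [set w | e / 3 <= S2 w] _ _ _ _) _.
- exact: mmeas.
- exact: mmeas.
- by apply: meas_le => //; exact: mavg.
- move=> w /= ew; have [h1|h1] := leP (e / 3) (S2 w); [by right|left].
  have key : `|n%:R^-1 * \sum_(i < n) g (X i.+1%:Z w) - n%:R^-1 * \sum_(i < n) gM (X i.+1%:Z w)| <= S2 w.
    rewrite -mulrBr -sumrB normrM ger0_norm ?invr_ge0// ler_wpM2l ?invr_ge0//.
    by rewrite (le_trans (ler_norm_sum _ _ _))//; apply: ler_sum => i _; rewrite ggM.
  have key2 : `|rE P (gM \o X 0) - rE P (g \o X 0)| <= e / 3.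
    rewrite distrC -rEB//; apply: le_trans (rE_abs_le (tl \o X 0) _ Ltl _) hM1 => [|w'].
      exact: LintB.
    by rewrite /= ggM.
  have tri (A B m u : R) : `|A - u| <= `|A - B| + `|B - m| + `|m - u|.
    by rewrite -addrA (le_trans (ler_distD B _ _))// lerD2l ler_distD.
  have := tri (n%:R^-1 * \sum_(i < n) g (X i.+1%:Z w)) (n%:R^-1 * \sum_(i < n) gM (X i.+1%:Z w))
    (rE P (gM \o X 0)) (rE P (g \o X 0)).
  by lra.
- rewrite (_ : dl = dl / 2 + dl / 2); last by field.
  apply: lerD.
    by apply: le_trans H; rewrite le_eqVlt; apply/orP; left; apply/eqP; congr (pr P _);
      apply/seteqP; split => w /=; under eq_bigr do rewrite Ei.
  apply: le_trans (markov_le _ LS2 _ e3) _; first exact: mavg.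
    by move=> w; rewrite mulr_ge0 ?invr_ge0// sumr_ge0.
  by rewrite ES2 ler_pdivrMr.
Qed.
End LLN.

(** * From the limit law to the coverage probability *)

Section Quantile.
Context {R : realType} {d : measure_display} {T : measurableType d}.
Variable P : probability T R.
Variable X : int -> T -> R.
Hypothesis mX : forall t, measurable_fun setT (X t).

Implicit Types (n b : nat) (x y : R) (w : T).

Lemma qn_gt0 n b : (0 < qn n b)%N. Proof. by rewrite /qn addn1. Qed.

Lemma Lsub_le n b x z w : x <= z -> Lsub X n b x w <= Lsub X n b z w.
Proof.
move=> xz; rewrite /Lsub ler_wpM2l ?invr_ge0//; apply: ler_sum => i _.
by case: ifPn => [h|_]; [rewrite (le_trans h xz)|case: ifP].
Qed.

(** Below the interval of this radius the empirical distribution function is 0, and at its upper end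
    it is 1. This makes the set in [Csub] nonempty and bounded below, without which [inf] carries no
    information. *)
Definition Tbound n b w : R := \sum_(1 <= i < (qn n b).+1) `|Tsub X b i w|.

Lemma Tbound_le n b w i : (1 <= i < (qn n b).+1)%N -> `|Tsub X b i w| <= Tbound n b w.
Proof.
move=> iq; rewrite /Tbound (bigD1_seq i) ?mem_index_iota ?iota_uniq//=.
by rewrite lerDl sumr_ge0.
Qed.

Lemma Lsub_top n b w : Lsub X n b (Tbound n b w) w = 1.
Proof.
rewrite /Lsub big_nat_cond (eq_bigr (fun=> 1)) => [|i /andP[iq _]].
  rewrite -big_nat_cond sumr_const_nat subSS subn0 mulVf// pnatr_eq0 -lt0n.
  exact: qn_gt0.
by rewrite (le_trans (ler_norm _) (Tbound_le w iq)).
Qed.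

Lemma Lsub_bot n b w x : x < - Tbound n b w -> Lsub X n b x w = 0.
Proof.
move=> xT; rewrite /Lsub big_nat_cond big1 ?mulr0// => i /andP[iq _].
rewrite leNgt (lt_le_trans xT)//= lerNl (le_trans _ (Tbound_le w iq))//.
by rewrite -normrN ler_norm.
Qed.

Lemma Csub_le n b x y w : 0 < y -> y <= Lsub X n b x w -> Csub X n b y w <= x.
Proof.
move=> y0 yL; apply: ge_inf => //; exists (- Tbound n b w) => z /= yz.
by rewrite leNgt; apply/negP => /Lsub_bot zL; move: yz; rewrite zL leNgt y0.
Qed.

Lemma Csub_ge n b x y w : y <= 1 -> Lsub X n b x w < y -> x <= Csub X n b y w.
Proof.
move=> y1 Ly; apply: lb_le_inf; first by exists (Tbound n b w) => /=; rewrite Lsub_top.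
move=> z /= yz; rewrite leNgt; apply/negP => zx.
by move: (le_lt_trans (Lsub_le n b w (ltW zx)) Ly); rewrite ltNge yz.
Qed.

Lemma Csub_mono n b y z w : 0 < y -> y <= z -> z <= 1 -> Csub X n b y w <= Csub X n b z w.
Proof.
move=> y0 yz z1; apply: lb_le_inf; first by exists (Tbound n b w) => /=; rewrite Lsub_top.
by move=> x /= zL; apply: Csub_le => //; exact: le_trans zL.
Qed.

Lemma Lsub_meas n b x : measurable_fun setT (Lsub X n b x).
Proof.
apply: measurable_funM => //.
apply: (@measurable_sum _ T R setT _ _ (fun i w => if Tsub X b i w <= x then 1 else 0)) => i.
by apply: meas_le_if; [exact: Tsub_meas|exact: measurable_cst].
Qed.

(** The quantile is below [x] exactly when some rational [r < x] already has [y <= L(r)];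
    monotonicity turns the infimum over the reals into a countable union. *)
Lemma Csub_meas n b y : 0 < y <= 1 -> measurable_fun setT (Csub X n b y).
Proof.
move=> /andP[y0 y1] mT.
apply: (measurability _ (RGenInftyO.measurableE R)) => //.
move=> _ [_ [x ->] <-]; rewrite setTI.
rewrite (_ : _ @^-1` _ = \bigcup_(r : rat) [set w | ratr r < x /\ y <= Lsub X n b (ratr r) w]).
  apply: bigcupT_measurable_rat => r; have [rx|rx] := ltP (ratr r) x.
    rewrite (_ : [set w | _] = [set w | y <= Lsub X n b (ratr r) w]).
      by apply: meas_le; [exact: measurable_cst|exact: Lsub_meas].
    by apply/seteqP; split => w //= [].
  by rewrite (_ : [set w | _] = set0)//; apply/seteqP; split => w //= [].
apply/seteqP; split => [w /=|w [r _ /= [rx yr]]].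
  rewrite in_itv/= => Cx.
  have [r] := rat_in_itvoo Cx; rewrite in_itv/= => /andP[Cr rx].
  exists r => //=; split=> //; rewrite leNgt; apply/negP => Ly.
  by move: Cr; rewrite ltNge (Csub_ge y1 Ly).
by rewrite in_itv/= (le_lt_trans _ rx)// Csub_le.
Qed.

(** [noncover] at [n] sees the block lengths only through their [n]-th value, so the constant
    sequence [b_] covers the general case by conversion. The two ways of missing the interval are
    disjoint because the lower quantile does not exceed the upper one. *)
Lemma noncoverE n b eta : 0 < eta < 1 ->
  let b_ := fun=> b in
  pr P (noncover X b_ eta n) =
  pr P [set w | Tstat X n w < Csub X n b (eta / 2) w] +
  (1 - pr P [set w | Tstat X n w <= Csub X n b (1 - eta / 2) w])
  /\ measurable (noncover X b_ eta n).
Proof.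
move=> /andP[e0 e1] b_.
have mTn : measurable_fun setT (Tstat X n) by exact: (Tsub_meas mX n 1).
have h1 : 0 < eta / 2 <= 1 by apply/andP; split; lra.
have h2 : 0 < 1 - eta / 2 <= 1 by apply/andP; split; lra.
have mA : measurable [set w | Tstat X n w < Csub X n b (eta / 2) w].
  by apply: meas_lt => //; exact: Csub_meas.
have mB : measurable [set w | Tstat X n w <= Csub X n b (1 - eta / 2) w].
  by apply: meas_le => //; exact: Csub_meas.
have E : noncover X b_ eta n = [set w | Tstat X n w < Csub X n b (eta / 2) w] `|`
    ~` [set w | Tstat X n w <= Csub X n b (1 - eta / 2) w].
  apply/seteqP; split => w /=.
    by move=> /negP; rewrite negb_and -ltNge => /orP[->|/negP]; [left|right].
  by move=> [h|h]; apply/negP; rewrite negb_and -ltNge ?h//; apply/orP; right; apply/negP.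
split; last by rewrite E; apply: measurableU => //; exact: measurableC.
rewrite E pr_setU_disj ?pr_setC//; first exact: measurableC.
apply/seteqP; split => // w [/= h1' h2']; apply: h2'.
apply/ltW/(lt_le_trans h1')/Csub_mono; lra.
Qed.
End Quantile.

Section Indicator.
Context {R : realType}.
Implicit Types (x : R) (m : nat).

Definition hx x m : (int -> R) -> R := fun p => if fT m p <= x then 1 else 0.

Lemma hx_meas x m : measurable_fun setT (hx x m : pathT (Ib m) -> R).
Proof. by apply: meas_le_if; [exact: fT_meas|exact: measurable_cst]. Qed.

Lemma hx_bnd x m p : `|hx x m p| <= 1.
Proof. by rewrite /hx; case: ifP; rewrite ?normr1 ?normr0. Qed.

End Indicator.
Arguments hx_meas {R} x m.

(** * Concentration of the subsampling distribution, and coverage *)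

Section Subsampling.
Context {R : realType} {d : measure_display} {T : measurableType d}.
Variable P : probability T R.
Variable X : int -> T -> R.
Hypothesis mX : forall t, measurable_fun setT (X t).
Hypothesis sX : stationary P X.
Variable b : nat -> nat.
Hypothesis bY : forall K, \forall n \near \oo, (K <= b n)%N.
Hypothesis b0 : (b n)%:R / n%:R @[n --> \oo] --> (0 : R).

Let q n := qn n (b n).

Lemma qn_big k (eta : R) : 0 < eta ->
  \forall n \near \oo, (0 < q n)%N /\ (b n + k)%:R <= eta * (q n)%:R.
Proof.
(* The solution of [2 * e = eta * (1 - e)]: both [b n] and [k] are at most [e * n], while [q n] is
   at least [(1 - e) * n]. *)
move=> eta0; pose e := eta / (2 + eta).
have e0 : 0 < e by rewrite divr_gt0// addr_gt0.
have /cvg_nearP/(_ e e0) hb := b0.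
apply: filterS3 hb (near_natr (k%:R / e)) (near_ge 1) => n h1 h2 n1.
split; first exact: qn_gt0.
have n0 : 0 < (n%:R : R) by rewrite ltr0n.
have hbn : (b n)%:R <= e * n%:R.
  by rewrite -ler_pdivrMr//; move: h1; rewrite subr0 => /ltW; apply: le_trans; exact: ler_norm.
have hk : k%:R <= e * n%:R by move: h2; rewrite ler_pdivrMr// mulrC.
have hq : n%:R - (b n)%:R <= (q n)%:R :> R.
  by rewrite lerBlDr -natrD ler_nat /q /qn; lia.
have ee : 2 * e = eta * (1 - e) by rewrite /e; field; lra.
rewrite natrD; have : 2 * e * n%:R <= eta * (n%:R - (b n)%:R).
  rewrite ee -mulrA ler_pM2l// mulrBl mul1r; lra.
have : eta * (n%:R - (b n)%:R) <= eta * (q n)%:R by rewrite ler_pM2l.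
lra.
Qed.

Lemma LsubE n x w : Lsub X n (b n) x w =
  (q n)%:R^-1 * \sum_(i < q n) hx x (b n) (path X i.+1 w).
Proof.
rewrite /Lsub big_add1 big_mkord; congr (_ * _); apply: eq_bigr => i _.
by rewrite Tsub_path.
Qed.

Lemma hx_rE x m : rE P (hx x m \o path X 0) = pr P [set w | Tstat X m w <= x].
Proof.
have mA : measurable [set w | Tstat X m w <= x].
  by apply: meas_le; [exact: (Tsub_meas mX m 1)|exact: measurable_cst].
rewrite -(block_rE mX sX 1 (hx_meas x m)) -rE_indic//; congr rE; apply/funext => w.
rewrite indicE /hx /=.
have -> : fT m (path X 1 w) = Tstat X m w.
  by have := congr1 (@^~ w) (@Tsub_path _ _ _ X m 1) => /= <-.
by case: ifPn => h; [rewrite mem_set|rewrite memNset//; apply/negP].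
Qed.

Hypothesis alpha0 : alpha P X k @[k --> \oo] --> (0 : R).

Lemma Lsub_conc x (e dl : R) : 0 < e -> 0 < dl -> \forall n \near \oo,
  pr P [set w | e <= `|Lsub X n (b n) x w - pr P [set w | Tstat X (b n) w <= x]|] <= dl.
Proof.
move=> e0 d0.
have := @block_avg_pr _ _ _ P X mX sX alpha0 b q (fun n => hx x (b n)) 1 e dl ltr01
  (fun n => hx_meas x (b n)) (fun n => hx_bnd x (b n)) qn_big e0 d0.
by apply: filterS => n; rewrite hx_rE; under eq_set do rewrite -LsubE.
Qed.

Section QuantileHit.
Variables (F : R -> R) (c y delta : R).
Hypotheses (y01 : 0 < y < 1) (delta0 : 0 < delta).
Hypothesis TF : forall x, `|x - c| < delta ->
  pr P [set w | Tstat X n w <= x] @[n --> \oo] --> F x.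
Hypotheses (Fc : F c = y) (cF : {for c, continuous F}).
Hypothesis Flt : forall x, x < c -> F x < y.
Hypothesis Fgt : forall x, c < x -> y < F x.

Let mT n : measurable_fun setT (Tstat X n) := Tsub_meas mX n 1.
Let mC n : measurable_fun setT (Csub X n (b n) y).
Proof. by apply: Csub_meas => //; move: y01; lra. Qed.
Let mTx n x : measurable [set w | Tstat X n w <= x].
Proof. exact: meas_le (mT n) (measurable_cst x). Qed.
Let mL n x : measurable_fun setT (Lsub X n (b n) x).
Proof. exact: Lsub_meas. Qed.

Lemma Lsub_far x (dl : R) : 0 < dl -> `|x - c| < delta ->
  (y < F x -> \forall n \near \oo, pr P [set w | Lsub X n (b n) x w < y] <= dl) /\
  (F x < y -> \forall n \near \oo, pr P [set w | y <= Lsub X n (b n) x w] <= dl).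
Proof.
move=> d0 xc.
have mabs n (p e : R) : measurable [set w | e <= `|Lsub X n (b n) x w - p|].
  apply: meas_le; first exact: measurable_cst.
  by apply: measurableT_comp => //; apply: measurable_funB.
split=> h.
  have e0 : 0 < (F x - y) / 2 by rewrite divr_gt0// subr_gt0.
  have /cvg_nearP/(_ _ e0) hF := TF xc.
  apply: filterS2 (Lsub_conc x e0 d0) (near_sub bY hF) => n h1 h2.
  apply: le_trans h1; apply: pr_le => //; first exact: meas_lt (mL n x) (measurable_cst y).
  by move=> w /= Ly; rewrite distrC ler_normr; apply/orP; left; move: h2; rewrite ltr_norml; lra.
have e0 : 0 < (y - F x) / 2 by rewrite divr_gt0// subr_gt0.
have /cvg_nearP/(_ _ e0) hF := TF xc.
apply: filterS2 (Lsub_conc x e0 d0) (near_sub bY hF) => n h1 h2.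
apply: le_trans h1; apply: pr_le => //; first exact: meas_le (measurable_cst y) (mL n x).
by move=> w /= Ly; rewrite ler_normr; apply/orP; left; move: h2; rewrite ltr_norml; lra.
Qed.

(** Strict crossing at [c] puts [L_n] above [y] at [c + u] and below [y] at [c - u] with high
    probability, so the random quantile lies within [u] of [c]. Comparing [T_n] with deterministic
    points around [c] then replaces any joint law of [T_n] and the quantile. *)
Lemma quantile_hit (e : R) : 0 < e -> \forall n \near \oo,
  pr P [set w | Tstat X n w <= Csub X n (b n) y w] <= y + e /\
  y - e <= pr P [set w | Tstat X n w < Csub X n (b n) y w].
Proof.
move=> e0.
have e3 : 0 < e / 3 by rewrite divr_gt0.
have /cvgrPdist_lt/(_ _ e3) [dd /= dd0 hdd] : F x @[x --> c] --> F c by exact: cF.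
pose u := Order.min delta dd / 3.
have m0 : 0 < Order.min delta dd by rewrite lt_min delta0.
have u0 : 0 < u by rewrite divr_gt0.
have ud : 3 * u <= delta by rewrite /u mulrC divfK// ge_min lexx.
have udd : 3 * u <= dd by rewrite /u mulrC divfK// ge_min lexx orbT.
have H (x : R) : `|x - c| <= 2 * u -> `|x - c| < delta /\ `|y - F x| < e / 3.
  move=> hx; have : `|x - c| < 3 * u by lra.
  split; first by lra.
  by rewrite -Fc; apply: hdd; rewrite /= distrC; lra.
have nu (t : R) : 0 <= t -> t <= 2 * u -> `|c + t - c| <= 2 * u /\ `|c - t - c| <= 2 * u.
  by move=> t0 tu; rewrite addrAC subrr add0r addrAC subrr add0r normrN ger0_norm.
have u2 : u <= 2 * u by lra.
have u20 : 0 <= 2 * u by lra.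
(* The point [c - 2 * u] leaves room below [c - u]: the second claim concerns the strict event that
   [T_n] is smaller than the quantile. *)
have [a1 a2] := nu u (ltW u0) u2; have [_ a3] := nu (2 * u) u20 (lexx _).
have ltcu : c < c + u by lra.
have ltuc : c - u < c by lra.
have [p1 p2] := H _ a1; have [m1 m2] := H _ a2; have [k1 k2] := H _ a3.
have [/(_ (Fgt ltcu)) L1 _] := Lsub_far e3 p1.
have [_ /(_ (Flt ltuc)) L2] := Lsub_far e3 m1.
have /cvg_nearP/(_ _ e3) T1 := TF p1.
have /cvg_nearP/(_ _ e3) T2 := TF k1.
have : \forall n \near \oo, (pr P [set w | Lsub X n (b n) (c + u) w < y] <= e / 3 /\
   pr P [set w | y <= Lsub X n (b n) (c - u) w] <= e / 3) by apply: filterS2 L1 L2.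
apply: filterS3 T1 T2 => n t1 t2 [l1 l2]; split.
  have : pr P [set w | Tstat X n w <= Csub X n (b n) y w] <=
    pr P [set w | Tstat X n w <= c + u] + pr P [set w | Lsub X n (b n) (c + u) w < y].
    apply: pr_le_setU; [exact: meas_le|exact: mTx|exact: meas_lt|].
    move=> w /= TC; have [h|h] := ltP (Lsub X n (b n) (c + u) w) y; [by right|left].
    by apply: le_trans TC (Csub_le _ h); case/andP: y01.
  by move: t1 p2; rewrite !ltr_norml; lra.
have : pr P [set w | Tstat X n w <= c - 2 * u] <=
  pr P [set w | Tstat X n w < Csub X n (b n) y w] + pr P [set w | y <= Lsub X n (b n) (c - u) w].
  apply: pr_le_setU; [exact: mTx|exact: meas_lt|exact: meas_le|].
  move=> w /= Tc; have [h|h] := leP y (Lsub X n (b n) (c - u) w); [by right|left].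
  have y1 : y <= 1 by move: y01; lra.
  by have := Csub_ge y1 h; lra.
by move: t2 k2; rewrite !ltr_norml; lra.
Qed.
End QuantileHit.

Lemma noncover_pr_cvg (eta l : R) : 0 < eta < 1 ->
  pr P (noncover X b eta n) @[n --> \oo] --> l ->
  P (noncover X b eta n) @[n --> \oo] --> l%:E.
Proof.
move=> he h; apply/fine_cvgP; split; last exact: h.
apply: nearW => n; apply: fin_num_measure.
by have [] := @noncoverE _ _ _ P X mX n (b n) eta he.
Qed.

Lemma noncover_to_eta (eta c1 c2 delta : R) (F : R -> R) : 0 < eta < 1 -> 0 < delta ->
  (forall x, `|x - c1| < delta -> pr P [set w | Tstat X n w <= x] @[n --> \oo] --> F x) ->
  (forall x, `|x - c2| < delta -> pr P [set w | Tstat X n w <= x] @[n --> \oo] --> F x) ->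
  F c1 = eta / 2 -> F c2 = 1 - eta / 2 ->
  {for c1, continuous F} -> {for c2, continuous F} ->
  (forall x, x < c1 -> F x < eta / 2) -> (forall x, c1 < x -> eta / 2 < F x) ->
  (forall x, x < c2 -> F x < 1 - eta / 2) -> (forall x, c2 < x -> 1 - eta / 2 < F x) ->
  P (noncover X b eta n) @[n --> \oo] --> eta%:E.
Proof.
move=> he d0 T1 T2 F1 F2 cF1 cF2 l1 g1 l2 g2.
apply: noncover_pr_cvg => //; apply/cvg_nearP => e e0.
have e4 : 0 < e / 4 by rewrite divr_gt0.
have y1 : 0 < eta / 2 < 1 by lra.
have y2 : 0 < 1 - eta / 2 < 1 by lra.
have mT n : measurable_fun setT (Tstat X n) := Tsub_meas mX n 1.
have mC n y : 0 < y < 1 -> measurable_fun setT (Csub X n (b n) y).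
  by move=> hy; apply: Csub_meas => //; move: hy; lra.
apply: filterS2 (quantile_hit y1 d0 T1 F1 cF1 l1 g1 e4) (quantile_hit y2 d0 T2 F2 cF2 l2 g2 e4).
move=> n [a1 a2] [b1 b2].
have [-> _] := @noncoverE _ _ _ P X mX n (b n) eta he.
have c1' : pr P [set w | Tstat X n w < Csub X n (b n) (eta / 2) w] <=
  pr P [set w | Tstat X n w <= Csub X n (b n) (eta / 2) w].
  by apply: pr_le; [apply: meas_lt|apply: meas_le|move=> w /= /ltW] => //; exact: mC.
have c2' : pr P [set w | Tstat X n w < Csub X n (b n) (1 - eta / 2) w] <=
  pr P [set w | Tstat X n w <= Csub X n (b n) (1 - eta / 2) w].
  by apply: pr_le; [apply: meas_lt|apply: meas_le|move=> w /= /ltW] => //; exact: mC.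
by rewrite ltr_norml; lra.
Qed.
End Subsampling.

(* When the mean is nonzero the two ranges of [T_n] and of the subsample statistics separate. *)
Section Separation.
Context {R : realType} {d : measure_display} {T : measurableType d}.
Variable P : probability T R.
Variable X : int -> T -> R.
Hypothesis mX : forall t, measurable_fun setT (X t).
Hypothesis sX : stationary P X.
Variable b : nat -> nat.

Lemma Lsub_rE n x : rE P (Lsub X n (b n) x) = pr P [set w | Tstat X (b n) w <= x] /\
  Lint P (Lsub X n (b n) x).
Proof.
have L (i : nat) : Lint P (fun w => hx x (b n) (path X i w)).
  apply: (Lint_bnd 1) => [|w]; last exact: hx_bnd.
  exact: (block_meas mX i (hx_meas x (b n))).
rewrite (_ : Lsub X n (b n) x = fun w => (qn n (b n))%:R^-1 *
   \sum_(i < qn n (b n)) hx x (b n) (path X i.+1 w)); last first.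
  by apply/funext => w; exact: LsubE.
split; last by apply: LintZ; apply: Lint_sum => i _; exact: L.
rewrite rEZ; last by apply: Lint_sum => i _; exact: L.
rewrite rE_sum => [|i _]; last exact: L.
rewrite (eq_bigr (fun=> rE P (hx x (b n) \o path X 0))) => [|i _]; last first.
  exact: (block_rE mX sX i.+1 (hx_meas x (b n))).
rewrite sumr_const card_ord -[rE P _ *+ _]mulr_natl mulrA mulVf ?mul1r ?hx_rE//.
by rewrite pnatr_eq0 -lt0n qn_gt0.
Qed.

(** The threshold [x n] may drift with [n], so concentration around a limit law is replaced by
    Markov's inequality for [L_n] or [1 - L_n] at [x n], whose mean is exactly a probability for
    [T_b]. Once this quantity falls below [eta / 2], the quantile facing [T_n] is on the other side
    of [x n]. *)
Lemma noncover_to_one (eta : R) : 0 < eta < 1 ->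
  (forall e, 0 < e -> exists x : nat -> R, \forall n \near \oo,
     pr P [set w | x n < Tstat X (b n) w] <= e /\ pr P [set w | Tstat X n w <= x n] <= e) \/
  (forall e, 0 < e -> exists x : nat -> R, \forall n \near \oo,
     pr P [set w | Tstat X (b n) w <= x n] <= e /\ pr P [set w | x n <= Tstat X n w] <= e) ->
  P (noncover X b eta n) @[n --> \oo] --> 1%E.
Proof.
move=> he H; apply: noncover_pr_cvg => //; apply/cvg_nearP => e e0.
have mT n : measurable_fun setT (Tstat X n) := Tsub_meas mX n 1.
have eta0 : 0 < eta / 2 by lra.
have mC n y : 0 < y < 1 -> measurable_fun setT (Csub X n (b n) y).
  by move=> hy; apply: Csub_meas => //; move: hy; lra.
have mL n x : measurable_fun setT (Lsub X n (b n) x) by exact: Lsub_meas.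
have y1 : 0 < eta / 2 < 1 by lra.
have y2 : 0 < 1 - eta / 2 < 1 by lra.
(* The second bound survives the division by [eta / 2] in Markov's inequality. *)
pose dl := Order.min (e / 3) (e / 3 * (eta / 2)).
have e3 : 0 < e / 3 by lra.
have d0 : 0 < dl by rewrite lt_min e3 mulr_gt0.
have [d1 d2] : dl <= e / 3 /\ dl <= e / 3 * (eta / 2).
  by rewrite /dl !ge_min !lexx orbT.
have fin n : 1 - pr P (noncover X b eta n) < e -> `|pr P (noncover X b eta n) - 1| < e.
  move=> h; rewrite distrC ger0_norm// subr_ge0 pr_le1//.
  by have [] := @noncoverE _ _ _ P X mX n (b n) eta he.
case: H => H; have [x hx] := H dl d0; apply: filterS hx => n [h1 h2]; apply: fin;
  have [-> _] := @noncoverE _ _ _ P X mX n (b n) eta he;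
  have [EL LL] := Lsub_rE n (x n).
- have m1 : pr P [set w | eta / 2 <= 1 - Lsub X n (b n) (x n) w] <= e / 3.
    have L1 : Lint P (fun w => 1 - Lsub X n (b n) (x n) w) := LintB (Lint_cst 1) LL.
    apply: le_trans (markov_le _ L1 _ eta0) _.
    + exact: measurable_funB.
    + move=> w; rewrite subr_ge0 /Lsub -[leRHS](@mulVf _ (qn n (b n))%:R); last first.
        by rewrite pnatr_eq0 -lt0n qn_gt0.
      rewrite ler_wpM2l ?invr_ge0//.
      apply: (@le_trans _ _ (\sum_(1 <= i < (qn n (b n)).+1) 1)).
        by apply: ler_sum => i _; case: ifP.
      by rewrite sumr_const_nat subSS subn0.
    rewrite ler_pdivrMr// rEB//; last exact: Lint_cst.
    rewrite rE_cst EL -pr_setC; last exact: meas_le (mT _) (measurable_cst _).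
    apply: le_trans d2; apply: le_trans h1.
    rewrite (_ : ~` _ = [set w | x n < Tstat X (b n) w])//.
    by apply/seteqP; split => w /=; rewrite ltNge => /negP.
  have := pr_ge0 (P := P) [set w | Tstat X n w < Csub X n (b n) (eta / 2) w].
  have : pr P [set w | Tstat X n w <= Csub X n (b n) (1 - eta / 2) w] <=
     pr P [set w | Tstat X n w <= x n] + pr P [set w | eta / 2 <= 1 - Lsub X n (b n) (x n) w].
    apply: pr_le_setU.
    + by apply: meas_le => //; exact: mC.
    + exact: meas_le (mT _) (measurable_cst _).
    + by apply: meas_le; [exact: measurable_cst|exact: measurable_funB].
    move=> w /= TC; have [h|h] := leP (eta / 2) (1 - Lsub X n (b n) (x n) w); [by right|left].
    by apply: le_trans TC (Csub_le _ _) => //; lra.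
  lra.
- have m1 : pr P [set w | eta / 2 <= Lsub X n (b n) (x n) w] <= e / 3.
    apply: le_trans (markov_le _ LL _ eta0) _ => //.
      by move=> w; rewrite mulr_ge0 ?invr_ge0// sumr_ge0// => i _; case: ifP.
    by rewrite ler_pdivrMr// EL; apply: le_trans d2.
  have c2' : pr P [set w | Tstat X n w <= Csub X n (b n) (1 - eta / 2) w] <= 1.
    by apply: pr_le1; apply: meas_le => //; exact: mC.
  have : pr P [set w | Csub X n (b n) (eta / 2) w <= Tstat X n w] <=
     pr P [set w | x n <= Tstat X n w] + pr P [set w | eta / 2 <= Lsub X n (b n) (x n) w].
    apply: pr_le_setU.
    + by apply: meas_le => //; exact: mC.
    + exact: meas_le (measurable_cst _) (mT _).
    + by apply: meas_le; [exact: measurable_cst|].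
    move=> w /= TC; have [h|h] := leP (eta / 2) (Lsub X n (b n) (x n) w); [by right|left].
    by apply: le_trans TC; apply: Csub_ge => //; lra.
  have -> : [set w | Tstat X n w < Csub X n (b n) (eta / 2) w] =
     ~` [set w | Csub X n (b n) (eta / 2) w <= Tstat X n w].
    by apply/seteqP; split => w /=; rewrite ltNge => /negP.
  rewrite pr_setC; last by apply: meas_le => //; exact: mC.
  lra.
Qed.
End Separation.

(** * Regularly varying tails *)

Section RegularTail.
Context {R : realType}.
Variables (G : R -> R) (kappa : R) (a : nat -> R).
Hypothesis Ganti : forall x y, x <= y -> G y <= G x.
Hypothesis G0 : forall x, 0 <= G x.
Hypothesis Greg : forall lam, 0 < lam -> G (lam * x) / G x @[x --> +oo] --> lam `^ (- kappa).
Hypothesis kap : 1 < kappa < 2.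
Hypothesis aY : a n @[n --> \oo] --> +oo.
Hypothesis nGa : n%:R * G (a n) @[n --> \oo] --> (1 : R).

Lemma a_ge (A : R) : \forall n \near \oo, A <= a n.
Proof. by move/cvgryPge: aY; exact. Qed.

Lemma nGa_near (e : R) : 0 < e -> \forall n \near \oo, `|n%:R * G (a n) - 1| < e.
Proof. by move/cvg_nearP: nGa; exact. Qed.

(** Otherwise [n * G (a n)] would be 0 as soon as [a n] has passed [x]. *)
Lemma G_pos x : 0 < G x.
Proof.
have [n [an hn]] : exists n, x <= a n /\ `|n%:R * G (a n) - 1| < 1.
  have [N _ hN] := filterI (a_ge x) (nGa_near ltr01).
  by exists N; exact: (hN N (leqnn N)).
have : 0 < n%:R * G (a n) by move: hn; rewrite ltr_norml; lra.
move=> h; apply: lt_le_trans _ (Ganti an).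
by rewrite lt_neqAle G0 andbT; apply: contraTneq h => <-; rewrite mulr0 ltxx.
Qed.

Lemma Greg_near (lam e : R) : 0 < lam -> 0 < e -> exists2 x0, 0 < x0 &
  forall x, x0 <= x -> `|G (lam * x) / G x - lam `^ (- kappa)| < e.
Proof.
move=> l0 e0; have /cvgrPdist_lt/(_ e e0) [A [_ hA]] := Greg l0.
exists (Order.max 1 (A + 1)); first by rewrite lt_max ltr01.
move=> x; rewrite ge_max => /andP[x1 xA]; rewrite distrC; apply: hA; lra.
Qed.

Lemma Greg_a (lam e : R) : 0 < lam -> 0 < e ->
  \forall n \near \oo, `|n%:R * G (lam * a n) - lam `^ (- kappa)| < e.
Proof.
move=> l0 e0.
have : n%:R * G (lam * a n) @[n --> \oo] --> lam `^ (- kappa).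
  rewrite -[X in _ --> X]mul1r.
  have h : (n%:R * G (a n)) * (G (lam * a n) / G (a n)) @[n --> \oo] --> 1 * lam `^ (- kappa).
    by apply: cvgM nGa _; exact: (cvg_comp _ _ aY (Greg l0)).
  apply: cvg_trans h; apply: near_eq_cvg; apply: nearW => n /=.
  by rewrite mulrACA mulfV ?mulr1 ?gt_eqF ?G_pos// mulrC mulrA.
by move/cvg_nearP; exact.
Qed.

Section Compare.
Variables (m : nat -> nat) (rho : R).
Hypothesis mY : forall K, \forall n \near \oo, (K <= m n)%N.
Hypothesis rho0 : 0 < rho.
Hypothesis mn : (m n)%:R / n%:R @[n --> \oo] --> rho.

Lemma nGam : n%:R * G (a (m n)) @[n --> \oo] --> rho^-1.
Proof.
have h1 : (m n)%:R * G (a (m n)) @[n --> \oo] --> (1 : R).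
  apply/cvg_nearP => e e0; exact: (near_sub mY (nGa_near e0)).
have h : (m n)%:R * G (a (m n)) * ((m n)%:R / n%:R)^-1 @[n --> \oo] --> 1 * rho^-1.
  by apply: cvgM h1 _; apply: cvgV => //; rewrite gt_eqF.
rewrite mul1r in h; apply: cvg_trans h; apply: near_eq_cvg.
apply: filterS (mY 1) => n m1 /=; rewrite invf_div.
by field; rewrite pnatr_eq0 -lt0n.
Qed.

(** The sequence [a] is accessible only through [G]. In the limit [n * G (a (m n))] is [rho^-1],
    while [n * G (lam * a n)] is lam to the power -kappa; [G] being nonincreasing, a strict order of
    these limits reverses into an order of the arguments. *)
Lemma a_sub_lt (lam : R) : 0 < lam -> lam `^ (- kappa) * rho < 1 ->
  \forall n \near \oo, a (m n) < lam * a n.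
Proof.
move=> l0; rewrite -ltr_pdivlMr// mul1r => h.
pose e := (rho^-1 - lam `^ (- kappa)) / 2.
have e0 : 0 < e by rewrite divr_gt0// subr_gt0.
have /cvg_nearP/(_ e e0) h1 := nGam.
apply: filterS3 h1 (Greg_a l0 e0) (near_ge 1) => n h1' h2 n1.
rewrite ltNge; apply/negP => /Ganti GG.
have : n%:R * G (a (m n)) <= n%:R * G (lam * a n) by rewrite ler_wpM2l.
by move: h1' h2; rewrite !ltr_norml /e; lra.
Qed.

Lemma a_sub_gt (lam : R) : 0 < lam -> 1 < lam `^ (- kappa) * rho ->
  \forall n \near \oo, lam * a n < a (m n).
Proof.
move=> l0; rewrite -ltr_pdivrMr// mul1r => h.
pose e := (lam `^ (- kappa) - rho^-1) / 2.
have e0 : 0 < e by rewrite divr_gt0// subr_gt0.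
have /cvg_nearP/(_ e e0) h1 := nGam.
apply: filterS3 h1 (Greg_a l0 e0) (near_ge 1) => n h1' h2 n1.
rewrite ltNge; apply/negP => /Ganti GG.
have : n%:R * G (lam * a n) <= n%:R * G (a (m n)) by rewrite ler_wpM2l.
by move: h1' h2; rewrite !ltr_norml /e; lra.
Qed.
End Compare.

(** The range of [kappa] in the form used below: by the upper bound [x * G x] decays geometrically
    along doublings, by the lower one [x ^ 2 * G x] grows geometrically. *)
Lemma pow2_kappa : 4^-1 < (2 : R) `^ (- kappa) < 2^-1.
Proof.
have h (p q : R) : p < q -> (2 : R) `^ p < 2 `^ q.
  by move=> pq; rewrite /powR gt_eqF// ltr_expR ltr_pM2r// ln_gt0// ltr1n.
have e4 : (4 : R)^-1 = 2 `^ (- 2).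
  by rewrite powRN (_ : 2 `^ 2 = 4)// (powR_mulrn 2)//; rewrite -natrX.
have e2 : (2 : R)^-1 = 2 `^ (- 1) by rewrite powR_inv1.
have /andP[k1 k2] := kap.
by rewrite e4 e2; apply/andP; split; apply: h; rewrite ltrN2.
Qed.

Lemma G_halving : exists2 rho : R, 0 < rho < 2^-1 &
  exists2 x0, 0 < x0 & forall x, x0 <= x -> G (2 * x) <= rho * G x.
Proof.
have /andP[k1 k2] := pow2_kappa.
pose e := (2^-1 - (2 : R) `^ (- kappa)) / 2.
have e0 : 0 < e by rewrite /e; lra.
have [x0 x00 hx] := Greg_near (ltr0Sn _ 1) e0.
exists (2 `^ (- kappa) + e); first by rewrite /e; lra.
exists x0 => // x /hx; rewrite ltr_norml -ler_pdivrMr ?G_pos//; lra.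
Qed.

Lemma G_doubling : exists2 c : R, 0 < c &
  exists2 x0, 0 < x0 & forall x, x0 <= x -> (1 + c) * G x <= 4 * G (2 * x).
Proof.
have /andP[k1 k2] := pow2_kappa.
pose e := ((2 : R) `^ (- kappa) - 4^-1) / 2.
have e0 : 0 < e by rewrite /e; lra.
have [x0 x00 hx] := Greg_near (ltr0Sn _ 1) e0.
exists (4 * e); first by rewrite mulr_gt0.
exists x0 => // x /hx; rewrite ltr_norml => /andP[h _].
rewrite -ler_pdivlMr ?G_pos// -mulrA.
have : 4 * (4^-1 + e) <= 4 * (G (2 * x) / G x) by rewrite ler_pM2l// ltW//; move: h; rewrite /e; lra.
by rewrite mulrDr mulfV.
Qed.

Lemma G_pow (rho x0 : R) : 0 < rho -> 0 < x0 -> (forall x, x0 <= x -> G (2 * x) <= rho * G x) ->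
  forall j x, x0 <= x -> G (2 ^+ j * x) <= rho ^+ j * G x.
Proof.
move=> r0 x00 h; elim=> [|j IH] x xx; first by rewrite !expr0 !mul1r.
have x1 : x0 <= 2 ^+ j * x.
  rewrite (le_trans xx)// ler_peMl ?(le_trans (ltW x00))// exprn_ege1//; lra.
rewrite exprS -mulrA (le_trans (h _ x1))// exprS -mulrA ler_pM2l//; exact: IH.
Qed.

Lemma pow2_bracket (u v : R) J : 0 < u -> 2 ^+ J * u <= v ->
  exists2 j, (J <= j)%N & 2 ^+ j * u <= v < 2 ^+ j.+1 * u.
Proof.
move=> u0 Jv.
have ex : exists j, v < 2 ^+ j * u.
  exists (Num.truncn `|v / u|).+1; rewrite -ltr_pdivrMr// (le_lt_trans (ler_norm _))//.
  rewrite (lt_le_trans (truncnS_gt _))// -natrX ler_nat.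
  exact: ltnW (ltn_expl _ (ltnSn 1)).
case: (ex_minnP ex) => j vj jmin.
have Jj : (J < j)%N.
  rewrite ltnNge; apply/negP => jJ.
  have jJu : 2 ^+ j * u <= 2 ^+ J * u by rewrite ler_pM2r// ler_weXn2l// ler1n.
  by have := lt_le_trans vj (le_trans jJu Jv); rewrite ltxx.
exists j.-1; first by lia.
rewrite (ltn_predK Jj) vj andbT leNgt; apply/negP => /jmin; lia.
Qed.

(* [a_n] grows more slowly than [n], uniformly: this is where [kappa > 1] enters. *)
Lemma scale_ratio (b : nat -> nat) (e : R) :
  (forall K, \forall n \near \oo, (K <= b n)%N) ->
  (b n)%:R / n%:R @[n --> \oo] --> (0 : R) -> 0 < e ->
  \forall n \near \oo, 0 < a (b n) /\ (b n)%:R * a n <= e * (n%:R * a (b n)).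
Proof.
move=> bY b0 e0.
have [rho /andP[r0 r1] [x0 x00 hr]] := G_halving.
have r20 : 0 <= 2 * rho < 1 by lra.
(* With [j] doublings between [a (b n)] and [a n], their ratio costs [2 * 2 ^ j] and the ratio of
   [b n] to [n] is at most [4 * rho ^ j]; the product is [8 * (2 * rho) ^ j]. *)
have [J hJ] : exists J, 8 * (2 * rho) ^+ J <= e.
  have /cvg_nearP/(_ (e / 8)) : (2 * rho) ^+ n @[n --> \oo] --> (0 : R).
    by apply: cvg_expr; rewrite ger0_norm; lra.
  case=> [|J _ /(_ J (leqnn J))]; first by lra.
  by rewrite subr0 => /ltW h; exists J; move: (le_trans (ler_norm _) h); lra.
pose g := ((2 : R) ^+ J) `^ (- kappa).
have g0 : 0 < g by rewrite powR_gt0// exprn_gt0.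
have p2J : 0 < (2 : R) ^+ J by rewrite exprn_gt0.
have g2 : 0 < g / 2 by lra.
have h12 : 0 < (2 : R)^-1 by lra.
have g4 : 0 < g / 4 by lra.
have /cvg_nearP/(_ _ g4) hbn := b0.
have hb2 : \forall n \near \oo, (1 <= n)%N /\ (1 <= b n)%N by apply: filterS2 (near_ge 1) (bY 1).
have hb3 : \forall n \near \oo, (x0 <= a (b n) /\ `|(b n)%:R * G (a (b n)) - 1| < 2^-1) /\
    `|(b n)%:R * G (2 ^+ J * a (b n)) - g| < g / 2.
  apply: (near_sub bY (Q := fun n => (x0 <= a n /\ `|n%:R * G (a n) - 1| < 2^-1) /\
    `|n%:R * G (2 ^+ J * a n) - g| < g / 2)).
  by apply: filterS3 (a_ge x0) (nGa_near h12) (Greg_a p2J g2).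
near=> n.
have [[h1 h2] h3] : (x0 <= a (b n) /\ `|(b n)%:R * G (a (b n)) - 1| < 2^-1) /\
    `|(b n)%:R * G (2 ^+ J * a (b n)) - g| < g / 2 by near: n.
have h4 : `|(b n)%:R / n%:R - 0| < g / 4 by near: n.
have h5 : `|n%:R * G (a n) - 1| < 2^-1 by near: n; exact: nGa_near.
have [n1 b1] : (1 <= n)%N /\ (1 <= b n)%N by near: n.
have n0 : 0 < (n%:R : R) by rewrite ltr0n.
have bp : 0 < ((b n)%:R : R) by rewrite ltr0n.
have ab0 : 0 < a (b n) by apply: lt_le_trans h1.
split=> //.
have hG5 : n%:R * G (a n) < 3 / 2 /\ 1 / 2 < n%:R * G (a n) by move: h5; rewrite ltr_norml; lra.
have hG2 : (b n)%:R * G (a (b n)) < 3 / 2 by move: h2; rewrite ltr_norml; lra.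
(* Fewer than [J] doublings would make [G (a n)] at least of order [1 / b n], against
   [n * G (a n) -> 1] and [b n = o(n)]. *)
have Jle : 2 ^+ J * a (b n) <= a n.
  rewrite leNgt; apply/negP => /ltW/Ganti GG.
  have c1 : (b n)%:R * G (2 ^+ J * a (b n)) > g / 2 by move: h3; rewrite ltr_norml -/g; lra.
  have c2 : (b n)%:R * G (2 ^+ J * a (b n)) <= (b n)%:R / n%:R * (n%:R * G (a n)).
    by rewrite mulrA divfK ?gt_eqF// ler_pM2l.
  have c3 : (b n)%:R / n%:R < g / 4 by move: h4; rewrite subr0; apply: le_lt_trans; exact: ler_norm.
  have : (b n)%:R / n%:R * (n%:R * G (a n)) <= g / 4 * (3 / 2).
    by apply: ler_pM; rewrite ?divr_ge0 ?mulr_ge0 ?G0//; [exact: ltW|case: hG5 => /ltW].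
  lra.
have [j Jj /andP[j1 j2]] := pow2_bracket ab0 Jle.
have Gj : G (a n) <= rho ^+ j * G (a (b n)).
  by apply: le_trans (Ganti j1) _; exact: G_pow hr _ _ h1.
have bn4 : (b n)%:R <= 4 * rho ^+ j * n%:R.
  have rj : 0 < rho ^+ j by rewrite exprn_gt0.
  have : (b n)%:R * (n%:R * G (a n)) <= rho ^+ j * n%:R * ((b n)%:R * G (a (b n))).
    rewrite mulrCA [leRHS](_ : _ = n%:R * ((b n)%:R * (rho ^+ j * G (a (b n))))); last by ring.
    by rewrite !ler_pM2l.
  have c1 : (b n)%:R * (1 / 2) <= (b n)%:R * (n%:R * G (a n)) by rewrite ler_pM2l// ltW//; case: hG5.
  have c2 : rho ^+ j * n%:R * ((b n)%:R * G (a (b n))) <= rho ^+ j * n%:R * (3 / 2).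
    by rewrite ler_pM2l ?mulr_gt0// ltW.
  have c3 : 0 <= rho ^+ j * n%:R by rewrite mulr_ge0// ltW.
  lra.
have an0 : 0 <= a n by apply: le_trans j1; rewrite mulr_ge0 ?exprn_ge0// ltW.
apply: (@le_trans _ _ ((4 * rho ^+ j * n%:R) * (2 ^+ j.+1 * a (b n)))).
  by apply: ler_pM => //; exact: ltW.
rewrite (_ : _ * _ * (_ * _) = 8 * (2 * rho) ^+ j * (n%:R * a (b n))); last first.
  by rewrite exprS exprMn; ring.
rewrite ler_pM2r ?mulr_gt0// (le_trans _ hJ)// ler_pM2l//.
by rewrite ler_wiXn2l//; lra.
Unshelve. all: by end_near. Qed.

(** A Karamata bound by dyadic induction, with [V A] standing for the second moment of the variable
    clipped at [A]. Passing from [A] to [2 * A] adds at most [4 * A ^ 2 * G A], while the right-hand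
    side grows by the factor [1 + c] of [G_doubling]. *)
Lemma truncated_second_moment (V : R -> R) : (forall A, 0 <= A -> V A <= A ^+ 2) ->
  (forall A, 0 <= A -> V (2 * A) <= V A + 4 * A ^+ 2 * G A) ->
  exists C x0, 0 < C /\ 0 < x0 /\ forall A, x0 <= A -> V A <= C * (A ^+ 2 * G A).
Proof.
move=> V1 V2; have [c c0 [x0 x00 hx]] := G_doubling.
(* [4 / c] lets the inductive step absorb its increment; the other term covers the first interval
   from [x0] to [2 * x0], where [V A <= A ^ 2] is used directly. *)
pose C := Order.max (4 / c) (G (2 * x0))^-1.
have C0 : 0 < C by rewrite lt_max divr_gt0.
have C4 : 4 <= c * C by rewrite mulrC -ler_pdivrMr// /C le_max lexx.
exists C, x0; split=> //; split=> //.
have step j : forall A, x0 <= A -> A <= 2 ^+ j.+1 * x0 -> V A <= C * (A ^+ 2 * G A).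
  elim: j => [|j IH] A A1 A2.
    have A0 : 0 < A by apply: lt_le_trans A1.
    apply: le_trans (V1 _ (ltW A0)) _.
    rewrite mulrCA -[leLHS]mulr1 ler_pM2l ?exprn_gt0//.
    apply: (@le_trans _ _ (C * G (2 * x0))).
      by rewrite -ler_pdivrMr ?G_pos// mul1r /C le_max lexx orbT.
    by rewrite ler_pM2l//; apply: Ganti; rewrite expr1 in A2.
  have [A3|A3] := leP A (2 ^+ j.+1 * x0); first exact: IH.
  pose B := A / 2.
  have AB : A = 2 * B by rewrite /B; field.
  have B1 : x0 <= B.
    have : 2 * x0 <= 2 ^+ j.+1 * x0.
      by rewrite ler_pM2r// exprS ler_peMr// exprn_ege1//; lra.
    rewrite /B; lra.
  have B2 : B <= 2 ^+ j.+1 * x0 by move: A2; rewrite exprS /B; lra.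
  have B0 : 0 < B by apply: lt_le_trans B1.
  rewrite AB; apply: le_trans (V2 _ (ltW B0)) _.
  have := IH _ B1 B2; have h := hx _ B1.
  have BG : 0 < B ^+ 2 * G B by rewrite mulr_gt0 ?exprn_gt0 ?G_pos.
  have h2 : (1 + c) * (B ^+ 2 * G B) <= (2 * B) ^+ 2 * G (2 * B).
    rewrite (_ : (2 * B) ^+ 2 * G (2 * B) = B ^+ 2 * (4 * G (2 * B))); last by ring.
    by rewrite mulrCA ler_pM2l ?exprn_gt0.
  have h3 : C * ((1 + c) * (B ^+ 2 * G B)) <= C * ((2 * B) ^+ 2 * G (2 * B)) by rewrite ler_pM2l.
  have h4 : 4 * (B ^+ 2 * G B) <= c * C * (B ^+ 2 * G B) by rewrite ler_pM2r.
  lra.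
move=> A A1.
have [j _ /andP[_ j2]] := @pow2_bracket x0 A 0 x00 (ltac:(by rewrite expr0 mul1r)).
exact: step (ltW j2).
Qed.

(** The increments over doublings are dominated by a geometric series of ratio [2 * rho < 1]. *)
Lemma truncated_first_moment (U : R -> R) :
  (forall A, 0 <= A -> U A <= A) -> (forall A B, A <= B -> U A <= U B) ->
  (forall A, 0 <= A -> U (2 * A) <= U A + A * G A) ->
  exists C, forall A, U A <= C.
Proof.
move=> U1 Um U2.
have [rho /andP[r0 r1] [x0 x00 hr]] := G_halving.
pose g := G x0; pose r := 2 * rho.
have r1' : 0 < 1 - r by rewrite /r; lra.
have g0 : 0 <= g by exact: G0.
have rn j : 0 <= r ^+ j by rewrite exprn_ge0// /r; lra.
have step j : U (2 ^+ j * x0) <= x0 + x0 * g * ((1 - r ^+ j) / (1 - r)).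
  elim: j => [|j IH].
    by rewrite !expr0 mul1r subrr mul0r mulr0 addr0; apply: U1; exact: ltW.
  rewrite exprS -mulrA; apply: le_trans (U2 _ _) _; first by rewrite mulr_ge0 ?exprn_ge0// ltW.
  have := G_pow r0 x00 hr j (lexx x0) => Gj.
  have : 2 ^+ j * x0 * G (2 ^+ j * x0) <= x0 * g * r ^+ j.
    rewrite /r exprMn (_ : x0 * g * _ = 2 ^+ j * x0 * (rho ^+ j * g)); last by ring.
    by rewrite ler_pM2l// mulr_gt0// exprn_gt0.
  have -> : (1 - r ^+ j.+1) / (1 - r) = (1 - r ^+ j) / (1 - r) + r ^+ j.
    by rewrite exprS; field; rewrite gt_eqF.
  move: IH; lra.
exists (x0 + x0 * g / (1 - r)) => A.
have [j hj] : exists j, A <= 2 ^+ j * x0.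
  have [A1|A1] := leP x0 A; last by exists 0; rewrite expr0 mul1r ltW.
  have [j _ /andP[_ j2]] := @pow2_bracket x0 A 0 x00 (ltac:(by rewrite expr0 mul1r)).
  by exists j.+1; exact: ltW.
apply: le_trans (Um _ _ hj) _; apply: le_trans (step j) _.
rewrite lerD2l; apply: ler_wpM2l; first by rewrite mulr_ge0// ltW.
by rewrite ler_piMl ?invr_ge0 ?(ltW r1')// gerBl.
Qed.
End RegularTail.

(** * Self-normalization under heavy tails *)

Section HeavyTail.
Context {R : realType} {d : measure_display} {T : measurableType d}.
Variable P : probability T R.
Variable X : int -> T -> R.
Hypothesis mX : forall t, measurable_fun setT (X t).
Hypothesis sX : stationary P X.
Variables (kappa : R) (a : nat -> R).
Hypothesis kap : 1 < kappa < 2.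
Hypothesis rv : regvar P (X 0) kappa.
Hypothesis na : norming P X a.

Definition tailG (x : R) : R := pr P [set w | x < `|X 0 w|].

Let mabs t : measurable_fun setT (fun w => `|X t w|).
Proof. by apply: measurableT_comp. Qed.

Lemma tailG_anti x y : x <= y -> tailG y <= tailG x.
Proof.
move=> xy; apply: pr_le; [exact: meas_lt|exact: meas_lt|].
by move=> w /=; exact: le_lt_trans.
Qed.

Lemma tailG_ge0 x : 0 <= tailG x. Proof. exact: pr_ge0. Qed.

Lemma cvg_scale (lam : R) : 0 < lam -> lam * x @[x --> +oo] --> +oo.
Proof.
move=> l0; apply/cvgryPge => A; exists (A / lam); split; first exact: num_real.
by move=> x /ltW; rewrite ler_pdivrMr// mulrC.
Qed.

(** The two one-sided weights sum to 1, so [tailG] itself is equivalent to [N]; slow variation of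
    [L] does the rest. *)
Lemma tailG_reg (lam : R) : 0 < lam ->
  tailG (lam * x) / tailG x @[x --> +oo] --> lam `^ (- kappa).
Proof.
move=> l0; have [L [pp [pm [[Lpos Lsv] [_ [_ [ppm [h1 h2]]]]]]]] := rv.
pose N x := L x * x `^ (- kappa).
have GN : tailG x / N x @[x --> +oo] --> (1 : R).
  rewrite -ppm.
  have h : pr P [set w | x < X 0 w] / (L x * x `^ (- kappa)) +
      pr P [set w | X 0 w < - x] / (L x * x `^ (- kappa)) @[x --> +oo] --> pp + pm.
    exact: cvgD h1 h2.
  apply: cvg_trans h; apply: near_eq_cvg.
  exists 0; split; first exact: num_real.
  move=> x x0 /=; rewrite -mulrDl; congr (_ / _).
  rewrite -pr_setU_disj; first 1 last.
  - exact: meas_lt (measurable_cst x) (mX 0).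
  - exact: meas_lt (mX 0) (measurable_cst (- x)).
  - apply/seteqP; split => // w [/= xX]; lra.
  congr (pr P _); apply/seteqP; split => w /=; rewrite ltr_normr [_ < - _]ltrNr.
    by move=> [|] ->//; rewrite orbT.
  by move=> /orP.
have GNl : tailG (lam * x) / N (lam * x) @[x --> +oo] --> (1 : R).
  exact: (cvg_comp _ _ (cvg_scale l0) GN).
have Npos : \forall x \near +oo, 0 < N x /\ 0 < x.
  have : \forall x \near +oo, (0 : R) < x by exists 0; split => //; exact: num_real.
  apply: filterS2 Lpos => x Lx x0; split=> //.
  by rewrite mulr_gt0// powR_gt0.
have Nposl : \forall x \near +oo, 0 < N (lam * x) by exact: (cvg_scale l0 (filterS (fun x => @proj1 _ _) Npos)).
have h : tailG (lam * x) / N (lam * x) * (L (lam * x) / L x * lam `^ (- kappa)) * (tailG x / N x)^-1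
    @[x --> +oo] --> 1 * (1 * lam `^ (- kappa)) * 1^-1.
  apply: cvgM; last by apply: cvgV => //; rewrite oner_neq0.
  by apply: cvgM GNl _; apply: cvgM (cvg_cst _); exact: Lsv.
rewrite -(_ : 1 * (1 * lam `^ (- kappa)) * 1^-1 = lam `^ (- kappa)); last by rewrite invr1; ring.
apply: cvg_trans h; apply: near_eq_cvg.
apply: filterS3 Npos Nposl Lpos => x [Nx x0] Nlx Lx /=.
have NE : N (lam * x) = L (lam * x) * lam `^ (- kappa) * x `^ (- kappa).
  by rewrite /N powRM ?mulrA// ltW.
have xk : 0 < x `^ (- kappa) by rewrite powR_gt0.
have lk : 0 < lam `^ (- kappa) by rewrite powR_gt0.
have Llx : L (lam * x) != 0 by apply: contraTneq Nlx => h0; rewrite NE h0 !mul0r ltxx.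
rewrite invf_div NE /N.
have [->|G0] := eqVneq (tailG x) 0; first by rewrite invr0 !mulr0.
by field; rewrite G0 Llx !gt_eqF.
Qed.

Let na1 : a n @[n --> \oo] --> +oo. Proof. by case: na. Qed.
Let na2 : n%:R * tailG (a n) @[n --> \oo] --> (1 : R). Proof. by case: na. Qed.

Lemma clip_meas (A : R) : measurable_fun setT (fun x : R => Order.min `|x| A).
Proof. by apply: measurable_minr => //; exact: measurable_cst. Qed.

Lemma clip_bnd (A x : R) : 0 <= A -> 0 <= Order.min `|x| A <= A.
Proof. by move=> A0; rewrite le_min normr_ge0 A0 ge_min lexx orbT. Qed.

Let clip_Lint k A : 0 <= A -> Lint P (fun w => Order.min `|X 0 w| A ^+ k).
Proof.
move=> A0; apply: (Lint_bnd (A ^+ k)).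
  by apply: measurable_funX; exact: (measurableT_comp (clip_meas A) (mX 0)).
move=> w; have /andP[h1 h2] := clip_bnd (X 0 w) A0.
by rewrite ger0_norm ?exprn_ge0// lerXn2r// nnegrE.
Qed.

Let ind_Lint (A : R) : Lint P (fun w => \1_[set w | A < `|X 0 w|] w : R).
Proof. by apply: Lint_indic; apply: meas_lt => //; exact: measurable_cst. Qed.

Let ind_rE (A : R) : rE P (fun w => \1_[set w | A < `|X 0 w|] w : R) = tailG A.
Proof. by apply: rE_indic; apply: meas_lt => //; exact: measurable_cst. Qed.

Let indE (A : R) w : (\1_[set w | A < `|X 0 w|] w : R) = if A < `|X 0 w| then 1 else 0.
Proof. by rewrite indicE; case: ifPn => h; [rewrite mem_set|rewrite memNset//; apply/negP]. Qed.

Lemma clip_second_moment : exists C x0 : R, 0 < C /\ 0 < x0 /\ forall A, x0 <= A ->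
  rE P (fun w => Order.min `|X 0 w| A ^+ 2) <= C * (A ^+ 2 * tailG A).
Proof.
apply: (truncated_second_moment tailG_anti tailG_ge0 tailG_reg kap na1 na2) => A A0.
  rewrite -[leRHS](rE_cst P); apply: rE_le; [exact: clip_Lint|exact: Lint_cst|].
  move=> w; have /andP[h1 h2] := clip_bnd (X 0 w) A0.
  by rewrite lerXn2r// nnegrE.
rewrite -ind_rE -rEZ// -rED; [|exact: clip_Lint|exact: LintZ].
apply: rE_le; [apply: clip_Lint; lra|by apply: LintD; [exact: clip_Lint|exact: LintZ]|].
move=> w; rewrite indE; have [h|h] := ltP A `|X 0 w|.
  have : Order.min `|X 0 w| (2 * A) ^+ 2 <= (2 * A) ^+ 2.
    have A20 : 0 <= 2 * A by lra.
    have /andP[h1 h2] := clip_bnd (X 0 w) A20.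
    by rewrite lerXn2r// nnegrE.
  by have := sqr_ge0 A; rewrite exprMn; lra.
rewrite mulr0 addr0 min_l//; lra.
Qed.

(** The clipped first moments are bounded, and monotone convergence passes to the limit. *)
Lemma heavy_Lint : Lint P (X 0).
Proof.
pose U A := rE P (fun w => Order.min `|X 0 w| (Order.max A 0)).
have L1 A : Lint P (fun w => Order.min `|X 0 w| (Order.max A 0)).
  have := @clip_Lint 1 (Order.max A 0); rewrite le_max lexx orbT => /(_ isT).
  by under eq_fun do rewrite expr1.
have [||A A0|C hC] := @truncated_first_moment R tailG kappa a tailG_anti tailG_ge0 tailG_reg kap na1 na2 U.
- move=> A A0; rewrite -[leRHS](rE_cst P); apply: rE_le => //; first exact: Lint_cst.
  by move=> w; rewrite max_l// ge_min lexx orbT.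
- move=> A B AB; apply: rE_le => // w; rewrite le_min ge_min lexx/=.
  by rewrite ge_min; apply/orP; right; rewrite ge_max !le_max AB lexx orbT.
- rewrite -ind_rE -rEZ// -rED//; last exact: LintZ.
  apply: rE_le => //; first by apply: LintD => //; exact: LintZ.
  move=> w; rewrite indE !max_l//; last by lra.
  have [h|h] := ltP A `|X 0 w|.
    by rewrite mulr1 ge_min; apply/orP; right; lra.
  by rewrite mulr0 addr0 ge_min lexx.
apply: Lint_lty => //.
pose g (n : nat) w := (Order.min `|X 0 w| n%:R)%:E.
have gE n : (\int[P]_w g n w = (U n%:R)%:E)%E.
  rewrite /U max_l// EFin_rE//; last by have := L1 n%:R; rewrite max_l.
have mg n : measurable_fun setT (g n).
  by apply/measurable_EFinP; exact: (measurableT_comp (clip_meas n%:R) (mX 0)).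
have gl w : limn (g ^~ w) = `|X 0 w|%:E.
  apply/cvg_lim => //; apply: cvg_near_cst.
  by apply: filterS (near_natr `|X 0 w|) => n h; rewrite /g min_l.
have H : (\int[P]_w g n w @[n --> \oo] --> \int[P]_w limn (g ^~ w))%E.
  apply: (@cvg_monotone_convergence _ T R P setT measurableT g mg).
    by move=> n w _; rewrite lee_fin; have /andP[] := @clip_bnd n%:R (X 0 w) (ler0n _ _).
  move=> w _ n k nk; rewrite lee_fin le_min ge_min lexx/= ge_min; apply/orP; right.
  by rewrite ler_nat.
have -> : (\int[P]_w `|X 0 w|%:E = limn (fun n => \int[P]_w g n w))%E.
  by rewrite (cvg_lim _ H)//; apply: eq_integral => w _; rewrite gl.
apply: le_lt_trans (ltry C); apply: lime_le; first by apply/cvg_ex; eexists; exact: H.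
by apply: nearW => n; rewrite gE lee_fin hC.
Qed.

(** The union bound, phrased as Markov's inequality for the number of exceedances, whose mean is
    [n * tailG (lam * a n)]. *)
Lemma max_pr_le (lam e : R) : 0 < lam -> 0 < e -> \forall n \near \oo,
  pr P [set w | 1 <= \sum_(i < n) (if lam * a n < `|X i.+1%:Z w| then 1 else 0 : R)]
    <= lam `^ (- kappa) + e.
Proof.
move=> l0 e0.
have mi (A : R) : measurable_fun setT (fun x : R => if A < `|x| then 1 else 0 : R).
  rewrite (_ : (fun x => _) = (fun x => 1 - (if `|x| <= A then 1 else 0))).
    by apply: measurable_funB => //; apply: meas_le_if => //; exact: measurable_cst.
  by apply/funext => x; rewrite ltNge; case: (_ <= A); rewrite ?subrr ?subr0.
have Li (A : R) t : Lint P (fun w => if A < `|X t w| then 1 else 0 : R).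
  apply: (Lint_bnd 1); first exact: (measurableT_comp (mi A) (mX t)).
  by move=> w; case: ifP; rewrite ?normr1 ?normr0.
have Ei (A : R) t : rE P (fun w => if A < `|X t w| then 1 else 0 : R) = tailG A.
  rewrite -ind_rE -[LHS]/(rE P ((fun x : R => if A < `|x| then 1 else 0 : R) \o X t)).
  rewrite stat_rE1//; congr rE; apply/funext => w /=; by rewrite indE.
apply: filterS (Greg_a tailG_anti tailG_ge0 tailG_reg na1 na2 l0 e0) => n h.
have LS : Lint P (fun w => \sum_(i < n) (if lam * a n < `|X i.+1%:Z w| then 1 else 0 : R)).
  by apply: Lint_sum => i _; exact: Li.
apply: le_trans (markov_le (Lint_meas LS) LS _ ltr01) _.
  by move=> w; rewrite sumr_ge0// => i _; case: ifP.
rewrite divr1 rE_sum; last by move=> i _; exact: Li.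
rewrite (eq_bigr (fun=> tailG (lam * a n))) => [|i _]; last exact: Ei.
rewrite sumr_const card_ord -mulr_natl; move: h; rewrite ltr_norml; lra.
Qed.

Lemma Qsum_upper (e : R) : 0 < e -> exists2 K : R, 0 < K &
  \forall n \near \oo, pr P [set w | K * a n <= Qsum X 1 n w] <= e.
Proof.
move=> e0; have [C [x0 [C0 [x00 hC]]]] := clip_second_moment.
(* As [kappa > 1] and [lam >= 1], the asymptotic bound of [max_pr_le], lam to the power -kappa, is
   at most [1 / lam], hence at most [e / 4]. *)
pose lam := Order.max 1 (4 / e).
have l1 : 1 <= lam by rewrite le_max lexx.
have l0 : 0 < lam by lra.
have e4 : 0 < e / 4 by rewrite divr_gt0.
have lk : lam `^ (- kappa) <= e / 4.
  apply: (@le_trans _ _ (lam `^ (-1))).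
    by apply: ler_powR => //; rewrite lerN2; move: kap; lra.
  have -> : e / 4 = (4 / e)^-1 by rewrite invf_div.
  rewrite powR_inv1; last exact: ltW.
  by rewrite lef_pV2 ?posrE ?divr_gt0// le_max lexx orbT.
(* [K ^ 2] cancels the factor [C * lam ^ 2] in the mean of the clipped sum of squares and leaves
   [n * tailG A], which is about lam to the power -kappa. *)
pose K := Num.sqrt (C * lam ^+ 2).
have K0 : 0 < K by rewrite sqrtr_gt0 mulr_gt0// exprn_gt0.
have K2 : K ^+ 2 = C * lam ^+ 2 by rewrite sqr_sqrtr// ltW// mulr_gt0// exprn_gt0.
exists K => //.
have h1 := Greg_a tailG_anti tailG_ge0 tailG_reg na1 na2 l0 e4.
have h2 := a_ge na1 (Order.max 1 x0).
apply: filterS3 (max_pr_le l0 e4) h1 h2 => n m1 g1; rewrite ge_max => /andP[an1 anx].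
pose A := lam * a n.
have an0 : 0 < a n by lra.
have A0 : 0 < A by rewrite mulr_gt0.
have Ax : x0 <= A by rewrite (le_trans anx)// ler_peMl// ltW.
pose S w := \sum_(i < n) Order.min `|X i.+1%:Z w| A ^+ 2.
have mc : measurable_fun setT (fun x : R => Order.min `|x| A ^+ 2).
  by apply: measurable_funX; exact: clip_meas.
have Lc t : Lint P (fun w => Order.min `|X t w| A ^+ 2).
  by have := stat_Lint1 mX sX t mc (clip_Lint 2 (ltW A0)).
have LS : Lint P S by apply: Lint_sum => i _; exact: Lc.
have ES : rE P S <= n%:R * (C * (A ^+ 2 * tailG A)).
  rewrite rE_sum => [|i _]; last exact: Lc.
  rewrite (eq_bigr (fun=> rE P (fun w => Order.min `|X 0 w| A ^+ 2))) => [|i _]; last first.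
    exact: (stat_rE1 mX sX i.+1 mc).
  by rewrite sumr_const card_ord -[leLHS]mulr_natl; apply: ler_wpM2l => //; exact: hC.
have Kan : 0 < (K * a n) ^+ 2 by rewrite exprn_gt0// mulr_gt0.
have mQ : measurable_fun setT (Qsum X 1 n) by exact: Qsum_meas.
have mI : measurable_fun setT (fun w => \sum_(i < n) (if A < `|X i.+1%:Z w| then 1 else 0 : R)).
  apply: (@measurable_sum _ T R setT _ _ (fun (i : 'I_n) w => if A < `|X i.+1%:Z w| then 1 else 0 : R)) => i.
  rewrite (_ : (fun x => _) = (fun x => 1 - (if `|X i.+1%:Z x| <= A then 1 else 0))).
    apply: measurable_funB => //; apply: meas_le_if; [exact: mabs|exact: measurable_cst].
  by apply/funext => x; rewrite ltNge; case: (_ <= A); rewrite ?subrr ?subr0.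
apply: le_trans (pr_le_setU
  [set w | 1 <= \sum_(i < n) (if A < `|X i.+1%:Z w| then 1 else 0 : R)]
  [set w | (K * a n) ^+ 2 <= S w] _ _ _ _) _.
- exact: meas_le (measurable_cst _) mQ.
- exact: meas_le (measurable_cst _) mI.
- exact: meas_le (measurable_cst _) (Lint_meas LS).
- move=> w /= KQ.
  have [/existsP[i iA]|/existsPn hn] := boolP [exists i : 'I_n, A < `|X i.+1%:Z w|].
    left; rewrite (bigD1 i)//= iA lerDl sumr_ge0// => j _; by case: ifP.
  right; have -> : S w = Qsum X 1 n w ^+ 2.
    rewrite /Qsum sqr_sqrtr; last by rewrite sumr_ge0// => j _; rewrite sqr_ge0.
    rewrite big_add1 big_mkord; apply: eq_bigr => i _.
    rewrite min_l; first by rewrite real_normK// num_real.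
    by rewrite leNgt; exact: hn.
  by rewrite lerXn2r// ?nnegrE ?sqrtr_ge0// ltW// mulr_gt0.
have m2 : pr P [set w | (K * a n) ^+ 2 <= S w] <= e / 4 + e / 4.
  apply: le_trans (markov_le (Lint_meas LS) LS _ Kan) _.
    by move=> w; rewrite sumr_ge0// => i _; rewrite sqr_ge0.
  rewrite ler_pdivrMr// (le_trans ES)// [(K * a n) ^+ 2]exprMn K2.
  rewrite (_ : n%:R * _ = n%:R * tailG A * (C * lam ^+ 2 * a n ^+ 2)); last by rewrite /A; ring.
  rewrite ler_wpM2r//; first by rewrite !mulr_ge0 ?sqr_ge0// ltW.
  by move: g1; rewrite -/A ltr_norml; lra.
rewrite -/A in m1; lra.
Qed.
End HeavyTail.

(** * Large values at spaced times *)

Section LowerBlocks.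
Context {R : realType} {d : measure_display} {T : measurableType d}.
Variable P : probability T R.
Variable X : int -> T -> R.
Hypothesis mX : forall t, measurable_fun setT (X t).
Hypothesis sX : stationary P X.

(** Only every [k]-th time is inspected, because anti-clustering bounds joint exceedances at lags of
    at least [k]. *)
Definition calm (u : R) (k N : nat) : (int -> R) -> R :=
  fun x => \prod_(i < N) (if `|x (i * k)%N%:Z| <= u then 1 else 0).

Lemma calm01 u k N x : 0 <= calm u k N x <= 1.
Proof.
rewrite /calm; apply/andP; split.
  by apply: prodr_ge0 => i _; case: ifP.
apply: (@le_trans _ _ (\prod_(i < N) 1)); last by rewrite big1.
by apply: ler_prod => i _; case: ifP; rewrite ?ler01 ?lexx.
Qed.

Lemma calm_meas u k N b : (forall i, (i < N)%N -> (i * k < b)%N) ->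
  measurable_fun setT (calm u k N : pathT (Ib b) -> R).
Proof.
move=> h; rewrite (_ : calm u k N = fun x => \prod_(i <- index_enum 'I_N)
   (if `|coord (i * k)%N x| <= u then 1 else 0))//.
apply: (@measurable_prod _ (pathT (Ib b)) R setT _ _ (fun (i : 'I_N) x =>
   (if `|coord (i * k)%N x| <= u then 1 else 0))) => i _.
apply: meas_le_if; last exact: measurable_cst.
by apply: measurableT_comp => //; exact: (coordI_meas (h i (ltn_ord i))).
Qed.

Lemma sum_spaced_le (f : nat -> R) k N : (forall t, 0 <= f t) -> (0 < k)%N ->
  \sum_(j < N) f (j.+1 * k)%N <= \sum_(k <= t < (N * k).+1) f t.
Proof.
move=> f0 k0; elim: N => [|N IH]; first by rewrite big_ord0 sumr_ge0.
case: N IH => [_|N IH].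
  by rewrite big_ord_recl big_ord0 addr0 mul1n big_nat1.
rewrite big_ord_recr/= (@big_cat_nat _ _ _ (N.+1 * k).+1)/=; [|nia|nia].
rewrite lerD// big_nat_recr/=; last by nia.
by rewrite lerDr sumr_ge0.
Qed.

Lemma sum_nat_widen (f : nat -> R) k n m : (forall t, 0 <= f t) -> (n <= m)%N ->
  \sum_(k <= t < n) f t <= \sum_(k <= t < m) f t.
Proof.
move=> f0 nm; have [kn|kn] := leqP k n; last first.
  by rewrite big_geq ?sumr_ge0// ltnW.
by rewrite (@big_cat_nat _ _ _ n k m)//= lerDl sumr_ge0.
Qed.

Lemma ind_le (u x : R) : 0 < u -> (if u < `|x| then 1 else 0 : R) <= Order.min (`|x| / u) 1.
Proof.
move=> u0; rewrite le_min; case: ifPn => h; rewrite ?lexx ?ler01 ?andbT.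
  by rewrite ler_pdivlMr// mul1r ltW.
by rewrite divr_ge0// ltW.
Qed.

Definition pairE (u : R) (t : nat) : R :=
  rE P (fun w => Order.min (`|X t%:Z w| / u) 1 * Order.min (`|X 0 w| / u) 1).

Lemma pairE_ge0 u t : 0 < u -> 0 <= pairE u t.
Proof.
by move=> u0; apply: rE_ge0 => w; apply: mulr_ge0; rewrite le_min ler01 andbT divr_ge0// ltW.
Qed.

Let ind u (x : R) : R := if u < `|x| then 1 else 0.
Let indm u : measurable_fun setT (ind u).
Proof.
rewrite (_ : ind u = (fun x => 1 - (if `|x| <= u then 1 else 0))).
  by apply: measurable_funB => //; apply: meas_le_if => //; exact: measurable_cst.
by apply/funext => x; rewrite /ind ltNge; case: (_ <= u); rewrite ?subrr ?subr0.
Qed.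
Let ind01 u x : 0 <= ind u x <= 1. Proof. by rewrite /ind; case: ifP; rewrite lexx ler01. Qed.

(** Bonferroni in telescoped form. Prepending one inspected time lowers the probability by that of
    an exceedance there followed by [M] calm times, which is at least [tailG u] minus the joint
    exceedance probabilities at the multiples of [k]. *)
Lemma calm_rE u k r N : 0 < u -> (0 < k)%N -> (N.+1 * k <= r)%N ->
  rE P (calm u k N.+1 \o path X 0) <=
  1 - N.+1%:R * (tailG P X u - \sum_(k <= t < r.+1) pairE u t).
Proof.
move=> u0 k0; set s := \sum_(_ <= _ < _) _.
have mcalm M : measurable_fun setT (calm u k M : pathT setT -> R).
  by apply: (Ib_meas (b := (M * k).+1)); apply: calm_meas => i; nia.
have Lc M p : Lint P (calm u k M \o path X p).
  apply: (Lint_bnd 1) => [|w]; first exact: (comp_path_meas mX p (mcalm M)).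
  by have /andP[h1 h2] := calm01 u k M (path X p w); rewrite ger0_norm.
have Li t : Lint P (fun w => ind u (X t w)).
  apply: (Lint_bnd 1) => [|w]; first exact: measurableT_comp.
  by have /andP[h1 h2] := ind01 u (X t w); rewrite ger0_norm.
have Lii t t' : Lint P (fun w => ind u (X t w) * ind u (X t' w)).
  apply: (Lint_bnd 1) => [|w]; first by apply: measurable_funM; exact: measurableT_comp.
  have /andP[h1 h2] := ind01 u (X t w); have /andP[h3 h4] := ind01 u (X t' w).
  by rewrite ger0_norm ?mulr_ge0// mulr_ile1.
have Gind : rE P (fun w => ind u (X 0 w)) = tailG P X u.
  have mab : measurable_fun setT (fun w => `|X 0 w|) by exact: measurableT_comp.
  rewrite /tailG -rE_indic; last exact: meas_lt (measurable_cst u) mab.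
  congr rE; apply/funext => w; rewrite indicE /ind.
  by case: ifPn => h; [rewrite mem_set|rewrite memNset//; apply/negP].
have s0 : 0 <= s by rewrite /s sumr_ge0// => t _; exact: pairE_ge0.
have step M : (M * k <= r)%N -> rE P (calm u k M.+1 \o path X 0) <=
    rE P (calm u k M \o path X 0) - (tailG P X u - s).
  move=> Mr.
  have recE w : calm u k M.+1 (path X 0 w) = calm u k M (path X k w) - ind u (X 0 w) * calm u k M (path X k w).
    rewrite /calm big_ord_recl /= mul0n {1}/path addr0.
    have -> : \prod_(i < M) (if `|path X 0 w (bump 0 i * k)%N| <= u then 1 else 0) =
      \prod_(i < M) (if `|path X k w (i * k)%N| <= u then 1 else 0) :> R.
      apply: eq_bigr => i _; rewrite /path addr0; congr (if `|X _ w| <= u then _ else _).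
      by rewrite -PoszD; congr Posz; rewrite /bump/=; lia.
    by rewrite /ind ltNge; case: (_ <= u) => /=; rewrite ?mul1r ?mul0r ?subr0 ?subrr.
  have Lk : Lint P (fun w => ind u (X 0 w) * calm u k M (path X k w)).
    apply: (Lint_bnd 1) => [|w].
      by apply: measurable_funM; [exact: measurableT_comp|exact: (comp_path_meas mX k (mcalm M))].
    have /andP[h1 h2] := ind01 u (X 0 w); have /andP[h3 h4] := calm01 u k M (path X k w).
    by rewrite ger0_norm ?mulr_ge0// mulr_ile1.
  have -> : rE P (calm u k M.+1 \o path X 0) = rE P (calm u k M \o path X k) -
      rE P (fun w => ind u (X 0 w) * calm u k M (path X k w)).
    by rewrite -rEB//; congr rE; apply/funext => w; exact: recE.
  rewrite (path_rE mX sX k (mcalm M)) lerD2l lerN2.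
  apply: (@le_trans _ _ (rE P (fun w => ind u (X 0 w) -
      \sum_(j < M) ind u (X 0 w) * ind u (X (j.+1 * k)%N w)))).
    rewrite rEB//; last by apply: Lint_sum => j _; exact: Lii.
    rewrite Gind lerD2l lerN2 rE_sum; last by move=> j _; exact: Lii.
    apply: (@le_trans _ _ (\sum_(j < M) pairE u (j.+1 * k)%N)).
      apply: ler_sum => j _; rewrite /pairE; apply: rE_le => //.
        apply: (Lint_bnd 1) => [|w].
          apply: measurable_funM; apply: measurable_minr => //; apply: measurable_funM => //;
            exact: measurableT_comp.
        have hm (y : R) : 0 <= Order.min (`|y| / u) 1 <= 1.
          by rewrite le_min ler01 andbT ge_min lexx orbT andbT divr_ge0// ltW.
        have /andP[h1 h2] := hm (X 0 w); have /andP[h3 h4] := hm (X (j.+1 * k)%N w).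
        by rewrite ger0_norm ?mulr_ge0// mulr_ile1.
      move=> w; rewrite mulrC; apply: ler_pM; try exact: ind_le.
        by have /andP[] := ind01 u (X (j.+1 * k)%N w).
      by have /andP[] := ind01 u (X 0 w).
    apply: le_trans (sum_spaced_le _ _ k0) _; first by move=> t; exact: pairE_ge0.
    by apply: sum_nat_widen => [t|]; [exact: pairE_ge0|rewrite ltnS].
  apply: rE_le => //; first by apply: LintB => //; apply: Lint_sum => j _; exact: Lii.
  move=> w; rewrite -mulr_sumr -[X in X - _ <= _]mulr1 -mulrBr.
  apply: ler_wpM2l; first by have /andP[] := ind01 u (X 0 w).
  have lb M' : 1 - \sum_(j < M') ind u (X (j.+1 * k)%N w) <= calm u k M' (path X k w).
    elim: M' => [|M' IH]; first by rewrite /calm !big_ord0 subr0.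
    rewrite /calm !big_ord_recr/= -/(calm u k M' (path X k w)).
    have -> : path X k w (M' * k)%N = X (M'.+1 * k)%N w by rewrite /path -PoszD mulSn addnC.
    have /andP[h1 h2] := calm01 u k M' (path X k w).
    by move: IH; rewrite /ind ltNge; case: (_ <= u) => /=; rewrite ?mulr1 ?mulr0; lra.
  exact: lb.
elim: N => [|N IH] Nr.
  have := step 0%N; rewrite mul0n => /(_ isT) h; apply: le_trans h _.
  rewrite (_ : calm u k 0 \o path X 0 = fun=> 1) ?rE_cst; first by rewrite mul1r.
  by apply/funext => w; rewrite /calm/= big_ord0.
apply: le_trans (step N.+1 _) _; first by nia.
have := IH (ltac:(nia)); rewrite -[N.+2]addn1 natrD; lra.
Qed.

Definition calmJ (u : R) (k N r J : nat) : (int -> R) -> R :=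
  fun x => \prod_(i < J) calm u k N (shift (i * r)%N x).

Lemma calmJ01 u k N r J x : 0 <= calmJ u k N r J x <= 1.
Proof.
have h i := calm01 u k N (shift (i * r)%N x).
rewrite /calmJ; apply/andP; split.
  by apply: prodr_ge0 => i _; have /andP[] := h i.
apply: (@le_trans _ _ (\prod_(i < J) 1)); last by rewrite big1.
by apply: ler_prod => i _; exact: h.
Qed.

(** In each block of length [r] the last [l] times are not read, so the window ends [l] before
    [J * r]; this is the gap that separates it from the next block. *)
Lemma calmJ_meas u k N r J l : (0 < k)%N -> (N * k + l <= r)%N -> (0 < J)%N ->
  measurable_fun setT (calmJ u k N r J : pathT (Ib (J * r - l)) -> R).
Proof.
move=> k0 Nr J0.
rewrite (_ : calmJ u k N r J = fun x => \prod_(i <- index_enum 'I_J) calm u k N (shift (i * r)%N x))//.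
apply: (@measurable_prod _ (pathT (Ib (J * r - l))) R setT _ _
  (fun (i : 'I_J) x => calm u k N (shift (i * r)%N x))) => i _.
have mN : measurable_fun setT (calm u k N : pathT (Ib (N * k)) -> R).
  by apply: calm_meas => j jN; rewrite ltn_pmul2r.
have ms : measurable_fun setT (shift (i * r)%N : @pathT R (Ib (J * r - l)) -> pathT (Ib (N * k))).
  apply: into_path_meas => t /andP[t0 tN]; apply: coord_meas => /=.
  have iJ := ltn_ord i.
  rewrite /Ib/= addr_ge0//=; apply: (@lt_le_trans _ _ (N * k + i * r)%N%:Z).
    by rewrite PoszD ltrD2r.
  by rewrite lez_nat; nia.
exact: (measurableT_comp mN ms).
Qed.

(** Each further block is detached at the price [alpha l]; the prices add up instead of compounding
    because the remaining factor is at most 1. *)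
Lemma calmJ_rE u k N r J l : (0 < k)%N -> (N * k + l <= r)%N ->
  rE P (calmJ u k N r J.+1 \o path X 0) <=
  rE P (calm u k N \o path X 0) ^+ J.+1 + J%:R * alpha P X l.
Proof.
move=> k0 Nr.
have mN : measurable_fun setT (calm u k N : pathT (Ib (N * k)) -> R).
  by apply: calm_meas => j jN; rewrite ltn_pmul2r.
set e := rE P (calm u k N \o path X 0).
have e01 : 0 <= e <= 1.
  rewrite /e rE_ge0/=; last by move=> w; have /andP[] := calm01 u k N (path X 0 w).
  apply: le_trans (ler_norm _) _; apply: rE_bnd => [|w]; first exact: (block_meas mX 0 mN).
  by have /andP[h1 h2] := calm01 u k N (path X 0 w); rewrite ger0_norm.
have a0 := alpha_ge0 P mX l.
elim: J => [|J IH].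
  rewrite mul0r addr0 expr1 le_eqVlt; apply/orP; left; apply/eqP; congr rE.
  apply/funext => w; rewrite /calmJ/= big_ord_recl big_ord0 mulr1; congr calm.
  by apply/funext => t; rewrite /shift mul0n addr0.
have mJ := calmJ_meas u k0 Nr (ltn0Sn J).
have := @mix_blocks _ _ _ P X mX sX 0 (J.+1 * r) (J.+1 * r - l) (N * k) l
  (calmJ u k N r J.+1) (calm u k N) 1 1 (ltac:(nia)) mJ mN ltr01 ltr01.
have b1 x : `|calmJ u k N r J.+1 x| <= 1 by have /andP[h1 h2] := calmJ01 u k N r J.+1 x; rewrite ger0_norm.
have b2 x : `|calm u k N x| <= 1 by have /andP[h1 h2] := calm01 u k N x; rewrite ger0_norm.
move=> /(_ b1 b2); rewrite !mul1r /rcov (block_rE mX sX (J.+1 * r) mN) -/e.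
have -> : rE P (fun w => (calmJ u k N r J.+1 \o path X 0%N) w * (calm u k N \o path X (J.+1 * r)%N) w)
   = rE P (calmJ u k N r J.+2 \o path X 0).
  congr rE; apply/funext => w; rewrite /calmJ/= [in RHS]big_ord_recr/=; congr (_ * calm u k N _).
  by apply/funext => t; rewrite /shift/path addr0.
move=> /ler_normlW h.
have {}h : rE P (calmJ u k N r J.+2 \o path X 0) <= rE P (calmJ u k N r J.+1 \o path X 0) * e + alpha P X l.
  by rewrite -lerBlDl.
apply: le_trans h _; move: e01 => /andP[e0 e1].
have h2 : rE P (calmJ u k N r J.+1 \o path X 0) * e <= (e ^+ J.+1 + J%:R * alpha P X l) * e by rewrite ler_wpM2r.
have h3 : J%:R * alpha P X l * e <= J%:R * alpha P X l by rewrite ler_piMr// mulr_ge0.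
rewrite exprSr -[X in X%:R]addn1 natrD; lra.
Qed.

Lemma Qsum_ge_coord n w t : (1 <= t <= n)%N -> `|X t%:Z w| <= Qsum X 1 n w.
Proof.
move=> tn; rewrite -[leLHS]sqrtr_sqr; apply: ler_wsqrtr.
rewrite (bigD1_seq t) ?mem_index_iota ?iota_uniq//=.
by rewrite lerDl sumr_ge0// => i _; rewrite sqr_ge0.
Qed.

Lemma pr_Qsum_le u (k N r J n l : nat) : (0 < k)%N -> (N * k + l <= r)%N -> (J.+1 * r <= n)%N ->
  pr P [set w | Qsum X 1 n w <= u] <= rE P (calm u k N \o path X 0) ^+ J.+1 + J%:R * alpha P X l.
Proof.
move=> k0 Nr Jn; apply: le_trans (calmJ_rE u J k0 Nr).
have mJ := calmJ_meas u k0 Nr (ltn0Sn J).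
have mQ : measurable [set w | Qsum X 1 n w <= u].
  by apply: meas_le; [exact: Qsum_meas|exact: measurable_cst].
rewrite -(block_rE mX sX 1 mJ) -rE_indic//; apply: rE_le.
- exact: Lint_indic.
- apply: (Lint_bnd 1) => [|w]; first exact: (block_meas mX 1 mJ).
  by have /andP[h1 h2] := calmJ01 u k N r J.+1 (path X 1 w); rewrite ger0_norm.
move=> w; rewrite indicE; have [wQ|] := boolP (w \in _); last first.
  by move=> _; have /andP[] := calmJ01 u k N r J.+1 (path X 1 w).
rewrite /calmJ/= big1// => i _; rewrite /calm big1// => j _.
have -> : shift (i * r)%N (path X 1 w) (j * k)%N = X (j * k + i * r + 1)%N%:Z w.
  by rewrite /shift/path !PoszD.
rewrite (le_trans (Qsum_ge_coord (n := n) _ _))//; last exact: set_mem wQ.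
by have := ltn_ord i; have := ltn_ord j; nia.
Qed.
End LowerBlocks.

(** Half of a block of length [r] is inspected with spacing [k], the other half contains the gap
    [l]. The halving and the roundings of [J] and [N] each cost a factor 2, whence [8 * k]. *)
Lemma block_arith (K m r l k : nat) : (0 < k)%N -> (0 < K)%N -> (4 * r <= m)%N ->
  (4 * k <= r)%N -> (2 * l <= r)%N ->
  let J := (K * m %/ r)%N in let N := (r %/ (2 * k))%N in
  [/\ (0 < J)%N, (J * r <= K * m)%N, (0 < N)%N, (N * k + l <= r)%N &
      (K * m <= J * N * (8 * k))%N /\ (N <= 2 * m)%N].
Proof.
move=> k0 K0 rm kr lr J N.
have r0 : (0 < r)%N by lia.
have Jr : (J * r <= K * m)%N by exact: leq_divM.
have Jr' : (K * m < J.+1 * r)%N by exact: ltn_ceil.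
have Nk : (N * (2 * k) <= r)%N by exact: leq_divM.
have Nk' : (r < N.+1 * (2 * k))%N by apply: ltn_ceil; lia.
move: J N Jr Jr' Nk Nk' => J N Jr Jr' Nk Nk'.
have mK : (m <= K * m)%N by nia.
have c1 : (r <= N * (4 * k))%N by nia.
have c2 : (K * m <= 2 * (J * r))%N by nia.
have J0 : (0 < J)%N by nia.
have N0 : (0 < N)%N by nia.
have c3 : (J * r <= J * (N * (4 * k)))%N by rewrite leq_mul2l c1 orbT.
by split=> //; [nia|split; [lia|nia]].
Qed.

(** * Lower bound for the self-normalizer *)

Section AntiClustering.
Context {R : realType} {d : measure_display} {T : measurableType d}.
Variable P : probability T R.
Variable X : int -> T -> R.
Hypothesis mX : forall t, measurable_fun setT (X t).
Hypothesis sX : stationary P X.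
Variables (kappa : R) (a : nat -> R).
Hypothesis kap : 1 < kappa < 2.
Hypothesis rv : regvar P (X 0) kappa.
Hypothesis na : norming P X a.
Hypothesis ac : AC_MX P X a.

(** As soon as [r n <= n], the coefficient at [l n] is at most [n / r n * alpha (l n)]; being
    nonincreasing, [alpha] stays small after one small value. *)
Lemma ac_alpha0 : alpha P X k @[k --> \oo] --> (0 : R).
Proof.
have [r [l [rY [rn [_ [_ [_ ral]]]]]]] := ac.
apply/cvg_nearP => e e0.
have /cvg_nearP/(_ e e0) h1 := ral; have /cvg_nearP/(_ 1 ltr01) h2 := rn.
have [n [ha [hr [r1 n1]]]] : exists n, `|n%:R / (r n)%:R * alpha P X (l n) - 0| < e /\
    `|(r n)%:R / n%:R - 0 : R| < 1 /\ (1 <= r n)%N /\ (1 <= n)%N.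
  have [N _ hN] : \forall n \near \oo, `|n%:R / (r n)%:R * alpha P X (l n) - 0| < e /\
    `|(r n)%:R / n%:R - 0 : R| < 1 /\ (1 <= r n)%N /\ (1 <= n)%N.
    have h3 : \forall n \near \oo, (1 <= r n)%N /\ (1 <= n)%N.
      by apply: filterS2 (natr_cvgy rY 1) (near_ge 1).
    by apply: filterS3 h1 h2 h3 => n ? ? [? ?].
  by exists N; exact: (hN N (leqnn N)).
exists (l n) => // k /= lk; have ak0 := alpha_ge0 P mX k.
rewrite subr0 ger0_norm//; apply: le_lt_trans (alpha_anti P mX lk) _.
have al0 := alpha_ge0 P mX (l n).
have n0 : 0 < (n%:R : R) by rewrite ltr0n.
have r0 : 0 < ((r n)%:R : R) by rewrite ltr0n.
move: ha hr; rewrite !subr0 !ger0_norm ?mulr_ge0 ?divr_ge0// => ha.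
rewrite ltr_pdivrMr// mul1r => hr; apply: le_lt_trans ha.
by rewrite ler_peMl// ler_pdivlMr// mul1r ltW.
Qed.

Lemma anti_cluster (r : nat -> nat) :
  limn_esup (fun n => (n%:R * \sum_(k <= t < (r n).+1)
        rE P (fun w => Num.min (`|X t%:Z w| / a n) 1 * Num.min (`|X 0 w| / a n) 1))%:E)
       @[k --> \oo] --> 0%E ->
  exists2 k, (0 < k)%N & \forall n \near \oo, n%:R * \sum_(k <= t < (r n).+1) pairE P X (a n) t <= 4^-1.
Proof.
move=> h.
have o4 : open_nbhs (0%E : \bar R) [set y | (y < (4^-1)%:E)%E].
  by split; [exact: open_ereal_lt_ereal|rewrite /= lte_fin].
have [K _ hK] := h _ (open_nbhs_nbhs o4).
(* [K.+1] instead of [K], so that the spacing is positive. *)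
have := hK K.+1 (leqnSn K); rewrite /= /limn_esup limf_esupE => /ereal_inf_lt[_ [V VF <-] hV].
exists K.+1 => //; apply: filterS VF => n Vn.
rewrite -lee_fin ltW//; apply: le_lt_trans hV; apply: ereal_sup_ubound.
by exists n.
Qed.

(** A substitute for bounding (1 - p)^J by exp(- J p); the induction rests on (1 - p) (1 + (J + 1)
    p) <= 1 + J p. *)
Lemma bernoulli_inv (p : R) J : 0 <= p <= 1 -> (1 - p) ^+ J * (1 + J%:R * p) <= 1.
Proof.
move=> /andP[p0 p1]; elim: J => [|J IH]; first by rewrite expr0 mul0r addr0 mulr1.
apply: le_trans IH; rewrite exprSr -mulrA ler_wpM2l ?exprn_ge0 ?subr_ge0//.
rewrite -[X in X%:R]addn1 natrD.
have : 0 <= p * (J%:R * p + p) by rewrite mulr_ge0// addr_ge0// mulr_ge0.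
lra.
Qed.

Lemma divn_cvg (K : nat) : (0 < K)%N ->
  (forall M, \forall n \near \oo, (M <= n %/ K)%N) /\
  (n %/ K)%:R / n%:R @[n --> \oo] --> (K%:R^-1 : R).
Proof.
move=> K0; split=> [M|].
  by apply: filterS (near_ge (M * K)) => n; rewrite leq_divRL.
apply/cvg_nearP => e e0; have e2 : 0 < e / 2 by lra.
apply: filterS2 (near_small_inv 1 e2) (near_ge 1) => n h n1.
have n0 : 0 < (n%:R : R) by rewrite ltr0n.
have Kp : 0 < (K%:R : R) by rewrite ltr0n.
have h1 : (n %/ K)%:R * K%:R <= n%:R :> R by rewrite -natrM ler_nat leq_divM.
have h2 : n%:R <= (n %/ K)%:R * K%:R + K%:R :> R.
  by rewrite -natrM -natrD ler_nat; have := ltn_ceil n K0; lia.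
have -> : (n %/ K)%:R / n%:R - K%:R^-1 = - ((n%:R - (n %/ K)%:R * K%:R) / K%:R) / n%:R :> R.
  by field; rewrite !gt_eqF.
apply: (@le_lt_trans _ _ (1 / n%:R)); last by lra.
rewrite mulNr normrN ger0_norm; last by rewrite !divr_ge0// subr_ge0.
by rewrite ler_pM2r ?invr_gt0// ler_pdivrMr// mul1r; lra.
Qed.

Lemma powR_small_gt (dl : R) : 0 < dl <= 1 -> dl^-1 <= dl `^ (- kappa).
Proof.
move=> /andP[d0 d1]; rewrite powRN lef_pV2 ?posrE ?powR_gt0//.
by apply: ge1r_powR; [rewrite d0|move: kap; lra].
Qed.

(** A stretch of length [n] may avoid the level [a n] with a probability that is not small. The time
    is therefore cut into [K'] stretches of length [m], and the level is [a m], still comparable to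
    [a n]; the expected number of exceedances then grows with [K']. *)
Lemma Qsum_lower (e : R) : 0 < e -> exists2 dl : R, 0 < dl &
  \forall n \near \oo, pr P [set w | Qsum X 1 n w <= dl * a n] <= e.
Proof.
move=> e0; have [r [l [rY [rn [hac [lY [lr ral]]]]]]] := ac.
have [k k0 hk] := anti_cluster hac.
(* The final estimate is (1 - p)^J <= 1 / (1 + J p) with J p at least [K' / (16 * k)]; this choice
   makes it at most [e / 2]. *)
have [K hK] : exists K, 32 * k%:R / e <= K.+1%:R.
  have [K _ hK] := near_natr (32 * k%:R / e); exists K.
  by apply: hK => /=; exact: leqnSn.
pose K' := K.+1.
have na1 : a n @[n --> \oo] --> +oo by case: na.
have na2 : n%:R * tailG P X (a n) @[n --> \oo] --> (1 : R) by case: na.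
have [mY mn] := divn_cvg (ltn0Sn K : (0 < K')%N).
pose m n := (n %/ K')%N.
(* Then dl to the power -kappa is at least [2 * K'], more than the [K'] that [a_sub_gt] asks for, so
   [dl * a n < a m] eventually. *)
pose dl : R := (2 * K'%:R)^-1.
have K'p : 1 <= (K'%:R : R) by rewrite ler1n.
have dl0 : 0 < dl by rewrite invr_gt0; lra.
exists dl => //.
have Ksc : 1 < dl `^ (- kappa) * K'%:R^-1.
  rewrite ltr_pdivlMr ?mul1r; last by lra.
  have dl1 : 0 < dl <= 1 by rewrite dl0 invf_le1; lra.
  by apply: lt_le_trans (powR_small_gt dl1); rewrite /dl invrK; lra.
have Kinv0 : 0 < (K'%:R^-1 : R) by rewrite invr_gt0; lra.
have hsc := a_sub_gt (tailG_anti P mX) (tailG_ge0 P X) (tailG_reg mX rv) na1 na2 mY Kinv0 mn dl0 Ksc.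
have e2 : 0 < e / 2 / K'%:R by rewrite !divr_gt0//; lra.
have h4 : 0 < (4^-1 : R) by lra.
have /cvg_nearP/(_ _ e2) hral := ral.
have /cvg_nearP/(_ _ h4) hlr := lr.
have /cvg_nearP/(_ _ h4) hrn := rn.
have hnG := nGa_near na2 h4.
have aY := a_ge na1 1.
pose Q mm := [/\ mm%:R * (\sum_(k <= t < (r mm).+1) pairE P X (a mm) t) <= 4^-1,
   `|mm%:R / (r mm)%:R * alpha P X (l mm) - 0| < e / 2 / K'%:R,
   (2 * l mm <= r mm)%N, (4 * r mm <= mm)%N & 
   [/\ `|mm%:R * tailG P X (a mm) - 1| < 4^-1, 1 <= a mm & (4 * k <= r mm)%N]].
have hQ : \forall mm \near \oo, Q mm.
  near=> mm.
  have r1 : (1 <= r mm)%N by near: mm; exact: (natr_cvgy rY 1).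
  have m1 : (1 <= mm)%N by near: mm; exact: near_ge.
  split.
  - by near: mm.
  - by near: mm.
  - have : `|(l mm)%:R / (r mm)%:R - 0 : R| < 4^-1 by near: mm.
    rewrite subr0 ger0_norm ?divr_ge0// ltr_pdivrMr ?ltr0n// => h.
    by have := ler0n R (r mm); rewrite -(ler_nat R) natrM; lra.
  - have : `|(r mm)%:R / mm%:R - 0 : R| < 4^-1 by near: mm.
    rewrite subr0 ger0_norm ?divr_ge0// ltr_pdivrMr ?ltr0n// => h.
    by have := ler0n R mm; rewrite -(ler_nat R) natrM; lra.
  - split; [by near: mm|by near: mm|near: mm; exact: (natr_cvgy rY (4 * k))].
apply: filterS2 (near_sub mY hQ) hsc => n; rewrite -/(m n).
have mE2 : (K' * m n <= n)%N by rewrite /m mulnC leq_divM.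
move: (m n) mE2 => mm mE2 [q1 q2 q3 q4 [q5 q6 q7]] hsc'.
have K'0 : (0 < K')%N by [].
have [J1p J1r N1p Nk [JN N2m]] := block_arith k0 K'0 q4 q7 q3.
have rp : (0 < r mm)%N by apply: leq_trans q7; rewrite muln_gt0.
have m0 : (0 < mm)%N by apply: leq_trans q4; rewrite muln_gt0.
move: (K' * mm %/ r mm)%N (r mm %/ (2 * k))%N J1p J1r N1p Nk JN N2m => J1 N1 J1p J1r N1p Nk JN N2m.
have am0 : 0 < a mm by lra.
case: J1 J1p J1r JN => [//|J] J1p J1r JN.
have Jn : (J.+1 * r mm <= n)%N by exact: leq_trans J1r mE2.
have mQ : measurable_fun setT (Qsum X 1 n) by exact: Qsum_meas.
apply: (@le_trans _ _ (pr P [set w | Qsum X 1 n w <= a mm])).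
  apply: pr_le; [exact: meas_le mQ (measurable_cst _)|exact: meas_le mQ (measurable_cst _)|].
  by move=> w /= h; rewrite (le_trans h)// ltW.
apply: le_trans (pr_Qsum_le mX sX (a mm) k0 Nk Jn) _.
have mp : 0 < (mm%:R : R) by rewrite ltr0n.
have rmp : 0 < ((r mm)%:R : R) by rewrite ltr0n.
have kp : 0 < (k%:R : R) by rewrite ltr0n.
have Kp : 0 < (K'%:R : R) by lra.
have -> : e = e / 2 + e / 2 by field.
have al0 := alpha_ge0 P mX (l mm).
have hJ : J%:R * alpha P X (l mm) <= K'%:R * (mm%:R / (r mm)%:R * alpha P X (l mm)).
  rewrite mulrA; apply: ler_wpM2r => //.
  by rewrite mulrA ler_pdivlMr// -!natrM ler_nat (leq_trans _ J1r)// leq_mul2r leqnSn orbT.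
have hK2 : K'%:R * (mm%:R / (r mm)%:R * alpha P X (l mm)) <= e / 2.
  move: q2; rewrite subr0 => /ltW/(le_trans (ler_norm _)).
  by rewrite ler_pdivlMr// mulrC.
apply: lerD (le_trans hJ hK2).
set E := rE P _.
have E0 : 0 <= E by apply: rE_ge0 => w; have /andP[] := calm01 (a mm) k N1 (path X 0 w).
(* A lower bound for the exceedance probability in one block: [mm * tailG (a mm)] is above 3/4, and
   the anti-clustering sum takes away at most 1/4. *)
pose p : R := N1%:R / (2 * mm%:R).
have p0 : 0 <= p by rewrite divr_ge0// mulr_ge0// ltW.
have p1 : p <= 1.
  by rewrite ler_pdivrMr ?mulr_gt0// mul1r -[2]/(2%:R) -natrM ler_nat.
have Ep : E <= 1 - p.
  rewrite /E -(prednK N1p); apply: le_trans (calm_rE mX sX (r := r mm) am0 k0 _) _.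
    by rewrite (prednK N1p) (leq_trans _ Nk)// leq_addr.
  rewrite (prednK N1p) lerD2l lerN2 /p ler_pdivrMr ?mulr_gt0//.
  rewrite -mulrA -[leLHS]mulr1 ler_wpM2l//.
  rewrite (_ : _ * (2 * mm%:R) = 2 * (mm%:R * tailG P X (a mm) - mm%:R * \sum_(k <= t < (r mm).+1) pairE P X (a mm) t)); last by ring.
  by move: q5; rewrite ltr_norml; lra.
apply: (@le_trans _ _ ((1 - p) ^+ J.+1)).
  by rewrite lerXn2r// nnegrE subr_ge0.
have Jp : K'%:R / (16 * k%:R) <= J.+1%:R * p.
  rewrite ler_pdivrMr ?mulr_gt0//.
  rewrite (_ : J.+1%:R * p * _ = J.+1%:R * N1%:R * (16 * k%:R) / (2 * mm%:R)); last first.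
    by rewrite /p; field; rewrite gt_eqF.
  rewrite ler_pdivlMr ?mulr_gt0//.
  rewrite (_ : K'%:R * _ = 2 * (K' * mm)%:R); last by rewrite natrM; ring.
  rewrite (_ : J.+1%:R * N1%:R * _ = 2 * (J.+1 * N1 * (8 * k))%:R); last by rewrite !natrM; ring.
  by rewrite ler_pM2l// ler_nat.
have p01 : 0 <= p <= 1 by rewrite p0.
have hB := bernoulli_inv J.+1 p01.
have hK' : 2 / e <= K'%:R / (16 * k%:R).
  rewrite ler_pdivlMr ?mulr_gt0//; apply: le_trans hK; lra.
have hh : 2 / e <= 1 + J.+1%:R * p by lra.
have q0 : 0 <= (1 - p) ^+ J.+1 by rewrite exprn_ge0// subr_ge0.
have : (1 - p) ^+ J.+1 * (2 / e) <= 1 by apply: le_trans hB; rewrite ler_wpM2l.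
by rewrite mulrA ler_pdivrMr// mul1r; lra.
Unshelve. all: by end_near. Qed.
End AntiClustering.

(** * Nonzero mean *)

Section NonzeroMean.
Context {R : realType} {d : measure_display} {T : measurableType d}.
Variable P : probability T R.
Variable X : int -> T -> R.
Hypothesis mX : forall t, measurable_fun setT (X t).
Hypothesis sX : stationary P X.
Hypothesis alpha0 : alpha P X k @[k --> \oo] --> (0 : R).
Hypothesis LX : Lint P (X 0).
Variable b : nat -> nat.
Hypothesis bY : forall K, \forall n \near \oo, (K <= b n)%N.
Variable c : nat -> R.
Hypothesis c0 : \forall n \near \oo, 0 < c n.
Hypothesis Qlow : forall e : R, 0 < e -> exists2 dl : R, 0 < dl &
  \forall n \near \oo, pr P [set w | Qsum X 1 n w <= dl * c n] <= e.
Hypothesis Qup : forall e : R, 0 < e -> exists2 K : R, 0 < K &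
  \forall n \near \oo, pr P [set w | K * c n <= Qsum X 1 n w] <= e.
Hypothesis cb : forall e : R, 0 < e -> \forall n \near \oo,
  (b n)%:R * c n <= e * (n%:R * c (b n)).

Let mS n : measurable_fun setT (Ssum X 1 n) := Ssum_meas mX n 1.
Let mQ n : measurable_fun setT (Qsum X 1 n) := Qsum_meas mX n 1.
Let mT n : measurable_fun setT (Tstat X n) := Tsub_meas mX n 1.

Lemma lln_S (s e dl : R) : 0 < e -> 0 < dl -> \forall n \near \oo,
  pr P [set w | e * n%:R <= `|s * Ssum X 1 n w - s * rE P (X 0) * n%:R|] <= dl.
Proof.
move=> e0 d0.
have Ls : Lint P ((fun x => s * x) \o X 0) by exact: LintZ.
have ms : measurable_fun setT (fun x : R => s * x) by exact: measurable_funM.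
have := lln mX sX alpha0 ms Ls e0 d0; apply: filterS2 (near_ge 1) => n n1 h.
have n0 : 0 < (n%:R : R) by rewrite ltr0n.
apply: le_trans h; rewrite le_eqVlt; apply/orP; left; apply/eqP; congr (pr P _).
apply/funext => w /=; apply/propext.
have -> : s * Ssum X 1 n w - s * rE P (X 0) * n%:R = 
  n%:R * (n%:R^-1 * \sum_(i < n) s * X i.+1%:Z w - rE P ((fun x => s * x) \o X 0)).
  rewrite rEZ// /Ssum big_add1 big_mkord -mulr_sumr.
  by field; rewrite gt_eqF.
by rewrite normrM gtr0_norm// mulrC ler_pM2l.
Qed.

(** The order [c] of the self-normalizer is abstract: it will be [a n] for heavy tails and [sqrt n]
    under finite variance. The sign [s] reduces a negative mean to a positive one. *)
Lemma separation (s : R) : 0 < s * rE P (X 0) -> forall e, 0 < e ->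
  exists x : nat -> R, \forall n \near \oo,
    pr P [set w | x n <= s * Tstat X (b n) w] <= e /\
    pr P [set w | s * Tstat X n w <= x n] <= e.
Proof.
set mu := s * rE P (X 0) => mu0 e e0.
have e3 : 0 < e / 3 by lra.
have [dl d0 hdl] := Qlow e3; have [K K0 hK] := Qup e3.
(* An upper bound for the subsample statistic: sum below [2 * mu * b n], self-normalizer above
   [dl * c (b n)]. The constant in [r0] is the one for which half of the drift, [mu / 2 * n],
   divided by [K * c n] is still at least this. *)
exists (fun n => 2 * mu * (b n)%:R / (dl * c (b n))).
have m2 : 0 < mu / 2 by lra.
have r0 : 0 < dl / (4 * K) by rewrite divr_gt0// mulr_gt0.
near=> n.
have n1 : (1 <= n)%N by near: n; exact: near_ge.
have b1 : (1 <= b n)%N by near: n; exact: bY.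
have cn0 : 0 < c n by near: n.
have cbn0 : 0 < c (b n) by near: n; exact: (near_sub bY c0).
have hS : pr P [set w | mu / 2 * n%:R <= `|s * Ssum X 1 n w - mu * n%:R|] <= e / 3.
  by near: n; exact: lln_S.
have hSb : pr P [set w | mu / 2 * (b n)%:R <= `|s * Ssum X 1 (b n) w - mu * (b n)%:R|] <= e / 3.
  by near: n; apply: (near_sub bY (Q := fun n => pr P [set w | mu / 2 * n%:R <= `|s * Ssum X 1 n w - mu * n%:R|] <= e / 3)); exact: lln_S.
have hQ1 : pr P [set w | Qsum X 1 n w <= dl * c n] <= e / 3 by near: n.
have hQb : pr P [set w | Qsum X 1 (b n) w <= dl * c (b n)] <= e / 3.
  by near: n; exact: (near_sub bY hdl).
have hQK : pr P [set w | K * c n <= Qsum X 1 n w] <= e / 3 by near: n.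
have hcb : (b n)%:R * c n <= dl / (4 * K) * (n%:R * c (b n)) by near: n; exact: cb.
have np : 0 < (n%:R : R) by rewrite ltr0n.
have bp : 0 < ((b n)%:R : R) by rewrite ltr0n.
have mA k (u : R) : measurable [set w | u <= `|s * Ssum X 1 k w - mu * k%:R|].
  apply: meas_le; first exact: measurable_cst.
  apply: measurableT_comp => //; apply: measurable_funB => //.
  exact: measurable_funM.
have mQ1 k (u : R) : measurable [set w | Qsum X 1 k w <= u] by exact: meas_le (mQ k) (measurable_cst _).
have mQ2 k (u : R) : measurable [set w | u <= Qsum X 1 k w] by exact: meas_le (measurable_cst _) (mQ k).
have msT k : measurable_fun setT (fun w => s * Tstat X k w) by exact: measurable_funM.
set x := 2 * mu * _ / _.
have mu2 : 0 < 2 * mu by lra.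
have mub2 : 0 < 2 * mu * (b n)%:R by rewrite pmulr_rgt0.
have muK : 0 < 2 * mu * K by rewrite pmulr_rgt0.
split.
  apply: le_trans (pr_le_setU _ _ _ (mA (b n) (mu / 2 * (b n)%:R)) (mQ1 (b n) (dl * c (b n))) _) _.
  - exact: meas_le (measurable_cst x) (msT _).
  - move=> w /= xT; have [h|h] := leP (Qsum X 1 (b n) w) (dl * c (b n)); [by right|left].
    have Q0 : 0 < Qsum X 1 (b n) w by apply: lt_trans h; rewrite mulr_gt0.
    rewrite leNgt; apply/negP; rewrite ltr_norml => /andP[_ h2].
    move: xT; rewrite leNgt => /negP; apply.
    rewrite /Tstat mulrA /x ltr_pdivrMr//.
    have mub : 0 < mu * (b n)%:R by rewrite pmulr_rgt0.
    have S2 : s * Ssum X 1 (b n) w < 2 * mu * (b n)%:R by lra.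
    apply: lt_trans S2 _; rewrite [ltRHS]mulrAC ltr_pdivlMr ?mulr_gt0//.
    by rewrite ltr_pM2l.
  lra.
apply: le_trans (pr_le_setU _ ([set w | Qsum X 1 n w <= dl * c n] `|` [set w | K * c n <= Qsum X 1 n w]) _ (mA n (mu / 2 * n%:R)) (measurableU _ _ (mQ1 _ _) (mQ2 _ _)) _) _.
- exact: meas_le (msT _) (measurable_cst x).
- move=> w /= Tx; have [h|h] := leP (Qsum X 1 n w) (dl * c n); [by right; left|].
  have [h'|h'] := leP (K * c n) (Qsum X 1 n w); [by right; right|left].
  have Q0 : 0 < Qsum X 1 n w by apply: lt_trans h; rewrite mulr_gt0.
  rewrite leNgt; apply/negP; rewrite ltr_norml => /andP[h2 _].
  move: Tx; rewrite leNgt => /negP; apply.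
  rewrite /Tstat mulrA /x ltr_pdivlMr//.
  have S2 : mu / 2 * n%:R < s * Ssum X 1 n w by lra.
  apply: le_lt_trans S2; rewrite [leLHS]mulrAC ler_pdivrMr ?mulr_gt0//.
  apply: (@le_trans _ _ (2 * mu * (b n)%:R * (K * c n))).
    by rewrite ler_pM2l// ltW.
  rewrite (_ : 2 * mu * _ * _ = 2 * mu * K * ((b n)%:R * c n)); last by ring.
  rewrite (_ : mu / 2 * _ * _ = 2 * mu * K * (dl / (4 * K) * (n%:R * c (b n)))); last first.
    by field; rewrite gt_eqF.
  by rewrite ler_pM2l.
have := pr_le_setU _ _ (measurableU _ _ (mQ1 n (dl * c n)) (mQ2 n (K * c n))) (mQ1 n (dl * c n)) (mQ2 n (K * c n)) (@subset_refl _ _) : pr P _ <= _.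
lra.
Unshelve. all: by end_near. Qed.

Lemma noncover_nonzero_mean (eta : R) : 0 < eta < 1 -> rE P (X 0) != 0 ->
  P (noncover X b eta n) @[n --> \oo] --> 1%E.
Proof.
move=> he mu0; apply: (noncover_to_one mX sX he).
have mTx n (u : R) : measurable [set w | u < Tstat X n w] by exact: meas_lt (measurable_cst _) (mT n).
have mTx' n (u : R) : measurable [set w | u <= Tstat X n w] by exact: meas_le (measurable_cst _) (mT n).
have [mup|mun|mu00] := ltgtP (rE P (X 0)) 0; last by rewrite mu00 eqxx in mu0.
  right=> e e0; have [|x hx] := @separation (-1) _ e e0; first by lra.
  exists (fun n => - x n); apply: filterS hx => n [h1 h2]; split.
    apply: le_trans h1; rewrite le_eqVlt; apply/orP; left; apply/eqP; congr (pr P _).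
    by apply/funext => w /=; apply/propext; rewrite mulN1r lerNr.
  apply: le_trans h2; rewrite le_eqVlt; apply/orP; left; apply/eqP; congr (pr P _).
  by apply/funext => w /=; apply/propext; rewrite mulN1r lerNl.
left=> e e0; have [|x hx] := @separation 1 _ e e0; first by lra.
exists x; apply: filterS hx => n [h1 h2]; split.
  apply: le_trans h1; apply: pr_le => //; first by under eq_set do rewrite mul1r.
  by move=> w /= /ltW; rewrite mul1r.
apply: le_trans h2; rewrite le_eqVlt; apply/orP; left; apply/eqP; congr (pr P _).
by apply/funext => w /=; rewrite mul1r.
Qed.
End NonzeroMean.

Section NonzeroMeanHeavy.
Context {R : realType} {d : measure_display} {T : measurableType d}.
Variable P : probability T R.
Variable X : int -> T -> R.
Hypothesis mX : forall t, measurable_fun setT (X t).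
Hypothesis sX : stationary P X.
Variable b : nat -> nat.
Hypothesis bY : ((b n)%:R : R) @[n --> \oo] --> +oo.
Hypothesis b0 : (b n)%:R / n%:R @[n --> \oo] --> (0 : R).

Lemma rE_neq0 : Lint P (X 0) -> (\int[P]_w (X 0 w)%:E != 0)%E -> rE P (X 0) != 0.
Proof. by move=> L; apply: contra => /eqP h; rewrite -EFin_rE// h. Qed.

Lemma noncover_heavy (kappa : R) (a : nat -> R) (eta : R) : 0 < eta < 1 -> 1 < kappa < 2 ->
  regvar P (X 0) kappa -> norming P X a -> AC_MX P X a ->
  (\int[P]_w (X 0 w)%:E != 0)%E ->
  P (noncover X b eta n) @[n --> \oo] --> 1%E.
Proof.
move=> he kap rv na ac mu.
have na1 : a n @[n --> \oo] --> +oo by case: na.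
have na2 : n%:R * tailG P X (a n) @[n --> \oo] --> (1 : R) by case: na.
have LX := heavy_Lint mX kap rv na.
apply: (@noncover_nonzero_mean _ _ _ P X mX sX (ac_alpha0 mX ac) LX b (natr_cvgy bY) a) => //.
- by apply: filterS (a_ge na1 1) => n; apply: lt_le_trans.
- by move=> e e0; exact: (Qsum_lower mX sX kap rv na ac e0).
- by move=> e e0; exact: (Qsum_upper mX sX kap rv na e0).
- move=> e e0.
  have := scale_ratio (tailG_anti P mX) (tailG_ge0 P X) (tailG_reg mX rv) kap na1 na2 (natr_cvgy bY) b0 e0.
  by apply: filterS => n [].
- exact: rE_neq0.
Qed.
End NonzeroMeanHeavy.

(** * Covariance inequalities under finite moments *)

Section FiniteVariance.
Context {R : realType} {d : measure_display} {T : measurableType d}.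
Variable P : probability T R.
Variable X : int -> T -> R.
Hypothesis mX : forall t, measurable_fun setT (X t).
Hypothesis sX : stationary P X.
Variable eps : R.
Hypothesis eps0 : 0 < eps.
Hypothesis mom : (\int[P]_w ((`|X 0 w| `^ (2 + eps))%:E) < +oo)%E.
Hypothesis mixing : (\sum_(0 <= k <oo) ((alpha P X k `^ (eps / (2 + eps)))%:E) < +oo)%E.

Let p := 2 + eps.
Let theta := eps / (2 + eps).

Lemma theta_gt0 : 0 < theta. Proof. by rewrite divr_gt0// addr_gt0. Qed.
Lemma theta_le1 : theta <= 1.
Proof. by rewrite ler_pdivrMr ?mul1r ?addr_gt0// lerDr. Qed.

Definition mixrate (k : nat) : R := alpha P X k `^ theta.

Lemma mixrate_ge0 k : 0 <= mixrate k. Proof. exact: powR_ge0. Qed.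

Lemma mixrate_anti k l : (k <= l)%N -> mixrate l <= mixrate k.
Proof.
move=> kl; apply: ge0_ler_powR; rewrite ?nnegrE ?(alpha_ge0 P mX)//.
  exact: ltW theta_gt0.
exact: (alpha_anti P mX kl).
Qed.

(** A power with exponent at most 1 does not decrease numbers of the unit interval; [alpha] may
    reach 2, so the comparison is made for [alpha / 2]. *)
Lemma alpha_mixrate k : alpha P X k <= 2 * mixrate k.
Proof.
have a0 := alpha_ge0 P mX k; have a2 := alpha_le2 P mX k.
have t0 := theta_gt0; have t1 := theta_le1.
pose x := alpha P X k / 2.
have x01 : 0 <= x <= 1 by rewrite /x; lra.
have [x0|x0] := eqVneq x 0.
  by have -> : alpha P X k = 0 by [move: x0; rewrite /x; lra]; rewrite mulr_ge0// mixrate_ge0.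
have xp : 0 < x <= 1 by rewrite lt_neqAle eq_sym x0/=; move: x01; lra.
have h : x <= x `^ theta by apply: ger1_powR.
have h2 : x `^ theta <= mixrate k.
  apply: ge0_ler_powR; rewrite ?nnegrE//; [exact: ltW|by case/andP: x01|rewrite /x; lra].
by move: (le_trans h h2); rewrite /x; lra.
Qed.

Lemma mixrate_sum : exists2 S, 0 <= S & forall n, \sum_(k < n) mixrate k <= S.
Proof.
have n0 : (0 <= \sum_(0 <= k <oo) (mixrate k)%:E)%E.
  by apply: nneseries_ge0 => k _ _; rewrite lee_fin mixrate_ge0.
exists (fine (\sum_(0 <= k <oo) (mixrate k)%:E)%E); first exact: fine_ge0.
move=> n; rewrite -lee_fin fineK; last first.
  by rewrite ge0_fin_numE.
apply: le_trans (nneseries_lim_ge n _); last by move=> k _ _; rewrite lee_fin mixrate_ge0.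
by rewrite big_mkord sumEFin.
Qed.

(** A nonincreasing summable sequence is o(1/n): the terms from [N] to [n] sum to at least
    [(n - N) * mixrate n], and [n <= 2 * (n - N)] once [n >= 2 * N]. *)
Lemma mixrate_tail (e : R) : 0 < e -> \forall n \near \oo, n%:R * mixrate n <= e.
Proof.
move=> e0; have [S S0 hS] := mixrate_sum.
pose u n := \sum_(k < n) mixrate k.
have hsup : has_sup (range u).
  split; first by exists (u 0%N), 0%N.
  by exists S => _ [n _ <-]; exact: hS.
have e2 : 0 < e / 2 by lra.
have [_ [N _ <-] hN] := sup_adherent e2 hsup.
apply: filterS (near_ge (2 * N)) => n nN.
have un : u n <= sup (range u) by apply: sup_upper_bound => //; exists n.
have Nn : (N <= n)%N by lia.
have : (n - N)%:R * mixrate n <= u n - u N.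
  rewrite /u -(big_mkord xpredT (fun k => mixrate k)) (@big_cat_nat _ _ _ N)//=.
  rewrite big_mkord addrAC subrr add0r.
  rewrite mulr_natl -sumr_const_nat; apply: ler_sum_nat => k /andP[_ kn].
  exact/mixrate_anti/ltnW.
rewrite natrB//.
have : (2 * N)%:R * mixrate n <= n%:R * mixrate n by rewrite ler_wpM2r ?mixrate_ge0// ler_nat.
rewrite natrM; lra.
Qed.

Lemma alpha_tail (e : R) : 0 < e -> \forall n \near \oo, n%:R * alpha P X n <= e.
Proof.
move=> e0; have e2 : 0 < e / 2 by lra.
apply: filterS (mixrate_tail e2) => n h.
have : n%:R * alpha P X n <= n%:R * (2 * mixrate n) by rewrite ler_wpM2l// alpha_mixrate.
lra.
Qed.

Lemma fv_alpha0 : alpha P X k @[k --> \oo] --> (0 : R).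
Proof.
apply/cvg_nearP => e e0; have e2 : 0 < e / 2 by lra.
apply: filterS2 (alpha_tail e2) (near_ge 1) => n h n1.
have a0 := alpha_ge0 P mX n; rewrite subr0 ger0_norm//.
apply: (@le_lt_trans _ _ (n%:R * alpha P X n)); last by lra.
by rewrite ler_peMl// ler1n.
Qed.

Lemma pow_ge_le1 (x : R) (j : nat) : (j <= 2)%N -> 0 <= x -> x ^+ j <= 1 + x `^ p.
Proof.
move=> j2 x0; have [x1|x1] := leP x 1.
  by rewrite (@le_trans _ _ 1) ?exprn_ile1// lerDl powR_ge0.
rewrite -powR_mulrn//; apply: (@le_trans _ _ (x `^ p)); last by rewrite lerDr.
apply: ler_powR; first exact: ltW.
by rewrite (@le_trans _ _ 2)// ?ler_nat// /p lerDl ltW.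
Qed.

Lemma fv_Lintp : Lint P (fun w => `|X 0 w| `^ p).
Proof.
apply: Lint_lty.
  by apply: (measurableT_comp (@measurable_powR R p)); exact: measurableT_comp.
by under eq_integral do rewrite ger0_norm ?powR_ge0//.
Qed.

Lemma fv_Lint2 : Lint P (fun w => X 0 w ^+ 2).
Proof.
apply: (Lint_le (fun w => 1 + `|X 0 w| `^ p)).
- exact: measurable_funX.
- exact: LintD (Lint_cst 1) fv_Lintp.
- by move=> w; rewrite normrX; exact: pow_ge_le1.
Qed.

Lemma fv_Lint : Lint P (X 0).
Proof.
apply: (Lint_le (fun w => 1 + `|X 0 w| `^ p)) => //.
  exact: LintD (Lint_cst 1) fv_Lintp.
by move=> w; rewrite -[leLHS]expr1; exact: pow_ge_le1.
Qed.

Section SelfNorm.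
Hypothesis X2 : 0 < rE P (fun w => X 0 w ^+ 2).
Let tau := Num.sqrt (rE P (fun w => X 0 w ^+ 2)).

Lemma tau_gt0 : 0 < tau. Proof. by rewrite sqrtr_gt0. Qed.

Lemma Qsum_sq n w : Qsum X 1 n w ^+ 2 = \sum_(i < n) X i.+1%:Z w ^+ 2.
Proof.
rewrite /Qsum sqr_sqrtr ?big_add1 ?big_mkord//.
by rewrite sumr_ge0// => i _; rewrite sqr_ge0.
Qed.

Lemma Qsum_lln (e dl : R) : 0 < e -> 0 < dl -> \forall n \near \oo,
  pr P [set w | e * n%:R <= `|Qsum X 1 n w ^+ 2 - tau ^+ 2 * n%:R|] <= dl.
Proof.
move=> e0 d0.
have := lln mX sX fv_alpha0 (@exprn_measurable R setT 2) fv_Lint2 e0 d0.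
apply: filterS2 (near_ge 1) => n n1 h.
have n0 : 0 < (n%:R : R) by rewrite ltr0n.
apply: le_trans h; rewrite le_eqVlt; apply/orP; left; apply/eqP; congr (pr P _).
apply/funext => w /=; apply/propext.
have tau2 : tau ^+ 2 = rE P (fun w => X 0 w ^+ 2) by rewrite /tau sqr_sqrtr// ltW.
rewrite Qsum_sq tau2.
have -> : \sum_(i < n) X i.+1%:Z w ^+ 2 - rE P (fun w => X 0 w ^+ 2) * n%:R =
   n%:R * (n%:R^-1 * \sum_(i < n) X i.+1%:Z w ^+ 2 - rE P (fun w => X 0 w ^+ 2)).
  by field; rewrite gt_eqF.
by rewrite normrM gtr0_norm// mulrC ler_pM2l.
Qed.

(** The square root is removed by factoring a difference of squares and keeping only [tau * sqrt n]
    from the second factor. *)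
Lemma Qsum_near (e dl : R) : 0 < e -> 0 < dl -> \forall n \near \oo,
  pr P [set w | e * Num.sqrt n%:R <= `|Qsum X 1 n w - tau * Num.sqrt n%:R|] <= dl.
Proof.
move=> e0 d0; have t0 := tau_gt0.
have et : 0 < e * tau by rewrite mulr_gt0.
apply: filterS2 (near_ge 1) (Qsum_lln et d0) => n n1 h.
apply: le_trans h; have mQ : measurable_fun setT (Qsum X 1 n) by exact: Qsum_meas.
apply: pr_le.
- by apply: meas_le; [exact: measurable_cst|apply: measurableT_comp => //; exact: measurable_funB].
- apply: meas_le; [exact: measurable_cst|apply: measurableT_comp => //].
  by apply: measurable_funB => //; exact: measurable_funX.
move=> w /= h.
have r0 : 0 <= Num.sqrt (n%:R : R) by rewrite sqrtr_ge0.
have q0 : 0 <= Qsum X 1 n w by exact: sqrtr_ge0.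
have -> : Qsum X 1 n w ^+ 2 - tau ^+ 2 * n%:R =
  (Qsum X 1 n w - tau * Num.sqrt n%:R) * (Qsum X 1 n w + tau * Num.sqrt n%:R).
  by rewrite -{1}[n%:R]sqr_sqrtr//; ring.
rewrite normrM -{1}[n%:R]sqr_sqrtr//.
rewrite (_ : e * tau * _ = (e * Num.sqrt n%:R) * (tau * Num.sqrt n%:R)); last by ring.
have tr : 0 <= tau * Num.sqrt n%:R by rewrite mulr_ge0// ltW.
apply: ler_pM => //; first by rewrite mulr_ge0// ltW.
by rewrite ger0_norm ?addr_ge0// lerDr.
Qed.
End SelfNorm.

Lemma noncover_fv (b : nat -> nat) (eta : R) : 0 < eta < 1 ->
  ((b n)%:R : R) @[n --> \oo] --> +oo -> (b n)%:R / n%:R @[n --> \oo] --> (0 : R) ->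
  (\int[P]_w (X 0 w)%:E != 0)%E ->
  P (noncover X b eta n) @[n --> \oo] --> 1%E.
Proof.
move=> he bY b0 /(rE_neq0 fv_Lint) mu0.
have X2 : 0 < rE P (fun w => X 0 w ^+ 2).
  have : 0 <= rE P (fun w => (X 0 w - rE P (X 0)) ^+ 2) by apply: rE_ge0 => w; rewrite sqr_ge0.
  have -> : rE P (fun w => (X 0 w - rE P (X 0)) ^+ 2) = rE P (fun w => X 0 w ^+ 2) - rE P (X 0) ^+ 2.
    transitivity (rE P (fun w => X 0 w ^+ 2 - 2 * rE P (X 0) * X 0 w + rE P (X 0) ^+ 2)).
      by congr rE; apply/funext => w; ring.
    have l2 := fv_Lint2; have l1 := LintZ (2 * rE P (X 0)) fv_Lint.
    rewrite (rED (LintB l2 l1) (Lint_cst _)) (rEB l2 l1) (rEZ _ fv_Lint).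
    by rewrite (rE_cst P (rE P (X 0) ^+ 2)); ring.
  have : 0 < rE P (X 0) ^+ 2 by rewrite exprn_even_gt0.
  lra.
have t0 := tau_gt0 X2; set tau := Num.sqrt _ in t0.
have mQ n : measurable_fun setT (Qsum X 1 n) by exact: Qsum_meas.
have mabs n (u v : R) : measurable [set w | u <= `|Qsum X 1 n w - v|].
  by apply: meas_le; [exact: measurable_cst|apply: measurableT_comp => //; exact: measurable_funB].
have t2 : 0 < tau / 2 by lra.
apply: (@noncover_nonzero_mean _ _ _ P X mX sX fv_alpha0 fv_Lint b (natr_cvgy bY) (fun n => Num.sqrt n%:R)) => //.
- by apply: filterS (near_ge 1) => n n1; rewrite sqrtr_gt0 ltr0n.
- move=> e e0; exists (tau / 2) => //.
  apply: filterS (Qsum_near X2 t2 e0) => n h; apply: le_trans h; apply: pr_le => //.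
    exact: meas_le (mQ n) (measurable_cst _).
  by move=> w /= h; rewrite distrC ler_normr; apply/orP; left; move: h; rewrite -/tau; lra.
- move=> e e0; exists (2 * tau); first lra.
  apply: filterS (Qsum_near X2 t0 e0) => n h; apply: le_trans h; apply: pr_le => //.
    exact: meas_le (measurable_cst _) (mQ n).
  by move=> w /= h; rewrite ler_normr; apply/orP; left; move: h; rewrite -/tau; lra.
- move=> e e0; have e2 : 0 < e ^+ 2 by rewrite exprn_gt0.
  have /cvg_nearP/(_ _ e2) hb := b0.
  apply: filterS2 hb (near_ge 1) => n h n1.
  have n0 : 0 < (n%:R : R) by rewrite ltr0n.
  have hbn : (b n)%:R <= e ^+ 2 * n%:R.
    by rewrite -ler_pdivrMr//; move: h; rewrite subr0 => /ltW; apply: le_trans; exact: ler_norm.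
  have hs : Num.sqrt (b n)%:R <= e * Num.sqrt n%:R.
    have -> : e * Num.sqrt n%:R = Num.sqrt (e ^+ 2 * n%:R).
      by rewrite sqrtrM ?sqr_ge0// sqrtr_sqr ger0_norm// ltW.
    exact: ler_wsqrtr.
  rewrite -{1}[(b n)%:R]sqr_sqrtr// -{2}[n%:R]sqr_sqrtr//.
  have sb := sqrtr_ge0 ((b n)%:R : R); have sn := sqrtr_ge0 (n%:R : R).
  have : Num.sqrt (b n)%:R * (Num.sqrt (b n)%:R * Num.sqrt n%:R) <= e * Num.sqrt n%:R * (Num.sqrt (b n)%:R * Num.sqrt n%:R).
    by rewrite ler_wpM2r// mulr_ge0.
  by rewrite !expr2; lra.
Qed.

(** * Davydov's inequality by truncation *)

Section Davydov.
Variables (g : R -> R) (m : R).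
Hypothesis mg : measurable_fun setT g.
Hypothesis m0 : 0 < m.
Hypothesis gLint : Lint P (fun w => `|g (X 0 w)| `^ p).
Hypothesis gmom : rE P (fun w => `|g (X 0 w)| `^ p) <= m.

(** In units of [A ^ 2 * dl], with [A] the truncation level of [dav_core]: 1 for the truncated
    covariance, 1 for the mixed moment and 3/2 for the product of the means. *)
Definition dav_cst : R := 7 / 2 * (2 * m) `^ (2 / p).

Let p2 : 2 < p. Proof. by rewrite /p ltrDl. Qed.

Let p0 : 0 < p. Proof. exact: lt_trans p2. Qed.

Lemma powR_div (x A : R) : 0 <= x -> 0 < A -> (x / A) `^ p = x `^ p / A `^ p.
Proof.
move=> x0 A0; rewrite powRM ?invr_ge0 ?(ltW A0)//; congr (_ * _).
by rewrite -powR_inv1 ?(ltW A0)// -powRrM mulN1r powRN.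
Qed.

Lemma pow_above (A x : R) j : (j <= 2)%N -> 0 < A -> A < x ->
  x ^+ j <= A ^+ j / A `^ p * x `^ p.
Proof.
move=> j2 A0 Ax; have x0 : 0 < x by apply: lt_trans Ax.
have xA : 1 <= x / A by rewrite ler_pdivlMr// mul1r ltW.
have : (x / A) ^+ j <= x `^ p / A `^ p.
  rewrite -powR_div// ?(ltW x0)// -powR_mulrn; last by rewrite divr_ge0// ltW.
  apply: ler_powR => //; apply: (@le_trans _ _ 2); last exact: ltW.
  by rewrite ler_nat.
rewrite exprMn exprVn ler_pdivrMr ?exprn_gt0//.
by move/le_trans; apply; rewrite le_eqVlt; apply/orP; left; apply/eqP; ring.
Qed.

Let mp : measurable_fun setT (fun x : R => `|g x| `^ p).
Proof. by apply: (measurableT_comp (@measurable_powR R p)); exact: measurableT_comp. Qed.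

Let Lp t : Lint P (fun w => `|g (X t w)| `^ p).
Proof. exact: (stat_Lint1 mX sX t mp gLint). Qed.

Let Ep t : rE P (fun w => `|g (X t w)| `^ p) <= m.
Proof. by have -> := stat_rE1 mX sX t mp. Qed.

Let mgX t : measurable_fun setT (fun w => g (X t w)).
Proof. exact: measurableT_comp. Qed.

Let L1 t : Lint P (fun w => g (X t w)).
Proof.
apply: (Lint_le (fun w => 1 + `|g (X t w)| `^ p)) => //.
  exact: LintD (Lint_cst 1) (Lp t).
by move=> w; rewrite -[leLHS]expr1; exact: pow_ge_le1.
Qed.

Let L2 t : Lint P (fun w => g (X t w) ^+ 2).
Proof.
apply: (Lint_le (fun w => 1 + `|g (X t w)| `^ p)).
- exact: measurable_funX.
- exact: LintD (Lint_cst 1) (Lp t).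
- by move=> w; rewrite normrX; exact: pow_ge_le1.
Qed.

Lemma dav_Lint2 s t : Lint P (fun w => g (X s w) * g (X t w)).
Proof.
apply: (Lint_le (fun w => g (X s w) ^+ 2 + g (X t w) ^+ 2)).
- exact: measurable_funM.
- exact: LintD.
- move=> w; rewrite normrM -[X in _ <= X + _]real_normK ?num_real// -[X in _ <= _ + X]real_normK ?num_real//.
  have := sqr_ge0 (`|g (X s w)| - `|g (X t w)|); rewrite !expr2.
  have : 0 <= `|g (X s w)| * `|g (X t w)| by rewrite mulr_ge0.
  lra.
Qed.

Lemma dav_Lint t : Lint P (fun w => g (X t w)). Proof. exact: L1. Qed.

Let gA (A x : R) := if `|g x| <= A then g x else 0.

Let mgA A : measurable_fun setT (gA A).
Proof.
rewrite (_ : gA A = fun x => (if `|g x| <= A then 1 else 0) * g x).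
  apply: measurable_funM => //; apply: meas_le_if; last exact: measurable_cst.
  exact: measurableT_comp.
by apply/funext => x; rewrite /gA; case: ifP; rewrite ?mul1r ?mul0r.
Qed.

Let gA_bnd A x : 0 < A -> `|gA A x| <= A.
Proof. by move=> A0; rewrite /gA; have [//|_] := leP `|g x| A; rewrite normr0 ltW. Qed.

Let gA_diff A x : 0 < A -> `|g x - gA A x| <= A / A `^ p * `|g x| `^ p.
Proof.
move=> A0; rewrite /gA; have [_|h] := leP `|g x| A.
  by rewrite subrr normr0 mulr_ge0 ?powR_ge0// divr_ge0 ?powR_ge0// ltW.
by rewrite subr0; exact: (@pow_above A `|g x| 1).
Qed.

Let gA_diff2 A x y : 0 < A ->
  `|g x * g y - gA A x * gA A y| <= A ^+ 2 / A `^ p * (`|g x| `^ p + `|g y| `^ p).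
Proof.
move=> A0.
have c0 : 0 <= A ^+ 2 / A `^ p by rewrite divr_ge0 ?powR_ge0// sqr_ge0.
have xp := powR_ge0 `|g x| p; have yp := powR_ge0 `|g y| p.
have big (u v : R) : 0 <= u -> u <= v -> A < v -> u * v <= A ^+ 2 / A `^ p * v `^ p.
  move=> u0 uv Av; apply: (@le_trans _ _ (v ^+ 2)); last exact: pow_above.
  by rewrite expr2 ler_wpM2r// (le_trans u0 uv).
have : `|g x| <= A /\ `|g y| <= A \/ `|g x| * `|g y| <= A ^+ 2 / A `^ p * (`|g x| `^ p + `|g y| `^ p).
  have [xA|xA] := leP `|g x| A; have [yA|yA] := leP `|g y| A; [by left|right..].
  - rewrite mulrDr (le_trans (big _ _ _ (le_trans xA (ltW yA)) yA))// lerDr mulr_ge0//.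
  - rewrite mulrC mulrDr (le_trans (big _ _ _ (le_trans yA (ltW xA)) xA))// lerDl mulr_ge0//.
  - have [xy|/ltW yx] := leP `|g x| `|g y|.
      by rewrite mulrDr (le_trans (big _ _ _ xy yA))// lerDr mulr_ge0.
    by rewrite mulrC mulrDr (le_trans (big _ _ _ yx xA))// lerDl mulr_ge0.
case=> [[xA yA]|h].
  by rewrite /gA xA yA subrr normr0 mulr_ge0// addr_ge0.
apply: le_trans h; rewrite /gA; case: ifP => _; case: ifP => _; rewrite ?mulr0 ?mul0r ?subr0 ?subrr ?normr0 ?normrM//.
Qed.

(** Truncating at the level [A] with [A ^ p = 2 * m / dl] balances the bounded covariance against
    the remainders: all are of order [A ^ 2 * dl], that is dl to the power [1 - 2 / p = theta]. The
    parameter [dl] stands for [alpha] so that a vanishing coefficient can be treated too. *)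
Lemma dav_core (i j : nat) (dl : R) : (i < j)%N -> 0 < dl <= 2 ->
  alpha P X (j - i.+1) <= dl ->
  `|rcov P (fun w => g (X i w)) (fun w => g (X j w))| <= dav_cst * dl `^ theta.
Proof.
move=> ij /andP[d0 d2] ad.
pose B := 2 * m / dl.
have B0 : 0 < B by rewrite !(divr_gt0, mulr_gt0).
have mB : m <= B by rewrite /B ler_pdivlMr// mulrC ler_pM2r.
pose A := B `^ (p^-1).
have A0 : 0 < A by exact: powR_gt0.
have Ap : A `^ p = B by rewrite /A -powRrM mulVf ?powRr1 ?gt_eqF// ltW.
have A2 : A ^+ 2 = B `^ (2 / p) by rewrite /A -powR_mulrn ?ltW// -powRrM mulrC.
have LA t : Lint P (fun w => gA A (X t w)).
  by apply: (Lint_bnd A); [exact: measurableT_comp|move=> w; exact: gA_bnd].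
have LAA : Lint P (fun w => gA A (X i w) * gA A (X j w)).
  apply: (Lint_bnd (A * A)); first by apply: measurable_funM; exact: measurableT_comp.
  by move=> w; rewrite normrM ler_pM//; exact: gA_bnd.
have c1 : `|rcov P (fun w => gA A (X i w)) (fun w => gA A (X j w))| <= A * A * alpha P X (j - i.+1).
  have e (t : nat) : (fun w => gA A (X t w)) = (gA A \o coord 0) \o path X t.
    by apply/funext => w; rewrite /coord/path/= add0r.
  have mh : measurable_fun setT (gA A \o coord 0 : pathT (Ib 1) -> R).
    exact: (measurableT_comp (mgA A) (coordI_meas (ltn0Sn 0))).
  rewrite (e i) (e j).
  have hij : (i + 1 + (j - i.+1) <= j)%N by rewrite addn1 subnKC.
  have hb x : `|(gA A \o coord 0) x| <= A by exact: gA_bnd.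
  exact: (mix_blocks mX sX hij mh mh A0 A0 hb hb).
have c2 : `|rE P (fun w => g (X i w) * g (X j w)) - rE P (fun w => gA A (X i w) * gA A (X j w))| <= A ^+ 2 / B * (m + m).
  rewrite -rEB//; last exact: dav_Lint2.
  apply: le_trans (rE_abs_le (fun w => A ^+ 2 / B * (`|g (X i w)| `^ p + `|g (X j w)| `^ p)) _ _ _) _.
  - by apply: LintB => //; exact: dav_Lint2.
  - by apply: LintZ; exact: LintD.
  - by move=> w; rewrite -Ap; exact: gA_diff2.
  rewrite rEZ; last exact: LintD.
  rewrite rED// ler_wpM2l ?lerD// divr_ge0 ?sqr_ge0// ltW//.
have c3 t : `|rE P (fun w => g (X t w)) - rE P (fun w => gA A (X t w))| <= A / B * m.
  rewrite -rEB//.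
  apply: le_trans (rE_abs_le (fun w => A / B * `|g (X t w)| `^ p) _ _ _) _.
  - exact: LintB.
  - exact: LintZ.
  - by move=> w; rewrite -Ap; exact: gA_diff.
  by rewrite rEZ// ler_wpM2l// divr_ge0// ltW.
have Est t : rE P (fun w => g (X t w)) = rE P (fun w => g (X 0 w)) by exact: (stat_rE1 mX sX t mg).
have EAst t : rE P (fun w => gA A (X t w)) = rE P (fun w => gA A (X 0 w)) by exact: (stat_rE1 mX sX t (mgA A)).
have c4 : `|rE P (fun w => gA A (X 0 w))| <= A.
  by apply: rE_bnd => [|w]; [exact: measurableT_comp|exact: gA_bnd].
move: c1 c2 (c3 0); rewrite /rcov !Est !EAst.
set E1 := rE P (fun w => g _ * _); set E2 := rE P (fun w => gA _ _ * _).
set mu := rE P (fun w => g (X 0 w)); set nu := rE P (fun w => gA A (X 0 w)).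
move=> c1 c2 {}c3.
have rt : 0 <= m / B <= 1 by rewrite divr_ge0 ?(ltW m0) ?(ltW B0)//= ler_pdivrMr// mul1r.
have eA : A / B * m = A * (m / B) by rewrite mulrAC mulrA.
have eA2 : A ^+ 2 / B * (m + m) = 2 * A ^+ 2 * (m / B) by field; rewrite gt_eqF.
rewrite eA in c3; rewrite eA2 in c2.
have rB : m / B = dl / 2 by rewrite /B; field; rewrite !gt_eqF.
have c5 : `|mu * mu - nu * nu| <= 3 * A ^+ 2 * (m / B).
  have -> : mu * mu - nu * nu = (mu - nu) * (mu - nu + 2 * nu) by ring.
  rewrite normrM; have h1 : `|mu - nu + 2 * nu| <= A * (m / B) + 2 * A.
    rewrite (le_trans (ler_normD _ _))// lerD// normrM ger0_norm// ler_pM2l//.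
  apply: (@le_trans _ _ (A * (m / B) * (A * (m / B) + 2 * A))).
    by apply: ler_pM.
  have /andP[r0 r1] := rt.
  have : m / B * (m / B) <= m / B by rewrite ler_piMr.
  have A20 : 0 < A ^+ 2 by rewrite exprn_gt0.
  move=> h; have : A ^+ 2 * (m / B * (m / B)) <= A ^+ 2 * (m / B) by rewrite ler_pM2l.
  by rewrite expr2; lra.
have A20 : 0 <= A ^+ 2 by rewrite sqr_ge0.
have c6 : A * A * alpha P X (j - i.+1) <= A ^+ 2 * dl by rewrite -expr2 ler_wpM2l.
apply: (@le_trans _ _ (7 / 2 * (A ^+ 2 * dl))).
  have -> : E1 - mu * mu = (E1 - E2) + (E2 - nu * nu) - (mu * mu - nu * nu) by ring.
  rewrite (le_trans (ler_normB _ _))// (le_trans (lerD (ler_normD _ _) (lexx _)))//.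
  by move: c1 c2 c5; rewrite rB; lra.
rewrite /dav_cst -[leRHS]mulrA ler_pM2l// A2 /B.
have -> : (2 * m / dl) `^ (2 / p) = (2 * m) `^ (2 / p) * dl `^ (- (2 / p)).
  rewrite powRM ?invr_ge0 ?(ltW d0)//; last by rewrite mulr_ge0// ltW.
  by congr (_ * _); rewrite -powR_inv1 ?(ltW d0)// -powRrM mulN1r.
rewrite -[leLHS]mulrA ler_wpM2l ?powR_ge0//.
rewrite -{2}[dl]powRr1 ?(ltW d0)// -powRD ?(gt_eqF d0) ?implybT//.
by rewrite (_ : - (2 / p) + 1 = theta)// /theta /p; field; rewrite gt_eqF// addr_gt0.
Qed.

Lemma dav_cst_gt0 : 0 < dav_cst.
Proof. by rewrite mulr_gt0// powR_gt0// mulr_gt0. Qed.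

(** For [alpha = 0] the truncation level would be infinite. Then [dav_core] holds for every [dl] in
    its range, and a [dl] adapted to a positive covariance would bound it by half of itself. *)
Lemma davydov (i j : nat) : (i < j)%N ->
  `|rcov P (fun w => g (X i w)) (fun w => g (X j w))| <= dav_cst * mixrate (j - i.+1).
Proof.
move=> ij; have K0 := dav_cst_gt0; have t0 := theta_gt0.
have a0 := alpha_ge0 P mX (j - i.+1).
have [az|az] := eqVneq (alpha P X (j - i.+1)) 0; last first.
  apply: dav_core => //; rewrite lt_neqAle eq_sym az a0/=; exact: alpha_le2.
rewrite /mixrate az powR0 ?mulr0 ?gt_eqF//.
rewrite leNgt; apply/negP; set c := `|_| => c0.
pose y := c / (2 * dav_cst).
have y0 : 0 < y by rewrite divr_gt0// mulr_gt0.
pose dl := Order.min 2 (y `^ theta^-1).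
have d0 : 0 < dl <= 2 by rewrite lt_min ge_min lexx powR_gt0// ltr0n.
have : dl `^ theta <= y.
  have yE : y = (y `^ theta^-1) `^ theta by rewrite -powRrM mulVf ?powRr1 ?gt_eqF// ltW.
  rewrite [leRHS]yE; apply: ge0_ler_powR; rewrite ?nnegrE ?(ltW t0) ?powR_ge0//.
    by case/andP: d0 => /ltW.
  by rewrite ge_min lexx orbT.
have := dav_core ij d0 _; rewrite az => /(_ (ltW (proj1 (andP d0)))) h1 h2.
have : c <= dav_cst * y by apply: le_trans h1 _; rewrite ler_pM2l.
rewrite /y (_ : dav_cst * _ = c / 2); last by field; rewrite gt_eqF.
lra.
Qed.

Lemma dav_var i : 0 <= rcov P (fun w => g (X i w)) (fun w => g (X i w)) <= dav_cst.
Proof.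
have E2 : rcov P (fun w => g (X i w)) (fun w => g (X i w)) =
    rE P (fun w => (g (X i w) - rE P (fun w => g (X i w))) ^+ 2).
  set mu := rE P (fun w => g (X i w)).
  transitivity (rE P (fun w => g (X i w) * g (X i w) - 2 * mu * g (X i w) + mu ^+ 2)).
    have LL := dav_Lint2 i i; have LZ := LintZ (2 * mu) (L1 i).
    rewrite (rED (LintB LL LZ) (Lint_cst _)) (rEB LL LZ) (rEZ _ (L1 i)).
    by rewrite (rE_cst P (mu ^+ 2)) /rcov -/mu; ring.
  by congr rE; apply/funext => w; ring.
rewrite {1}E2 rE_ge0/=; last by move=> w; rewrite sqr_ge0.
pose A := m `^ (p^-1).
have A0 : 0 < A by exact: powR_gt0.
have Ap : A `^ p = m by rewrite /A -powRrM mulVf ?powRr1 ?gt_eqF// ltW.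
have A2 : A ^+ 2 = m `^ (2 / p) by rewrite /A -powR_mulrn ?ltW// -powRrM mulrC.
have h1 : rE P (fun w => g (X i w) * g (X i w)) <= 2 * A ^+ 2.
  have LL := dav_Lint2 i i.
  have LR : Lint P (fun w => A ^+ 2 + A ^+ 2 / m * `|g (X i w)| `^ p).
    by apply: (LintD (Lint_cst _)); exact: LintZ.
  apply: (@le_trans _ _ (rE P (fun w => A ^+ 2 + A ^+ 2 / m * `|g (X i w)| `^ p))).
    apply: rE_le => // w; rewrite -expr2 -[leLHS]real_normK ?num_real//.
    have [h|h] := leP `|g (X i w)| A.
      rewrite -[leLHS]addr0 lerD//; first by rewrite lerXn2r// nnegrE// ltW.
      by rewrite mulr_ge0 ?powR_ge0// divr_ge0 ?sqr_ge0// ltW.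
    rewrite -[leLHS]add0r lerD ?sqr_ge0// -Ap; exact: pow_above.
  rewrite (rED (Lint_cst _) (LintZ _ (Lp i))) (rEZ _ (Lp i)) (rE_cst P (A ^+ 2)).
  have : A ^+ 2 / m * rE P (fun w => `|g (X i w)| `^ p) <= A ^+ 2 / m * m.
    by rewrite ler_wpM2l// divr_ge0 ?sqr_ge0// ltW.
  rewrite divfK ?gt_eqF//; lra.
have h2 : A ^+ 2 <= (2 * m) `^ (2 / p).
  rewrite A2; apply: ge0_ler_powR; rewrite ?nnegrE ?divr_ge0 ?(ltW p0) ?(ltW m0) ?mulr_ge0 ?(ltW m0)//.
  by rewrite ler_peMl ?(ltW m0)// ler1n.
have h3 : 0 <= rE P (fun w => g (X i w)) * rE P (fun w => g (X i w)) by rewrite -expr2 sqr_ge0.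
rewrite /rcov /dav_cst; have := powR_ge0 (2 * m) (2 / p); lra.
Qed.

(** A positive lag [t] is weighted by [mixrate (t - 1)]: in [mix_blocks] a single time is a block of
    length 1, which shifts the gap by one. *)
Definition lag_weight (i j : nat) : R :=
  if i == j then 1 else mixrate (maxn i j - (minn i j).+1).

Lemma lag_weight_sum (S : R) (i n : nat) : (forall k, \sum_(l < k) mixrate l <= S) ->
  \sum_(0 <= j < n) lag_weight i j <= 1 + 2 * S.
Proof.
move=> hS.
have w0 j : 0 <= lag_weight i j by rewrite /lag_weight; case: ifP => // _; exact: mixrate_ge0.
apply: le_trans (sum_nat_widen 0 w0 (leq_addr i.+1 n)) _.
rewrite (@big_cat_nat _ _ _ i)//=; last by lia.
rewrite [X in _ + X]big_ltn; last by lia.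
have -> : \sum_(0 <= j < i) lag_weight i j = \sum_(0 <= j < i) mixrate j.
  rewrite big_nat_rev/= add0n; apply: eq_big_nat => j ji.
  rewrite /lag_weight ifF; last by apply/eqP; lia.
  by congr mixrate; lia.
have -> : \sum_(i.+1 <= j < n + i.+1) lag_weight i j = \sum_(0 <= j < n) mixrate j.
  rewrite -[X in index_iota X _]add0n big_addn addnK; apply: eq_big_nat => j ji.
  rewrite /lag_weight ifF; last by apply/eqP; lia.
  by congr mixrate; lia.
have := hS i; have := hS n; rewrite !big_mkord /lag_weight eqxx; lra.
Qed.

Lemma cov_weight (i j : nat) :
  `|rcov P (fun w => g (X i w)) (fun w => g (X j w))| <= dav_cst * lag_weight i j.
Proof.
rewrite /lag_weight; have [ij|ji|->] := ltngtP i j.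
- exact: davydov.
- by rewrite rcovC; exact: davydov.
- by have /andP[h1 h2] := dav_var j; rewrite mulr1 ger0_norm.
Qed.

(** The predicate [Q] is arbitrary so that one estimate serves the full sum and the times dropped
    between blocks. Each row of covariances is completed to all indices, at a total weight of at
    most [1 + 2 * S]. *)
Lemma var_sum (S : R) (n : nat) (Q : pred nat) :
  (forall k, \sum_(l < k) mixrate l <= S) ->
  rE P (fun w => (\sum_(i < n | Q i) (g (X i.+1%:Z w) - rE P (fun w => g (X 0 w)))) ^+ 2)
  <= (\sum_(i < n | Q i) 1) * (dav_cst * (1 + 2 * S)).
Proof.
move=> hS; have K0 := dav_cst_gt0.
have S0 : 0 <= S by have := hS 0%N; rewrite big_ord0.
pose Y (i : nat) w := g (X i.+1%:Z w).
have -> : (fun w => (\sum_(i < n | Q i) (g (X i.+1%:Z w) - rE P (fun w => g (X 0 w)))) ^+ 2) =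
  (fun w => (\sum_(i <- [seq i <- iota 0 n | Q i]) (Y i w - rE P (fun w => g (X 0 w)))) ^+ 2).
  by apply/funext => w; rewrite big_filter -(big_mkord Q (fun i => Y i w - _)) /index_iota subn0.
rewrite (rE_sqr_sum _ (c := fun=> rE P (fun w => g (X 0 w)))); first last.
- by move=> i; rewrite (stat_rE1 mX sX i.+1 mg).
- by move=> i j; exact: dav_Lint2.
- by move=> i; exact: dav_Lint.
rewrite -(big_mkord Q (fun=> 1)) mulr_suml /index_iota subn0 -[leRHS]big_filter.
apply: ler_sum => i _; rewrite mul1r.
apply: (@le_trans _ _ (\sum_(0 <= j < n) dav_cst * lag_weight i.+1 j.+1)).
  rewrite big_filter [leRHS](bigID Q)/= /index_iota subn0 -[leLHS]addr0 lerD//.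
    apply: ler_sum => j _; apply: le_trans (ler_norm _) _; exact: cov_weight.
  apply: sumr_ge0 => j _; rewrite mulr_ge0 ?(ltW K0)// /lag_weight; case: ifP => // _.
  exact: mixrate_ge0.
rewrite -mulr_sumr ler_pM2l//; apply: le_trans (lag_weight_sum i n hS).
apply: ler_sum => j _; rewrite le_eqVlt; apply/orP; left; apply/eqP.
by rewrite /lag_weight eqSS; congr (if _ then _ else mixrate _); lia.
Qed.
End Davydov.
End FiniteVariance.

(** * Gaussian smoothing *)

Section Gauss.
Context {R : realType}.
Local Notation mu := (@lebesgue_measure R).
Local Notation gam := (@normal_prob R 0 1).
Local Notation pdf := (@normal_pdf R 0 1).

(** The Radon-Nikodym derivative of [normal_prob] is identified with the density almost everywhere
    by comparing integrals over all measurable sets. *)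
Lemma gauss_ge0_integral (f : R -> \bar R) : measurable_fun setT f -> (forall x, 0 <= f x)%E ->
  (\int[gam]_x f x = \int[mu]_x (f x * (pdf x)%:E))%E.
Proof.
move=> mf f0; have dom := @normal_prob_dominates R 0 1.
rewrite -(Radon_Nikodym_SigmaFinite.change_of_variables dom f0 measurableT mf).
apply: ae_eq_integral => //.
- apply: emeasurable_funM => //; apply: (measurable_int mu).
  exact: Radon_Nikodym_SigmaFinite.f_integrable.
- by apply: emeasurable_funM => //; apply/measurable_EFinP; exact: measurable_normal_pdf.
- apply: ae_eqe_mul2l; apply: integral_ae_eq => //.
  + exact: Radon_Nikodym_SigmaFinite.f_integrable.
  + by apply/measurable_EFinP; exact: measurable_normal_pdf.
  + by move=> E _ mE; rewrite -Radon_Nikodym_SigmaFinite.f_integral.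
Qed.

Lemma pdfE (m s x : R) : 0 < s -> normal_pdf m s x =
  (s * Num.sqrt (pi *+ 2))^-1 * expR (- ((x - m) ^+ 2 / (2 * s ^+ 2))).
Proof.
move=> s0; rewrite normal_pdfE ?gt_eqF// /normal_peak /normal_fun; congr (_^-1 * expR _).
  by rewrite -mulrnAr sqrtrM ?sqr_ge0// sqrtr_sqr gtr0_norm.
by rewrite mulNr mulr_natl.
Qed.

Lemma pdf_symm x : pdf (- x) = pdf x.
Proof. by rewrite !pdfE// !subr0 sqrrN. Qed.

Lemma lebesgue_neg (f : R -> \bar R) : measurable_fun setT f -> (forall x, 0 <= f x)%E ->
  (\int[mu]_x f (- x)%R = \int[mu]_x f x)%E.
Proof.
move=> mf f0.
rewrite -{1}(preimage_setT (-%R : R -> measurableTypeR R)) -ge0_integral_pushforward//=.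
by apply: eq_measure_integral => //= A mA AS; exact/lebesgue_measureN.
Qed.

Lemma gauss_Lint3 : Lint gam (fun z => `|z| ^+ 3).
Proof.
have mz : measurable_fun setT (fun z : R => `|z| ^+ 3).
  by apply: measurable_funX; exact: normr_measurable.
apply: Lint_lty => //; under eq_integral do rewrite normrX normr_id.
rewrite gauss_ge0_integral; [|exact/measurable_EFinP|by move=> x; rewrite lee_fin exprn_ge0].
(* With [u = x ^ 2], the cube is at most [1 + u ^ 2 <= 29 * (1 + 3 / 16 * u) ^ 2 <= 29 * exp (3 / 8
   * u)], and 3/8 is the difference between the exponents of the two densities; the ratio of their
   peaks doubles 29. *)
apply: (@le_lt_trans _ _ (\int[mu]_x (58%:E * (normal_pdf 0 2 x)%:E))%E).
  apply: ge0_le_integral => //.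
  - by move=> x _; rewrite mule_ge0 ?lee_fin ?normal_pdf_ge0.
  - apply: emeasurable_funM; [exact/measurable_EFinP|apply/measurable_EFinP; exact: measurable_normal_pdf].
  - apply: emeasurable_funM => //; apply/measurable_EFinP; exact: measurable_normal_pdf.
  move=> x _; rewrite -!EFinM lee_fin !pdfE// !subr0 expr1n mul1r mulr1.
  have aux (S E : R) : S != 0 -> 58 * ((2 * S)^-1 * E) = S^-1 * (29 * E).
    by move=> S0; field.
  rewrite aux; last by rewrite gt_eqF// sqrtr_gt0 pmulrn_lgt0// pi_gt0.
  rewrite mulrCA ler_wpM2l ?invr_ge0 ?sqrtr_ge0//.
  pose u := x ^+ 2; have u0 : 0 <= u by exact: sqr_ge0.
  have -> : - (x ^+ 2 / 2) = - (x ^+ 2 / (2 * 2 ^+ 2)) - (3 / 16 * u) *+ 2 by rewrite /u; field.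
  rewrite expRD mulrCA [leRHS]mulrC ler_wpM2l ?expR_ge0// expRN ler_pdivrMr ?expR_gt0//.
  have h1 : `|x| ^+ 3 <= 1 + u ^+ 2.
    have [x1|x1] := leP `|x| 1.
      by rewrite (@le_trans _ _ 1) ?exprn_ile1// lerDl sqr_ge0.
    rewrite (_ : u ^+ 2 = `|x| ^+ 4); first by rewrite (@le_trans _ _ (`|x| ^+ 4)) ?lerDr// ler_weXn2l// ltW.
    by rewrite /u -[x ^+ 2]real_normK ?num_real// -exprM.
  have h2 : (1 + 3 / 16 * u) ^+ 2 <= expR ((3 / 16 * u) *+ 2).
    rewrite mulr2n expRD -expr2; apply: lerXn2r; rewrite ?nnegrE ?expR_ge0 ?expR_ge1Dx//; lra.
  apply: le_trans h1 _; apply: (@le_trans _ _ (29 * (1 + 3 / 16 * u) ^+ 2)); last by rewrite ler_pM2l.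
  have := sqr_ge0 u; rewrite !expr2; lra.
rewrite ge0_integralZl//.
- by rewrite integral_normal_pdf mule1 ltry.
- by apply/measurable_EFinP; exact: measurable_normal_pdf.
- by move=> x _; rewrite lee_fin normal_pdf_ge0.
Qed.

Lemma gauss_Lint_pow j : (j <= 3)%N -> Lint gam (fun z => z ^+ j).
Proof.
move=> j3; apply: (@Lint_le _ _ _ gam _ (fun z : R => 1 + `|z| ^+ 3)).
- by apply: exprn_measurable.
- exact: LintD (Lint_cst 1) gauss_Lint3.
move=> z; rewrite normrX; have [z1|z1] := leP `|z| 1.
  by rewrite (@le_trans _ _ 1) ?exprn_ile1// lerDl exprn_ge0.
by rewrite (@le_trans _ _ (`|z| ^+ 3)) ?lerDr// ler_weXn2l// ltW.
Qed.

(** [gauss_ge0_integral] is for nonnegative functions, so the identity is split into two positive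
    parts, which reflection exchanges. *)
Lemma gauss_mean : rE gam (fun z => z) = 0.
Proof.
have Lm (s : R) : Lint gam (fun z => Order.max (s * z) 0).
  apply: (@Lint_le _ _ _ gam _ (fun z : R => `|s * z ^+ 1|)).
  - apply: measurable_maxr; [exact: measurable_funM|exact: measurable_cst].
  - by apply: Lint_abs; apply: LintZ; exact: gauss_Lint_pow.
  - move=> z; rewrite expr1; case: (leP (s * z) 0) => h; rewrite ?normr0//.
have mm (s : R) : measurable_fun setT (fun z : R => (Order.max (s * z) 0)%:E).
  by apply/measurable_EFinP; exact: Lint_meas (Lm s).
have m0 (s z : R) : (0 <= (Order.max (s * z) 0)%:E)%E by rewrite lee_fin le_max lexx orbT.
have e : rE gam (fun z => Order.max (1 * z) 0) = rE gam (fun z => Order.max (-1 * z) 0).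
  rewrite /rE (gauss_ge0_integral (mm 1) (m0 1)) (gauss_ge0_integral (mm (-1)) (m0 (-1))).
  rewrite -[in RHS]lebesgue_neg.
  - congr fine; apply: eq_integral => x _.
    by rewrite pdf_symm mulN1r opprK mul1r.
  - apply: emeasurable_funM => //; apply/measurable_EFinP; exact: measurable_normal_pdf.
  - by move=> x; rewrite mule_ge0// lee_fin normal_pdf_ge0.
transitivity (rE gam (fun z => Order.max (1 * z) 0 - Order.max (-1 * z) 0)).
  congr rE; apply/funext => z; rewrite mul1r mulN1r.
  by have [h|h] := leP z 0; have [h'|h'] := leP (- z) 0; lra.
by rewrite (rEB (Lm 1) (Lm (-1))) e subrr.
Qed.

Lemma gauss_itv_pos (a b : R) : a < b -> 0 < pr gam `]a, b].
Proof.
move=> ab.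
pose M := Order.max `|a| `|b|.
pose k := pdf M.
have k0 : 0 < k by rewrite /k pdfE// mulr_gt0 ?expR_gt0// invr_gt0 mul1r sqrtr_gt0 pmulrn_lgt0// pi_gt0.
have : (k%:E * (b - a)%:E <= gam `]a, b])%E.
  have -> : (k%:E * (b - a)%:E = \int[mu]_(x in `]a, b]) k%:E)%E.
    by rewrite integral_cst//= lebesgue_measure_itv/= lte_fin ab EFinB.
  apply: ge0_le_integral => //.
  - by move=> x _; rewrite lee_fin ltW.
  - by apply/measurable_funTS/measurable_EFinP; exact: measurable_normal_pdf.
  move=> x; rewrite /= in_itv/= => /andP[ax xb]; rewrite lee_fin /k !pdfE//.
  rewrite !subr0; apply: ler_wpM2l; first by rewrite invr_ge0 mul1r sqrtr_ge0.
  rewrite ler_expR lerN2 ler_wpM2r ?invr_ge0 ?mulr_ge0//.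
  rewrite -[x ^+ 2]real_normK ?num_real// lerXn2r ?nnegrE//; first by rewrite le_max normr_ge0.
  rewrite /M le_max; have [x0|x0] := leP 0 x.
    by rewrite ger0_norm//; apply/orP; right; have := ler_norm b; lra.
  by rewrite ltr0_norm//; apply/orP; left; rewrite -[`|a|]normrN; have := ler_norm (- a); lra.
rewrite -EFin_pr// -EFinM lee_fin; apply: lt_le_trans.
by rewrite mulr_gt0// subr_gt0.
Qed.

Lemma gauss_var_gt0 : 0 < rE gam (fun z => z ^+ 2).
Proof.
have h := gauss_itv_pos (ltr1n R 2).
apply: (lt_le_trans h); rewrite -rE_indic//; apply: rE_le.
- exact: Lint_indic.
- exact: gauss_Lint_pow.
move=> z; rewrite indicE; have [|_] := boolP (z \in _); last exact: sqr_ge0.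
rewrite inE/= in_itv/= => /andP[z1 _]; rewrite -(expr1n R 2) lerXn2r// ?nnegrE//; lra.
Qed.

(** For fixed [z] substitute [w = (a * z + b * z') / c], exchange the two integrals, and integrate
    [z] out. *)
Lemma gauss_conv (phi : R -> R) (x a b : R) : continuous phi -> (forall t, 0 <= phi t <= 1) ->
  0 < a -> 0 < b ->
  rE gam (fun z => rE gam (fun z' => phi (x + a * z + b * z'))) =
  rE gam (fun w => phi (x + Num.sqrt (a ^+ 2 + b ^+ 2) * w)).
Proof.
move=> cphi phi01 a0 b0.
have phi0 t : 0 <= phi t by case/andP: (phi01 t).
have mphi : measurable_fun setT phi by exact: continuous_measurable_fun.
set c := Num.sqrt _.
have c2 : c ^+ 2 = a ^+ 2 + b ^+ 2 by rewrite sqr_sqrtr// addr_ge0// sqr_ge0.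
have c0 : 0 < c by rewrite sqrtr_gt0 addr_gt0// exprn_gt0.
have cpdf : continuous pdf by apply: continuous_normal_pdf.
have mpdf : measurable_fun setT pdf by exact: measurable_normal_pdf.
have pdf0 t : 0 <= pdf t by exact: normal_pdf_ge0.
have cbge0 : 0 <= c / b by rewrite divr_ge0// ltW.
(* Completing the square: given [w], the variable [z] is normal with mean [a / c * w] and deviation
   [b / c]. *)
have key z w : pdf ((c * w - a * z) / b) * (c / b) * pdf z =
   pdf w * normal_pdf (a / c * w) (b / c) z.
  have bc0 : 0 < b / c by rewrite divr_gt0.
  have s0 : Num.sqrt (pi *+ 2) != 0 :> R by rewrite gt_eqF// sqrtr_gt0 pmulrn_lgt0// pi_gt0.
  rewrite !pdfE// !subr0 !expr1n !mulr1 !mul1r.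
  have -> : (b / c * Num.sqrt (pi *+ 2))^-1 = c / b * (Num.sqrt (pi *+ 2))^-1 :> R.
    by field; rewrite s0 !gt_eqF.
  rewrite (_ : _^-1 * _ * (c / b) * _ = (Num.sqrt (pi *+ 2))^-1 * (Num.sqrt (pi *+ 2))^-1 * (c / b) *
    (expR (- (((c * w - a * z) / b) ^+ 2 / 2)) * expR (- (z ^+ 2 / 2)))); last by ring.
  rewrite [RHS](_ : _ = (Num.sqrt (pi *+ 2))^-1 * (Num.sqrt (pi *+ 2))^-1 * (c / b) *
    (expR (- (w ^+ 2 / 2)) * expR (- ((z - a / c * w) ^+ 2 / (2 * (b / c) ^+ 2))))); last by ring.
  congr (_ * _); rewrite -!expRD; congr expR.
  have b2 : b ^+ 2 = c ^+ 2 - a ^+ 2 by rewrite c2; ring.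
  apply: (mulIf (_ : 2 * b ^+ 2 != 0)); first by rewrite gt_eqF// mulr_gt0// exprn_gt0.
  rewrite [LHS](_ : _ = - (c * w - a * z) ^+ 2 - z ^+ 2 * b ^+ 2); last by field; rewrite gt_eqF.
  rewrite [RHS](_ : _ = - w ^+ 2 * b ^+ 2 - (c * z - a * w) ^+ 2); last by field; rewrite !gt_eqF.
  by rewrite b2; ring.
pose K (zw : R * R) : R := phi (x + c * zw.2) * (pdf ((c * zw.2 - a * zw.1) / b) * (c / b)).
have mK : measurable_fun setT (fun zw => (K zw)%:E).
  apply/measurable_EFinP; apply: measurable_funM.
    by apply: (measurableT_comp mphi); apply: measurable_funD => //; apply: measurable_funM.
  apply: measurable_funM => //; apply: (measurableT_comp mpdf); apply: measurable_funM => //.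
  by apply: measurable_funB; apply: measurable_funM.
have K0 zw : (0 <= (K zw)%:E)%E by rewrite lee_fin /K; do 2 (apply: mulr_ge0 => //).
pose H (zw : R * R) : R := K zw * pdf zw.1.
have mH : measurable_fun setT (fun zw => (H zw)%:E).
  apply/measurable_EFinP; apply: measurable_funM; first exact/measurable_EFinP.
  exact: (measurableT_comp mpdf).
have H0 zw : (0 <= (H zw)%:E)%E by rewrite /H EFinM mule_ge0// lee_fin.
have inner z : (\int[gam]_z' (phi (x + a * z + b * z'))%:E = \int[mu]_w (K (z, w))%:E)%E.
  rewrite gauss_ge0_integral; first last.
  - by move=> z'; rewrite lee_fin.
  - apply/measurable_EFinP; apply: (measurableT_comp mphi); apply: measurable_funD => //; exact: measurable_funM.
  under eq_integral do rewrite -EFinM.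
  pose F (w : R) : R := (c * w - a * z) / b.
  have dF w : is_derive w (1 : R) F (c / b).
    have e : F = (c / b) \*: (id : R -> R) + cst (- (a * z / b)).
      by apply/funext => t; rewrite /F /= fctE /= /GRing.scale/=; field; rewrite gt_eqF.
    by rewrite e; apply: is_derive_eq; rewrite subr0 /GRing.scale/= mulr1.
  have F' : derive1 F = cst (c / b).
    by apply/funext => t; rewrite derive1E; exact: (@derive_val _ _ _ _ _ _ _ (dF t)).
  have cb0 : 0 < c / b by rewrite divr_gt0.
  rewrite (@increasing_ge0_integration_by_substitutionT _ F (fun z' => phi (x + a * z + b * z') * pdf z')); first last.
  - by move=> t; rewrite mulr_ge0.
  - move=> t; apply: continuousM; last exact: cpdf.
    apply: (@continuous_comp _ _ _ (fun t : R => x + a * z + b * t) phi); last exact: cphi.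
    by apply: continuousD; [exact: cvg_cst|apply: continuousM; [exact: cvg_cst|exact: cvg_id]].
  - apply/cvgryPge => A; near=> t; rewrite /F ler_pdivlMr// lerBrDr [c * t]mulrC -ler_pdivrMr//.
  - apply/cvgrNyPle => A; near=> t; rewrite /F ler_pdivrMr// lerBlDr [c * t]mulrC -ler_pdivlMr//.
  - by move=> t; exact: ex_derive.
  - by rewrite F'; exact: is_cvg_cst.
  - by rewrite F'; exact: is_cvg_cst.
  - by rewrite F' => t; exact: cvg_cst.
  - move=> u v uv; rewrite /F ltr_pM2r ?invr_gt0// ltrD2r ltr_pM2l//.
  apply: eq_integral => w _; rewrite F' /=; congr EFin.
  have e : x + a * z + b * F w = x + c * w by rewrite /F; field; rewrite gt_eqF.
  have -> : forall u v : R -> R, (u * v) w = u w * v w by [].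
  by rewrite /= e -mulrA.
transitivity (fine (\int[gam]_z \int[mu]_w (K (z, w))%:E)%E).
  rewrite /rE; congr fine; apply: eq_integral => z _; rewrite -inner -EFin_rE//.
  apply: (Lint_bnd 1).
    apply: (measurableT_comp mphi); apply: measurable_funD => //; exact: measurable_funM.
  by move=> z'; rewrite ger0_norm//; case/andP: (phi01 (x + a * z + b * z')).
rewrite /rE; congr fine.
rewrite gauss_ge0_integral; first last.
- by move=> z; apply: integral_ge0 => w _; exact: K0.
- exact: (@measurable_fun_fubini_tonelli_F _ _ _ _ R mu (fun zw => (K zw)%:E)).
transitivity (\int[mu]_z \int[mu]_w (H (z, w))%:E)%E.
  apply: eq_integral => z _; rewrite -ge0_integralZr//.
  - apply/measurable_EFinP; rewrite /K/=; apply: measurable_funM.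
      by apply: (measurableT_comp mphi); apply: measurable_funD => //; apply: measurable_funM.
    apply: measurable_funM => //; apply: (measurableT_comp mpdf); apply: measurable_funM => //.
    by apply: measurable_funB => //; apply: measurable_funM.
  - by rewrite lee_fin.
rewrite (@fubini_tonelli _ _ _ _ _ mu mu (fun zw => (H zw)%:E))//.
rewrite gauss_ge0_integral; first last.
- by move=> w; rewrite lee_fin.
- apply/measurable_EFinP; apply: (measurableT_comp mphi); apply: measurable_funD => //; exact: measurable_funM.
apply: eq_integral => w _; rewrite /H/K/=.
under eq_integral do rewrite -mulrA key mulrA EFinM.
rewrite ge0_integralZl//.
- by rewrite integral_normal_pdf ?mule1// gt_eqF// divr_gt0.
- by apply/measurable_EFinP; exact: measurable_normal_pdf.
- by move=> z _; rewrite lee_fin normal_pdf_ge0.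
- by rewrite lee_fin mulr_ge0.
Unshelve. all: by end_near. Qed.
End Gauss.

(** * Test functions and the Gaussian semigroup *)

Section Smooth.
Context {R : realType}.
Local Notation gam := (@normal_prob R 0 1).
Implicit Types f : R -> R.

(** [f1] and [f2] act as the first two derivatives, but only through inequalities that survive
    averaging; smoothing then preserves the whole record with the same [C], without differentiating
    under the integral. *)
Record smooth3 (C : R) f f1 f2 : Prop := Smooth3 {
  sm_bnd : forall x, `|f x| <= C;
  sm_bnd1 : forall x, `|f1 x| <= C;
  sm_bnd2 : forall x, `|f2 x| <= C;
  sm_lip : forall x y, `|f x - f y| <= C * `|x - y|;
  sm_lip1 : forall x y, `|f1 x - f1 y| <= C * `|x - y|;
  sm_lip2 : forall x y, `|f2 x - f2 y| <= C * `|x - y|;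
  sm_taylor : forall x h,
    `|f (x + h) - f x - f1 x * h - f2 x * h ^+ 2 / 2| <= C * `|h| ^+ 3 }.

Definition gsm (a : R) f (x : R) : R := rE gam (fun z => f (x + a * z)).
Definition gm2 : R := rE gam (fun z => z ^+ 2).
Definition gm3 : R := rE gam (fun z => `|z| ^+ 3).

Lemma lip_cont (C : R) f : (forall x y, `|f x - f y| <= C * `|x - y|) -> continuous f.
Proof.
move=> hf x; apply/cvgrPdist_le => e e0.
have C0 : 0 < `|C| + 1 by apply: ltr_wpDl.
near=> y; apply: le_trans (hf x y) _.
apply: (@le_trans _ _ ((`|C| + 1) * `|x - y|)).
  by apply: ler_wpM2r => //; rewrite (le_trans (ler_norm C))// lerDl.
rewrite mulrC -ler_pdivlMr//; apply: ltW.
near: y; apply/nbhs_normP; exists (e / (`|C| + 1)) => //=; exact: divr_gt0.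
Unshelve. all: by end_near. Qed.

Lemma gsm_Lint (C : R) f a x : continuous f -> (forall y, `|f y| <= C) ->
  Lint gam (fun z => f (x + a * z)).
Proof.
move=> cf bf; apply: (Lint_bnd C) => [|z]; last exact: bf.
apply: (measurableT_comp (continuous_measurable_fun cf)).
by apply: measurable_funD => //; apply: measurable_funM.
Qed.

Lemma gsm_bnd (C : R) f a : continuous f -> (forall y, `|f y| <= C) ->
  forall x, `|gsm a f x| <= C.
Proof.
by move=> cf bf x; apply: rE_bnd => [|z]; [exact: Lint_meas (gsm_Lint a x cf bf)|exact: bf].
Qed.

Lemma gsm_lip (C : R) f a : (forall y, `|f y| <= C) ->
  (forall x y, `|f x - f y| <= C * `|x - y|) ->
  forall x y, `|gsm a f x - gsm a f y| <= C * `|x - y|.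
Proof.
move=> bf lf x y; have cf := lip_cont lf.
rewrite /gsm -(rEB (gsm_Lint a x cf bf) (gsm_Lint a y cf bf)).
apply: rE_bnd => [|z].
  exact: Lint_meas (LintB (gsm_Lint a x cf bf) (gsm_Lint a y cf bf)).
by apply: le_trans (lf _ _) _; rewrite opprD addrACA subrr addr0.
Qed.

Lemma gsm_smooth (C : R) f f1 f2 a : smooth3 C f f1 f2 ->
  smooth3 C (gsm a f) (gsm a f1) (gsm a f2).
Proof.
case=> b0 b1 b2 l0 l1 l2 tay.
have c0 := lip_cont l0; have c1 := lip_cont l1; have c2 := lip_cont l2.
split; [exact: gsm_bnd|exact: gsm_bnd|exact: gsm_bnd|exact: gsm_lip|exact: gsm_lip|exact: gsm_lip|].
move=> x h.
have L0 y := gsm_Lint a y c0 b0; have L1 := LintZ h (gsm_Lint a x c1 b1).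
have L2 := LintZ (h ^+ 2 / 2) (gsm_Lint a x c2 b2).
have LL := LintB (LintB (LintB (L0 (x + h)) (L0 x)) L1) L2.
have -> : gsm a f (x + h) - gsm a f x - gsm a f1 x * h - gsm a f2 x * h ^+ 2 / 2 =
  rE gam (fun z => f (x + h + a * z) - f (x + a * z) - h * f1 (x + a * z)
     - h ^+ 2 / 2 * f2 (x + a * z)).
  rewrite (rEB (LintB (LintB (L0 (x + h)) (L0 x)) L1) L2) (rEB (LintB (L0 (x + h)) (L0 x)) L1).
  rewrite (rEB (L0 (x + h)) (L0 x)) (rEZ h (gsm_Lint a x c1 b1)) (rEZ (h ^+ 2 / 2) (gsm_Lint a x c2 b2)).
  rewrite /gsm; ring.
apply: rE_bnd; first exact: Lint_meas LL.
move=> z; have := tay (x + a * z) h; apply: le_trans; rewrite le_eqVlt; apply/orP; left; apply/eqP.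
by rewrite [x + h + _]addrAC; congr `|_|; ring.
Qed.

Lemma gsm_iter_smooth (C : R) f f1 f2 a k : smooth3 C f f1 f2 ->
  smooth3 C (iter k (gsm a) f) (iter k (gsm a) f1) (iter k (gsm a) f2).
Proof. by move=> s; elim: k => //= k; exact: gsm_smooth. Qed.

(** The first-order term drops out because the Gaussian mean is 0. What remains is the second-order
    expansion that a centred summand of variance [a ^ 2 * gm2] would give. *)
Lemma gsm_expand (C : R) f f1 f2 a x : 0 <= a -> smooth3 C f f1 f2 ->
  `|gsm a f x - f x - a ^+ 2 * gm2 / 2 * f2 x| <= C * (a ^+ 3 * gm3).
Proof.
move=> a0 [b0 b1 b2 l0 l1 l2 tay].
have L0 := gsm_Lint a x (lip_cont l0) b0.
have L1 := LintZ (f1 x * a) (@gauss_Lint_pow R 1 isT).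
have L2 := LintZ (f2 x * a ^+ 2 / 2) (@gauss_Lint_pow R 2 isT).
have LL := LintB (LintB (LintB L0 (Lint_cst (f x))) L1) L2.
have e1 : rE gam (fun z => z ^+ 1) = 0.
  by rewrite -[RHS](@gauss_mean R); congr rE; apply/funext => z; rewrite expr1.
have -> : gsm a f x - f x - a ^+ 2 * gm2 / 2 * f2 x =
  rE gam (fun z => f (x + a * z) - cst (f x) z - f1 x * a * z ^+ 1 - f2 x * a ^+ 2 / 2 * z ^+ 2).
  rewrite (rEB (LintB (LintB L0 (Lint_cst (f x))) L1) L2) (rEB (LintB L0 (Lint_cst (f x))) L1).
  rewrite (rEB L0 (Lint_cst (f x))) (rEZ (f1 x * a) (@gauss_Lint_pow R 1 isT)).
  rewrite (rEZ (f2 x * a ^+ 2 / 2) (@gauss_Lint_pow R 2 isT)) e1 (rE_cst gam (f x)).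
  rewrite /gsm /gm2; ring.
have -> : C * (a ^+ 3 * gm3) = rE gam (fun z => C * a ^+ 3 * `|z| ^+ 3).
  by rewrite (rEZ _ (@gauss_Lint3 R)) mulrA.
apply: rE_abs_le => //; first exact: LintZ (@gauss_Lint3 R).
move=> z; have := tay x (a * z).
have -> : `|a * z| ^+ 3 = a ^+ 3 * `|z| ^+ 3 by rewrite normrM (ger0_norm a0) exprMn.
rewrite mulrA (_ : cst (f x) z = f x)// expr1.
by congr (`|_| <= _); ring.
Qed.

Lemma gsm_lipa (C : R) f a a' x : (forall y, `|f y| <= C) ->
  (forall x y, `|f x - f y| <= C * `|x - y|) ->
  `|gsm a f x - gsm a' f x| <= C * `|a - a'| * rE gam (fun z => `|z ^+ 1|).
Proof.
move=> bf lf; have cf := lip_cont lf.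
have Lz := Lint_abs (@gauss_Lint_pow R 1 isT).
rewrite -(rEZ _ Lz) /gsm -(rEB (gsm_Lint a x cf bf) (gsm_Lint a' x cf bf)).
apply: rE_abs_le; [exact: LintB (gsm_Lint a x cf bf) (gsm_Lint a' x cf bf)|exact: LintZ|].
move=> z; apply: le_trans (lf _ _) _.
by rewrite opprD addrACA subrr add0r -mulrBl normrM mulrA expr1.
Qed.

Lemma gsm_iter (phi : R -> R) a k x : continuous phi -> (forall t, 0 <= phi t <= 1) -> 0 < a ->
  iter k.+1 (gsm a) phi x = gsm (a * Num.sqrt k.+1%:R) phi x.
Proof.
move=> cphi p01 a0; elim: k x => [|k IH] x; first by rewrite sqrtr1 mulr1.
rewrite iterS {1}/gsm.
transitivity (rE gam (fun z => rE gam (fun z' => phi (x + a * z + a * Num.sqrt k.+1%:R * z')))).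
  by congr rE; apply/funext => z; exact: IH.
rewrite gauss_conv//; last by rewrite mulr_gt0// sqrtr_gt0 ltr0n.
have -> : Num.sqrt (a ^+ 2 + (a * Num.sqrt k.+1%:R) ^+ 2) = a * Num.sqrt k.+2%:R.
  rewrite exprMn sqr_sqrtr ?ler0n// (_ : _ + _ = a ^+ 2 * k.+2%:R).
    by rewrite sqrtrM ?sqr_ge0// sqrtr_sqr gtr0_norm.
  by rewrite -[in RHS]natr1; ring.
by [].
Qed.

Lemma deriv_bound (f df : R -> R) K h : (forall t, is_derive t (1 : R) f (df t)) ->
  (forall t, `|t| <= `|h| -> `|df t| <= K) -> `|f h - f 0| <= K * `|h|.
Proof.
move=> Df bf.
have cf (x y : R) : {within `[x, y], continuous f}.
  by apply: continuous_subspaceT => t; apply: differentiable_continuous; exact/derivable1_diffP.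
have [h0|h0] := leP 0 h.
  have [c] := MVT_segment h0 (fun x _ => Df x) (cf 0 h).
  rewrite in_itv/= => /andP[c0 ch] ->; rewrite subr0 normrM ler_wpM2r//.
  by apply: bf; rewrite !ger0_norm.
have [c] := MVT_segment (ltW h0) (fun x _ => Df x) (cf h 0).
rewrite in_itv/= => /andP[ch c0]; rewrite distrC => ->; rewrite sub0r normrM normrN ler_wpM2r//.
by apply: bf; rewrite !ler0_norm ?lerN2// ltW.
Qed.

Lemma derive_shift (f df : R -> R) x t : (forall t, is_derive t (1 : R) f (df t)) ->
  is_derive t (1 : R) (fun t => f (x + t)) (df (x + t)).
Proof.
move=> Df.
have Ds : is_derive t (1 : R) (fun t => x + t) 1.
  have -> : (fun t => x + t) = cst x + (id : R -> R) by [].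
  by apply: is_derive_eq; rewrite add0r.
have := @is_derive1_comp _ f (fun t => x + t) t _ _ (Df _) Ds.
by rewrite mulr1.
Qed.

Lemma deriv_lip (f df : R -> R) K : (forall t, is_derive t (1 : R) f (df t)) ->
  (forall t, `|df t| <= K) -> forall x y, `|f x - f y| <= K * `|x - y|.
Proof.
move=> Df bf x y.
have := @deriv_bound (fun t => f (y + t)) (fun t => df (y + t)) K (x - y)
  (fun t => derive_shift y t Df) (fun t _ => bf (y + t)).
by rewrite addr0 subrKC.
Qed.

(** The Taylor bound comes from two mean value inequalities: the remainder [r1] of [f1] is
    quadratic, and it is the derivative of the remainder [r0] of [f]. *)
Lemma smooth3_deriv (C : R) f f1 f2 f3 :
  (forall t, is_derive t (1 : R) f (f1 t)) -> (forall t, is_derive t (1 : R) f1 (f2 t)) ->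
  (forall t, is_derive t (1 : R) f2 (f3 t)) ->
  (forall t, `|f t| <= C) -> (forall t, `|f1 t| <= C) -> (forall t, `|f2 t| <= C) ->
  (forall t, `|f3 t| <= C) -> smooth3 C f f1 f2.
Proof.
move=> D0 D1 D2 b0 b1 b2 b3.
split => //; [exact: deriv_lip D0 b1|exact: deriv_lip D1 b2|exact: deriv_lip D2 b3|].
move=> x h.
have C0 : 0 <= C by apply: le_trans (b0 0).
have hl2 := deriv_lip D2 b3.
pose r1 t := f1 (x + t) - f1 x - f2 x * t.
pose r0 t := f (x + t) - f x - f1 x * t - f2 x / 2 * t ^+ 2.
have Dr1 t : is_derive t (1 : R) r1 (f2 (x + t) - f2 x).
  have ds := derive_shift x t D1.
  have -> : r1 = (fun t => f1 (x + t)) - cst (f1 x) - f2 x \*: (id : R -> R) by [].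
  by apply: is_derive_eq; rewrite subr0 /GRing.scale/= mulr1.
have Dr0 t : is_derive t (1 : R) r0 (r1 t).
  have ds := derive_shift x t D0.
  have -> : r0 = (fun t => f (x + t)) - cst (f x) - f1 x \*: (id : R -> R)
     - (f2 x / 2) \*: ((id : R -> R) * (id : R -> R)).
    by apply/funext => u; rewrite /r0 expr2.
  by apply: is_derive_eq; rewrite /r1 subr0 /GRing.scale/=; field.
have B1 t : `|r1 t| <= C * `|t| * `|t|.
  have := @deriv_bound r1 _ (C * `|t|) t Dr1.
  rewrite {2}/r1 addr0 mulr0 !subr0 subrr subr0; apply => s st.
  apply: le_trans (hl2 _ _) _; rewrite [x + s]addrC addrK; exact: ler_wpM2l.
have := @deriv_bound r0 _ (C * `|h| * `|h|) h Dr0.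
rewrite {2}/r0 addr0 expr0n/= !mulr0 !subr0 subrr subr0 /r0.
have -> : f2 x / 2 * h ^+ 2 = f2 x * h ^+ 2 / 2 by ring.
rewrite (_ : C * `|h| ^+ 3 = C * `|h| * `|h| * `|h|); last by ring.
apply => s st; apply: le_trans (B1 s) _.
by apply: ler_pM => //; [exact: mulr_ge0|exact: ler_wpM2l].
Qed.

(** A smooth decreasing step at [y] of width about [1 / K]. The logistic shape satisfies
    [g' = - K * (g - g ^ 2)], so all its derivatives are polynomials in [g], hence bounded. *)
Definition sigm (K y s : R) : R := (1 + expR (K * (s - y)))^-1.

Lemma sigm01 K y s : 0 <= sigm K y s <= 1.
Proof.
have e0 := expR_gt0 (K * (s - y)).
by rewrite /sigm invr_ge0 invf_le1 ?ltr_pwDl// lerDl !ltW// addr_gt0.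
Qed.

Lemma sigm_smooth K y : 1 <= K -> exists f1 f2, smooth3 (3 * K ^+ 3) (sigm K y) f1 f2.
Proof.
move=> K1; have K0 : 0 < K by lra.
pose g := sigm K y.
pose f1 (s : R) := - K * (g s - g s * g s).
pose f2 (s : R) := - K * (f1 s - (f1 s * g s + g s * f1 s)).
pose f3 (s : R) := - K * (f2 s - (f2 s * g s + f1 s * f1 s + (f1 s * f1 s + g s * f2 s))).
have e0 s : 1 + expR (K * (s - y)) != 0 by rewrite gt_eqF// addr_gt0// expR_gt0.
have De s : is_derive s (1 : R) (fun s => 1 + expR (K * (s - y))) (K * expR (K * (s - y))).
  have Da : is_derive s (1 : R) (fun s => K * (s - y)) K.
    have -> : (fun s => K * (s - y)) = K \*: ((id : R -> R) - cst y) by [].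
    by apply: is_derive_eq; rewrite subr0 /GRing.scale/= mulr1.
  have Dx := @is_derive1_comp _ expR (fun s => K * (s - y)) s _ _ (is_derive_expR _) Da.
  have -> : (fun s => 1 + expR (K * (s - y))) = cst 1 + (expR \o (fun s => K * (s - y))) by [].
  by apply: is_derive_eq; rewrite add0r mulrC.
have Dg s : is_derive s (1 : R) g (f1 s).
  have dV := @ex_derive _ _ _ _ _ _ _ (De s).
  apply: DeriveDef; first exact: (@derivableV _ _ (fun s => 1 + expR (K * (s - y))) s 1 (e0 s) dV).
  rewrite (@deriveV _ _ (fun s => 1 + expR (K * (s - y))) s 1 (e0 s) dV) (@derive_val _ _ _ _ _ _ _ (De s)).
  have := e0 s; rewrite /f1 /g /sigm /GRing.scale/=; set E := expR _ => E0; field.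
  exact: E0.
have D1 s : is_derive s (1 : R) f1 (f2 s).
  have -> : f1 = (- K) \*: (g - g * g) by [].
  by apply: is_derive_eq; rewrite /f2 /GRing.scale/=; ring.
have D2 s : is_derive s (1 : R) f2 (f3 s).
  have -> : f2 = (- K) \*: (f1 - (f1 * g + g * f1)) by [].
  by apply: is_derive_eq; rewrite /f3 /GRing.scale/=; ring.
have b0 s : `|g s| <= 1 by have /andP[h1 h2] := sigm01 K y s; rewrite ger0_norm.
have bq s : `|g s - g s * g s| <= 1.
  by have /andP[h1 h2] := sigm01 K y s; rewrite -/(g s) in h1 h2 *; rewrite ler_norml; nra.
have bl s : `|1 - 2 * g s| <= 1.
  by have /andP[h1 h2] := sigm01 K y s; rewrite -/(g s) in h1 h2 *; rewrite ler_norml; lra.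
have b1 s : `|f1 s| <= K by rewrite /f1 normrM normrN (gtr0_norm K0) ler_piMr// ltW.
have b2 s : `|f2 s| <= K ^+ 2.
  rewrite /f2 (_ : f1 s - _ = f1 s * (1 - 2 * g s)); last by ring.
  rewrite normrM normrN (gtr0_norm K0) expr2 ler_wpM2l ?(ltW K0)// normrM -[leRHS]mulr1.
  exact: ler_pM.
have b3 s : `|f3 s| <= 3 * K ^+ 3.
  rewrite /f3 (_ : f2 s - _ = f2 s * (1 - 2 * g s) - 2 * (f1 s * f1 s)); last by ring.
  rewrite normrM normrN (gtr0_norm K0) (_ : 3 * K ^+ 3 = K * (K ^+ 2 * 1 + 2 * (K * K))); last by ring.
  rewrite ler_wpM2l ?(ltW K0)//; apply: le_trans (ler_normB _ _) _.
  apply: lerD; first by rewrite normrM; exact: ler_pM.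
  rewrite normrM ger0_norm// ler_wpM2l// normrM; exact: ler_pM.
have k3 : 1 <= K ^+ 3 by rewrite exprn_ege1.
have k13 : K <= K ^+ 3 by rewrite -{1}[K]expr1 ler_weXn2l.
have k23 : K ^+ 2 <= K ^+ 3 by rewrite ler_weXn2l.
exists f1, f2; apply: (@smooth3_deriv _ g f1 f2 f3) => // s.
- by apply: le_trans (b0 s) _; lra.
- by apply: le_trans (b1 s) _; lra.
- by apply: le_trans (b2 s) _; lra.
Qed.

End Smooth.

(** * Lindeberg replacement for dependent blocks *)

Section Lindeberg.
Context {R : realType} {d : measure_display} {T : measurableType d}.
Variable P : probability T R.
Local Notation gm2 := (@gm2 R).
Local Notation gm3 := (@gm3 R).

(** Both sides are expanded to second order around [S]; the Gaussian summand is present only as the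
    operator [gsm a]. Equal variances leave third-order terms and the covariances of [U] and [U ^ 2]
    with functions of [S], which mixing controls. *)
Lemma lindeberg_step (C B al a v : R) (u u1 u2 : R -> R) (S U : T -> R) :
  smooth3 C u u1 u2 -> 0 <= B -> 0 <= a -> 0 <= al -> a ^+ 2 * gm2 = v ->
  measurable_fun setT S -> measurable_fun setT U -> (forall w, `|U w| <= B) ->
  rE P U = 0 -> rE P (fun w => U w ^+ 2) = v ->
  `|rcov P (fun w => u1 (S w)) U| <= C * B * al ->
  `|rcov P (fun w => u2 (S w)) (fun w => U w ^+ 2)| <= C * B ^+ 2 * al ->
  `|rE P (fun w => u (S w + U w)) - rE P (fun w => gsm a u (S w))|
    <= C * (B * v + a ^+ 3 * gm3 + B * al + B ^+ 2 * al).
Proof.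
move=> sm B0 a0 al0 av mS mU bU EU EU2 c1 c2.
have [b0 b1 b2 l0 l1 l2 tay] := sm; have [g0 _ _ gl _ _ _] := gsm_smooth a sm.
have C0 : 0 <= C by apply: le_trans (b0 0).
have mc (f : R -> R) (Y : T -> R) (K : R) : (forall x y, `|f x - f y| <= K * `|x - y|) ->
    measurable_fun setT Y -> measurable_fun setT (fun w => f (Y w)).
  by move=> lf mY; apply: (measurableT_comp (continuous_measurable_fun (lip_cont lf))).
have mSU : measurable_fun setT (fun w => S w + U w) by exact: measurable_funD.
have LuSU : Lint P (fun w => u (S w + U w)) by apply: (Lint_bnd C) => //; exact: mc l0 mSU.
have LuS : Lint P (fun w => u (S w)) by apply: (Lint_bnd C) => //; exact: mc l0 mS.
have LgS : Lint P (fun w => gsm a u (S w)) by apply: (Lint_bnd C) => //; exact: mc gl mS.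
have Lu2 : Lint P (fun w => u2 (S w)) by apply: (Lint_bnd C) => //; exact: mc l2 mS.
have mU2 : measurable_fun setT (fun w => U w ^+ 2) by exact: measurable_funX.
have bU2 w : `|U w ^+ 2| <= B ^+ 2 by rewrite normrX lerXn2r// nnegrE.
have LU2 : Lint P (fun w => U w ^+ 2) by apply: (Lint_bnd (B ^+ 2)).
have L1U : Lint P (fun w => u1 (S w) * U w).
  apply: (Lint_bnd (C * B)); first by apply: measurable_funM => //; exact: mc l1 mS.
  by move=> w; rewrite normrM ler_pM.
have L2U : Lint P (fun w => u2 (S w) * U w ^+ 2).
  apply: (Lint_bnd (C * B ^+ 2)); first by apply: measurable_funM => //; exact: mc l2 mS.
  by move=> w; rewrite normrM ler_pM.
pose D1 w := u (S w + U w) - u (S w) - u1 (S w) * U w - 1 / 2 * (u2 (S w) * U w ^+ 2).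
pose D2 w := gsm a u (S w) - u (S w) - v / 2 * u2 (S w).
have LD1 : Lint P D1 by exact: LintB (LintB (LintB LuSU LuS) L1U) (LintZ _ L2U).
have LD2 : Lint P D2 by exact: LintB (LintB LgS LuS) (LintZ _ Lu2).
have eD1 : rE P D1 = rE P (fun w => u (S w + U w)) - rE P (fun w => u (S w))
    - rE P (fun w => u1 (S w) * U w) - 1 / 2 * rE P (fun w => u2 (S w) * U w ^+ 2).
  rewrite (rEB (LintB (LintB LuSU LuS) L1U) (LintZ (1 / 2) L2U)) (rEB (LintB LuSU LuS) L1U).
  by rewrite (rEB LuSU LuS) (rEZ (1 / 2) L2U).
have eD2 : rE P D2 = rE P (fun w => gsm a u (S w)) - rE P (fun w => u (S w))
    - v / 2 * rE P (fun w => u2 (S w)).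
  by rewrite (rEB (LintB LgS LuS) (LintZ (v / 2) Lu2)) (rEB LgS LuS) (rEZ (v / 2) Lu2).
have h1 : `|rE P D1| <= C * (B * v).
  rewrite -EU2 -(rEZ B LU2) -(rEZ C (LintZ B LU2)).
  apply: rE_abs_le => //; first exact: LintZ (LintZ B LU2).
  move=> w; rewrite /D1 (_ : 1 / 2 * _ = u2 (S w) * U w ^+ 2 / 2); last by ring.
  apply: le_trans (tay _ _) _; rewrite ler_wpM2l// exprS ler_pM//.
  by rewrite -normrX ger0_norm// sqr_ge0.
have h2 : `|rE P D2| <= C * (a ^+ 3 * gm3).
  apply: rE_bnd; first exact: Lint_meas LD2.
  by move=> w; rewrite /D2 -av; exact: gsm_expand sm.
rewrite /rcov EU mulr0 subr0 in c1; rewrite /rcov EU2 in c2.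
move: h1 h2; rewrite eD1 eD2.
set x1 := rE P (fun w => u (S w + U w)); set x2 := rE P (fun w => u (S w)) in eD1 *.
set x3 := rE P (fun w => gsm a u (S w)); set x4 := rE P (fun w => u1 (S w) * U w) in c1 *.
set x5 := rE P (fun w => u2 (S w) * U w ^+ 2) in c2 *; set x6 := rE P (fun w => u2 (S w)) in c2 *.
rewrite !ler_norml in c1 c2 * => /andP[p1 p2] /andP[p3 p4].
move/andP: c1 => [q1 q2]; move/andP: c2 => [q3 q4].
have : 0 <= C * B ^+ 2 * al by rewrite !mulr_ge0// sqr_ge0.
lra.
Qed.

(** Telescoping over the number of blocks already replaced; the constant is the same at every stage
    because smoothing preserves [smooth3 C]. *)
Lemma lindeberg (C B al a v : R) (u u1 u2 : R -> R) (k : nat) (U : nat -> T -> R) :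
  smooth3 C u u1 u2 -> 0 <= B -> 0 <= a -> 0 <= al -> a ^+ 2 * gm2 = v ->
  (forall i, measurable_fun setT (U i)) -> (forall i w, `|U i w| <= B) ->
  (forall i, rE P (U i) = 0) -> (forall i, rE P (fun w => U i w ^+ 2) = v) ->
  (forall i f, continuous f -> (forall x, `|f x| <= C) ->
    `|rcov P (fun w => f (\sum_(j < i) U j w)) (U i)| <= C * B * al) ->
  (forall i f, continuous f -> (forall x, `|f x| <= C) ->
    `|rcov P (fun w => f (\sum_(j < i) U j w)) (fun w => U i w ^+ 2)| <= C * B ^+ 2 * al) ->
  `|rE P (fun w => u (\sum_(j < k) U j w)) - iter k (gsm a) u 0|
    <= k%:R * (C * (B * v + a ^+ 3 * gm3 + B * al + B ^+ 2 * al)).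
Proof.
move=> sm B0 a0 al0 av mU bU EU EU2 c1 c2; set dl := C * _.
suff H i : (i <= k)%N ->
    `|rE P (fun w => iter (k - i) (gsm a) u (\sum_(j < i) U j w)) - iter k (gsm a) u 0| <= i%:R * dl.
  by have := H k (leqnn k); rewrite subnn.
elim: i => [_|i IH ik].
  rewrite mul0r subn0 (_ : (fun w => _) = fun=> iter k (gsm a) u 0); last first.
    by apply/funext => w; rewrite big_ord0.
  by rewrite rE_cst subrr normr0.
have := IH (ltnW ik); rewrite -(subnSK ik).
have [_ _ _ _ l1 l2 _] := gsm_iter_smooth a (k - i.+1) sm.
have [_ b1 b2 _ _ _ _] := gsm_iter_smooth a (k - i.+1) sm.
have st := @lindeberg_step C B al a v _ _ _ (fun w => \sum_(j < i) U j w) (U i)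
  (gsm_iter_smooth a (k - i.+1) sm) B0 a0 al0 av
  (@measurable_sum _ T R setT _ _ (fun (j : 'I_i) w => U j w) (fun j => mU j)) (mU i) (bU i) (EU i) (EU2 i)
  (c1 i _ (lip_cont l1) b1) (c2 i _ (lip_cont l2) b2).
have -> : (fun w => iter (k - i.+1) (gsm a) u (\sum_(j < i.+1) U j w)) =
  (fun w => iter (k - i.+1) (gsm a) u (\sum_(j < i) U j w + U i w)).
  by apply/funext => w; rewrite big_ord_recr.
move: st; rewrite -/dl => st h.
rewrite -natr1 mulrDl mul1r [leRHS]addrC.
apply: le_trans (lerD st h); apply: le_trans (ler_normD _ _).
by rewrite addrA subrK.
Qed.

End Lindeberg.

Section SmoothSqrt.
Context {R : realType}.
Local Notation gm2 := (@gm2 R).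
Local Notation m1 := (rE (@normal_prob R 0 1) (fun z => `|z ^+ 1|)).

(** The difference of square roots is divided by the root at the fixed variance [s], so the constant
    does not depend on [x]. *)
Lemma gsm_sqrt_lip (C : R) (u u1 u2 : R -> R) (x s x0 : R) : smooth3 C u u1 u2 -> 0 < C ->
  0 <= x -> 0 < s ->
  `|gsm (Num.sqrt (x / gm2)) u x0 - gsm (Num.sqrt (s / gm2)) u x0| <=
  C * ((gm2 * Num.sqrt (s / gm2))^-1 * m1) * `|x - s|.
Proof.
move=> [bu _ _ lu _ _ _] C0 hx0 hs0.
have m20 : 0 < gm2 := gauss_var_gt0.
have z0 : 0 <= m1 by exact: rE_ge0.
apply: le_trans (gsm_lipa _ _ _ bu lu) _; move: z0; set mm := rE (normal_prob 0 1) _ => z0.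
pose x1 := x / gm2; pose x2 := s / gm2; rewrite -/x1 -/x2.
rewrite (_ : C * ((gm2 * Num.sqrt x2)^-1 * mm) * `|x - s| = C * ((gm2 * Num.sqrt x2)^-1 * `|x - s|) * mm); last by ring.
apply: ler_wpM2r => //; rewrite ler_pM2l//.
have x10 : 0 <= x1 by rewrite divr_ge0// ltW.
have x20 : 0 < x2 by rewrite divr_gt0.
have q2 : 0 < Num.sqrt x2 by rewrite sqrtr_gt0.
have hx : `|Num.sqrt x1 - Num.sqrt x2| * Num.sqrt x2 <= `|x1 - x2|.
  have -> : x1 - x2 = (Num.sqrt x1 - Num.sqrt x2) * (Num.sqrt x1 + Num.sqrt x2).
    by rewrite -subr_sqr (sqr_sqrtr x10) (sqr_sqrtr (ltW x20)).
  rewrite normrM; apply: ler_wpM2l => //; rewrite [leRHS]ger0_norm ?addr_ge0 ?sqrtr_ge0//.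
  by rewrite lerDr sqrtr_ge0.
have -> : (gm2 * Num.sqrt x2)^-1 * `|x - s| = `|x - s| / gm2 / Num.sqrt x2 by rewrite invfM; ring.
rewrite ler_pdivlMr//; apply: le_trans hx _.
by rewrite /x1 /x2 -mulrBl normrM [`|gm2^-1|]ger0_norm ?invr_ge0 ?(ltW m20).
Qed.

End SmoothSqrt.

Section SmoothL2.
Context {R : realType} {d : measure_display} {T : measurableType d}.
Variable P : probability T R.

(** The inequality [|S - V| <= e + (S - V) ^ 2 / e] passes from a second moment to a first one. *)
Lemma smooth_L2 (C e : R) (u u1 u2 : R -> R) (S V : T -> R) : smooth3 C u u1 u2 -> 0 < C ->
  0 < e -> Lint P S -> Lint P V -> Lint P (fun z => (S z - V z) ^+ 2) ->
  rE P (fun z => (S z - V z) ^+ 2) <= e ^+ 2 ->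
  `|rE P (fun z => u (S z)) - rE P (fun z => u (V z))| <= C * (2 * e).
Proof.
move=> [bu _ _ lu _ _ _] C0 e0 LS LV LSV2 h2; have cu := lip_cont lu.
have mc (Y : T -> R) : Lint P Y -> Lint P (fun z => u (Y z)).
  move=> LY; apply: (Lint_bnd C) => [|z]; last exact: bu.
  exact: (measurableT_comp (continuous_measurable_fun cu) (Lint_meas LY)).
rewrite -(rEB (mc _ LS) (mc _ LV)).
apply: (@le_trans _ _ (rE P (fun z => C * (cst e z + e^-1 * (S z - V z) ^+ 2)))).
  apply: rE_abs_le; first exact: LintB (mc _ LS) (mc _ LV).
    exact: LintZ (LintD (Lint_cst e) (LintZ _ LSV2)).
  move=> z; apply: le_trans (lu _ _) _; rewrite ler_pM2l//= /cst.
  have [h|h] := leP `|S z - V z| e; first by rewrite (le_trans h)// lerDl mulr_ge0 ?invr_ge0 ?sqr_ge0// ltW.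
  rewrite (@le_trans _ _ (e^-1 * (S z - V z) ^+ 2))// ?lerDr ?(ltW e0)//.
  rewrite ler_pdivlMl// -[(S z - V z) ^+ 2]real_normK ?num_real// expr2 ler_wpM2r//.
  exact: ltW.
rewrite (rEZ C (LintD (Lint_cst e) (LintZ _ LSV2))) (rED (Lint_cst e) (LintZ _ LSV2)).
rewrite (rEZ _ LSV2) (rE_cst P e) ler_pM2l// mulr_natl mulr2n lerD2l ler_pdivrMl//.
Qed.

End SmoothL2.

(** * Central limit theorem *)

Section BlockArith.
Context {R : realType}.

(** The time is divided into periods of length [D.+1 * q]; the first [q] times of a period are the
    gap, the others the block, hence the condition on the remainder. *)
Lemma sum_blocks (F : nat -> R) (q D k : nat) :
  \sum_(0 <= i < k * (D.+1 * q) | (q <= i %% (D.+1 * q))%N) F i =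
  \sum_(j < k) \sum_(0 <= t < D * q) F (t + q + j * (D.+1 * q))%N.
Proof.
set w := (D.+1 * q)%N.
have [q0|q0] := posnP q.
  rewrite (_ : (k * w)%N = 0%N); last by rewrite /w q0 !muln0.
  rewrite big_geq//; apply/esym/big1 => j _; by rewrite q0 muln0 big_geq.
have w0 : (0 < w)%N by rewrite muln_gt0.
elim: k => [|k IH]; first by rewrite mul0n big_geq// big_ord0.
rewrite big_ord_recr/= -IH mulSn addnC.
rewrite (@big_cat_nat _ _ _ (k * w))//= ?leq_addr//; congr (_ + _).
rewrite -{1}[(k * w)%N]add0n big_addn addKn.
have qw : (q <= w)%N by rewrite /w mulSn leq_addr.
rewrite (@big_cat_nat _ _ _ q)//= big_nat_cond big_pred0 ?add0r; last first.
  move=> i; apply/negP => /andP[/andP[_ iq]].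
  by rewrite addnC modnMDl modn_small ?(leq_trans iq)// leqNgt iq.
rewrite -{1}[q]add0n big_addn (_ : (w - q = D * q)%N); last by rewrite /w mulSn addKn.
rewrite big_nat_cond [RHS]big_nat_cond; apply: eq_bigl => i.
have [iD|] := ltnP i (D * q); last by rewrite andbF.
rewrite [(i + q + _)%N]addnC modnMDl modn_small ?leq_addl//.
by rewrite /w mulSn addnC ltn_add2l.
Qed.

Lemma sum_blocks_le (F : nat -> R) (q D k n : nat) : (k * (D.+1 * q) <= n)%N ->
  \sum_(i < n | (i < k * (D.+1 * q))%N && (q <= i %% (D.+1 * q))%N) F i =
  \sum_(j < k) \sum_(0 <= t < D * q) F (t + q + j * (D.+1 * q))%N.
Proof.
move=> kn; rewrite -sum_blocks (big_nat_widen _ _ n)//.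
by rewrite big_mkord; apply: eq_bigl => i; rewrite andbC.
Qed.

Lemma block_count (q D n : nat) : (0 < q)%N ->
  (n%:R : R) - (n %/ (D.+1 * q) * (D * q))%:R <= (D.+1 * q)%:R + n%:R / D.+1%:R.
Proof.
move=> q0; set w := (D.+1 * q)%N; set k := (n %/ w)%N.
have w0 : (0 < w)%N by rewrite muln_gt0.
have e : n = (k * (D * q) + (k * q + n %% w))%N.
  by rewrite {1}(divn_eq n w) -/k /w mulSn mulnDr; lia.
rewrite {1}e natrD addrAC subrr add0r natrD addrC lerD ?ler_nat ?(ltnW (ltn_pmod _ _))//.
rewrite ler_pdivlMr// -natrM ler_nat (leq_trans _ (leq_divM n w))//.
by rewrite -/k /w; apply: eq_leq; lia.
Qed.

(** The gap length. A block is [D.+1] gaps long, hence at most [sqrt n / D.+1], so its normalized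
    sum is of order [1 / D.+1]; the gaps take the fraction [1 / D.+2] of each period. One parameter
    controls both errors. *)
Definition blk (D n : nat) : nat := Num.truncn (Num.sqrt n%:R / D.+1%:R ^+ 2 : R).

Lemma blk_le D n : (blk D n)%:R * D.+1%:R ^+ 2 <= Num.sqrt n%:R :> R.
Proof.
have h : (0 : R) <= Num.sqrt n%:R / D.+1%:R ^+ 2 by rewrite divr_ge0// ?sqrtr_ge0// sqr_ge0.
have /andP[h1 _] := truncn_itv h.
by rewrite -ler_pdivlMr// exprn_gt0.
Qed.

Lemma blk_gt D n : Num.sqrt n%:R < (blk D n).+1%:R * D.+1%:R ^+ 2 :> R.
Proof.
have h : (0 : R) <= Num.sqrt n%:R / D.+1%:R ^+ 2 by rewrite divr_ge0// ?sqrtr_ge0// sqr_ge0.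
have /andP[_ h2] := truncn_itv h.
by rewrite -ltr_pdivrMr// exprn_gt0.
Qed.

Lemma blk_near D K : \forall n \near \oo, (K <= blk D n)%N.
Proof.
apply: filterS (near_natr ((K%:R * D.+1%:R ^+ 2) ^+ 2 : R)) => n h.
rewrite -ltnS -(ltr_nat R) -(ltr_pM2r (_ : 0 < D.+1%:R ^+ 2 :> R)) ?exprn_gt0//.
apply: le_lt_trans (blk_gt D n).
rewrite -(@ler_pXn2r _ 2)// ?nnegrE ?sqrtr_ge0 ?mulr_ge0 ?sqr_ge0//.
by rewrite sqr_sqrtr.
Qed.

Lemma blk_small D (e : R) : 0 < e -> \forall n \near \oo, (D.+2 * blk D n)%:R / n%:R <= e.
Proof.
move=> e0; apply: filterS2 (near_natr ((2 / e) ^+ 2)) (near_ge 1) => n h n1.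
have n0 : (0 : R) < n%:R by rewrite ltr0n.
have s0 : 0 < Num.sqrt (n%:R : R) by rewrite sqrtr_gt0.
have hs : 2 / e <= Num.sqrt (n%:R : R).
  rewrite -(@ler_pXn2r _ 2)// ?nnegrE ?sqrtr_ge0 ?divr_ge0 ?(ltW e0)//.
  by rewrite sqr_sqrtr// ltW.
have b := blk_le D n.
rewrite ler_pdivrMr// -{1}(sqr_sqrtr (ltW n0)) natrM.
have D2 : (D.+2%:R : R) <= 2 * D.+1%:R ^+ 2.
  rewrite -natrX -natrM ler_nat; nia.
have b0 : (0 : R) <= (blk D n)%:R by [].
apply: (@le_trans _ _ (2 * Num.sqrt n%:R)).
  apply: (@le_trans _ _ (2 * D.+1%:R ^+ 2 * (blk D n)%:R)); first exact: ler_wpM2r.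
  by rewrite -mulrA ler_pM2l// mulrC.
rewrite expr2 mulrA ler_pM2r// mulrC -ler_pdivrMr//.
Qed.

(** The number of blocks is at most a constant times the gap length, so the mixing errors of all
    blocks cost a multiple of [q * alpha q]. *)
Lemma blk_count D n : (0 < blk D n)%N ->
  (n %/ (D.+2 * blk D n))%:R <= 4 * D.+1%:R ^+ 4 * (blk D n)%:R :> R.
Proof.
move=> b0; set q := blk D n in b0 *; have := blk_gt D n; rewrite -/q => h.
have hn : (n%:R : R) <= (2 * q%:R * D.+1%:R ^+ 2) ^+ 2.
  rewrite -(sqr_sqrtr (ler0n R n)) ler_pXn2r// ?nnegrE ?sqrtr_ge0 ?mulr_ge0 ?sqr_ge0//.
  apply: le_trans (ltW h) _; apply: ler_wpM2r; first exact: sqr_ge0.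
  by rewrite -natrM ler_nat mul2n -addnn -addn1 leq_add2l.
have q0 : (0 : R) < q%:R by rewrite ltr0n.
rewrite -(ler_pM2r q0); apply: le_trans (_ : n%:R <= _).
  rewrite -natrM ler_nat (leq_trans _ (leq_divM n (D.+2 * q)))// leq_mul//; lia.
by apply: le_trans hn _; rewrite le_eqVlt; apply/orP; left; apply/eqP; ring.
Qed.

End BlockArith.

(** * Central limit theorem for bounded functions of the process *)

Section BoundedCLT.
Context {R : realType} {d : measure_display} {T : measurableType d}.
Variable P : probability T R.
Variable X : int -> T -> R.
Hypothesis mX : forall t, measurable_fun setT (X t).
Hypothesis sX : stationary P X.
Variables (y : R -> R) (B0 K s : R).
Hypothesis my : measurable_fun setT y.
Hypothesis B00 : 0 < B0.
Hypothesis yB : forall x, `|y x| <= B0.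
Hypothesis Ey : rE P (fun w => y (X 0 w)) = 0.
Hypothesis K0 : 0 < K.
Hypothesis hV : forall n (Q : pred nat),
  rE P (fun w => (\sum_(i < n | Q i) y (X i.+1%:Z w)) ^+ 2) <= (\sum_(i < n | Q i) 1) * K.
Hypothesis s0 : 0 < s.

Local Notation gm2 := (@gm2 R).
Local Notation gm3 := (@gm3 R).
Variables (D n : nat).
Let q := @blk R D n.
Let w := (D.+2 * q)%N.
Let k := (n %/ w)%N.
Let L := (D.+1 * q)%N.

Let hb (x : int -> R) : R := (Num.sqrt n%:R)^-1 * \sum_(0 <= t < L) y (x t%:Z).

(** The gap comes before the block: the [j]-th block starts at [q + j * w + 1], and everything read
    earlier ends by time [j * w]. *)
Definition blockU (j : nat) (u : T) : R :=
  (Num.sqrt n%:R)^-1 * \sum_(0 <= t < L) y (X (t + q + j * w).+1%:Z u).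

Lemma hb_meas : measurable_fun setT (hb : pathT (Ib L) -> R).
Proof. by apply: measurable_funM => //; exact: (@block_sum_meas R L y my). Qed.

Lemma blockU_path j : blockU j = hb \o path X (q + j * w).+1.
Proof.
apply/funext => u; rewrite /blockU /hb /path/=; congr (_ * _); apply: eq_bigr => t _.
by congr (y (X _ u)); rewrite -PoszD; congr Posz; lia.
Qed.

Lemma blockU_meas j : measurable_fun setT (blockU j).
Proof. by rewrite blockU_path; exact: (block_meas mX _ hb_meas). Qed.

Hypothesis q0 : (0 < q)%N.

Let n0 : (0 < n)%N.
Proof.
rewrite lt0n; apply/eqP => e; move: q0; rewrite /q /blk e sqrtr0 mul0r.
by rewrite truncn0.
Qed.

Let rn0 : 0 < Num.sqrt (n%:R : R). Proof. by rewrite sqrtr_gt0 ltr0n. Qed.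

Let B := B0 / D.+1%:R.

Lemma hb_bnd x : `|hb x| <= B.
Proof.
rewrite /hb normrM ger0_norm ?invr_ge0 ?(ltW rn0)// mulrC ler_pdivrMr//.
apply: le_trans (ler_norm_sum _ _ _) _.
apply: (@le_trans _ _ (\sum_(0 <= t < L) B0)); first by apply: ler_sum => t _; exact: yB.
rewrite sumr_const_nat subn0 -[leLHS]mulr_natr /B -mulrA ler_pM2l// /L.
rewrite ler_pdivlMl// natrM mulrA -expr2 mulrC; exact: blk_le.
Qed.

Lemma blockU_bnd j u : `|blockU j u| <= B.
Proof. by rewrite blockU_path; exact: hb_bnd. Qed.

Let yX (i : nat) : rE P (fun u => y (X i%:Z u)) = 0.
Proof. by rewrite -Ey; exact: (stat_rE1 mX sX i%:Z my). Qed.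

Let LyX (i : nat) : Lint P (fun u => y (X i%:Z u)).
Proof. by apply: (Lint_bnd B0) => //; exact: measurableT_comp. Qed.

Lemma blockU_mean j : rE P (blockU j) = 0.
Proof.
rewrite /blockU rEZ; last by apply: Lint_sum => i _; exact: LyX.
by rewrite rE_sum ?big1 ?mulr0// => i _; exact: LyX.
Qed.

Let v := rE P (fun u => blockU 0 u ^+ 2).

Let hb2_meas : measurable_fun setT ((fun x => hb x ^+ 2) : pathT (Ib L) -> R).
Proof. by apply: measurable_funX; exact: hb_meas. Qed.

Lemma blockU_var j : rE P (fun u => blockU j u ^+ 2) = v.
Proof.
rewrite /v !blockU_path.
rewrite (block_rE mX sX (q + j * w).+1 hb2_meas).
by rewrite -(block_rE mX sX (q + 0 * w).+1 hb2_meas).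
Qed.

Lemma blockU_varE : v = n%:R^-1 * rE P (fun u => (\sum_(i < L) y (X i.+1%:Z u)) ^+ 2).
Proof.
have m1 : measurable_fun setT ((fun x => (\sum_(0 <= t < L) y (coord t%:Z x)) ^+ 2) : pathT (Ib L) -> R).
  by apply: measurable_funX; exact: (@block_sum_meas R L y my).
have -> : (fun u => (\sum_(i < L) y (X i.+1%:Z u)) ^+ 2) =
    (fun x => (\sum_(0 <= t < L) y (coord t%:Z x)) ^+ 2) \o path X 1%N.
  apply/funext => u /=; congr (_ ^+ 2); rewrite big_mkord; apply: eq_bigr => i _.
  by rewrite /coord /path -PoszD addn1.
rewrite (block_rE mX sX 1 m1) -(block_rE mX sX (q + 0 * w).+1 m1) -rEZ; last first.
  apply: (Lint_bnd ((L%:R * B0) ^+ 2)); first exact: (block_meas mX _ m1).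
  move=> u; rewrite normrX lerXn2r ?nnegrE ?mulr_ge0 ?(ltW B00)//.
  apply: le_trans (ler_norm_sum _ _ _) _.
  apply: (@le_trans _ _ (\sum_(0 <= t < L) B0)); first by apply: ler_sum => t _; exact: yB.
  by rewrite sumr_const_nat subn0 -[leLHS]mulr_natl.
rewrite /v blockU_path; congr rE; apply/funext => u; rewrite /hb /= exprMn exprVn sqr_sqrtr//.
Qed.

Let past (f : R -> R) (i : nat) (x : int -> R) : R :=
  f (\sum_(j < i) ((Num.sqrt n%:R)^-1 * \sum_(t < L) y (coord (t + q + j * w)%N%:Z x))).

Lemma past_meas f i : continuous f -> measurable_fun setT (past f i : pathT (Ib (i * w)) -> R).
Proof.
move=> cf; apply: (measurableT_comp (continuous_measurable_fun cf)).
apply: (@measurable_sum _ (pathT (Ib (i * w))) _ _ _ _ (fun (j : 'I_i) x => _)) => j.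
apply: measurable_funM => //.
apply: (@measurable_sum _ (pathT (Ib (i * w))) _ _ _ _ (fun (t : 'I_L) x => _)) => t.
apply: (measurableT_comp my); apply: coordI_meas.
have tL := ltn_ord t; have ji := ltn_ord j.
apply: (@leq_trans (j.+1 * w)); last by rewrite leq_mul2r ji orbT.
by rewrite mulSn ltn_add2r /w mulSn addnC ltn_add2l.
Qed.

Lemma past_path f i : past f i \o path X 1%N = (fun u => f (\sum_(j < i) blockU j u)).
Proof.
apply/funext => u; rewrite /past/=; congr f; apply: eq_bigr => j _; rewrite /blockU.
by rewrite big_mkord; congr (_ * _); apply: eq_bigr => t _; rewrite /coord/path -PoszD addn1.
Qed.

Lemma past_mix1 (C : R) f i : 0 < C -> continuous f -> (forall x, `|f x| <= C) ->
  `|rcov P (fun u => f (\sum_(j < i) blockU j u)) (blockU i)| <= C * B * alpha P X q.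
Proof.
move=> C0 cf bf; rewrite -past_path blockU_path.
have B1 : 0 < B by rewrite divr_gt0.
apply: (@mix_blocks _ _ _ P X mX sX 1 (q + i * w).+1 (i * w) L q (past f i) hb C B) => //.
- by rewrite add1n addSn addnC.
- exact: past_meas.
- exact: hb_meas.
- by move=> x; exact: bf.
- by move=> x; exact: hb_bnd.
Qed.

Lemma past_mix2 (C : R) f i : 0 < C -> continuous f -> (forall x, `|f x| <= C) ->
  `|rcov P (fun u => f (\sum_(j < i) blockU j u)) (fun u => blockU i u ^+ 2)|
   <= C * B ^+ 2 * alpha P X q.
Proof.
have B1 : 0 < B by rewrite divr_gt0.
move=> C0 cf bf; rewrite -past_path.
rewrite (_ : (fun u => blockU i u ^+ 2) = (fun x => hb x ^+ 2) \o path X (q + i * w).+1); last first.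
  by rewrite blockU_path.
apply: (@mix_blocks _ _ _ P X mX sX 1 (q + i * w).+1 (i * w) L q (past f i) (fun x => hb x ^+ 2) C (B ^+ 2)) => //.
- by rewrite add1n addSn addnC.
- exact: past_meas.
- by rewrite exprn_gt0.
- by move=> x; exact: bf.
- by move=> x; rewrite normrX lerXn2r ?nnegrE ?(ltW B1)//; exact: hb_bnd.
Qed.

(** The blocks omit the gaps, a fraction [1 / D.+2] of the time, and an incomplete last period
    shorter than [w]; [hV] turns this count into a variance. *)
Lemma rest_var : rE P (fun u =>
    ((Num.sqrt n%:R)^-1 * (\sum_(i < n) y (X i.+1%:Z u)) - \sum_(j < k) blockU j u) ^+ 2)
  <= (w%:R / n%:R + D.+2%:R^-1) * K.
Proof.
pose Q i := (i < k * w)%N && (q <= i %% w)%N.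
have kn : (k * w <= n)%N by exact: leq_divM.
have e u : (Num.sqrt n%:R)^-1 * (\sum_(i < n) y (X i.+1%:Z u)) - \sum_(j < k) blockU j u =
    (Num.sqrt n%:R)^-1 * \sum_(i < n | ~~ Q i) y (X i.+1%:Z u).
  rewrite (bigID (fun i : 'I_n => Q i))/=.
  rewrite (@sum_blocks_le R (fun i => y (X i.+1%:Z u)) q D.+1 k n kn) /blockU -mulr_sumr -mulrBr.
  by rewrite addrAC subrr add0r.
under eq_fun do rewrite e exprMn exprVn sqr_sqrtr//.
rewrite rEZ; last first.
  apply: (Lint_bnd ((n%:R * B0) ^+ 2)).
    apply: measurable_funX; apply: (@Lint_meas _ _ _ P); apply: Lint_sum => i _; exact: LyX.
  move=> u; rewrite normrX lerXn2r ?nnegrE ?mulr_ge0 ?(ltW B00)//.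
  apply: le_trans (ler_norm_sum _ _ _) _.
  apply: (@le_trans _ _ (\sum_(i < n | ~~ Q i) B0)); first by apply: ler_sum => t _; exact: yB.
  apply: (@le_trans _ _ (\sum_(i < n) B0)).
    by rewrite [leRHS](bigID (fun i : 'I_n => ~~ Q i))/= lerDl sumr_ge0// => i _; exact: ltW.
  by rewrite sumr_const card_ord -[leLHS]mulr_natl.
have c : \sum_(i < n | ~~ Q i) (1 : R) <= w%:R + n%:R / D.+2%:R.
  have := @block_count R q D.+1 n q0; apply: le_trans.
  have t : \sum_(i < n) (1 : R) = n%:R by rewrite sumr_const card_ord.
  have e1 : \sum_(i < n | Q i) (1 : R) = (k * L)%:R.
    rewrite (@sum_blocks_le R (fun=> 1) q D.+1 k n kn).
    rewrite (eq_bigr (fun=> L%:R)); last by move=> j _; rewrite sumr_const_nat subn0.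
    by rewrite sumr_const card_ord natrM [k%:R * _]mulrC mulr_natr.
  have e2 : (n%:R : R) = \sum_(i < n | Q i) (1 : R) + \sum_(i < n | ~~ Q i) (1 : R).
    by rewrite -t (bigID (fun i : 'I_n => Q i)).
  by rewrite [X in _ <= X - _]e2 e1 addrAC subrr add0r.
have nn : (0 : R) < n%:R by rewrite ltr0n.
have hQ := @hV n (fun i => ~~ Q i).
rewrite mulrC ler_pdivrMr//; apply: (le_trans hQ).
rewrite [_ * K * _]mulrAC; apply: ler_wpM2r; first exact: ltW.
apply: le_trans c _; rewrite mulrDl mulfVK ?gt_eqF//; by rewrite mulrC.
Qed.


(** The summands of the constant are, in order, the price of dropping the gaps, the Taylor remainder
    of the blocks, that of the Gaussian, the mixing terms, and the replacement of the variance
    [k * v] by [s]. *)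
Lemma clt_step (C e : R) (u u1 u2 : R -> R) : smooth3 C u u1 u2 -> 0 < C -> 0 < e <= 1 ->
  (forall x, 0 <= u x <= 1) ->
  B0 / D.+1%:R <= e -> 2 * K / D.+2%:R <= e ^+ 2 -> 2 * s / D.+2%:R <= e -> 4 * e <= s ->
  w%:R / n%:R <= D.+2%:R^-1 :> R ->
  4 * D.+1%:R ^+ 4 * (q%:R * alpha P X q) <= 1 ->
  `|L%:R^-1 * rE P (fun u => (\sum_(i < L) y (X i.+1%:Z u)) ^+ 2) - s| <= e ->
  `|rE P (fun z => u ((Num.sqrt n%:R)^-1 * \sum_(i < n) y (X i.+1%:Z z)))
     - gsm (Num.sqrt (s / gm2)) u 0| <=
  C * (2 + (s + 2) + (s + 2) * (gm3 / (gm2 * Num.sqrt (gm2))) + 2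
       + 2 / (gm2 * Num.sqrt (s / gm2)) * rE (@normal_prob R 0 1) (fun z => `|z ^+ 1|)) * e.
Proof.
move=> sm C0 /andP[e0 e1] u01 hB hK hs2 es hw ha hL.
have nn : (0 : R) < n%:R by rewrite ltr0n.
have m20 : 0 < gm2 := gauss_var_gt0.
have m30 : 0 <= gm3 by apply: rE_ge0 => z; rewrite exprn_ge0.
have B1 : 0 < B by rewrite divr_gt0.
have Be : B <= e by [].
have D2 : (0 : R) < D.+2%:R by [].
have L0 : (0 < L)%N by rewrite muln_gt0.
have kL : (1 : R) - 2 / D.+2%:R <= ((k%:R * L%:R) / n%:R : R) <= (1 : R).
  apply/andP; split; last first.
    rewrite ler_pdivrMr// mul1r -natrM ler_nat (leq_trans _ (leq_divM n w))// leq_mul2l.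
    by rewrite leq_mul2r leqnSn !orbT.
  have := @block_count R q D.+1 n q0; rewrite natrM -/w -/k -/L => h.
  rewrite ler_pdivlMr// mulrBl mul1r; move: hw; rewrite ler_pdivrMr// => hw.
  have -> : 2 / D.+2%:R * n%:R = n%:R / D.+2%:R + n%:R / D.+2%:R :> R by ring.
  have aux (x1 x2 x3 x4 : R) : x1 - x2 <= x3 + x4 -> x3 <= x4 -> x1 - (x4 + x4) <= x2 by lra.
  by apply: aux h _; rewrite mulrC.
have kvE : k%:R * v = (k%:R * L%:R / n%:R) * (L%:R^-1 * rE P (fun u => (\sum_(i < L) y (X i.+1%:Z u)) ^+ 2)).
  rewrite blockU_varE; set E := rE _ _; field.
  by rewrite !pnatr_eq0 -!lt0n L0 n0.
have kvs : `|k%:R * v - s| <= 2 * e.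
  rewrite kvE; move: hL kL; set x := L%:R^-1 * _; set r := _ / n%:R; rewrite !ler_norml => /andP[x1 x2] /andP[r1 r2].
  have r0 : 0 <= r by rewrite divr_ge0// mulr_ge0.
  have sr : s * (1 - r) <= e.
    apply: le_trans hs2; by rewrite [2 * s]mulrC -mulrA ler_pM2l// lerBlDl -lerBlDr.
  have sr0 : 0 <= s * (1 - r) by rewrite mulr_ge0 ?(ltW s0)// subr_ge0.
  have -> : r * x - s = r * (x - s) - s * (1 - r) by ring.
  have h1 : r * (x - s) <= e.
    by apply: (@le_trans _ _ (r * e)); [exact: ler_wpM2l|rewrite ger_pMl].
  have h2 : - e <= r * (x - s).
    rewrite lerNl -mulrN; apply: (@le_trans _ _ (r * e)); last by rewrite ger_pMl.
    by apply: ler_wpM2l => //; rewrite lerNl.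
  by apply/andP; split; lra.
have kv0 : 0 < k%:R * v by move: kvs; rewrite ler_norml => /andP[]; lra.
have kvle : k%:R * v <= s + 2 by move: kvs; rewrite ler_norml => /andP[]; lra.
have v0 : 0 <= v by apply: rE_ge0 => x; exact: sqr_ge0.
have vp : 0 < v by rewrite lt_def v0 andbT; apply/eqP => z; move: kv0; rewrite z mulr0 ltxx.
have kp : (0 < k)%N by rewrite lt0n; apply/eqP => z; move: kv0; rewrite z mul0r ltxx.
have vB : v <= B ^+ 2.
  apply: le_trans (ler_norm _) _; apply: rE_bnd; first by apply: measurable_funX; exact: blockU_meas.
  by move=> x; rewrite normrX lerXn2r ?nnegrE ?(ltW B1)//; exact: blockU_bnd.
pose a := Num.sqrt (v / gm2).
have a0 : 0 < a by rewrite sqrtr_gt0 divr_gt0.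
have a2 : a ^+ 2 * gm2 = v by rewrite sqr_sqrtr ?divr_ge0 ?(ltW m20)// divfK// gt_eqF.
have s20 : 0 < Num.sqrt (gm2) by rewrite sqrtr_gt0.
have aB : a <= B / Num.sqrt (gm2).
  rewrite /a sqrtrM// sqrtrV ?(ltW m20)// ler_pM2r ?invr_gt0//.
  by rewrite -[B]ger0_norm ?(ltW B1)// -sqrtr_sqr ler_wsqrtr.
have lin := lindeberg k sm (ltW B1) (ltW a0) (alpha_ge0 P mX q) a2 blockU_meas blockU_bnd
  blockU_mean blockU_var (fun i f cf bf => past_mix1 i C0 cf bf) (fun i f cf bf => past_mix2 i C0 cf bf).
have [bu _ _ lu _ _ _] := sm; have cu := lip_cont lu.
have T2 : k%:R * (C * (B * v + a ^+ 3 * gm3 + B * alpha P X q + B ^+ 2 * alpha P X q)) <=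
    C * ((s + 2) + (s + 2) * (gm3 / (gm2 * Num.sqrt (gm2))) + 2) * e.
  rewrite mulrCA -mulrA ler_pM2l// !mulrDr !mulrDl.
  have kal : k%:R * alpha P X q <= 1.
    apply: le_trans ha; rewrite mulrA; apply: ler_wpM2r; first exact: (alpha_ge0 P mX q).
    exact: blk_count.
  have kal0 : 0 <= k%:R * alpha P X q by rewrite mulr_ge0// (alpha_ge0 P mX).
  have t1 : k%:R * (B * v) <= (s + 2) * e.
    by rewrite mulrCA mulrC ler_pM// ?(ltW B1)// ltW.
  have t2 : k%:R * (a ^+ 3 * gm3) <= (s + 2) * (gm3 / (gm2 * Num.sqrt (gm2))) * e.
    have -> : k%:R * (a ^+ 3 * gm3) = k%:R * v * (a * (gm3 / gm2)).
      by rewrite -a2; field; rewrite gt_eqF.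
    have -> : (s + 2) * (gm3 / (gm2 * Num.sqrt (gm2))) * e =
       (s + 2) * (e / Num.sqrt (gm2) * (gm3 / gm2)).
      by field; rewrite !gt_eqF.
    have g0 : 0 <= gm3 / gm2 by rewrite divr_ge0// ltW.
    apply: ler_pM => //; [exact: ltW|by rewrite mulr_ge0// ltW|].
    apply: ler_wpM2r => //; apply: le_trans aB _; by rewrite ler_pM2r ?invr_gt0.
  have t3 : k%:R * (B * alpha P X q) <= e.
    rewrite mulrCA -[e]mulr1; apply: ler_pM => //; exact: ltW.
  have t4 : k%:R * (B ^+ 2 * alpha P X q) <= e.
    rewrite mulrCA -[e]mulr1; apply: ler_pM => //; first exact: sqr_ge0.
    by rewrite expr2 -[e]mulr1; apply: ler_pM => //; [exact: ltW|exact: ltW|exact: le_trans Be e1].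
  lra.
pose S z := (Num.sqrt n%:R)^-1 * \sum_(i < n) y (X i.+1%:Z z).
pose V z := \sum_(j < k) blockU j z.
have LyS : Lint P S.
  by apply: LintZ; apply: Lint_sum => i _; exact: LyX.
have LV : Lint P V.
  by apply: Lint_sum => j _; apply: (Lint_bnd B) => [|z]; [exact: blockU_meas|exact: blockU_bnd].
have SB z : `|S z| <= n%:R * B0 * (Num.sqrt n%:R)^-1.
  rewrite /S normrM ger0_norm ?invr_ge0 ?sqrtr_ge0// mulrC; apply: ler_wpM2r.
    by rewrite invr_ge0 sqrtr_ge0.
  apply: le_trans (ler_norm_sum _ _ _) _.
  apply: (@le_trans _ _ (\sum_(i < n) B0)); first by apply: ler_sum => t _; exact: yB.
  by rewrite sumr_const card_ord -[leLHS]mulr_natl.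
have VB z : `|V z| <= k%:R * B.
  apply: le_trans (ler_norm_sum _ _ _) _.
  apply: (@le_trans _ _ (\sum_(i < k) B)); first by apply: ler_sum => t _; exact: blockU_bnd.
  by rewrite sumr_const card_ord -[leLHS]mulr_natl.
have T1 : `|rE P (fun z => u (S z)) - rE P (fun z => u (V z))| <= C * (2 * e).
  have LSV2 : Lint P (fun z => (S z - V z) ^+ 2).
    apply: (Lint_bnd ((n%:R * B0 * (Num.sqrt n%:R)^-1 + k%:R * B) ^+ 2)).
      by apply: measurable_funX; exact: Lint_meas (LintB LyS LV).
    move=> z; rewrite normrX lerXn2r ?nnegrE//.
      by rewrite addr_ge0 ?mulr_ge0 ?invr_ge0 ?sqrtr_ge0// ltW.
    by apply: le_trans (ler_normB _ _) _; exact: lerD.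
  apply: (smooth_L2 sm C0 e0 LyS LV LSV2); apply: le_trans rest_var _.
  apply: (@le_trans _ _ (2 * K / D.+2%:R)) => //.
  have -> : 2 * K / D.+2%:R = (D.+2%:R^-1 + D.+2%:R^-1) * K by ring.
  by apply: ler_wpM2r; [exact: ltW|rewrite lerD2r].
have it : iter k (gsm a) u 0 = gsm (Num.sqrt (k%:R * v / gm2)) u 0.
  rewrite -[in LHS](prednK kp) gsm_iter// prednK// /a -sqrtrM ?divr_ge0 ?(ltW m20)//.
  by rewrite (_ : v / gm2 * k%:R = k%:R * v / gm2)//; ring.
have T3 : `|gsm (Num.sqrt (k%:R * v / gm2)) u 0 - gsm (Num.sqrt (s / gm2)) u 0| <=
    C * (2 / (gm2 * Num.sqrt (s / gm2)) * rE (@normal_prob R 0 1) (fun z => `|z ^+ 1|)) * e.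
  apply: le_trans (gsm_sqrt_lip 0 sm C0 (ltW kv0) s0) _.
  set m1 := rE (normal_prob 0 1) _; have z0 : 0 <= m1 by exact: rE_ge0.
  rewrite (_ : C * (2 / _ * m1) * e = C * ((gm2 * Num.sqrt (s / gm2))^-1 * m1) * (2 * e)); last by ring.
  apply: ler_wpM2l kvs; rewrite mulr_ge0 ?(ltW C0)// mulr_ge0// invr_ge0 mulr_ge0 ?sqrtr_ge0//.
  exact: ltW.
move: lin T2 T1 T3; rewrite it -/(V _) /S /V.
set r1 := rE P _; set r2 := rE P _; set r3 := gsm _ _ _; set r4 := gsm _ _ _ => lin T2 T1 T3.
have : `|r2 - r4| <= `|r2 - r1| + (`|r1 - r3| + `|r3 - r4|).
  have -> : r2 - r4 = (r2 - r1) + ((r1 - r3) + (r3 - r4)) by ring.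
  by apply: le_trans (ler_normD _ _) _; rewrite lerD2l; exact: ler_normD.
move=> h; apply: (le_trans h); move: T1 lin T2 T3.
set m1 := rE (normal_prob 0 1) _; set K1 := (s + 2) * _; set K2 := 2 / _ * m1.
set A1 := `|r2 - r1|; set A2 := `|r1 - r3|; set A3 := `|r3 - r4| => T1 lin T2 T3.
have -> : C * (2 + (s + 2) + K1 + 2 + K2) * e = C * (2 * e) + C * (s + 2 + K1 + 2) * e + C * K2 * e.
  by ring.
by rewrite -addrA; apply: lerD => //; apply: lerD => //; apply: le_trans lin T2.
Qed.

End BoundedCLT.

Section BoundedLimit.
Context {R : realType} {d : measure_display} {T : measurableType d}.
Variable P : probability T R.
Variable X : int -> T -> R.
Hypothesis mX : forall t, measurable_fun setT (X t).
Hypothesis sX : stationary P X.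
Local Notation gm2 := (@gm2 R).

Lemma bounded_clt (y : R -> R) (B0 K s C : R) (u u1 u2 : R -> R) :
  measurable_fun setT y -> 0 < B0 -> (forall x, `|y x| <= B0) ->
  rE P (fun w => y (X 0 w)) = 0 -> 0 < K ->
  (forall n (Q : pred nat),
    rE P (fun w => (\sum_(i < n | Q i) y (X i.+1%:Z w)) ^+ 2) <= (\sum_(i < n | Q i) 1) * K) ->
  0 < s ->
  n%:R^-1 * rE P (fun w => (\sum_(i < n) y (X i.+1%:Z w)) ^+ 2) @[n --> \oo] --> s ->
  (forall e : R, 0 < e -> \forall n \near \oo, n%:R * alpha P X n <= e) ->
  smooth3 C u u1 u2 -> 0 < C -> (forall x, 0 <= u x <= 1) ->
  rE P (fun z => u ((Num.sqrt n%:R)^-1 * \sum_(i < n) y (X i.+1%:Z z))) @[n --> \oo]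
    --> gsm (Num.sqrt (s / gm2)) u 0.
Proof.
move=> my B00 yB Ey K0 hV s0 hs ha sm C0 u01; apply/cvg_nearP => dl dl0.
set Kc := (2 + (s + 2) + (s + 2) * (@gm3 R / (gm2 * Num.sqrt gm2)) + 2
       + 2 / (gm2 * Num.sqrt (s / gm2)) * rE (@normal_prob R 0 1) (fun z => `|z ^+ 1|)).
have m20 : 0 < gm2 := gauss_var_gt0.
have Kc0 : 0 < Kc.
  have g3 : 0 <= @gm3 R by apply: rE_ge0 => z; rewrite exprn_ge0.
  have h1 : 0 <= (s + 2) * (@gm3 R / (gm2 * Num.sqrt gm2)).
    by rewrite mulr_ge0 ?divr_ge0 ?mulr_ge0 ?sqrtr_ge0 ?addr_ge0// ltW.
  have h2 : 0 <= 2 / (gm2 * Num.sqrt (s / gm2)) * rE (@normal_prob R 0 1) (fun z => `|z ^+ 1|).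
    by rewrite mulr_ge0 ?rE_ge0// divr_ge0// mulr_ge0 ?sqrtr_ge0// ltW.
  by rewrite /Kc; move: h1 h2; set a := _ * (_ / _); set b := _ * rE _ _ => h1 h2; lra.
(* Order of the choices: [e] from the accuracy [dl] and the condition [4 * e <= s], then [D] from
   [e], and only then a large [n]. *)
pose e := Order.min 1 (Order.min (s / 4) (dl / (2 * (C * Kc)))).
have CK0 : 0 < 2 * (C * Kc) by rewrite !mulr_gt0.
have e0 : 0 < e by rewrite !lt_min ltr01 !divr_gt0.
have [e1 es ed] : [/\ e <= 1, 4 * e <= s & C * Kc * e < dl].
  split; first by rewrite ge_min lexx.
    have : e <= s / 4 by rewrite !ge_min lexx !orbT.
    by rewrite ler_pdivlMr// mulrC.
  have : e <= dl / (2 * (C * Kc)) by rewrite !ge_min lexx !orbT.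
  by rewrite ler_pdivlMr//; move: CK0; set ck := C * Kc; nra.
pose A := Order.max (B0 / e) (Order.max (2 * K / e ^+ 2) (2 * s / e)).
have [D hD] : exists D : nat, A <= D%:R.
  by have [N _ hN] := near_natr A; exists N; apply: hN => /=.
have hD1 : A <= D.+1%:R by apply: le_trans hD _; rewrite ler_nat.
have hD2 : A <= D.+2%:R by apply: le_trans hD1 _; rewrite ler_nat.
have a1 : B0 / D.+1%:R <= e.
  by rewrite ler_pdivrMr// mulrC -ler_pdivrMr//; apply: le_trans hD1; rewrite le_max lexx.
have a2 : 2 * K / D.+2%:R <= e ^+ 2.
  rewrite ler_pdivrMr// [leRHS]mulrC -ler_pdivrMr ?exprn_gt0//; apply: le_trans hD2.
  by rewrite !le_max lexx !orbT.
have a3 : 2 * s / D.+2%:R <= e.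
  rewrite ler_pdivrMr// [leRHS]mulrC -ler_pdivrMr//; apply: le_trans hD2.
  by rewrite !le_max lexx !orbT.
have bn : forall N, \forall n \near \oo, (N <= @blk R D n)%N by move=> N; exact: blk_near.
have D4 : (0 : R) < (4 * D.+1%:R ^+ 4)^-1 by rewrite invr_gt0 mulr_gt0// exprn_gt0.
have h1 := near_sub bn (ha _ D4).
have h2 : \forall n \near \oo, `|(D.+1 * @blk R D n)%:R^-1 *
    rE P (fun w => (\sum_(i < (D.+1 * @blk R D n)) y (X i.+1%:Z w)) ^+ 2) - s| < e.
  move/cvg_nearP : hs => /(_ e e0); apply: near_sub => N.
  by apply: filterS (bn N) => n h; rewrite (leq_trans h)// leq_pmull.
have D20 : (0 : R) < D.+2%:R^-1 by rewrite invr_gt0.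
near=> n.
apply: (le_lt_trans _ ed).
apply: (clt_step mX sX my B00 yB Ey K0 hV s0 (D := D) _ sm C0) => //.
- by near: n; exact: bn.
- by rewrite e0.
- by near: n; exact: blk_small.
- have p4 : (0 : R) < 4 * D.+1%:R ^+ 4 by rewrite mulr_gt0// exprn_gt0.
  rewrite mulrC -(ler_pdivlMr _ _ p4) div1r; near: n; exact: h1.
- by apply: ltW; near: n; exact: h2.
Unshelve. all: by end_near. Qed.

End BoundedLimit.

(** * Long-run variance *)

Section VarianceLimit.
Context {R : realType} {d : measure_display} {T : measurableType d}.
Variable P : probability T R.
Variable X : int -> T -> R.
Hypothesis mX : forall t, measurable_fun setT (X t).
Hypothesis sX : stationary P X.
Variable eps : R.
Hypothesis eps0 : 0 < eps.
Hypothesis mixing : (\sum_(0 <= k <oo) ((alpha P X k `^ (eps / (2 + eps)))%:E) < +oo)%E.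
Variables (g : R -> R) (m : R).
Hypothesis mg : measurable_fun setT g.
Hypothesis m0 : 0 < m.
Hypothesis gLint : Lint P (fun w => `|g (X 0 w)| `^ (2 + eps)).
Hypothesis gmom : rE P (fun w => `|g (X 0 w)| `^ (2 + eps)) <= m.

Let c (t : nat) := rcov P (fun w => g (X 0 w)) (fun w => g (X t%:Z w)).

Definition lrv : R := c 0 + 2 * limn (series (fun t => c t.+1)).

Let cshift (i t : nat) : rcov P (fun w => g (X i%:Z w)) (fun w => g (X (i + t)%N%:Z w)) = c t.
Proof.
have mc (j : int) : measurable_fun setT ((fun x => g (x j)) : pathT setT -> R).
  by apply: (measurableT_comp mg); exact: coord_meas.
have e0 : (fun w => g (X i%:Z w)) = (fun x => g (x 0)) \o path X i%:Z.
  by apply/funext => w; rewrite /= /path add0r.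
have e1 : (fun w => g (X (i + t)%N%:Z w)) = (fun x => g (x t%:Z)) \o path X i%:Z.
  by apply/funext => w; rewrite /= /path PoszD addrC.
have f0 : (fun w => g (X 0 w)) = (fun x => g (x 0)) \o path X 0.
  by apply/funext => w; rewrite /= /path add0r.
have f1 : (fun w => g (X t%:Z w)) = (fun x => g (x t%:Z)) \o path X 0.
  by apply/funext => w; rewrite /= /path addr0.
have mcc : measurable_fun setT ((fun x => g (x 0) * g (x t%:Z)) : pathT setT -> R).
  by apply: measurable_funM; exact: mc.
have e2 : (fun w => g (X i%:Z w) * g (X (i + t)%N%:Z w)) = (fun x => g (x 0) * g (x t%:Z)) \o path X i%:Z.
  by apply/funext => w; rewrite /= /path add0r PoszD addrC.
have f2 : (fun w => g (X 0 w) * g (X t%:Z w)) = (fun x => g (x 0) * g (x t%:Z)) \o path X 0.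
  by apply/funext => w; rewrite /= /path add0r addr0.
rewrite /c /rcov e2 f2 (path_rE mX sX i mcc) e0 e1 f0 f1.
by rewrite (path_rE mX sX i (mc 0)) (path_rE mX sX i (mc t%:Z)).
Qed.

Let L1 t : Lint P (fun w => g (X t w)) := dav_Lint mX sX eps0 mg gLint t.
Let L2 s t : Lint P (fun w => g (X s w) * g (X t w)) := dav_Lint2 mX sX eps0 mg gLint s t.
Let mu := rE P (fun w => g (X 0 w)).
Let V n := rE P (fun w => (\sum_(i < n) (g (X i.+1%:Z w) - mu)) ^+ 2).

Let VE n : V n = \sum_(i < n) \sum_(j < n) rcov P (fun w => g (X i.+1%:Z w)) (fun w => g (X j.+1%:Z w)).
Proof.
rewrite /V (@rE_sqr_sum _ _ _ P 'I_n (index_enum _) (fun (i : 'I_n) w => g (X i.+1%:Z w)) (fun=> mu))//.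
by move=> i; rewrite /mu; exact/esym/(stat_rE1 mX sX i.+1%:Z mg).
Qed.

Let VS n : V n.+1 = V n + (c 0 + 2 * series (fun t => c t.+1) n).
Proof.
have last : rcov P (fun w => g (X n.+1%:Z w)) (fun w => g (X n.+1%:Z w)) = c 0.
  by rewrite -(cshift n.+1 0) addn0.
have half : \sum_(i < n) rcov P (fun w => g (X i.+1%:Z w)) (fun w => g (X n.+1%:Z w)) =
    series (fun t => c t.+1) n.
  rewrite /series/= big_mkord (reindex_inj rev_ord_inj)/=; apply: eq_bigr => i _.
  rewrite -(cshift (n - i.+1).+1 i.+1) (_ : ((n - i.+1).+1 + i.+1)%N = n.+1)//.
  by rewrite addSn subnK.
have half' : \sum_(i < n) rcov P (fun w => g (X n.+1%:Z w)) (fun w => g (X i.+1%:Z w)) =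
    series (fun t => c t.+1) n.
  by rewrite -half; apply: eq_bigr => i _; exact: rcovC.
rewrite !VE big_ord_recr/= [X in _ + X]big_ord_recr/=.
under eq_bigr do rewrite big_ord_recr/=.
rewrite big_split/= last half half'.
set A := \sum_(i < n) _; move: (c 0) (series _ n) => c0 S; ring.
Qed.

Lemma lrv_cvg : cvgn (series (fun t => c t.+1)).
Proof.
have [S S0 hS] := mixrate_sum mixing.
apply: normed_cvg; apply: nondecreasing_is_cvgn.
  by apply: nondecreasing_series => n _ _; exact: normr_ge0.
exists (dav_cst eps m * S) => _ [n _ <-]; rewrite /series/=.
apply: (@le_trans _ _ (\sum_(0 <= k < n) dav_cst eps m * mixrate P X eps k)).
  apply: ler_sum => k _; have := davydov mX sX eps0 mg m0 gLint gmom (ltn0Sn k).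
  by rewrite subSS subn0.
by rewrite -mulr_sumr big_mkord ler_wpM2l// ltW// dav_cst_gt0.
Qed.

(** By [VS] the increments of [V] are the partial sums that define the long-run variance, so
    [V n / n] is a Cesaro mean of a convergent sequence. *)
Lemma var_lim : n%:R^-1 * V n @[n --> \oo] --> lrv.
Proof.
pose C k := c 0 + 2 * series (fun t => c t.+1) k.
have VC n : V n = series C n.
  elim: n => [|n IH].
    rewrite /V /series/= big_geq// -[RHS](rE_cst P 0); congr rE; apply/funext => w.
    by rewrite big_ord0 expr0n.
  by rewrite VS IH /series/= big_nat_recr.
have CL : C n @[n --> \oo] --> lrv.
  by apply: cvgD; [exact: cvg_cst|apply: cvgM; [exact: cvg_cst|exact: lrv_cvg]].
have h := cesaro CL; rewrite -cvg_shiftS.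
rewrite (_ : [sequence n.+1%:R^-1 * V n.+1]_n = arithmetic_mean C)//.
by apply/funext => n; rewrite /arithmetic_mean/= VC.
Qed.

End VarianceLimit.

Section L2Tools.
Context {R : realType} {d : measure_display} {T : measurableType d}.
Variable P : probability T R.

Lemma Lint_prod2 (f g : T -> R) : measurable_fun setT f -> measurable_fun setT g ->
  Lint P (fun w => f w ^+ 2) -> Lint P (fun w => g w ^+ 2) -> Lint P (fun w => f w * g w).
Proof.
move=> mf mg Lf Lg; apply: (Lint_le (fun w => f w ^+ 2 + g w ^+ 2)).
- exact: measurable_funM.
- exact: LintD.
move=> w; rewrite normrM -[f w ^+ 2]real_normK ?num_real// -[g w ^+ 2]real_normK ?num_real//.
by have := normr_ge0 (f w); have := normr_ge0 (g w); nra.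
Qed.

Lemma Lint_sqr_sum (n : nat) (Y : nat -> T -> R) : (forall i, measurable_fun setT (Y i)) ->
  (forall i, Lint P (fun w => Y i w ^+ 2)) -> Lint P (fun w => (\sum_(i < n) Y i w) ^+ 2).
Proof.
move=> mY LY; rewrite (_ : (fun w => _) = fun w => \sum_(i < n) \sum_(j < n) Y i w * Y j w).
  by apply: Lint_sum => i _; apply: Lint_sum => j _; exact: Lint_prod2.
by apply/funext => w; rewrite expr2 mulr_suml; apply: eq_bigr => i _; rewrite mulr_sumr.
Qed.

Lemma Lint_sqrB (f : T -> R) c : Lint P f -> Lint P (fun w => f w ^+ 2) ->
  Lint P (fun w => (f w - c) ^+ 2).
Proof.
move=> Lf Lf2; have := LintD (LintB Lf2 (LintZ (2 * c) Lf)) (@Lint_cst _ _ _ P (c ^+ 2)).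
by congr Lint; apply/funext => w; rewrite /cst; ring.
Qed.

(** The cross term is split by [2 * |A * Z| <= e * A ^ 2 + Z ^ 2 / e], so a perturbation with second
    moment of order [e ^ 2] changes the second moment by order [e]. *)
Lemma var_perturb (A Z : T -> R) (e a z : R) : measurable_fun setT A -> measurable_fun setT Z ->
  Lint P (fun w => A w ^+ 2) -> Lint P (fun w => Z w ^+ 2) -> 0 < e <= 1 -> 0 <= z ->
  rE P (fun w => A w ^+ 2) <= a -> rE P (fun w => Z w ^+ 2) <= e ^+ 2 * z ->
  `|rE P (fun w => (A w + Z w) ^+ 2) - rE P (fun w => A w ^+ 2)| <= e * (a + 2 * z).
Proof.
move=> mA mZ LA LZ /andP[e0 e1] z0 ha hz.
have LAZ := Lint_prod2 mA mZ LA LZ.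
have LD : Lint P (fun w => 2 * (A w * Z w) + Z w ^+ 2) := LintD (LintZ 2 LAZ) LZ.
have -> : rE P (fun w => (A w + Z w) ^+ 2) =
    rE P (fun w => A w ^+ 2) + rE P (fun w => 2 * (A w * Z w) + Z w ^+ 2).
  by rewrite -(rED LA LD); congr rE; apply/funext => w; ring.
rewrite addrAC subrr add0r.
apply: (@le_trans _ _ (rE P (fun w => e * A w ^+ 2 + (e^-1 + 1) * Z w ^+ 2))).
  apply: (rE_abs_le _ LD (LintD (LintZ e LA) (LintZ _ LZ))) => w.
  apply: le_trans (ler_normD _ _) _; rewrite [(e^-1 + 1) * _]mulrDl mul1r addrA [`|Z w ^+ 2|]ger0_norm ?sqr_ge0// lerD2r.
  rewrite normrM ger0_norm// normrM -[A w ^+ 2]real_normK ?num_real// -[Z w ^+ 2]real_normK ?num_real//.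
  rewrite -(ler_pM2l e0) mulrDr [e * (e^-1 * _)]mulrA mulfV ?gt_eqF// mul1r.
  have := sqr_ge0 (e * `|A w| - `|Z w|); move: `|A w| `|Z w| => x y; nra.
rewrite (rED (LintZ e LA) (LintZ _ LZ)) (rEZ _ LA) (rEZ _ LZ) mulrDr.
apply: lerD; first by rewrite ler_pM2l.
apply: (@le_trans _ _ ((e^-1 + 1) * (e ^+ 2 * z))).
  by apply: ler_wpM2l => //; rewrite addr_ge0 ?invr_ge0// ltW.
have -> : (e^-1 + 1) * (e ^+ 2 * z) = e * z + e * e * z by field; rewrite gt_eqF.
have -> : e * (2 * z) = e * z + 1 * e * z by ring.
by rewrite lerD2l; apply: ler_wpM2r => //; apply: ler_wpM2r => //; exact: ltW.
Qed.

End L2Tools.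

(** * Removing the truncation *)

Section CLT.
Context {R : realType} {d : measure_display} {T : measurableType d}.
Variable P : probability T R.
Variable X : int -> T -> R.
Hypothesis mX : forall t, measurable_fun setT (X t).
Hypothesis sX : stationary P X.
Variable eps : R.
Hypothesis eps0 : 0 < eps.
Hypothesis mom : (\int[P]_w ((`|X 0 w| `^ (2 + eps))%:E) < +oo)%E.
Hypothesis mixing : (\sum_(0 <= k <oo) ((alpha P X k `^ (eps / (2 + eps)))%:E) < +oo)%E.
Local Notation gm2 := (@gm2 R).
Local Notation p := (2 + eps).

(** A truncation remainder whose moment of order [p] is small enough has, through [var_sum], as
    small a variance per term as desired, uniformly in the number of terms. *)
Lemma dav_cst_small (e : R) : 0 < e -> exists2 m, 0 < m & dav_cst eps m = e.
Proof.
move=> e0; have p0 : 0 < p by rewrite addr_gt0.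
have t0 : 0 < e / (7 / 2) by rewrite divr_gt0.
exists ((e / (7 / 2)) `^ (p / 2) / 2); first by rewrite divr_gt0// powR_gt0.
rewrite /dav_cst [2 * _]mulrC divfK// -powRrM (_ : p / 2 * (2 / p) = 1); last by field; rewrite gt_eqF.
by rewrite powRr1 ?(ltW t0)//; field.
Qed.

(** The threshold is on the power [p] because [tail_small] is applied to that power of [|X 0|]. *)
Let tr (M x : R) : R := (if `|x| `^ p <= M then 1 else 0) * x.

Let tr_meas M : measurable_fun setT (tr M).
Proof.
apply: measurable_funM => //; apply: meas_le_if; last exact: measurable_cst.
by apply: (measurableT_comp (@measurable_powR R p)); exact: normr_measurable.
Qed.

Let tr_bnd M x : `|tr M x| <= 1 + `|M|.
Proof.
rewrite /tr; have [h|_] := leP (`|x| `^ p) M; last by rewrite mul0r normr0 addr_ge0.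
rewrite mul1r -[leLHS]expr1; apply: le_trans (pow_ge_le1 eps0 _ _) _ => //.
by rewrite lerD2l (le_trans h)// ler_norm.
Qed.

Let tr_pow M x : `|tr M x| `^ p <= `|x| `^ p.
Proof.
rewrite /tr; case: ifP => _; rewrite ?mul1r// mul0r normr0 powR0 ?powR_ge0//.
by rewrite gt_eqF// addr_gt0.
Qed.

Let tr_rest M x : `|x - tr M x| `^ p = if `|x| `^ p <= M then 0 else `|x| `^ p.
Proof.
rewrite /tr; case: ifP => _; rewrite ?mul1r ?mul0r ?subr0// subrr normr0 powR0//.
by rewrite gt_eqF// addr_gt0.
Qed.

Theorem clt (C : R) (u u1 u2 : R -> R) : rE P (X 0) = 0 -> 0 < sigma2 P X ->
  smooth3 C u u1 u2 -> 0 < C -> (forall x, 0 <= u x <= 1) ->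
  rE P (fun z => u ((Num.sqrt n%:R)^-1 * \sum_(i < n) X i.+1%:Z z)) @[n --> \oo]
    --> gsm (Num.sqrt (sigma2 P X / gm2)) u 0.
Proof.
move=> EX0 s0 sm C0 u01; set s := sigma2 P X in s0 *.
have p0 : 0 < p by rewrite addr_gt0.
have Lp := fv_Lintp mX mom.
have [S S0 hS] := mixrate_sum mixing.
pose mx := rE P (fun w => `|X 0 w| `^ p) + 1.
have mx0 : 0 < mx by rewrite ltr_wpDl// rE_ge0// => w; exact: powR_ge0.
pose K := dav_cst eps mx * (1 + 2 * S).
have K0 : 0 < K by rewrite mulr_gt0 ?dav_cst_gt0// ltr_pwDl// mulr_ge0.
have LX t : Lint P (X t) by exact: (stat_Lint1 mX sX t (@measurable_id _ _ setT) (fv_Lint mX eps0 mom)).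
have mXi (i : nat) : measurable_fun setT (fun w => X i.+1%:Z w) by exact: mX.
have Lx1 : Lint P (fun w => `|(fun x : R => x) (X 0 w)| `^ p) by exact: Lp.
have vlX : n%:R^-1 * rE P (fun w => (\sum_(i < n) X i.+1%:Z w) ^+ 2) @[n --> \oo] --> s.
  have := @var_lim _ _ _ P X mX sX eps eps0 mixing (fun x => x) mx (@measurable_id _ _ setT) mx0 Lp.
  have h1 : rE P (fun w => `|X 0 w| `^ p) <= mx by rewrite lerDl.
  move=> /(_ h1); apply: cvg_trans; apply: near_eq_cvg; near=> n; congr (_ * rE P _).
  by apply/funext => w; congr (_ ^+ 2); apply: eq_bigr => i _; rewrite EX0 subr0.
apply/cvg_nearP => dl dl0.
pose m1 := rE (@normal_prob R 0 1) (fun z => `|z ^+ 1|).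
pose Kg := C * ((gm2 * Num.sqrt (s / gm2))^-1 * m1).
have m20 : 0 < gm2 := gauss_var_gt0.
have Kg0 : 0 <= Kg.
  by rewrite /Kg mulr_ge0 ?(ltW C0)// mulr_ge0 ?rE_ge0// invr_ge0 mulr_ge0 ?sqrtr_ge0// ltW.
pose Kt := 2 * C + Kg * (K + 4) + 1.
have KK : 0 <= Kg * (K + 4) by rewrite mulr_ge0// addr_ge0// ltW.
have Kt0 : 0 < Kt by rewrite /Kt; lra.
(* The middle bound keeps the long-run variance of the truncated variables at least [s / 2], hence
   positive. *)
pose e := Order.min 1 (Order.min (s / 2 / (K + 4)) (dl / 2 / Kt)).
have K40 : 0 < K + 4 by rewrite addr_gt0.
have e0 : 0 < e by rewrite !lt_min ltr01 !divr_gt0.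
have [e1 es ed] : [/\ e <= 1, e * (K + 4) <= s / 2 & Kt * e < dl].
  split; first by rewrite ge_min lexx.
    have : e <= s / 2 / (K + 4) by rewrite !ge_min lexx !orbT.
    by rewrite ler_pdivlMr.
  have : e <= dl / 2 / Kt by rewrite !ge_min lexx !orbT.
  by rewrite ler_pdivlMr// mulrC => h; apply: le_lt_trans h _; lra.
have S20 : 0 < 1 + 2 * S by rewrite ltr_pwDl// mulr_ge0.
have [m m0 hm] : exists2 m, 0 < m & dav_cst eps m * (1 + 2 * S) <= e ^+ 2.
  have [m m0 hm] := @dav_cst_small (e ^+ 2 / (1 + 2 * S)) (divr_gt0 (exprn_gt0 2 e0) S20).
  by exists m => //; rewrite hm divfK// gt_eqF.
have [M [M0 hM]] := tail_small Lp m0.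
pose g := tr M; pose h (x : R) := x - tr M x.
have mg : measurable_fun setT g by exact: tr_meas.
have mh : measurable_fun setT h by exact: measurable_funB.
have Lgp : Lint P (fun w => `|g (X 0 w)| `^ p).
  apply: (Lint_le (fun w => `|X 0 w| `^ p)) => //.
    apply: (measurableT_comp (@measurable_powR R p)); apply: measurableT_comp => //.
    exact: (measurableT_comp mg).
  by move=> w; rewrite ger0_norm ?powR_ge0//; exact: tr_pow.
have Lhp : Lint P (fun w => `|h (X 0 w)| `^ p).
  apply: (Lint_le (fun w => `|X 0 w| `^ p)) => //.
    apply: (measurableT_comp (@measurable_powR R p)); apply: measurableT_comp => //.
    exact: (measurableT_comp mh).
  by move=> w; rewrite ger0_norm ?powR_ge0// tr_rest; case: ifP => _; rewrite ?powR_ge0.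
have Egp : rE P (fun w => `|g (X 0 w)| `^ p) <= mx.
  by rewrite ler_wpDr//; apply: (rE_le Lgp Lp) => w; exact: tr_pow.
have Ehp : rE P (fun w => `|h (X 0 w)| `^ p) <= m.
  apply: le_trans hM; rewrite le_eqVlt; apply/orP; left; apply/eqP; congr rE.
  by apply/funext => w; rewrite tr_rest [`|_ `^ _|]ger0_norm ?powR_ge0.
pose mu := rE P (fun w => g (X 0 w)); pose nu := rE P (fun w => h (X 0 w)).
pose A n w := \sum_(i < n) (g (X i.+1%:Z w) - mu).
pose Z n w := \sum_(i < n) (h (X i.+1%:Z w) - nu).
have Lg t : Lint P (fun w => g (X t w)) := dav_Lint mX sX eps0 mg Lgp t.
have Lh t : Lint P (fun w => h (X t w)) := dav_Lint mX sX eps0 mh Lhp t.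
have munu : mu + nu = 0.
  rewrite /mu /nu -(rED (Lg 0) (Lh 0)) -EX0; congr rE; apply/funext => w.
  by rewrite /g /h addrC subrK.
have AZ n w : \sum_(i < n) X i.+1%:Z w = A n w + Z n w.
  rewrite /A /Z -big_split/=; apply: eq_bigr => i _.
  rewrite addrACA -opprD munu subr0 /g /h addrC subrK//.
have Lg2 n : Lint P (fun w => A n w ^+ 2).
  apply: (@Lint_sqr_sum _ _ _ P n (fun i w => g (X i.+1%:Z w) - mu)) => i.
    by apply: measurable_funB => //; exact: Lint_meas (Lg _).
  by apply: Lint_sqrB => //; exact: (dav_Lint2 mX sX eps0 mg Lgp).
have Lh2 n : Lint P (fun w => Z n w ^+ 2).
  apply: (@Lint_sqr_sum _ _ _ P n (fun i w => h (X i.+1%:Z w) - nu)) => i.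
    by apply: measurable_funB => //; exact: Lint_meas (Lh _).
  by apply: Lint_sqrB => //; exact: (dav_Lint2 mX sX eps0 mh Lhp).
have LA n : Lint P (A n) by apply: Lint_sum => i _; exact: LintB (Lg _) (Lint_cst mu).
have LZ n : Lint P (Z n) by apply: Lint_sum => i _; exact: LintB (Lh _) (Lint_cst nu).
have VA n (Q : pred nat) : rE P (fun w => (\sum_(i < n | Q i) (g (X i.+1%:Z w) - mu)) ^+ 2)
    <= (\sum_(i < n | Q i) 1) * K.
  exact: (var_sum mX sX eps0 mom mixing mg mx0 Lgp Egp n Q hS).
have VZ n : rE P (fun w => Z n w ^+ 2) <= e ^+ 2 * n%:R.
  have := var_sum mX sX eps0 mom mixing mh m0 Lhp Ehp n predT hS; rewrite -/nu => h1.
  apply: le_trans h1 _; rewrite sumr_const card_ord mulrC; exact: ler_wpM2r.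
have VA' n : rE P (fun w => A n w ^+ 2) <= n%:R * K.
  by have := VA n predT; rewrite sumr_const card_ord.
pose sg := lrv P X g.
have vlg : n%:R^-1 * rE P (fun w => A n w ^+ 2) @[n --> \oo] --> sg.
  exact: (@var_lim _ _ _ P X mX sX eps eps0 mixing g mx mg mx0 Lgp Egp).
(* Both long-run variances are limits of normalized variances, so they are compared at one large
   [n], where [var_perturb] applies. *)
have ssg : `|sg - s| <= e * (K + 4).
  move/cvg_nearP : (vlX) => /(_ e e0) h1; move/cvg_nearP : (vlg) => /(_ e e0) h2.
  near \oo => n.
  have n0 : (0 : R) < n%:R by rewrite ltr0n; near: n; exact: near_ge.
  have a1 : `|n%:R^-1 * rE P (fun w => (\sum_(i < n) X i.+1%:Z w) ^+ 2) - s| < e by near: n; exact: h1.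
  have a2 : `|n%:R^-1 * rE P (fun w => A n w ^+ 2) - sg| < e by near: n; exact: h2.
  have e01 : 0 < e <= 1 by rewrite e0.
  have a3 := var_perturb (Lint_meas (LA n)) (Lint_meas (LZ n)) (Lg2 n) (Lh2 n) e01 (ler0n R n) (VA' n) (VZ n).
  move: a1 a3; under eq_fun do rewrite AZ.
  set v1 := rE P _; set v2 := rE P _ in a2 *.
  move=> a1 a3.
  have a4 : `|n%:R^-1 * v1 - n%:R^-1 * v2| <= e * (K + 2).
    rewrite -mulrBr normrM ger0_norm ?invr_ge0// ler_pdivrMl//; apply: le_trans a3 _.
    by rewrite le_eqVlt; apply/orP; left; apply/eqP; ring.
  have -> : sg - s = - (n%:R^-1 * v2 - sg) + - (n%:R^-1 * v1 - n%:R^-1 * v2) + (n%:R^-1 * v1 - s) by ring.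
  rewrite (_ : e * (K + 4) = e + e * (K + 2) + e); last by ring.
  apply: le_trans (ler_normD _ _) _; apply: lerD; last exact: ltW.
  by apply: le_trans (ler_normD _ _) _; rewrite !normrN; apply: lerD => //; exact: ltW.
have sg0 : 0 < sg.
  have := le_trans ssg es; rewrite ler_norml => /andP[+ _]; rewrite lerBrDl => h1.
  by apply: lt_le_trans h1; rewrite subr_gt0 ltr_pdivrMr// ltr_pMr// (ltr1n R 2).
have B0 : 0 < 2 * (1 + `|M|) by rewrite mulr_gt0// ltr_pwDl.
have yB x : `|g x - mu| <= 2 * (1 + `|M|).
  rewrite mulr_natl mulr2n; apply: le_trans (ler_normB _ _) _; apply: lerD; first exact: tr_bnd.
  by apply: rE_bnd => [|w]; [exact: Lint_meas (Lg 0)|exact: tr_bnd].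
have my : measurable_fun setT (fun x => g x - mu) by exact: measurable_funB.
have Ey : rE P (fun w => g (X 0 w) - mu) = 0.
  by rewrite (rEB (Lg 0) (Lint_cst mu)) (rE_cst P mu) subrr.
have lim := @bounded_clt _ _ _ P X mX sX (fun x => g x - mu) _ K sg C u u1 u2 my B0 yB Ey K0 VA sg0 vlg
  (alpha_tail mX eps0 mom mixing) sm C0 u01.
move/cvg_nearP : lim => /(_ e e0) lim.
near=> n.
have n0 : (0 : R) < n%:R by rewrite ltr0n; near: n; exact: near_ge.
have b1 : `|rE P (fun z => u ((Num.sqrt n%:R)^-1 * A n z)) - gsm (Num.sqrt (sg / gm2)) u 0| < e by near: n.
have b2 := gsm_sqrt_lip 0 sm C0 (ltW sg0) s0.
have b3 : `|rE P (fun z => u ((Num.sqrt n%:R)^-1 * \sum_(i < n) X i.+1%:Z z)) -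
    rE P (fun z => u ((Num.sqrt n%:R)^-1 * A n z))| <= C * (2 * e).
  have E z : (Num.sqrt n%:R)^-1 * (\sum_(i < n) X i.+1%:Z z) - (Num.sqrt n%:R)^-1 * A n z =
      (Num.sqrt n%:R)^-1 * Z n z by rewrite AZ; ring.
  have E2 : (fun z => ((Num.sqrt n%:R)^-1 * (\sum_(i < n) X i.+1%:Z z) - (Num.sqrt n%:R)^-1 * A n z) ^+ 2) =
      (fun z => n%:R^-1 * Z n z ^+ 2).
    by apply/funext => z; rewrite E exprMn exprVn sqr_sqrtr// ltW.
  apply: (@smooth_L2 _ _ _ P C e u u1 u2 _ _ sm C0 e0).
  - by apply: LintZ; apply: Lint_sum => i _; exact: LX.
  - exact: LintZ.
  - by rewrite E2; exact: LintZ.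
  - by rewrite E2 (rEZ _ (Lh2 n)) ler_pdivrMl// mulrC.
apply: (le_lt_trans _ ed); move: b1 b2 b3.
set r1 := rE P _; set r2 := gsm _ _ _; set r3 := gsm _ _ _; set r4 := rE P _ => b1 b2 b3.
have b4 : Kg * `|sg - s| <= Kg * (e * (K + 4)) by exact: ler_wpM2l.
have -> : r4 - r3 = (r4 - r1) + ((r1 - r2) + (r2 - r3)) by ring.
apply: le_trans (ler_normD _ _) _; apply: le_trans (lerD b3 (ler_normD _ _)) _.
apply: (@le_trans _ _ (C * (2 * e) + (e + Kg * (e * (K + 4))))).
  by rewrite lerD2l; apply: lerD; [exact: ltW|exact: le_trans b2 b4].
by rewrite le_eqVlt; apply/orP; left; apply/eqP; rewrite /Kt; ring.
Unshelve. all: by end_near. Qed.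

End CLT.

(** * Coverage in the finite variance case *)

Section GaussCdf.
Context {R : realType}.
Local Notation gam := (@normal_prob R 0 1).
Local Notation pdf := (@normal_pdf R 0 1).

Definition gcdf (y : R) : R := pr gam [set z | z <= y].

Let mI (y : R) : measurable [set z : measurableTypeR R | z <= y].
Proof. by apply: (@meas_le R _ (measurableTypeR R) (fun z => z) (cst y)). Qed.

Lemma gcdf_split (x y : R) : x <= y -> gcdf y = gcdf x + pr gam `]x, y].
Proof.
move=> xy; rewrite -pr_setU_disj//.
- congr pr; apply/seteqP; split => z /=; rewrite in_itv/=.
    by move=> zy; have [zx|zx] := leP z x; [left|right].
  by case=> [zx|/andP[]//]; exact: le_trans xy.
- by apply/seteqP; split => z //= [zx]; rewrite in_itv/= ltNge zx.
Qed.

Lemma gcdf_lt (x y : R) : x < y -> gcdf x < gcdf y.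
Proof. by move=> xy; rewrite (gcdf_split (ltW xy)) ltrDl gauss_itv_pos. Qed.

Lemma gauss_itv_le (a b : R) : a <= b -> pr gam `]a, b] <= pdf 0 * (b - a).
Proof.
move=> ab.
have k0 : 0 <= pdf 0 by exact: normal_pdf_ge0.
have [->|ba] := eqVneq a b; first by rewrite set_itv_ge ?bnd_simp ?ltxx// /pr measure0 subrr mulr0.
have lt_ab : a < b by rewrite lt_neqAle ba ab.
have : (gam `]a, b] <= (pdf 0)%:E * (b - a)%:E)%E.
  have -> : ((pdf 0)%:E * (b - a)%:E = \int[@lebesgue_measure R]_(x in `]a, b]) (pdf 0)%:E)%E.
    by rewrite integral_cst//= lebesgue_measure_itv/= lte_fin lt_ab EFinB.
  apply: ge0_le_integral => //.
  - by move=> x _; rewrite lee_fin normal_pdf_ge0.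
  - by apply/measurable_funTS/measurable_EFinP; exact: measurable_normal_pdf.
  move=> x _; rewrite lee_fin !pdfE//.
  rewrite !subr0; apply: ler_wpM2l; first by rewrite invr_ge0 mul1r sqrtr_ge0.
  by rewrite ler_expR lerN2 ler_wpM2r ?invr_ge0 ?mulr_ge0// expr0n/= sqr_ge0.
by rewrite -EFin_pr// -EFinM lee_fin.
Qed.

Lemma gcdf_lip (x y : R) : `|gcdf x - gcdf y| <= pdf 0 * `|x - y|.
Proof.
wlog xy : x y / x <= y.
  by move=> H; have [/H//|/ltW/H] := leP x y; rewrite distrC [`|y - x|]distrC.
rewrite distrC [`|x - y|]distrC (gcdf_split xy) addrAC subrr add0r ger0_norm ?pr_ge0//.
by rewrite ger0_norm ?subr_ge0//; exact: gauss_itv_le.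
Qed.

Lemma gcdf_tail (M : R) : 0 < M -> gcdf (- M) <= @gm2 R / M ^+ 2 /\ 1 - @gm2 R / M ^+ 2 <= gcdf M.
Proof.
move=> M0.
have h := @chebyshev_le _ _ _ gam (fun z : R => z) M (@gm2 R) (@measurable_id _ _ setT)
  (@gauss_Lint_pow R 2 isT) M0 (lexx _).
have mA : measurable [set z : measurableTypeR R | M <= `|z|].
  by apply: (@meas_le R _ (measurableTypeR R) (cst M) (fun z => `|z|)) => //; exact: normr_measurable.
split.
  apply: le_trans h; apply: pr_le => // z /= zM; rewrite ler0_norm; first by rewrite lerNr.
  by rewrite (le_trans zM)// oppr_le0 ltW.
rewrite lerBlDr -lerBlDl /gcdf -(pr_setC (mI M)); apply: le_trans h; apply: pr_le => //.
  exact: measurableC.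
by move=> z /= /negP; rewrite -ltNge => Mz; rewrite (le_trans (ltW Mz))// ler_norm.
Qed.

End GaussCdf.

Section Sigmoid.
Context {R : realType}.

Lemma sigm_hi (K y s r dl : R) : 0 < K -> 0 < r -> 1 <= dl * (K * r) -> s <= y - r ->
  1 - dl <= sigm K y s.
Proof.
move=> K0 r0 h sy; have Kr : 0 < K * r by exact: mulr_gt0.
have E0 := expR_gt0 (K * (s - y)); set E := expR _ in E0.
have E1 : E * (1 + K * r) <= 1.
  have : E <= expR (- (K * r)).
    by rewrite ler_expR -mulrN ler_pM2l// lerBlDr addrC.
  move=> hE; apply: (@le_trans _ _ (expR (- (K * r)) * expR (K * r))).
    by apply: ler_pM => //; [exact: ltW|rewrite addr_ge0// ltW|exact: expR_ge1Dx].
  by rewrite -expRD addNr expR0.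
have dE : E <= dl.
  rewrite -(ler_pM2r Kr); apply: le_trans h; apply: le_trans E1; rewrite ler_pM2l//.
  by rewrite lerDr.
rewrite /sigm -/E -[leRHS]mul1r ler_pdivlMr ?addr_gt0//; nra.
Qed.

Lemma sigm_lo (K y s r dl : R) : 0 < K -> 0 < r -> 1 <= dl * (K * r) -> y + r <= s ->
  sigm K y s <= dl.
Proof.
move=> K0 r0 h sy; have Kr : 0 < K * r by exact: mulr_gt0.
have E1 : K * r <= 1 + expR (K * (s - y)).
  apply: (@le_trans _ _ (K * (s - y))); first by rewrite ler_pM2l// lerBrDl.
  by apply: le_trans (_ : _ <= expR (K * (s - y))) _; rewrite ?lerDr//;
    apply: le_trans (expR_ge1Dx _); rewrite lerDr.
have d0 : 0 <= dl by rewrite -(pmulr_lge0 dl Kr); exact: le_trans h.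
rewrite /sigm; have p : 0 < 1 + expR (K * (s - y)) by rewrite addr_gt0// expR_gt0.
by rewrite -[_^-1]mul1r ler_pdivrMr//; apply: le_trans h _; exact: ler_wpM2l.
Qed.

End Sigmoid.

Section SigmoidPr.
Context {R : realType} {d : measure_display} {T : measurableType d}.
Variable P : probability T R.
Variables (K y r dl : R) (f : T -> R).
Hypothesis K1 : 1 <= K.
Hypothesis r0 : 0 < r.
Hypothesis dK : 1 <= dl * (K * r).
Hypothesis mf : measurable_fun setT f.

Let K0 : 0 < K. Proof. exact: lt_le_trans K1. Qed.

Let Ls : Lint P (fun w => sigm K y (f w)).
Proof.
have [f1 [f2 [_ _ _ l _ _ _]]] := sigm_smooth y K1.
apply: (Lint_bnd 1) => [|w].
  exact: (measurableT_comp (continuous_measurable_fun (lip_cont l))).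
by have /andP[h1 h2] := sigm01 K y (f w); rewrite ger0_norm.
Qed.

Let mle t : measurable [set w | f w <= t]. Proof. exact: (meas_le mf (measurable_cst t)). Qed.

Lemma pr_sigm_hi : pr P [set w | f w <= y - r] <= rE P (fun w => sigm K y (f w)) + dl.
Proof.
rewrite -(rE_indic (mle _)) -(rE_cst P dl) -(rED Ls (Lint_cst dl)).
apply: rE_le => //; [exact: Lint_indic|exact: LintD Ls (Lint_cst dl)|] => w.
have d0 : 0 <= dl by rewrite -(pmulr_lge0 dl (mulr_gt0 K0 r0)); exact: le_trans dK.
have /andP[s0 _] := sigm01 K y (f w).
rewrite indicE; have [|_] := boolP (w \in _); last by rewrite addr_ge0.
by rewrite inE/= => h; rewrite -lerBlDr; exact: sigm_hi dK h.
Qed.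

Lemma pr_sigm_lo : rE P (fun w => sigm K y (f w)) <= pr P [set w | f w <= y + r] + dl.
Proof.
have mI := mle (y + r); have LI := @Lint_indic _ _ _ P _ mI.
rewrite -(rE_indic mI) -(rE_cst P dl) -(rED LI (Lint_cst dl)).
apply: rE_le => //; first exact: LintD LI (Lint_cst dl).
move=> w; have d0 : 0 <= dl by rewrite -(pmulr_lge0 dl (mulr_gt0 K0 r0)); exact: le_trans dK.
have /andP[_ s1] := sigm01 K y (f w).
rewrite indicE; have [_|] := boolP (w \in _); first by rewrite (le_trans s1)// lerDl.
rewrite notin_setE/= => /negP; rewrite -ltNge => h; rewrite add0r.
exact: sigm_lo K0 r0 dK (ltW h).
Qed.

End SigmoidPr.

Section FVcoverage.
Context {R : realType} {d : measure_display} {T : measurableType d}.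
Variable P : probability T R.
Variable X : int -> T -> R.
Hypothesis mX : forall t, measurable_fun setT (X t).
Hypothesis sX : stationary P X.
Variable eps : R.
Hypothesis eps0 : 0 < eps.
Hypothesis mom : (\int[P]_w ((`|X 0 w| `^ (2 + eps))%:E) < +oo)%E.
Hypothesis mixing : (\sum_(0 <= k <oo) ((alpha P X k `^ (eps / (2 + eps)))%:E) < +oo)%E.
Hypothesis EX0 : rE P (X 0) = 0.
Hypothesis s0 : 0 < sigma2 P X.
Local Notation gm2 := (@gm2 R).
Local Notation gam := (@normal_prob R 0 1).
Local Notation pdf := (@normal_pdf R 0 1).

Let sg := Num.sqrt (sigma2 P X / gm2).
Let sg0 : 0 < sg. Proof. by rewrite sqrtr_gt0 divr_gt0//; exact: gauss_var_gt0. Qed.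

Let S n w := (Num.sqrt n%:R)^-1 * \sum_(i < n) X i.+1%:Z w.

Let mS n : measurable_fun setT (S n).
Proof.
apply: measurable_funM => //.
by apply: (@measurable_sum _ T R setT _ _ (fun (i : 'I_n) w => X i.+1%:Z w)) => i; exact: mX.
Qed.

Let gsm_gcdf K y r dl : 1 <= K -> 0 < r -> 1 <= dl * (K * r) ->
  gcdf ((y - r) / sg) - dl <= gsm sg (sigm K y) 0 <= gcdf ((y + r) / sg) + dl.
Proof.
move=> K1 r0 dK.
have mf : measurable_fun setT (fun z : measurableTypeR R => 0 + sg * z).
  by apply: measurable_funD => //; apply: measurable_funM.
have E t : [set z : measurableTypeR R | 0 + sg * z <= t] = [set z | z <= t / sg].
  by apply/seteqP; split => z /=; rewrite add0r ler_pdivlMr// mulrC.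
have := @pr_sigm_hi _ _ _ gam K y r dl _ K1 r0 dK mf.
have := @pr_sigm_lo _ _ _ gam K y r dl _ K1 r0 dK mf.
by rewrite !E => h1 h2; apply/andP; split; rewrite ?lerBlDr.
Qed.

(** The logistic step is compared with an indicator twice, under [P] and under the Gaussian law, and
    each comparison shifts the point by [e / 2]. *)
Lemma sum_limit (y e dl : R) : 0 < e -> 0 < dl -> \forall n \near \oo,
  gcdf ((y - e) / sg) - dl <= pr P [set w | S n w <= y] <= gcdf ((y + e) / sg) + dl.
Proof.
move=> e0 d0; pose r := e / 2; pose D := dl / 3.
have er : e = r + r by rewrite /r -splitr.
have dD : dl = D + D + D by rewrite /D; field.
have r0 : 0 < r by rewrite divr_gt0.
have D0 : 0 < D by rewrite divr_gt0.
have Dr : 0 < D * r by exact: mulr_gt0.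
pose K := Order.max 1 ((D * r)^-1).
have K1 : 1 <= K by rewrite le_max lexx.
have dK : 1 <= D * (K * r).
  by rewrite mulrCA -ler_pdivrMr// div1r le_max lexx orbT.
have lim (z : R) : \forall n \near \oo, `|rE P (fun w => sigm K z (S n w)) - gsm sg (sigm K z) 0| < D.
  have [f1 [f2 sm]] := sigm_smooth z K1.
  have C0 : 0 < 3 * K ^+ 3 by rewrite mulr_gt0// exprn_gt0// (lt_le_trans ltr01).
  have := clt mX sX eps0 mom mixing EX0 s0 sm C0 (sigm01 K z).
  by move/cvg_nearP; apply.
apply: filterS2 (lim (y - r)) (lim (y + r)) => n h1 h2.
have /andP[a1 _] := gsm_gcdf (y - r) K1 r0 dK.
have /andP[_ a2] := gsm_gcdf (y + r) K1 r0 dK.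
have b1 := @pr_sigm_lo _ _ _ P K (y - r) r D _ K1 r0 dK (mS n).
have b2 := @pr_sigm_hi _ _ _ P K (y + r) r D _ K1 r0 dK (mS n).
rewrite subrK in b1; rewrite addrK in b2.
rewrite -addrA -er in a2; rewrite -addrA -opprD -er in a1.
move: h1 h2; rewrite dD => /ltr_normlP[+ _] /ltr_normlP[_ h2]; rewrite ltrNl => h1.
rewrite ltrBrDl in h1; rewrite ltrBlDl in h2; apply/andP; split.
  rewrite !opprD !addrA lerBlDr; apply: le_trans b1; apply: le_trans (ltW h1).
  by rewrite lerD2r.
rewrite !addrA; apply: le_trans b2 _; rewrite lerD2r; apply: le_trans (ltW h2) _.
by rewrite lerD2r.
Qed.

(** If the second moment vanished, so would all covariances with [X 0], and with them [sigma2]. *)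
Let X2 : 0 < rE P (fun w => X 0 w ^+ 2).
Proof.
rewrite lt_def rE_ge0 ?andbT; last by move=> w; exact: sqr_ge0.
apply/eqP => z0.
have L2 t : Lint P (fun w => X t w ^+ 2).
  exact: (@stat_Lint1 _ _ _ P X mX sX (fun x : R => x ^+ 2) t (@exprn_measurable R setT 2) (fv_Lint2 mX eps0 mom)).
have E2 t : rE P (fun w => X t w ^+ 2) = 0.
  by rewrite -z0; exact: (@stat_rE1 _ _ _ P X mX sX (fun x : R => x ^+ 2) t (@exprn_measurable R setT 2)).
have c0 t : rcov P (X 0) (X t) = 0.
  rewrite /rcov EX0 mul0r subr0; apply/eqP; rewrite -normr_le0.
  have -> : 0 = rE P (fun w => X 0 w ^+ 2 + X t w ^+ 2) by rewrite (rED (L2 0) (L2 t)) !E2 addr0.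
  apply: rE_abs_le; [exact: Lint_prod2|exact: LintD|] => w.
  rewrite normrM -[X 0 w ^+ 2]real_normK ?num_real// -[X t w ^+ 2]real_normK ?num_real//.
  by have := normr_ge0 (X 0 w); have := normr_ge0 (X t w); nra.
move: s0; rewrite /sigma2 c0 add0r.
rewrite (_ : series _ = fun=> 0); first by rewrite lim_cst// mulr0 ltxx.
by apply/funext => n; rewrite /series/= big1.
Qed.

Let tau := Num.sqrt (rE P (fun w => X 0 w ^+ 2)).
Let tau0 : 0 < tau. Proof. by rewrite sqrtr_gt0. Qed.

Let F (x : R) := gcdf (x * tau / sg).

Let F_lip x y : `|F x - F y| <= (pdf 0 * (tau / sg)) * `|x - y|.
Proof.
apply: le_trans (gcdf_lip _ _) _.
have -> : x * tau / sg - y * tau / sg = (x - y) * (tau / sg) by ring.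
have ts : 0 <= tau / sg by rewrite divr_ge0// ltW.
by rewrite normrM (ger0_norm ts) -mulrA [_ * (tau / sg)]mulrC.
Qed.

(** Slutsky's argument: where [Qsum / sqrt n] is within [e] of [tau], the event [T_n <= x] is caught
    between events for [S] at [x * tau - |x| * e] and [x * tau + |x| * e]; the Lipschitz bound on
    [gcdf] absorbs the shift. *)
Lemma Tstat_gauss (x : R) : pr P [set w | Tstat X n w <= x] @[n --> \oo] --> F x.
Proof.
apply/cvg_nearP => dl dl0; have d3 : dl / 4 + dl / 4 + dl / 4 < dl by lra.
have k0 : 0 <= pdf 0 by exact: normal_pdf_ge0.
have c0 : 0 < (pdf 0 + 1) * (`|x| + 1) / sg by rewrite divr_gt0// mulr_gt0// ltr_wpDl.
(* The first bound keeps the self-normalizer positive on the good event; the second makes the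
   Lipschitz error at most [dl / 4]. *)
pose e := Order.min (tau / 2) (dl / 4 / ((pdf 0 + 1) * (`|x| + 1) / sg)).
have d40 : 0 < dl / 4 by rewrite divr_gt0.
have e0 : 0 < e by rewrite lt_min (divr_gt0 d40 c0) divr_gt0.
have et : e < tau.
  apply: (@le_lt_trans _ _ (tau / 2)); first by rewrite ge_min lexx.
  by rewrite ltr_pdivrMr// ltr_pMr// (ltr1n R 2).
have ed : pdf 0 * ((`|x| * e + e) / sg) <= dl / 4.
  have : e <= dl / 4 / ((pdf 0 + 1) * (`|x| + 1) / sg) by rewrite ge_min lexx orbT.
  rewrite ler_pdivlMr//; apply: le_trans.
  have -> : pdf 0 * ((`|x| * e + e) / sg) = e * (pdf 0 * (`|x| + 1) / sg) by ring.
  by rewrite ler_pM2l// ler_pM2r ?invr_gt0// ler_wpM2r ?lerDl// addr_ge0.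
have h1 := sum_limit (x * tau + `|x| * e) e0 d40.
have h2 := sum_limit (x * tau - `|x| * e) e0 d40.
have h3 := Qsum_near mX sX eps0 mom mixing X2 e0 d40.
have h4 := near_ge 1.
near=> n.
have n1 : (1 <= n)%N by near: n.
have rn : 0 < Num.sqrt (n%:R : R) by rewrite sqrtr_gt0 ltr0n.
have /andP[_ a1] : gcdf ((x * tau + `|x| * e - e) / sg) - dl / 4
   <= pr P [set w | S n w <= x * tau + `|x| * e] <= gcdf ((x * tau + `|x| * e + e) / sg) + dl / 4.
  by near: n; exact: h1.
have /andP[a2 _] : gcdf ((x * tau - `|x| * e - e) / sg) - dl / 4
   <= pr P [set w | S n w <= x * tau - `|x| * e] <= gcdf ((x * tau - `|x| * e + e) / sg) + dl / 4.
  by near: n; exact: h2.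
have a3 : pr P [set w | e * Num.sqrt n%:R <= `|Qsum X 1 n w - tau * Num.sqrt n%:R|] <= dl / 4.
  by near: n; exact: h3.
have SE w : Ssum X 1 n w = S n w * Num.sqrt n%:R.
  by rewrite /S mulrC mulrA mulfV ?gt_eqF// mul1r /Ssum big_add1 big_mkord.
have mT : measurable_fun setT (Tstat X n) := Tsub_meas mX n 1.
have mTx : measurable [set w | Tstat X n w <= x] := meas_le mT (measurable_cst x).
have mSy y : measurable [set w | S n w <= y] := meas_le (mS n) (measurable_cst y).
have mB : measurable [set w | e * Num.sqrt n%:R <= `|Qsum X 1 n w - tau * Num.sqrt n%:R|].
  apply: meas_le => //; apply: measurableT_comp => //; apply: measurable_funB => //.
  exact: Qsum_meas.
have good w : ~ (e * Num.sqrt n%:R <= `|Qsum X 1 n w - tau * Num.sqrt n%:R|) ->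
    [/\ 0 < Qsum X 1 n w & `|x * Qsum X 1 n w - x * tau * Num.sqrt n%:R| <= `|x| * e * Num.sqrt n%:R].
  move=> /negP; rewrite -ltNge => h; split.
    move: h; rewrite ltr_norml => /andP[h _].
    have : e * Num.sqrt n%:R < tau * Num.sqrt n%:R by rewrite ltr_pM2r.
    rewrite -subr_gt0 => hh; rewrite ltrBrDl in h; exact: lt_trans hh h.
  by rewrite -mulrA -mulrBr normrM -mulrA; apply: ler_wpM2l => //; exact: ltW.
have u1 : pr P [set w | Tstat X n w <= x] <= pr P [set w | S n w <= x * tau + `|x| * e] + dl / 4.
  apply: le_trans (lerD (lexx _) a3); apply: pr_le_setU => // w /= Tx.
  have [|/good[Q0]] := pselect (e * Num.sqrt n%:R <= `|Qsum X 1 n w - tau * Num.sqrt n%:R|); first by right.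
  rewrite ler_norml => /andP[_ hq]; left.
  move: Tx; rewrite /Tstat ler_pdivrMr// SE => hS.
  by rewrite -(ler_pM2r rn) mulrDl -lerBlDl; apply: le_trans hq; rewrite lerD2r.
have u2 : pr P [set w | S n w <= x * tau - `|x| * e] <= pr P [set w | Tstat X n w <= x] + dl / 4.
  apply: le_trans (lerD (lexx _) a3); apply: pr_le_setU => // w /= Sx.
  have [|/good[Q0]] := pselect (e * Num.sqrt n%:R <= `|Qsum X 1 n w - tau * Num.sqrt n%:R|); first by right.
  rewrite ler_norml => /andP[hq _]; left.
  rewrite /Tstat ler_pdivrMr// SE; move: Sx; rewrite -(ler_pM2r rn) mulrBl => hS.
  by rewrite lerBrDl in hq; exact: le_trans hS hq.
have l1 : gcdf ((x * tau + `|x| * e + e) / sg) <= F x + dl / 4.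
  rewrite -lerBlDl; apply: le_trans (ler_norm _) _; apply: le_trans (gcdf_lip _ _) _.
  apply: le_trans ed; apply: ler_wpM2l => //; rewrite -mulrBl.
  rewrite (_ : _ - x * tau = `|x| * e + e); last by ring.
  by rewrite ger0_norm// divr_ge0 ?addr_ge0 ?mulr_ge0 ?(ltW e0) ?(ltW sg0).
have l2 : F x - dl / 4 <= gcdf ((x * tau - `|x| * e - e) / sg).
  rewrite lerBlDr -lerBlDl; apply: le_trans (ler_norm _) _; apply: le_trans (gcdf_lip _ _) _.
  apply: le_trans ed; apply: ler_wpM2l => //; rewrite -mulrBl.
  rewrite (_ : x * tau - _ = `|x| * e + e); last by ring.
  by rewrite ger0_norm// divr_ge0 ?addr_ge0 ?mulr_ge0 ?(ltW e0) ?(ltW sg0).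
rewrite ltr_norml; apply/andP; split.
  rewrite ltrBrDl; apply: (@lt_le_trans _ _ (F x - dl / 4 - dl / 4 - dl / 4)).
    by rewrite -!addrA ltrD2l -!opprD ltrN2 addrA.
  rewrite lerBlDr; apply: le_trans u2; apply: le_trans a2; by rewrite lerD2r.
rewrite ltrBlDl; apply: (@le_lt_trans _ _ (F x + (dl / 4 + dl / 4 + dl / 4))); last by rewrite ltrD2l.
by rewrite !addrA; apply: le_trans u1 _; rewrite lerD2r; apply: le_trans a1 _; rewrite lerD2r.
Unshelve. all: by end_near. Qed.

Lemma F_hit (q : R) : 0 < q < 1 -> exists c, F c = q.
Proof.
move=> /andP[q0 q1]; have m20 : 0 < gm2 := gauss_var_gt0.
pose t := Order.min q (1 - q); have t0 : 0 < t by rewrite lt_min q0 subr_gt0.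
pose M := Num.sqrt (gm2 / t).
have M0 : 0 < M by rewrite sqrtr_gt0 divr_gt0.
have Mt : gm2 / M ^+ 2 = t.
  by rewrite sqr_sqrtr ?divr_ge0 ?(ltW m20) ?(ltW t0)// invf_div mulrC divfK// gt_eqF.
have [h1 h2] := gcdf_tail M0; rewrite Mt in h1 h2.
have FM z : F (z * sg / tau) = gcdf z by rewrite /F divfK ?gt_eqF// mulfK// gt_eqF.
have Ma : F (- M * sg / tau) <= q by rewrite FM (le_trans h1)// ge_min lexx.
have Mb : q <= F (M * sg / tau).
  by rewrite FM (le_trans _ h2)// lerBrDr -lerBrDl ge_min lexx orbT.
have ab : - M * sg / tau <= M * sg / tau.
  rewrite ler_pM2r ?invr_gt0// ler_pM2r//; apply: (@le_trans _ _ 0); last exact: ltW.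
  by rewrite oppr_le0 ltW.
have cF : {within `[- M * sg / tau, M * sg / tau], continuous F}.
  by apply: continuous_subspaceT; exact: lip_cont F_lip.
have [|c _ <-] := IVT (v := q) ab cF; last by exists c.
by rewrite ge_min Ma/= le_max Mb orbT.
Qed.

Lemma noncover_gauss (b : nat -> nat) (eta : R) : 0 < eta < 1 ->
  ((b n)%:R : R) @[n --> \oo] --> +oo -> (b n)%:R / n%:R @[n --> \oo] --> (0 : R) ->
  P (noncover X b eta n) @[n --> \oo] --> eta%:E.
Proof.
move=> eta01 bY b0; have /andP[h0 h1] := eta01.
have [c1 Fc1] : exists c, F c = eta / 2 by apply: F_hit; lra.
have [c2 Fc2] : exists c, F c = 1 - eta / 2 by apply: F_hit; lra.
have Fl x y : x < y -> F x < F y by move=> xy; apply: gcdf_lt; rewrite ltr_pM2r ?invr_gt0// ltr_pM2r.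
have cF := lip_cont F_lip.
apply: (@noncover_to_eta _ _ _ P X mX sX b (natr_cvgy bY) b0 (fv_alpha0 mX eps0 mom mixing) eta c1 c2 1 F) => //.
- by move=> x _; exact: Tstat_gauss.
- by move=> x _; exact: Tstat_gauss.
- exact: cF.
- exact: cF.
- by move=> x; rewrite -Fc1; exact: Fl.
- by move=> x; rewrite -Fc1; exact: Fl.
- by move=> x; rewrite -Fc2; exact: Fl.
- by move=> x; rewrite -Fc2; exact: Fl.
Qed.

End FVcoverage.

(** * Coverage in the stable case *)

Section PositivePart.
Context {R : realType}.

(** [dist_limit] speaks of bounded continuous functions; with this form of the positive part, the
    continuity of the test functions below reduces to that of the norm. *)
Definition ppart (t : R) : R := (t + `|t|) / 2.

Lemma ppart_ge t : 0 <= t -> ppart t = t.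
Proof. by move=> t0; rewrite /ppart ger0_norm//; field. Qed.

Lemma ppart_le t : t <= 0 -> ppart t = 0.
Proof. by move=> t0; rewrite /ppart ler0_norm// subrr mul0r. Qed.

Lemma ppart_ge0 t : 0 <= ppart t.
Proof. by have [h|/ltW h] := leP 0 t; rewrite ?(ppart_ge h)// (ppart_le h). Qed.

Lemma ppart_gt0 t : (0 < ppart t) = (0 < t).
Proof.
have [h|h] := leP t 0; first by rewrite (ppart_le h) ltxx.
by rewrite (ppart_ge (ltW h)).
Qed.

Lemma ppart_homo s t : s <= t -> ppart s <= ppart t.
Proof.
have [h|/ltW h] := leP s 0; first by rewrite (ppart_le h) ppart_ge0.
by move=> st; rewrite (ppart_ge h) ppart_ge// (le_trans h).
Qed.

Lemma ppart_cont (U : topologicalType) (f : U -> R) : continuous f ->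
  continuous (fun u => ppart (f u)).
Proof.
move=> cf u; apply: cvgM; last exact: cvg_cst.
by apply: cvgD; [exact: cf|apply: cvg_norm; exact: cf].
Qed.

Definition ramp (x r t : R) : R := ppart (1 - ppart (t - x) / r).

Lemma ramp_le1 x r t : 0 < r -> ramp x r t <= 1.
Proof.
move=> r0; rewrite -[leRHS](ppart_ge (@ler01 R)); apply: ppart_homo.
by rewrite lerBlDr lerDl divr_ge0 ?ppart_ge0// ltW.
Qed.

Lemma ramp_bnd x r t : 0 < r -> `|ramp x r t| <= 1.
Proof. by move=> r0; rewrite ger0_norm ?ppart_ge0// ramp_le1. Qed.

Lemma ramp_1 x r t : 0 < r -> t <= x -> ramp x r t = 1.
Proof.
by move=> r0 tx; rewrite /ramp (@ppart_le (t - x)) ?subr_le0// mul0r subr0 ppart_ge.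
Qed.

Lemma ramp_0 x r t : 0 < r -> x + r <= t -> ramp x r t = 0.
Proof.
move=> r0 h; have h1 : r <= t - x by rewrite lerBrDl.
by rewrite /ramp ppart_le// (@ppart_ge (t - x)) ?(le_trans (ltW r0))// subr_le0 ler_pdivlMr// mul1r.
Qed.

Lemma ramp_cont x r : continuous (ramp x r).
Proof.
apply: ppart_cont => t; apply: cvgB; first exact: cvg_cst.
apply: cvgM; last exact: cvg_cst.
by apply: (@ppart_cont R (fun t => t - x)) => s; apply: cvgB; [exact: cvg_id|exact: cvg_cst].
Qed.

End PositivePart.

Section MoreMeas.
Context {R : realType} {d : measure_display} {T : measurableType d}.
Variable P : probability T R.

(** [g^-1 = g * (g ^ 2)^-1], at 0 as well, reduces a denominator of any sign to a nonnegative
    one. *)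
Lemma meas_div (f g : T -> R) : measurable_fun setT f -> measurable_fun setT g ->
  measurable_fun setT (fun w => f w / g w).
Proof.
move=> mf mg; rewrite (_ : (fun w => _) = (fun w => f w * (g w * (g w ^+ 2)^-1))).
  apply: measurable_funM => //; apply: measurable_funM => //.
  by apply: meas_inv_ge0; [exact: measurable_funX|move=> u; exact: sqr_ge0].
apply/funext => w; congr (_ * _); have [->|g0] := eqVneq (g w) 0; first by rewrite invr0 mul0r.
by rewrite expr2; field.
Qed.

Lemma pr_tail (f : T -> R) (e : R) : measurable_fun setT f -> 0 < e ->
  exists2 M, 0 < M & pr P [set w | M <= `|f w|] <= e.
Proof.
move=> mf e0; have ma : measurable_fun setT (fun w => `|f w|) by exact: measurableT_comp.
pose A (n : nat) := [set w | n%:R <= `|f w|].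
have mA n : measurable (A n) by exact: (meas_le (measurable_cst _) ma).
have [|||||_ _] := @dominated_convergence _ T R P setT measurableT
   (fun n w => (\1_(A n) w)%:E) (fun=> 0%E) (fun w => 1%:E).
- by move=> n; exact/measurable_EFinP.
- exact: measurable_cst.
- apply: aeW => w _; apply: cvg_near_cst.
  apply: filterS (near_natr (`|f w| + 1)) => n h; rewrite indicE memNset//= /A/= => h1.
  by have := le_trans h h1; rewrite gerDl ler10.
- exact: (@Lint_cst _ _ _ P 1).
- by apply: aeW => w n _; rewrite lee_fin indicE ger0_norm// lern1 leq_b1.
rewrite integral_cst//= mul0e => h.
have h' : rE P (\1_(A n)) @[n --> \oo] --> (0 : R).
  have := @fine_cvg _ _ _ _ (fun n => (\int[P]_w (\1_(A n) w)%:E)%E) 0 h; exact.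
move/cvg_nearP: h' => /(_ e e0) [N _ hN].
exists N.+1%:R; first by rewrite ltr0n.
have := hN N.+1 (leqnSn N); rewrite subr0 rE_indic// => /ltW; apply: le_trans.
exact: ler_norm.
Qed.

End MoreMeas.

Section NearLimit.
Context {R : realType}.

Lemma lim_le_near (u : nat -> R) (l e : R) : u n @[n --> \oo] --> l ->
  (\forall n \near \oo, u n <= e) -> l <= e.
Proof.
move/cvg_nearP => h1 h2; apply/ler_addgt0Pr => t t0.
have [n [a1 a2]] : exists n, `|u n - l| < t /\ u n <= e.
  by have [N _ hN] := filterI (h1 t t0) h2; exists N; exact: (hN N (leqnn N)).
move: a1; rewrite ltr_norml => /andP[a1 _]; rewrite ltrBrDl in a1.
by rewrite -lerBlDr; apply: le_trans (ltW a1) a2.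
Qed.

End NearLimit.

(** * Weak limit of the self-normalized sum *)

Section WeakLimit.
Context {R : realType} {d : measure_display} {T : measurableType d}.
Variable P : probability T R.
Variable X : int -> T -> R.
Hypothesis mX : forall t, measurable_fun setT (X t).
Hypothesis sX : stationary P X.
Variables (kappa : R) (a : nat -> R).
Hypothesis kap : 1 < kappa < 2.
Hypothesis rv : regvar P (X 0) kappa.
Hypothesis na : norming P X a.
Hypothesis ac : AC_MX P X a.
Context {d' : measure_display} {T' : measurableType d'}.
Variables (Q : probability T' R) (xi zeta : T' -> R).
Hypothesis dl : dist_limit P X a Q xi zeta.

Let mxi : measurable_fun setT xi. Proof. by case: dl. Qed.
Let mzeta : measurable_fun setT zeta. Proof. by case: dl => _ []. Qed.
Let rho w := xi w / zeta w.

Lemma ratio_meas : measurable_fun setT rho. Proof. exact: meas_div. Qed.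

Let aY : a n @[n --> \oo] --> +oo. Proof. by case: na. Qed.

Lemma a_near_gt0 : \forall n \near \oo, 0 < a n.
Proof. by apply: filterS (a_ge aY 1) => n; apply: lt_le_trans. Qed.

Let mS n : measurable_fun setT (Ssum X 1 n) := Ssum_meas mX n 1.
Let mQ n : measurable_fun setT (Qsum X 1 n) := Qsum_meas mX n 1.

Lemma dist_limit_rE (f : R * R -> R) (M : R) : continuous f -> (forall v, `|f v| <= M) ->
  rE P (fun w => f (Ssum X 1 n w / a n, Qsum X 1 n w / a n)) @[n --> \oo]
    --> rE Q (fun w => f (xi w, zeta w)).
Proof. by case: dl => _ [_ h] cf bf; apply: h => //; exists M. Qed.

(** [Qsum_lower] keeps [Qsum / a] away from 0 with high probability for all large [n], and a ramp
    from [r / 2] to [r] carries this over to [zeta]. A single radius serves both laws. *)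
Lemma zeta_pos (e : R) : 0 < e -> exists2 r : R, 0 < r &
  pr Q [set w | zeta w <= r] <= e /\ \forall n \near \oo, pr P [set w | Qsum X 1 n w <= r * a n] <= e.
Proof.
move=> e0; have [r r0 hr] := Qsum_lower mX sX kap rv na ac e0.
have r2 : 0 < r / 2 by rewrite divr_gt0.
have rr : r / 2 + r / 2 = r by rewrite -splitr.
exists (r / 2) => //; split; last first.
  apply: filterS2 hr a_near_gt0 => n h a0; apply: le_trans h; apply: pr_le.
  - by apply: meas_le.
  - by apply: meas_le.
  - move=> w /= h; apply: le_trans h _; rewrite ler_pM2r//.
    by rewrite ler_pdivrMr// ler_pMr// (ler1n R 2).
pose f (v : R * R) := ramp (r / 2) (r / 2) v.2.
have cf : continuous f.
  by move=> v; apply: (@continuous_comp _ _ _ snd (ramp (r / 2) (r / 2))); [exact: cvg_snd|exact: ramp_cont].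
have bf v : `|f v| <= 1 by exact: ramp_bnd.
have lim := dist_limit_rE cf bf.
have mzr : measurable [set w | zeta w <= r / 2] by exact: meas_le.
apply: (@le_trans _ _ (rE Q (fun w => f (xi w, zeta w)))).
  rewrite -rE_indic//; apply: rE_le; first exact: Lint_indic.
    apply: (Lint_bnd 1) => [|w]; last exact: bf.
    by apply: (measurableT_comp (continuous_measurable_fun (@ramp_cont R (r / 2) (r / 2)))).
  move=> w; rewrite indicE /f/=; have [|_] := boolP (w \in _); last exact: ppart_ge0.
  by rewrite inE/= => h; rewrite ramp_1.
apply: (lim_le_near lim); apply: filterS2 hr a_near_gt0 => n h a0; apply: le_trans h.
have mA : measurable [set w | Qsum X 1 n w <= r * a n] by exact: meas_le.
rewrite -rE_indic//; apply: rE_le.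
- apply: (Lint_bnd 1) => [|w]; last exact: bf.
  apply: (measurableT_comp (continuous_measurable_fun (@ramp_cont R (r / 2) (r / 2)))).
  by apply: measurable_funM.
- exact: Lint_indic.
move=> w; rewrite indicE /f/=; have [_|] := boolP (w \in _); first exact: ramp_le1.
rewrite notin_setE/= => /negP; rewrite -ltNge => h.
by rewrite ramp_0// rr ler_pdivlMr// ltW.
Qed.

(** The quotient is discontinuous at a zero denominator. Replacing the denominator by its maximum
    with [r] (the function [g]) restores continuity and costs, under either law, [2 * M] times the
    probability that it is at most [r]. *)
Lemma Tstat_weak (h : R -> R) (M : R) : continuous h -> (forall t, `|h t| <= M) ->
  rE P (fun w => h (Tstat X n w)) @[n --> \oo] --> rE Q (fun w => h (rho w)).
Proof.
move=> ch bh; apply/cvg_nearP => e e0.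
have M0 : 0 <= M by apply: le_trans (bh 0).
have mh := continuous_measurable_fun ch.
pose e' := e / (6 * (M + 1)).
have e'0 : 0 < e' by rewrite divr_gt0// mulr_gt0// ltr_wpDl.
have he : 2 * M * e' + 2 * M * e' + e / 6 < e.
  have M1 : 0 < M + 1 by rewrite ltr_wpDl.
  have : M * e' <= e / 6.
    rewrite /e' mulrA ler_pdivrMr ?mulr_gt0//.
    have -> : e / 6 * (6 * (M + 1)) = M * e + e by field.
    by rewrite lerDl ltW.
  by rewrite -!mulrA; move: (M * e') => x; lra.
have [r r0 [hz hq]] := zeta_pos e'0.
pose g (z : R) := r + ppart (z - r).
have gp z : 0 < g z by rewrite ltr_wpDr// ppart_ge0.
have gE z : r < z -> g z = z.
  by move=> rz; rewrite /g ppart_ge ?subr_ge0 ?ltW// subrKC.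
have cg : continuous g.
  move=> z; apply: cvgD; first exact: cvg_cst.
  by apply: (@ppart_cont R R (fun z => z - r)) => s; apply: cvgB; [exact: cvg_id|exact: cvg_cst].
pose f (v : R * R) := h (v.1 / g v.2).
have cf : continuous f.
  move=> v; apply: (@continuous_comp _ _ _ (fun v : R * R => v.1 / g v.2) h); last exact: ch.
  apply: cvgM; first exact: cvg_fst.
  apply: cvgV; first by rewrite gt_eqF.
  by apply: (@continuous_comp _ _ _ snd g); [exact: cvg_snd|exact: cg].
have bf v : `|f v| <= M by exact: bh.
have /cvg_nearP lim := dist_limit_rE cf bf.
have e6 : 0 < e / 6 by rewrite divr_gt0.
have mf dU (U : measurableType dU) (u v : U -> R) : measurable_fun setT u -> measurable_fun setT v ->
    measurable_fun setT (fun w => f (u w, v w)).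
  move=> mu mv; apply: (measurableT_comp mh); apply: meas_div => //.
  exact: (measurableT_comp (continuous_measurable_fun cg)).
have diff dU (U : measurableType dU) (PU : probability U R) (u v : U -> R) :
    measurable_fun setT u -> measurable_fun setT v ->
    `|rE PU (fun w => h (u w / v w)) - rE PU (fun w => f (u w, v w))| <=
      2 * M * pr PU [set w | v w <= r].
  move=> mu mv; have mA : measurable [set w | v w <= r] by exact: meas_le.
  have L1 : Lint PU (fun w => h (u w / v w)).
    by apply: (Lint_bnd M) => //; apply: (measurableT_comp mh); exact: meas_div.
  have L2 : Lint PU (fun w => f (u w, v w)) by apply: (Lint_bnd M) => //; exact: mf.
  rewrite -(rEB L1 L2) -rE_indic// -rEZ; last exact: Lint_indic.
  apply: rE_abs_le; [exact: LintB|apply: LintZ; exact: Lint_indic|] => w.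
  rewrite indicE; have [_|] := boolP (w \in _).
    by rewrite mulr1 mulr_natl mulr2n (le_trans (ler_normB _ _))// lerD.
  by rewrite notin_setE/= => /negP; rewrite -ltNge => rv'; rewrite /f/= gE// subrr normr0 mulr0.
have d1 := diff _ _ Q xi zeta mxi mzeta.
apply: filterS3 (lim _ e6) hq a_near_gt0 => n h1 h2 a0.
have d2 := diff _ _ P (fun w => Ssum X 1 n w / a n) (fun w => Qsum X 1 n w / a n)
  (measurable_funM (mS n) (measurable_cst _)) (measurable_funM (mQ n) (measurable_cst _)).
have TE : (fun w => h (Tstat X n w)) = (fun w => h (Ssum X 1 n w / a n / (Qsum X 1 n w / a n))).
  by apply/funext => w; congr h; rewrite /Tstat invf_div mulrA divfK// gt_eqF.
have QE : [set w | Qsum X 1 n w / a n <= r] = [set w | Qsum X 1 n w <= r * a n].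
  by apply/seteqP; split => w /=; rewrite ler_pdivrMr.
rewrite QE -TE in d2; apply: le_lt_trans he.
set x1 := rE P (fun w => h _) in d2 *; set x2 := rE P (fun w => f _) in d2 h1.
set x3 := rE Q (fun w => h _) in d1 *; set x4 := rE Q (fun w => f _) in d1 h1.
have -> : x1 - x3 = (x1 - x2) + (x4 - x3) + (x2 - x4) by ring.
apply: le_trans (ler_normD _ _) _; apply: lerD; last exact: ltW.
apply: le_trans (ler_normD _ _) _; apply: lerD.
  by apply: le_trans d2 _; apply: ler_wpM2l => //; rewrite mulr_ge0.
by rewrite distrC; apply: le_trans d1 _; apply: ler_wpM2l => //; rewrite mulr_ge0.
Qed.

Let F := ratio_cdf Q xi zeta.

Let mrho x : measurable [set w | rho w <= x].
Proof. by apply: meas_le => //; exact: ratio_meas. Qed.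

Lemma ratio_cdf_le x y : x <= y -> F x <= F y.
Proof. by move=> xy; apply: pr_le => // w /= h; exact: le_trans xy. Qed.

Lemma ratio_cdf_tail (e : R) : 0 < e -> exists2 M, 0 < M & F (- M) <= e /\ 1 - e <= F M.
Proof.
move=> e0; have [M M0 hM] := pr_tail Q ratio_meas e0.
have mA : measurable [set w | M <= `|rho w|].
  by apply: meas_le => //; apply: measurableT_comp => //; exact: ratio_meas.
exists M => //; split.
  apply: le_trans hM; apply: pr_le => // w /= h.
  by rewrite -normrN (le_trans _ (ler_norm _))// lerNr.
rewrite lerBlDr -lerBlDl -[F M]/(pr Q [set w | rho w <= M]) -pr_setC//; apply: le_trans hM; apply: pr_le => //.
  exact: measurableC.
by move=> w /= /negP; rewrite -ltNge => h; rewrite (le_trans (ltW h))// ler_norm.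
Qed.

(** The upper bound uses a ramp that starts to fall at [x], the lower bound one that has reached 0
    at [x]. *)
Lemma Tstat_cdf_cvg x : {for x, continuous F} ->
  pr P [set w | Tstat X n w <= x] @[n --> \oo] --> F x.
Proof.
move=> cF; apply/cvg_nearP => e e0; have e2 : 0 < e / 2 by rewrite divr_gt0.
have [r r0 hr] : exists2 r, 0 < r & forall y, `|x - y| <= r -> `|F x - F y| < e / 2.
  have : \forall t \near nbhs x, `|F x - F t| < e / 2.
    by apply: (@cvgr_dist_lt _ _ _ (nbhs x) _ F (F x) cF).
  move=> /nbhs_normP[r r0 h]; exists (r / 2); first by rewrite divr_gt0.
  move=> y hy; apply: h => /=; apply: le_lt_trans hy _.
  by rewrite ltr_pdivrMr// ltr_pMr// (ltr1n R 2).
have mramp (y : R) dU (U : measurableType dU) (PU : probability U R) (u : U -> R) :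
    measurable_fun setT u -> Lint PU (fun w => ramp y r (u w)).
  move=> mu; apply: (Lint_bnd 1) => [|w]; last exact: ramp_bnd.
  exact: (measurableT_comp (continuous_measurable_fun (@ramp_cont R y r))).
have up (y : R) dU (U : measurableType dU) (PU : probability U R) (u : U -> R) :
    measurable_fun setT u -> pr PU [set w | u w <= y] <= rE PU (fun w => ramp y r (u w)).
  move=> mu; have mA : measurable [set w | u w <= y] by exact: meas_le.
  rewrite -rE_indic//; apply: rE_le; [exact: Lint_indic|exact: mramp|] => w.
  rewrite indicE; have [|_] := boolP (w \in _); last exact: ppart_ge0.
  by rewrite inE/= => h; rewrite ramp_1.
have lo (y : R) dU (U : measurableType dU) (PU : probability U R) (u : U -> R) :
    measurable_fun setT u -> rE PU (fun w => ramp y r (u w)) <= pr PU [set w | u w <= y + r].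
  move=> mu; have mA : measurable [set w | u w <= y + r] by exact: meas_le.
  rewrite -rE_indic//; apply: rE_le; [exact: mramp|exact: Lint_indic|] => w.
  rewrite indicE; have [_|] := boolP (w \in _); first exact: ramp_le1.
  by rewrite notin_setE/= => /negP; rewrite -ltNge => h; rewrite ramp_0// ltW.
have l1 := @Tstat_weak (ramp x r) 1 (@ramp_cont R x r) (fun t => ramp_bnd x t r0).
have l2 := @Tstat_weak (ramp (x - r) r) 1 (@ramp_cont R (x - r) r) (fun t => ramp_bnd (x - r) t r0).
have u1 := lo x _ _ Q rho ratio_meas.
have u2 := up (x - r) _ _ Q rho ratio_meas.
have f1 : F (x + r) < F x + e / 2.
  have := hr (x + r); rewrite opprD addrA subrr add0r normrN gtr0_norm// => /(_ (lexx _)).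
  by rewrite ltr_norml => /andP[h _]; rewrite ltrBrDl ltrBlDr in h.
have f2 : F x - e / 2 < F (x - r).
  have := hr (x - r); rewrite opprB addrC subrK gtr0_norm// => /(_ (lexx _)).
  by rewrite ltr_norml => /andP[_ h]; rewrite ltrBlDr addrC -ltrBlDr.
move/cvg_nearP : l1 => /(_ _ e2); move/cvg_nearP : l2 => /(_ _ e2); apply: filterS2 => n h2 h1.
have v1 := up x _ _ P _ (Tsub_meas mX n 1 : measurable_fun setT (Tstat X n)).
have v2 := lo (x - r) _ _ P _ (Tsub_meas mX n 1 : measurable_fun setT (Tstat X n)).
rewrite subrK in v2.
move: h1 h2; rewrite !ltr_norml => /andP[_ h1] /andP[h2 _].
rewrite ltrBlDl in h1; rewrite ltrBrDl in h2.
apply/andP; split.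
  rewrite ltrBrDl; apply: lt_le_trans v2; apply: le_lt_trans h2.
  by rewrite [X in _ - X <= _](splitr e) opprD addrA lerD2r; exact: le_trans (ltW f2) u2.
rewrite ltrBlDl; apply: le_lt_trans v1 _; apply: lt_le_trans h1 _.
by rewrite [X in _ <= _ + X](splitr e) addrA lerD2r; exact: le_trans u1 (ltW f1).
Qed.

End WeakLimit.

Section SupportPoint.
Context {R : realType} {d : measure_display} {T : measurableType d}.
Variable P : probability T R.

(* Only countably many boxes are needed, so the union of the null ones is null and
   misses some point of [A]. *)
Lemma support_point (u v : T -> R) (A : set T) : measurable_fun setT u -> measurable_fun setT v ->
  measurable A -> 0 < pr P A ->
  exists2 w0, A w0 & forall e : R, 0 < e ->
    0 < pr P [set w | `|u w - u w0| < e /\ `|v w - v w0| < e].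
Proof.
move=> mu mv mA A0.
have mB (x y e : R) : measurable [set w | `|u w - x| < e /\ `|v w - y| < e].
  rewrite (_ : [set w | _] = [set w | `|u w - x| < e] `&` [set w | `|v w - y| < e])//.
  by apply: measurableI; apply: meas_lt => //; apply: measurableT_comp => //; exact: measurable_funB.
pose box (c : int * int * nat) : set T :=
  [set w | `|u w - c.1.1%:~R / c.2.+1%:R| < c.2.+1%:R^-1 /\ `|v w - c.1.2%:~R / c.2.+1%:R| < c.2.+1%:R^-1].
pose F (n : nat) : set T := if unpickle n is Some c then
  (if P (box c) == 0%E then box c else set0) else set0.
have FE c : F (pickle c) = if P (box c) == 0%E then box c else set0 by rewrite /F pickleK.
have nF : P.-negligible (\bigcup_n F n).
  apply: negligible_bigcup => n; rewrite /F; case: unpickle => [c|]; last exact: negligible_set0.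
  case: eqP => [h|_]; last exact: negligible_set0.
  by apply/negligibleP; [exact: mB|].
apply: contrapT => H.
have AF : A `<=` \bigcup_n F n.
  move=> w0 Aw0; apply: contrapT => nw; apply: H; exists w0 => // e e0.
  have [k hk] : exists k : nat, 2 / k.+1%:R <= e.
    have [N _ hN] := @near_small_inv R 2 e e0; exists N; exact: (hN N.+1 (leqnSn N)).
  have k0 : (0 : R) < k.+1%:R by [].
  have fl (x : R) : `|x - (Num.floor (x * k.+1%:R))%:~R / k.+1%:R| < k.+1%:R^-1.
    have /andP[h1 h2] := floor_itv (x * k.+1%:R).
    have -> : x - (Num.floor (x * k.+1%:R))%:~R / k.+1%:R =
      (x * k.+1%:R - (Num.floor (x * k.+1%:R))%:~R) / k.+1%:R by field.
    rewrite normrM [`|k.+1%:R^-1|]ger0_norm// -[ltRHS]mul1r ltr_pM2r ?invr_gt0//.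
    rewrite ger0_norm ?subr_ge0// ltrBlDl; by rewrite intrD in h2.
  pose c := (Num.floor (u w0 * k.+1%:R), Num.floor (v w0 * k.+1%:R), k).
  have bw : box c w0 by split; exact: fl.
  have : P (box c) != 0%E.
    apply/negP => z; apply: nw; exists (pickle c); [by []|rewrite (FE c) z; exact: bw].
  move=> z; apply: (@lt_le_trans _ _ (pr P (box c))).
    by rewrite lt_def pr_ge0 andbT; apply: contra z => /eqP z; rewrite -EFin_pr ?z//; exact: mB.
  apply: pr_le; [exact: mB|exact: mB|] => w [h1 h2]; case: bw => g1 g2.
  have tri (x y t : R) : `|x - t| < k.+1%:R^-1 -> `|y - t| < k.+1%:R^-1 -> `|x - y| < e.
    move=> a1 a2; apply: lt_le_trans hk; rewrite mulr_natl mulr2n.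
    have -> : x - y = (x - t) - (y - t) by ring.
    by apply: le_lt_trans (ler_normB _ _) _; exact: ltrD.
  by split; [exact: tri h1 g1|exact: tri h2 g2].
have : P.-negligible A by exact: negligibleS nF.
move/(negligibleP _ mA) => z; by move: A0; rewrite /pr z ltxx.
Qed.

End SupportPoint.

Section Interpolation.
Context {R : realType}.

(** As [l] grows from 0, the ratio moves from [x1 / z1 <= c] towards [x2 / z2 >= c'], so it takes
    the value [m] on the way. *)
Lemma interpolate (x1 z1 x2 z2 c c' m : R) : 0 < z1 -> 0 < z2 -> x1 <= c * z1 -> c' * z2 <= x2 ->
  c < m -> m < c' ->
  exists2 l, 0 < l & x1 + l * x2 = m * Num.sqrt (z1 ^+ 2 + l ^+ 2 * z2 ^+ 2).
Proof.
move=> z10 z20 hx1 hx2 cm mc.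
pose s l := Num.sqrt (z1 ^+ 2 + l ^+ 2 * z2 ^+ 2).
pose g l := x1 + l * x2 - m * s l.
have cs : continuous s.
  move=> l; apply: (@continuous_comp R R R (fun l : R => z1 ^+ 2 + l ^+ 2 * z2 ^+ 2) (@Num.sqrt R)); last exact: sqrt_continuous.
  apply: cvgD; first exact: cvg_cst.
  by apply: cvgM; [apply: cvgM; exact: cvg_id|exact: cvg_cst].
have cg : continuous g.
  move=> l; apply: cvgB; last by apply: cvgM; [exact: cvg_cst|exact: cs].
  by apply: cvgD; [exact: cvg_cst|apply: cvgM; [exact: cvg_id|exact: cvg_cst]].
have g0 : g 0 < 0.
  rewrite /g /s mul0r addr0 expr0n/= mul0r addr0 sqrtr_sqr gtr0_norm// subr_lt0.
  by apply: le_lt_trans hx1 _; rewrite ltr_pM2r.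
(* The solution of [L * z2 * (c' - m) = |x1| + |m| * z1 + 1]: the advantage of the second point
   outweighs whatever comes from the first. *)
pose L := (`|x1| + `|m| * z1 + 1) / (z2 * (c' - m)).
have cm0 : 0 < c' - m by rewrite subr_gt0.
have L0 : 0 < L.
  by rewrite divr_gt0 ?mulr_gt0// ltr_wpDl// addr_ge0// mulr_ge0// ltW.
have sL1 : s L <= z1 + L * z2.
  have p1 : 0 <= z1 + L * z2 := addr_ge0 (ltW z10) (mulr_ge0 (ltW L0) (ltW z20)).
  rewrite -(ger0_norm p1) -sqrtr_sqr; apply: ler_wsqrtr.
  rewrite -subr_ge0 (_ : _ - _ = 2 * (z1 * (L * z2))); last by move: (L) => L'; ring.
  exact: mulr_ge0 (ler0n R 2) (mulr_ge0 (ltW z10) (mulr_ge0 (ltW L0) (ltW z20))).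
have sL2 : L * z2 <= s L.
  have p1 : 0 <= L * z2 := mulr_ge0 (ltW L0) (ltW z20).
  rewrite -(ger0_norm p1) -sqrtr_sqr; apply: ler_wsqrtr.
  by rewrite exprMn lerDr sqr_ge0.
have gL : 0 < g L.
  have h1 : m * s L <= m * (L * z2) + `|m| * z1.
    have [m0|m0] := leP 0 m.
      by rewrite ger0_norm// -mulrDr ler_wpM2l// addrC.
    rewrite ler_wpDr ?mulr_ge0// ?(ltW z10)//; exact: (ler_wnM2l (ltW m0)).
  have h2 : L * (c' * z2) <= L * x2 by rewrite ler_pM2l.
  have h3 : L * z2 * (c' - m) = `|x1| + `|m| * z1 + 1.
    by rewrite -mulrA /L divfK// mulf_neq0// gt_eqF.
  have h4 : - `|x1| <= x1 by rewrite lerNl -normrN ler_norm.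
  rewrite /g subr_gt0; apply: le_lt_trans h1 _.
  have h5 : L * z2 * (c' - m) = L * (c' * z2) - m * (L * z2) by ring.
  rewrite h5 in h3; move: h2 h3 h4; move: (L * (c' * z2)) (L * x2) (m * (L * z2)) (`|m| * z1) `|x1|.
  by move=> *; lra.
have [|l lI gl] := @IVT R g 0 L 0 (ltW L0) (continuous_subspaceT cg).
  by rewrite ge_min (ltW g0)/= le_max (ltW gL) orbT.
exists l; last by apply/eqP; rewrite -subr_eq0; apply/eqP.
move: lI; rewrite in_itv/= => /andP[l0 _]; rewrite lt_def l0 andbT.
by apply/eqP => z; rewrite z in gl; rewrite gl ltxx in g0.
Qed.

Lemma mul_near (r s l x e M : R) : 0 <= e <= 1 -> `|r - l| <= e -> `|s - x| <= e -> `|l| <= M -> `|x| <= M ->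
  `|r * s - l * x| <= (2 * M + 1) * e.
Proof.
move=> /andP[e0 e1] h1 h2 hl hx.
have -> : r * s - l * x = l * (s - x) + (r - l) * x + (r - l) * (s - x) by ring.
rewrite (_ : (2 * M + 1) * e = M * e + e * M + e * 1); last by ring.
apply: le_trans (ler_normD _ _) _; apply: lerD.
  by apply: le_trans (ler_normD _ _) _; rewrite !normrM; apply: lerD; apply: ler_pM.
by rewrite normrM; apply: ler_pM => //; exact: le_trans h2 e1.
Qed.

(* The self-normalized sum of two blocks and a short gap, as a function of the
   normalized sums of the two blocks, the gap and the ratio of the two scales. *)
Lemma two_block_near (x1 z1 x2 z2 l m h : R) : 0 < z1 -> 0 < z2 -> 0 < l -> 0 < h ->
  x1 + l * x2 = m * Num.sqrt (z1 ^+ 2 + l ^+ 2 * z2 ^+ 2) ->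
  exists2 e, 0 < e & forall s1 q1 s2 q2 u v r,
    `|s1 - x1| <= e -> `|q1 - z1| <= e -> `|s2 - x2| <= e -> `|q2 - z2| <= e ->
    `|u| <= e -> `|v| <= e -> `|r - l| <= e ->
    `|(s1 + u + r * s2) / Num.sqrt (q1 ^+ 2 + v ^+ 2 + (r * q2) ^+ 2) - m| <= h.
Proof.
move=> z10 z20 l0 h0 E; set D := Num.sqrt _ in E.
have D20 : 0 < z1 ^+ 2 + l ^+ 2 * z2 ^+ 2 by rewrite addr_gt0 ?mulr_gt0 ?exprn_gt0.
have D0 : 0 < D by rewrite sqrtr_gt0.
have DD : D ^+ 2 = z1 ^+ 2 + l ^+ 2 * z2 ^+ 2 by rewrite sqr_sqrtr ?ltW.
pose M := Order.max `|l| (Order.max `|x2| (Order.max z1 (Order.max z2 (l * z2)))).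
have [Ml Mx2 Mz1 Mz2 Mlz] : [/\ `|l| <= M, `|x2| <= M, z1 <= M, z2 <= M & l * z2 <= M].
  by split; rewrite /M !le_max lexx ?orbT.
have M0 : 0 <= M by apply: le_trans Ml.
pose K := 2 * M + 1; have K0 : 0 < K by rewrite /K ltr_wpDl// mulr_ge0.
pose B := K + 1 + (2 * M + 1) * K; pose A := 2 + K.
have B0 : 0 < B by rewrite /B -/K (addr_gt0 (addr_gt0 K0 ltr01) (mulr_gt0 K0 K0)).
have A0 : 0 < A by rewrite addr_gt0.
pose C := A + (`|m| + h) * (B / D).
have C0 : 0 < C by rewrite /C ltr_wpDr// mulr_ge0 ?addr_ge0 ?divr_ge0// ltW.
(* The bound by [K^-1] allows a second use of [mul_near], for the square of a product; the third
   keeps the quantity under the root at least [D ^ 2 / 2]; the last gives the final accuracy. *)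
pose e := Order.min 1 (Order.min K^-1 (Order.min (D ^+ 2 / 2 / B) (h * D / C))).
have e0 : 0 < e by rewrite !lt_min ltr01 invr_gt0 K0 !divr_gt0 ?mulr_gt0 ?exprn_gt0.
have [e1 eK eB eC] : [/\ e <= 1, K * e <= 1, B * e <= D ^+ 2 / 2 & C * e <= h * D].
  split; first by rewrite ge_min lexx.
  - by rewrite mulrC -ler_pdivlMr// div1r !ge_min lexx !orbT.
  - by rewrite mulrC -ler_pdivlMr// !ge_min lexx !orbT.
  - by rewrite mulrC -ler_pdivlMr// !ge_min lexx !orbT.
have e01 : 0 <= e <= 1 by rewrite (ltW e0).
exists e => // s1 q1 s2 q2 u v r hs1 hq1 hs2 hq2 hu hv hr.
set num := s1 + u + r * s2; set W := _ + _ + _.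
have hnum : `|num - m * D| <= A * e.
  rewrite -E (_ : num - _ = (s1 - x1) + u + (r * s2 - l * x2)); last by rewrite /num; ring.
  rewrite (_ : A * e = e + e + K * e); last by rewrite /A; ring.
  apply: le_trans (ler_normD _ _) _; apply: lerD; last exact: mul_near.
  by apply: le_trans (ler_normD _ _) _; exact: lerD.
have z1M : `|z1| <= M by rewrite ger0_norm// ltW.
have z2M : `|z2| <= M by rewrite ger0_norm// ltW.
have lzM : `|l * z2| <= M by rewrite ger0_norm// ltW// mulr_gt0.
have hrq := mul_near e01 hr hq2 Ml z2M.
have hq11 : `|q1 ^+ 2 - z1 ^+ 2| <= K * e by rewrite !expr2; exact: mul_near.
have Ke01 : 0 <= K * e <= 1 by rewrite mulr_ge0 ?(ltW K0) ?(ltW e0).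
have hrq2 : `|(r * q2) ^+ 2 - (l * z2) ^+ 2| <= (2 * M + 1) * (K * e) by rewrite !expr2; exact: mul_near.
have hW : `|W - D ^+ 2| <= B * e.
  rewrite DD (_ : W - _ = (q1 ^+ 2 - z1 ^+ 2) + v ^+ 2 + ((r * q2) ^+ 2 - (l * z2) ^+ 2)); last by rewrite /W; ring.
  rewrite (_ : B * e = K * e + e + (2 * M + 1) * (K * e)); last by rewrite /B; ring.
  apply: le_trans (ler_normD _ _) _; apply: lerD => //.
  apply: le_trans (ler_normD _ _) _; apply: lerD => //.
  rewrite normrX expr2 -[leRHS]mulr1; apply: ler_pM => //; exact: le_trans hv e1.
have W0 : 0 < W.
  have : `|W - D ^+ 2| <= D ^+ 2 / 2 by apply: le_trans hW eB.
  rewrite ler_norml => /andP[hh _]; rewrite lerBrDl in hh; apply: lt_le_trans hh.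
  by rewrite [X in X - _]splitr addrK divr_gt0// exprn_gt0.
have hden : `|Num.sqrt W - D| <= B / D * e.
  rewrite mulrAC ler_pdivlMr//; apply: le_trans hW.
  have -> : W - D ^+ 2 = (Num.sqrt W - D) * (Num.sqrt W + D) by rewrite -subr_sqr (sqr_sqrtr (ltW W0)).
  rewrite normrM; apply: ler_wpM2l => //.
  by rewrite ger0_norm ?addr_ge0 ?sqrtr_ge0 ?(ltW D0)// lerDr sqrtr_ge0.
have sW : 0 < Num.sqrt W by rewrite sqrtr_gt0.
have -> : num / Num.sqrt W - m = (num - m * Num.sqrt W) / Num.sqrt W by field; rewrite gt_eqF.
rewrite normrM [`|(Num.sqrt W)^-1|]ger0_norm ?invr_ge0 ?sqrtr_ge0// ler_pdivrMr//.
have -> : num - m * Num.sqrt W = (num - m * D) - m * (Num.sqrt W - D) by ring.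
apply: le_trans (ler_normB _ _) _; rewrite normrM.
apply: (@le_trans _ _ (A * e + `|m| * (B / D * e))).
  by apply: lerD => //; exact: ler_wpM2l.
have : h * (D - B / D * e) <= h * Num.sqrt W.
  rewrite ler_pM2l//; move: hden; rewrite ler_norml => /andP[hh _].
  by rewrite lerBrDr addrC in hh.
apply: le_trans; rewrite mulrBr lerBrDr; apply: le_trans eC.
by rewrite le_eqVlt; apply/orP; left; apply/eqP; rewrite /C; ring.
Qed.

End Interpolation.

(** * Absence of gaps in the law of the ratio *)

Section NoGap.
Context {R : realType} {d : measure_display} {T : measurableType d}.
Variable P : probability T R.
Variable X : int -> T -> R.
Hypothesis mX : forall t, measurable_fun setT (X t).
Hypothesis sX : stationary P X.
Variables (kappa : R) (a : nat -> R).
Hypothesis kap : 1 < kappa < 2.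
Hypothesis rv : regvar P (X 0) kappa.
Hypothesis na : norming P X a.
Hypothesis ac : AC_MX P X a.
Context {d' : measure_display} {T' : measurableType d'}.
Variables (Q : probability T' R) (xi zeta : T' -> R).
Hypothesis dl : dist_limit P X a Q xi zeta.

Let mxi : measurable_fun setT xi. Proof. by case: dl. Qed.
Let mzeta : measurable_fun setT zeta. Proof. by case: dl => _ []. Qed.
Let rho w := xi w / zeta w.
Let mrho : measurable_fun setT rho := ratio_meas dl.
Let aY : a n @[n --> \oo] --> +oo. Proof. by case: na. Qed.
Let nGa : n%:R * tailG P X (a n) @[n --> \oo] --> (1 : R). Proof. by case: na. Qed.

(** Some [r > 0] bounds [zeta] from below outside an event of at most half the probability, so the
    support point can be taken where [zeta > r]. *)
Lemma ratio_support (A : set R) : measurable A -> 0 < pr Q [set w | A (rho w)] ->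
  exists x z, [/\ 0 < z, A (x / z) & forall e, 0 < e ->
    0 < pr Q [set w | `|xi w - x| < e /\ `|zeta w - z| < e]].
Proof.
move=> mA; set p := pr Q _ => p0.
have [r r0 [hr _]] := zeta_pos mX sX kap rv na ac dl (divr_gt0 p0 (ltr0n R 2)).
have mB : measurable [set w | A (rho w)].
  by rewrite -[X in measurable X]setTI; exact: mrho.
have mC : measurable [set w | r < zeta w] by exact: meas_lt.
have mD : measurable [set w | zeta w <= r] by exact: meas_le.
have mI : measurable ([set w | A (rho w)] `&` [set w | r < zeta w]) by exact: measurableI.
have h : 0 < pr Q ([set w | A (rho w)] `&` [set w | r < zeta w]).
  have : p <= pr Q ([set w | A (rho w)] `&` [set w | r < zeta w]) + pr Q [set w | zeta w <= r].
    by apply: pr_le_setU => // w /= Aw; have [h|h] := leP (zeta w) r; [right|left].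
  move=> h; have h' := le_trans h (lerD (lexx _) hr).
  by rewrite -lerBlDr [X in X - _]splitr addrK in h'; apply: lt_le_trans h'; rewrite divr_gt0.
have [w0 [Aw zw] hw] := support_point mxi mzeta mI h.
by exists (xi w0), (zeta w0); split => //; exact: lt_trans zw.
Qed.

(** Continuous, so that its mean passes to the limit, and supported near a point, so that its
    positivity locates the pair of normalized sums. *)
Let bump (x z e : R) (v : R * R) : R := ppart (1 - (`|v.1 - x| + `|v.2 - z|) / e).

Let bump_cont x z e : continuous (bump x z e).
Proof.
apply: ppart_cont => v; apply: cvgB; first exact: cvg_cst.
apply: cvgM; last exact: cvg_cst.
by apply: cvgD; apply: cvg_norm; apply: cvgB; [exact: cvg_fst|exact: cvg_cst|exact: cvg_snd|exact: cvg_cst].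
Qed.

Let bump_01 x z e v : 0 < e -> 0 <= bump x z e v <= 1.
Proof.
move=> e0; rewrite ppart_ge0 -[leRHS](ppart_ge (@ler01 R)) ppart_homo//.
by rewrite lerBlDr lerDl divr_ge0 ?addr_ge0// ltW.
Qed.

Let bump_bnd x z e v : 0 < e -> `|bump x z e v| <= 1.
Proof. by move=> e0; have /andP[h1 h2] := bump_01 x z v e0; rewrite ger0_norm. Qed.

Let bump_pos x z e v : 0 < e -> 0 < bump x z e v -> `|v.1 - x| <= e /\ `|v.2 - z| <= e.
Proof.
move=> e0; rewrite ppart_gt0 subr_gt0 ltr_pdivrMr// mul1r => h.
by split; apply: ltW; apply: le_lt_trans h; rewrite ?lerDl ?lerDr.
Qed.

Let bump_meas dU (U : measurableType dU) x z e (u v : U -> R) :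
  measurable_fun setT u -> measurable_fun setT v -> measurable_fun setT (fun w => bump x z e (u w, v w)).
Proof.
move=> mu mv; have mp : measurable_fun setT (@ppart R).
  by apply: continuous_measurable_fun; apply: (@ppart_cont R R id) => t; exact: cvg_id.
apply: (measurableT_comp mp); apply: measurable_funB => //; apply: measurable_funM => //.
by apply: measurable_funD; apply: measurableT_comp => //; exact: measurable_funB.
Qed.

Let bump_E x z e : 0 < e -> (forall e', 0 < e' -> 0 < pr Q [set w | `|xi w - x| < e' /\ `|zeta w - z| < e']) ->
  0 < rE Q (fun w => bump x z e (xi w, zeta w)).
Proof.
move=> e0 h; have e4 : 0 < e / 4 by rewrite divr_gt0.
have mA : measurable [set w | `|xi w - x| < e / 4 /\ `|zeta w - z| < e / 4].
  rewrite (_ : [set w | _] = [set w | `|xi w - x| < e / 4] `&` [set w | `|zeta w - z| < e / 4])//.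
  by apply: measurableI; apply: meas_lt => //; apply: measurableT_comp => //; exact: measurable_funB.
apply: (@lt_le_trans _ _ (2^-1 * pr Q [set w | `|xi w - x| < e / 4 /\ `|zeta w - z| < e / 4])).
  by rewrite mulr_gt0// h.
rewrite -rE_indic// -rEZ; last exact: Lint_indic.
apply: rE_le; first by apply: LintZ; exact: Lint_indic.
  by apply: (Lint_bnd 1) => [|w]; [exact: bump_meas|exact: bump_bnd].
move=> w; rewrite indicE; have [|_] := boolP (w \in _); last by rewrite mulr0 ppart_ge0.
rewrite inE/= mulr1 => -[h1 h2].
have : 2^-1 <= 1 - (`|xi w - x| + `|zeta w - z|) / e.
  rewrite lerBrDl -lerBrDr ler_pdivrMr//.
  have -> : (1 - 2^-1) * e = e / 4 + e / 4 by field.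
  by apply: lerD; exact: ltW.
move=> h3; rewrite /bump/= ppart_ge//; apply: le_trans h3; by rewrite invr_ge0.
Qed.

Lemma two_block_split (n g m : nat) (w : T) (c r : R) : 0 < c -> 0 < r ->
  Tstat X (n + g + m) w =
  (Ssum X 1 n w / c + Ssum X n.+1 g w / c + r / c * (Ssum X (n + g).+1 m w / r)) /
  Num.sqrt ((Qsum X 1 n w / c) ^+ 2 + (Qsum X n.+1 g w / c) ^+ 2
     + (r / c * (Qsum X (n + g).+1 m w / r)) ^+ 2).
Proof.
move=> c0 r0.
have split3 (f : nat -> R) : \sum_(1 <= t < 1 + (n + g + m)) f t =
    \sum_(1 <= t < 1 + n) f t + \sum_(n.+1 <= t < n.+1 + g) f t
    + \sum_((n + g).+1 <= t < (n + g).+1 + m) f t.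
  rewrite !add1n !addSn (@big_cat_nat _ _ _ (n + g).+1)//=; last by rewrite ltnS leq_addr.
  by congr (_ + _); rewrite (@big_cat_nat _ _ _ n.+1)//= ltnS leq_addr.
have Sq i b : Qsum X i b w ^+ 2 = \sum_(i <= t < i + b) X t%:Z w ^+ 2.
  by rewrite sqr_sqrtr// sumr_ge0// => t _; exact: sqr_ge0.
have -> : r / c * (Ssum X (n + g).+1 m w / r) = Ssum X (n + g).+1 m w / c by field; rewrite !gt_eqF.
have -> : r / c * (Qsum X (n + g).+1 m w / r) = Qsum X (n + g).+1 m w / c by field; rewrite !gt_eqF.
have SE : Ssum X 1 n w + Ssum X n.+1 g w + Ssum X (n + g).+1 m w = Ssum X 1 (n + g + m) w.
  by rewrite /Ssum split3.
have QE : Qsum X 1 n w ^+ 2 + Qsum X n.+1 g w ^+ 2 + Qsum X (n + g).+1 m w ^+ 2 = Qsum X 1 (n + g + m) w ^+ 2.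
  by rewrite !Sq split3.
have -> : Ssum X 1 n w / c + Ssum X n.+1 g w / c + Ssum X (n + g).+1 m w / c = Ssum X 1 (n + g + m) w / c.
  by rewrite -SE !mulrDl.
have -> : (Qsum X 1 n w / c) ^+ 2 + (Qsum X n.+1 g w / c) ^+ 2 + (Qsum X (n + g).+1 m w / c) ^+ 2 =
    (Qsum X 1 (n + g + m) w / c) ^+ 2.
  by rewrite [RHS]exprMn -QE !exprMn !mulrDl.
have q0 : 0 <= Qsum X 1 (n + g + m) w / c by rewrite divr_ge0 ?sqrtr_ge0// ltW.
by rewrite sqrtr_sqr (ger0_norm q0) /Tstat invf_div mulrA divfK ?gt_eqF.
Qed.

(** The gap has a fixed length, so its norm is bounded in probability by stationarity, while [a n]
    tends to infinity. *)
Lemma gap_small (g : nat) (t e : R) : 0 < t -> 0 < e ->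
  \forall n \near \oo, pr P [set w | t * a n <= Qsum X n.+1 g w] <= e.
Proof.
move=> t0 e0; have [M M0 hM] := pr_tail P (Qsum_meas mX g 0) e0.
apply: filterS (a_ge aY (M / t)) => n h.
have mA : measurable [set y : R | t * a n <= y].
  by apply: (@meas_le R _ _ (cst (t * a n)) (fun y => y)).
have := block_pr mX sX n.+1 (@fQ_meas R g) mA.
have -> : [set w | [set y : R | t * a n <= y] (fQ g (path X n.+1 w))] = [set w | t * a n <= Qsum X n.+1 g w].
  by apply/seteqP; split => w /=; rewrite -[Qsum X n.+1 g w]/((Qsum X n.+1 g) w) Qsum_path.
move=> ->; apply: le_trans hM; apply: pr_le.
- rewrite -[X in measurable X]setTI; apply: (block_meas mX 0 (@fQ_meas R g)) => //.
- apply: meas_le => //; apply: measurableT_comp => //; exact: Qsum_meas.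
move=> w /= hw; rewrite Qsum_path /=; apply: le_trans (ler_norm _); apply: le_trans hw.
by rewrite mulrC -ler_pdivrMr.
Qed.

Lemma Ssum_le_Qsum i b w : `|Ssum X i b w| <= b%:R * Qsum X i b w.
Proof.
rewrite /Ssum; apply: le_trans (ler_norm_sum _ _ _) _.
apply: (@le_trans _ _ (\sum_(i <= t < i + b) Qsum X i b w)); last first.
  by rewrite sumr_const_nat addKn -[leLHS]mulr_natl.
apply: ler_sum_nat => t /andP[h1 h2]; rewrite -sqrtr_sqr; apply: ler_wsqrtr.
rewrite (bigD1_seq t)/= ?mem_index_iota ?h1 ?iota_uniq//.
by rewrite lerDl sumr_ge0// => s _; exact: sqr_ge0.
Qed.

Lemma no_gap (c c' : R) : c < c' -> 0 < pr Q [set w | rho w <= c] -> 0 < pr Q [set w | c' <= rho w] ->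
  pr Q [set w | c < rho w < c'] = 0 -> False.
Proof.
move=> cc pc pc' p0.
have mle t : measurable [set y : R | y <= t] by exact: (@meas_le R _ _ (fun y => y) (cst t)).
have mge t : measurable [set y : R | t <= y] by exact: (@meas_le R _ _ (cst t) (fun y => y)).
have [x1 [z1 [z10 /= xz1 s1]]] := ratio_support (mle c) pc.
have [x2 [z2 [z20 /= xz2 s2]]] := ratio_support (mge c') pc'.
rewrite ler_pdivrMr// in xz1; rewrite ler_pdivlMr// in xz2.
pose m := (c + c') / 2; pose h := (c' - c) / 4.
have h0 : 0 < h by rewrite divr_gt0// subr_gt0.
have [l l0 El] := interpolate z10 z20 xz1 xz2 (midf_lt cc).1 (midf_lt cc).2.
have [e e0 he] := two_block_near z10 z20 l0 h0 El.
pose f1 := bump x1 z1 e; pose f2 := bump x2 z2 e.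
have k1 : 0 < rE Q (fun w => f1 (xi w, zeta w)) by exact: bump_E.
have k2 : 0 < rE Q (fun w => f2 (xi w, zeta w)) by exact: bump_E.
set K1 := rE Q _ in k1; set K2 := rE Q _ in k2.
have K12 : 0 < K1 * K2 by exact: mulr_gt0.
have K4 : 0 < K1 * K2 / 4 by rewrite divr_gt0.
have K8 : 0 < K1 * K2 / 8 by rewrite divr_gt0.
have lim1 : rE P (fun w => f1 (Ssum X 1 n w / a n, Qsum X 1 n w / a n)) @[n --> \oo] --> K1.
  by apply: (dist_limit_rE dl (M := 1)); [exact: bump_cont|move=> v; exact: bump_bnd].
have lim2 : rE P (fun w => f2 (Ssum X 1 n w / a n, Qsum X 1 n w / a n)) @[n --> \oo] --> K2.
  by apply: (dist_limit_rE dl (M := 1)); [exact: bump_cont|move=> v; exact: bump_bnd].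
(* The norming sequence grows like a power [1 / kappa] of the length, so this ratio of lengths
   brings [a (mm n) / a n] within [e] of [l]; [aup] and [alo] are the two sides of this. *)
pose q := l `^ kappa; have q0 : 0 < q by exact: powR_gt0.
pose mm (n : nat) := Num.truncn (q * n%:R).
have mmb n : (mm n)%:R <= q * n%:R < (mm n).+1%:R by apply: truncn_itv; rewrite mulr_ge0// ltW.
have mmY K : \forall n \near \oo, (K <= mm n)%N.
  apply: filterS (near_natr (K%:R / q)) => n hn.
  rewrite -ltnS -(ltr_nat R); have /andP[_] := mmb n; apply: le_lt_trans.
  by rewrite mulrC -ler_pdivrMr.
have mmq : (mm n)%:R / n%:R @[n --> \oo] --> q.
  apply/cvg_nearP => t t0; apply: filterS2 (near_natr (2 / t)) (near_ge 1) => n hn n1.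
  have n0 : (0 : R) < n%:R by rewrite ltr0n.
  have /andP[b1 b2] := mmb n.
  have -> : (mm n)%:R / n%:R - q = - ((q * n%:R - (mm n)%:R) / n%:R) by field; rewrite gt_eqF.
  rewrite normrN ger0_norm; last by rewrite divr_ge0 ?subr_ge0// ltW.
  rewrite ltr_pdivrMr//; apply: (@lt_le_trans _ _ 1); first by rewrite ltrBlDl natr1.
  rewrite ler_pdivrMr// in hn; rewrite mulrC; apply: le_trans hn; exact: ler1n.
have kap0 : 0 < kappa by case/andP: kap => /(lt_trans ltr01).
have powlt (x y : R) : 0 < x -> x < y -> y `^ (- kappa) * x `^ kappa < 1.
  move=> x0 xy; have y0 := lt_trans x0 xy.
  rewrite powRN mulrC ltr_pdivrMr ?powR_gt0// mul1r.
  by apply: gt0_ltr_powR; rewrite ?nnegrE ?(ltW x0) ?(ltW y0).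
have aup : \forall n \near \oo, a (mm n) < (l + e) * a n.
  apply: (a_sub_lt (tailG_anti P mX) (tailG_ge0 P X) (tailG_reg mX rv) aY nGa mmY q0 mmq).
    by rewrite addr_gt0.
  by apply: powlt => //; rewrite ltrDl.
(* The minimum with [l / 2] keeps the factor positive. *)
have alo : \forall n \near \oo, (l - Order.min e (l / 2)) * a n < a (mm n).
  have e'0 : 0 < Order.min e (l / 2) by rewrite lt_min e0 divr_gt0.
  have le0 : 0 < l - Order.min e (l / 2).
    rewrite subr_gt0; apply: (@le_lt_trans _ _ (l / 2)); first by rewrite ge_min lexx orbT.
    by rewrite ltr_pdivrMr// ltr_pMr// (ltr1n R 2).
  apply: (a_sub_gt (tailG_anti P mX) (tailG_ge0 P X) (tailG_reg mX rv) aY nGa mmY q0 mmq le0).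
  rewrite powRN mulrC ltr_pdivlMr ?powR_gt0// mul1r.
  by apply: gt0_ltr_powR; rewrite ?nnegrE ?(ltW le0) ?(ltW l0)// ltrBlDr ltrDl.
(* Independence is needed only up to a fixed fraction of [K1 * K2], so a gap of constant length is
   enough, and such a gap is negligible against [a n]. *)
have [g hg] : exists g, alpha P X g <= K1 * K2 / 4.
  have /cvg_nearP/(_ _ K4) [N _ hN] := ac_alpha0 mX ac.
  exists N; have := hN N (leqnn N); rewrite subr0 => /ltW; apply: le_trans; exact: ler_norm.
(* By [Ssum_le_Qsum] the sum over the gap is at most [g] times its norm; the successor avoids a zero
   denominator. *)
pose t := e / g.+1%:R; have t0 : 0 < t by rewrite divr_gt0.
pose F1 n (x : int -> R) := f1 (fS n x / a n, fQ n x / a n).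
pose F2 n (x : int -> R) := f2 (fS (mm n) x / a (mm n), fQ (mm n) x / a (mm n)).
have mF1 n : measurable_fun setT (F1 n : pathT (Ib n) -> R).
  by apply: bump_meas; apply: measurable_funM => //; [exact: (@fS_meas R n)|exact: (@fQ_meas R n)].
have mF2 n : measurable_fun setT (F2 n : pathT (Ib (mm n)) -> R).
  by apply: bump_meas; apply: measurable_funM => //; [exact: (@fS_meas R (mm n))|exact: (@fQ_meas R (mm n))].
have bF1 n x : `|F1 n x| <= 1 by exact: bump_bnd.
have bF2 n x : `|F2 n x| <= 1 by exact: bump_bnd.
have E1 : rE P (F1 n \o path X 1%N) @[n --> \oo] --> K1.
  apply: cvg_trans lim1; apply: near_eq_cvg; near=> n; congr rE.
  by apply/funext => w; rewrite /F1/= Ssum_path Qsum_path.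
have E2 : rE P (F2 n \o path X (n + g).+1) @[n --> \oo] --> K2.
  apply/cvg_nearP => s s0; move/cvg_nearP : lim2 => /(_ s s0) h2.
  apply: filterS (near_sub mmY h2) => n.
  rewrite (block_rE mX sX (n + g).+1 (mF2 n)) -(block_rE mX sX 1 (mF2 n)).
  rewrite (_ : F2 n \o path X 1%N = (fun w => f2 (Ssum X 1 (mm n) w / a (mm n), Qsum X 1 (mm n) w / a (mm n))))//.
  by apply/funext => w; rewrite /F2/= Ssum_path Qsum_path.
have E12 : rE P (F1 n \o path X 1%N) * rE P (F2 n \o path X (n + g).+1) @[n --> \oo] --> K1 * K2 by exact: cvgM.
pose N n := (n + g + mm n)%N.
have NY K : \forall n \near \oo, (K <= N n)%N.
  by apply: filterS (near_ge K) => n h1; rewrite /N -addnA (leq_trans h1)// leq_addr.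
(* A tent supported on the gap, so its mean under the limit law is 0; on [|x - m| <= h] it is at
   least [h], which converts a small mean into a small probability. *)
pose hh (x : R) := ppart ((c' - c) / 2 - `|x - m|).
have hhc : continuous hh.
  apply: ppart_cont => x; apply: cvgB; first exact: cvg_cst.
  by apply: cvg_norm; apply: cvgB; [exact: cvg_id|exact: cvg_cst].
have hhb x : `|hh x| <= (c' - c) / 2.
  rewrite ger0_norm ?ppart_ge0// -[leRHS]ppart_ge ?divr_ge0 ?subr_ge0 ?(ltW cc)//.
  by apply: ppart_homo; rewrite lerBlDr lerDl.
have hh_rho : rE Q (fun w => hh (rho w)) = 0.
  have mG : measurable [set w | c < rho w < c'].
    rewrite (_ : [set w | _] = [set w | c < rho w] `&` [set w | rho w < c']).
      by apply: measurableI; exact: meas_lt.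
    by apply/seteqP; split => w /=; [move/andP|move=> h1; apply/andP].
  apply/eqP; rewrite -normr_le0.
  have -> : 0 = (c' - c) / 2 * pr Q [set w | c < rho w < c'] by rewrite p0 mulr0.
  rewrite -rE_indic// -rEZ; last exact: Lint_indic.
  apply: rE_abs_le; last move=> w.
  - apply: (Lint_bnd ((c' - c) / 2)) => //.
    exact: (measurableT_comp (continuous_measurable_fun hhc)).
  - by apply: LintZ; exact: Lint_indic.
  - rewrite indicE; have [_|] := boolP (w \in _); first by rewrite mulr1.
    rewrite notin_setE/= => /negP hw; rewrite mulr0 /hh ppart_le ?normr0//.
    rewrite subr_le0 leNgt; apply: contra hw; rewrite ltr_norml => /andP[b1 b2].
    rewrite /m in b1 b2; move: b1 b2; rewrite ltrBrDr ltrBlDr.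
    have -> : - ((c' - c) / 2) + (c + c') / 2 = c by field.
    have -> : (c' - c) / 2 + (c + c') / 2 = c' by field.
    by move=> -> ->.
have limh : rE P (fun w => hh (Tstat X n w)) @[n --> \oo] --> (0 : R).
  by rewrite -hh_rho; exact: (Tstat_weak mX sX kap rv na ac dl hhc hhb).
have hK : 0 < h * (K1 * K2 / 8) by exact: mulr_gt0.
move/cvg_nearP : limh => /(_ _ hK) /(near_sub NY) L1.
move/cvg_nearP : E12 => /(_ _ K4) L2.
have L3 := gap_small g t0 K8.
have L4 := a_near_gt0 na.
have L5 := near_sub mmY L4.
have [n [[[n1 n2] [n3 n4]] [n5 [n6 n7]]]] : exists n,
   ((`|rE P (fun w => hh (Tstat X (N n) w)) - 0| < h * (K1 * K2 / 8) /\
     `|rE P (F1 n \o path X 1%N) * rE P (F2 n \o path X (n + g).+1) - K1 * K2| < K1 * K2 / 4) /\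
    (pr P [set w | t * a n <= Qsum X n.+1 g w] <= K1 * K2 / 8 /\ 0 < a n)) /\
   (0 < a (mm n) /\ (a (mm n) < (l + e) * a n /\ (l - Order.min e (l / 2)) * a n < a (mm n))).
  have [M _ hM] := filterI (filterI (filterI L1 L2) (filterI L3 L4)) (filterI L5 (filterI aup alo)).
  by exists M; exact: (hM M (leqnn M)).
have mP1 := block_meas mX 1 (mF1 n); have mP2 := block_meas mX (n + g).+1 (mF2 n).
have cov := @mix_blocks _ _ _ P X mX sX 1 (n + g).+1 n (mm n) g (F1 n) (F2 n) 1 1
  (leqnn _) (mF1 n) (mF2 n) ltr01 ltr01 (bF1 n) (bF2 n).
rewrite !mul1r in cov; have cov2 := le_trans cov hg.
(* The product of the two means exceeds three quarters of [K1 * K2], and dependence takes away at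
   most one quarter. *)
have lower : K1 * K2 / 2 <= rE P (fun w => (F1 n \o path X 1%N) w * (F2 n \o path X (n + g).+1) w).
  move: cov2 n2; rewrite /rcov ler_norml ltr_norml => /andP[b1 _] /andP[b2 _].
  rewrite lerBrDl in b1; rewrite ltrBrDl in b2; apply: le_trans b1.
  rewrite -lerBlDr opprK; apply: le_trans (ltW b2).
  by rewrite le_eqVlt; apply/orP; left; apply/eqP; field.
have mT : measurable_fun setT (Tstat X (N n)) := Tsub_meas mX (N n) 1.
have mB : measurable [set w | t * a n <= Qsum X n.+1 g w] by apply: meas_le => //; exact: Qsum_meas.
have mC : measurable [set w | `|Tstat X (N n) w - m| <= h].
  by apply: meas_le => //; apply: measurableT_comp => //; exact: measurable_funB.
have good w : 0 < F1 n (path X 1%N w) -> 0 < F2 n (path X (n + g).+1 w) ->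
    Qsum X n.+1 g w < t * a n -> `|Tstat X (N n) w - m| <= h.
  rewrite /F1 /F2 => /(bump_pos e0)[/= b1 b2] /(bump_pos e0)[/= b3 b4] bq.
  rewrite /N (two_block_split n g (mm n) w n4 n5) !Ssum_path !Qsum_path /=; apply: he => //.
  - rewrite normrM [`|(a n)^-1|]gtr0_norm ?invr_gt0// ler_pdivrMr//.
    have := Ssum_le_Qsum n.+1 g w; rewrite Ssum_path/= => b5; apply: le_trans b5 _.
    apply: (@le_trans _ _ (g%:R * (t * a n))); first by rewrite ler_wpM2l// ltW.
    rewrite mulrA ler_pM2r// /t mulrC mulrAC ler_pdivrMr// ler_pM2l// ler_nat//.
  - rewrite Qsum_path/= in bq.
    have Q0 : 0 <= fQ g (path X n.+1 w) by exact: sqrtr_ge0.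
    rewrite ger0_norm ?divr_ge0 ?(ltW n4)// ler_pdivrMr//; apply: le_trans (ltW bq) _.
    by rewrite ler_pM2r// /t ler_pdivrMr// ler_pMr// ler1n.
  - rewrite ler_norml; apply/andP; split; last first.
      by rewrite lerBlDl ler_pdivrMr// ltW.
    rewrite lerBrDl ler_pdivlMr//; apply: le_trans (ltW n7); rewrite ler_pM2r// lerD2l lerN2.
    by rewrite ge_min lexx.
have up : rE P (fun w => (F1 n \o path X 1%N) w * (F2 n \o path X (n + g).+1) w) <=
    pr P [set w | `|Tstat X (N n) w - m| <= h] + pr P [set w | t * a n <= Qsum X n.+1 g w].
  have LL := LintD (@Lint_indic _ _ _ P _ mC) (@Lint_indic _ _ _ P _ mB).
  rewrite -(rE_indic mC) -(rE_indic mB) -(rED (Lint_indic _ mC) (Lint_indic _ mB)).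
  apply: rE_le => // [|w].
    apply: (Lint_bnd 1) => [|w]; first exact: measurable_funM.
    by rewrite normrM; apply: mulr_ile1; rewrite ?normr_ge0//; [exact: bF1|exact: bF2].
  have /andP[u0 u1] := bump_01 x1 z1 (fS n (path X 1%N w) / a n, fQ n (path X 1%N w) / a n) e0.
  have /andP[v0 v1] := bump_01 x2 z2 (fS (mm n) (path X (n + g).+1 w) / a (mm n), fQ (mm n) (path X (n + g).+1 w) / a (mm n)) e0.
  rewrite -/f1 -/f2 -/(F1 n _) -/(F2 n _) in u0 u1 v0 v1.
  have prod1 : F1 n (path X 1%N w) * F2 n (path X (n + g).+1 w) <= 1 by rewrite mulr_ile1.
  rewrite !indicE /=; have [wB|] := boolP (w \in [set w | t * a n <= Qsum X n.+1 g w]).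
    by rewrite (le_trans prod1)// lerDr.
  rewrite notin_setE/= => /negP; rewrite -ltNge => hq.
  have [wC|] := boolP (w \in [set w | `|Tstat X (N n) w - m| <= h]); first by rewrite (le_trans prod1)// lerDl.
  rewrite notin_setE/= addr0 => hn; rewrite leNgt; apply/negP => pp; apply: hn; apply: good => //.
  - by rewrite lt_def u0 andbT; apply/eqP => z; rewrite z mul0r ltxx in pp.
  - by rewrite lt_def v0 andbT; apply/eqP => z; rewrite z mulr0 ltxx in pp.
have prC : K1 * K2 / 8 <= pr P [set w | `|Tstat X (N n) w - m| <= h].
  have := le_trans lower (le_trans up (lerD (lexx _) n3)); rewrite -lerBlDr; apply: le_trans.
  rewrite -mulrBr ler_pM2l//; lra.
have : h * pr P [set w | `|Tstat X (N n) w - m| <= h] <= rE P (fun w => hh (Tstat X (N n) w)).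
  rewrite -(rE_indic mC) -(rEZ h (Lint_indic _ mC)); apply: rE_le.
  - by apply: LintZ; exact: Lint_indic.
  - apply: (Lint_bnd ((c' - c) / 2)) => //.
    exact: (measurableT_comp (continuous_measurable_fun hhc)).
  move=> w; rewrite indicE; have [|_] := boolP (w \in _); last by rewrite mulr0 ppart_ge0.
  rewrite inE/= mulr1 => hw; rewrite /hh ppart_ge.
    rewrite lerBrDr -lerBrDl; apply: le_trans hw _.
    by rewrite le_eqVlt; apply/orP; left; apply/eqP; rewrite /h; field.
  rewrite subr_ge0; apply: le_trans hw _; rewrite /h ler_pM2l ?subr_gt0//; lra.
move=> low2; have low3 : h * (K1 * K2 / 8) <= rE P (fun w => hh (Tstat X (N n) w)).
  by apply: le_trans low2; rewrite ler_pM2l.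
move: n1; rewrite subr0 => n1; have := lt_le_trans n1 low3.
by rewrite ltNge ler_norm.
Unshelve. all: by end_near. Qed.


Let F := ratio_cdf Q xi zeta.
Let mrle x : measurable [set w | rho w <= x].
Proof. exact: meas_le. Qed.

(** Strictness on the left is the infimum, and continuity at the quantile fixes the value [q]. If
    [F] took the value [q] again further right, no mass would lie strictly between although both
    sides carry some, as [0 < q < 1]; this is what [no_gap] forbids. *)
Lemma quantile_strict (q : R) : 0 < q < 1 -> cont_near F (ratio_quantile Q xi zeta q) ->
  [/\ F (ratio_quantile Q xi zeta q) = q,
      forall x, x < ratio_quantile Q xi zeta q -> F x < q &
      forall x, ratio_quantile Q xi zeta q < x -> q < F x].
Proof.
move=> /andP[q0 q1] [r [r0 cF]]; set c := ratio_quantile Q xi zeta q in cF *.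
have Fle x y : x <= y -> F x <= F y by exact: (ratio_cdf_le dl).
have t0 : 0 < Order.min (q / 2) (1 - q) by rewrite lt_min divr_gt0//= subr_gt0.
have [M M0 [tl tr]] := ratio_cdf_tail dl t0.
have FM1 : F (- M) < q.
  apply: le_lt_trans tl _; apply: (@le_lt_trans _ _ (q / 2)); first by rewrite ge_min lexx.
  by rewrite ltr_pdivrMr// ltr_pMr// (ltr1n R 2).
have FM2 : q <= F M.
  by apply: le_trans tr; rewrite lerBrDl -lerBrDr ge_min lexx orbT.
have hi : has_inf [set x | q <= F x].
  split; first by exists M.
  exists (- M) => x /= qx; rewrite leNgt; apply/negP => /ltW/Fle h.
  by have := le_lt_trans (le_trans qx h) FM1; rewrite ltxx.
have lt_c x : x < c -> F x < q.
  move=> xc; rewrite ltNge; apply/negP => qx.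
  by have := ge_inf hi.2 qx; rewrite leNgt xc.
have gt_c x : c < x -> q <= F x.
  move=> cx; have [y qy yx] := inf_lt hi.1 cx.
  by apply: le_trans qy _; exact: Fle (ltW yx).
have cc : {for c, continuous F} by apply: cF; rewrite subrr normr0.
have near_c (e : R) : 0 < e -> exists2 s, 0 < s & forall y, `|c - y| <= s -> `|F c - F y| < e.
  move=> e0; have : \forall t \near nbhs c, `|F c - F t| < e.
    by apply: (@cvgr_dist_lt _ _ _ (nbhs c) _ F (F c) cc).
  move=> /nbhs_normP[s s0 h]; exists (s / 2); first by rewrite divr_gt0.
  move=> y hy; apply: h => /=; apply: le_lt_trans hy _.
  by rewrite ltr_pdivrMr// ltr_pMr// (ltr1n R 2).
have Fc : F c = q.
  apply/eqP; rewrite eq_le; apply/andP; split; apply/ler_addgt0Pr => e e0.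
    have [s s0 hs] := near_c e e0; have := hs (c - s).
    rewrite subKr gtr0_norm// => /(_ (lexx _)); rewrite ltr_norml => /andP[_ h].
    rewrite ltrBlDr in h; apply: le_trans (ltW h) _; rewrite addrC lerD2r; apply: ltW.
    by apply: lt_c; rewrite ltrBlDr ltrDl.
  have [s s0 hs] := near_c e e0; have := hs (c + s).
  rewrite opprD addrA subrr add0r normrN gtr0_norm// => /(_ (lexx _)); rewrite ltr_norml => /andP[h _].
  rewrite ltrBrDl in h; rewrite -lerBlDr; apply: le_trans (ltW h); rewrite lerD2r.
  by apply: gt_c; rewrite ltrDl.
split => // x cx; rewrite lt_neqAle gt_c// andbT; apply/negP => /eqP Fx.
apply: (no_gap cx).
- by rewrite -[pr Q _]/(F c) Fc.
- apply: (@lt_le_trans _ _ (1 - F x)); first by rewrite -Fx subr_gt0.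
  rewrite -[F x]/(pr Q [set w | rho w <= x]) -pr_setC//; apply: pr_le; first exact: measurableC.
    exact: meas_le.
  by move=> w /= /negP; rewrite -ltNge => /ltW.
- have mG : measurable [set w | c < rho w < x].
    rewrite (_ : [set w | _] = [set w | c < rho w] `&` [set w | rho w < x]).
      by apply: measurableI; exact: meas_lt.
    by apply/seteqP; split => w /=; [move/andP|move=> h1; apply/andP].
  apply/eqP; rewrite eq_le pr_ge0 andbT.
  have h : pr Q ([set w | rho w <= c] `|` [set w | c < rho w < x]) <= F x.
    apply: pr_le => //; first exact: measurableU.
    move=> w /= [h|/andP[_ /ltW//]]; exact: le_trans h (ltW cx).
  have dj : [set w | rho w <= c] `&` [set w | c < rho w < x] = set0.
    by apply/seteqP; split => w //= [h2 /andP[h1 _]]; move: h1; rewrite ltNge h2.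
  rewrite pr_setU_disj// -[pr Q [set w | rho w <= c]]/(F c) Fc -Fx in h.
  by rewrite gerDl in h.
Qed.

(** Continuity on a whole neighbourhood of each quantile yields convergence of the distribution
    functions at all nearby points, as [noncover_to_eta] asks. *)
Lemma noncover_stable (b : nat -> nat) (eta : R) : 0 < eta < 1 ->
  ((b n)%:R : R) @[n --> \oo] --> +oo -> (b n)%:R / n%:R @[n --> \oo] --> (0 : R) ->
  cont_near F (ratio_quantile Q xi zeta (eta / 2)) ->
  cont_near F (ratio_quantile Q xi zeta (1 - eta / 2)) ->
  P (noncover X b eta n) @[n --> \oo] --> eta%:E.
Proof.
move=> eta01 bY b0 cn1 cn2; have /andP[h0 h1] := eta01.
have e1 : 0 < eta / 2 < 1 by lra.
have e2 : 0 < 1 - eta / 2 < 1 by lra.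
have [Fc1 lt1 gt1] := quantile_strict e1 cn1.
have [Fc2 lt2 gt2] := quantile_strict e2 cn2.
have [d1 [d10 c1]] := cn1; have [d2 [d20 c2]] := cn2.
have d0 : 0 < Order.min d1 d2 by rewrite lt_min d10.
apply: (@noncover_to_eta _ _ _ P X mX sX b (natr_cvgy bY) b0 (ac_alpha0 mX ac) eta
  (ratio_quantile Q xi zeta (eta / 2)) (ratio_quantile Q xi zeta (1 - eta / 2)) (Order.min d1 d2) F) => //.
- move=> x; rewrite lt_min => /andP[hx _]; exact: (Tstat_cdf_cvg mX sX kap rv na ac dl (c1 x hx)).
- move=> x; rewrite lt_min => /andP[_ hx]; exact: (Tstat_cdf_cvg mX sX kap rv na ac dl (c2 x hx)).
- by apply: c1; rewrite subrr normr0.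
- by apply: c2; rewrite subrr normr0.
Qed.

End NoGap.

(** * Consistency of subsampling *)

Theorem theorem7 (R : realType) (d : measure_display) (T : measurableType d)
    (P : probability T R) (X : int -> T -> R) (eta : R) (b : nat -> nat) :
  (forall t, measurable_fun setT (X t)) ->
  stationary P X ->
  0 < eta < 1 ->
  (((b n)%:R : R) @[n --> \oo] --> +oo) ->
  (((b n)%:R / n%:R : R) @[n --> \oo] --> (0 : R)) ->
  ( (\int[P]_w (X 0 w)%:E = 0)%E ->
    ( (FV P X /\ 0 < sigma2 P X) \/
      (exists kappa : R, 1 < kappa < 2 /\ RV P X kappa /\
        exists a : nat -> R, norming P X a /\ AC_MX P X a /\
        exists (d' : measure_display) (T' : measurableType d')
               (Q : probability T' R) (xi zeta : T' -> R),
          dist_limit P X a Q xi zeta /\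
          cont_near (ratio_cdf Q xi zeta) (ratio_quantile Q xi zeta (eta / 2)) /\
          cont_near (ratio_cdf Q xi zeta) (ratio_quantile Q xi zeta (1 - eta / 2))) ) ->
    P (noncover X b eta n) @[n --> \oo] --> eta%:E )
  /\
  ( (\int[P]_w (X 0 w)%:E != 0)%E ->
    ( FV P X \/
      (exists kappa : R, 1 < kappa < 2 /\ RV P X kappa /\
        exists a : nat -> R, norming P X a /\ AC_MX P X a) ) ->
    P (noncover X b eta n) @[n --> \oo] --> 1%E ).

Proof.
move=> mX sX eta01 bY b0; split.
  move=> EX; have EX0 : rE P (X 0) = 0 by rewrite /rE EX.
  case=> [[[eps [eps0 [mom mixing]]] s0]|].
    exact: (noncover_gauss mX sX eps0 mom mixing EX0 s0 eta01 bY b0).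
  move=> [kappa [kap [[rv _] [a [na [ac [d' [T' [Q [xi [zeta [dl [c1 c2]]]]]]]]]]]]].
  exact: (noncover_stable mX sX kap rv na ac dl eta01 bY b0 c1 c2).
move=> EX; case=> [[eps [eps0 [mom mixing]]]|[kappa [kap [[rv _] [a [na ac]]]]]].
  exact: (noncover_fv mX sX eps0 mom mixing eta01 bY b0 EX).
exact: (noncover_heavy mX sX bY b0 eta01 kap rv na ac EX).
Qed.
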